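(* Let $\mathcal P(D_y)$ be a homogeneous properly elliptic differential operator of order $2m$ with constant coefficients in $\mathbb R^2$, with formal adjoint $\mathcal P^*(D_y)$. Let $a>a_1$ be real, $l\ge0$ an integer, $f\in H_a^l(\mathbb R^2)\cap H_{a_1}^l(\mathbb R^2)$, and suppose the lines $\mathrm{Im}\,\lambda=a_1+1-l-2m$ and $\mathrm{Im}\,\lambda=a+1-l-2m$ contain no eigenvalues of $\tilde{\mathcal P}(\lambda)$. Let $u\in H_a^{l+2m}(\mathbb R^2)$ be a solution of $\mathcal P(D_y)u=f$ and let $$u=\sum_{n=1}^N\sum_{j=1}^{J_n}\sum_{k=0}^{\varkappa_{j,n}-1}c_n^{(k,j)}u_n^{(k,j)}+u_1,\qquad u_n^{(k,j)}=r^{i\lambda_n}\sum_{q=0}^k\frac1{q!}(i\ln r)^q\varphi_n^{(k-q,j)}(\omega),$$ be its asymptotic representation, where $\lambda_1,\dots,\lambda_N$ are the eigenvalues of $\tilde{\mathcal P}(\lambda)$ in the strip $a_1+1-l-2m<\mathrm{Im}\,\lambda<a+1-l-2m$, $\{\varphi_n^{(0,j)},\dots,\varphi_n^{(\varkappa_{j,n}-1,j)}:j=1,\dots,J_n\}$ is a canonical system of Jordan chains of $\tilde{\mathcal P}(\lambda)$ at $\lambda_n$, $c_n^{(k,j)}$ are constants, and $u_1\in H_{a_1}^{l+2m}(\mathbb R^2)$ satisfies $\mathcal P(D_y)u_1=f$. Then $$c_n^{(k,j)}=\big(f,\ iv_n^{(\varkappa_{j,n}-k-1,j)}\big)_{L_2(\mathbb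 R^2)}.$$ Here $$v_n^{(\nu,j)}=r^{i\bar\lambda_n+2m-2}\sum_{q=0}^\nu\frac1{q!}(i\ln r)^q\psi_n^{(\nu-q,j)}$$ is a power solution of $\mathcal P^*(D_y)v=0$ in $\mathbb R^2\setminus\{0\}$; $\{\psi_n^{(0,j)},\dots,\psi_n^{(\varkappa_{j,n}-1,j)}:j=1,\dots,J_n\}$ is a canonical system of Jordan chains of the operator $\tilde{\mathcal Q}(\lambda)$ corresponding to the eigenvalue $\bar\lambda_n-2i(m-1)$; and the chains $\varphi_n$ and $\psi_n$ satisfy the biorthogonality and normalization conditions $$\sum_{p=0}^\nu\sum_{q=0}^k\frac1{(\nu+k+1-p-q)!}\big(\partial_\lambda^{\nu+k+1-p-q}\tilde{\mathcal P}(\lambda_n)\varphi_n^{(q,\xi)},\psi_n^{(p,\zeta)}\big)_{L_2(0,2\pi)}=\delta_{\xi,\zeta}\,\delta_{\varkappa_{\xi,n}-k-1,\nu}$$ for $\zeta,\xi=1,\dots,J_n$, $\nu=0,\dots,\varkappa_{\zeta,n}-1$, $k=0,\dots,\varkappa_{\xi,n}-1$.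
   Context: $(\omega,r)$ are polar coordinates of $y\in\mathbb R^2$. $H_a^l(\mathbb R^2)$ is the completion of $C_0^\infty(\mathbb R^2\setminus\{0\})$ in the norm $\big(\sum_{|\alpha|\le l}\int_{\mathbb R^2}r^{2(a-l+|\alpha|)}|D_y^\alpha w|^2dy\big)^{1/2}$. With $D_\omega=-i\partial_\omega$, $D_r=-i\partial_r$, write $\mathcal P(D_y)=r^{-2m}\tilde{\mathcal P}(\omega,D_\omega,rD_r)$ and $\mathcal P^*(D_y)=r^{-2m}\widetilde{\mathcal P^*}(\omega,D_\omega,rD_r)$. $W^l_{2\pi}(0,2\pi)$ is the closure in the Sobolev space $W^l_2(0,2\pi)$ of the $2\pi$-periodic infinitely differentiable functions. Both $\tilde{\mathcal P}(\lambda)=\tilde{\mathcal P}(\omega,D_\omega,\lambda)$ and $\tilde{\mathcal Q}(\lambda)=\widetilde{\mathcal P^*}(\omega,D_\omega,\lambda)$ act from $W_{2\pi}^{l+2m}(0,2\pi)$ to $W_{2\pi}^l(0,2\pi)$. They are related by the Green formula $(\tilde{\mathcal P}(\lambda)\tilde u,\tilde v)_{L_2(0,2\pi)}=(\tilde u,\tilde{\mathcal Q}(\bar\lambda-2i(m-1))\tilde v)_{L_2(0,2\pi)}$ for smooth $2\pi$-periodic $\tilde u,\tilde v$. Inner products are linear in the first and antilinear in the second argument. Jordan chains (for a holomorphic operator-valued function $A(\lambda)$, here $\tilde{\mathcal P}$ or $\tilde{\mathcal Q}$). A root function at $\lambda_0$ is a function $\varphi(\lambda)=\sum_{j\ge0}(\lambda-\lambda_0)^j\varphi^{(j)}$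 holomorphic at $\lambda_0$ with values in the domain space, $\varphi(\lambda_0)\ne0$, and $A(\lambda)\varphi(\lambda)$ vanishing at $\lambda_0$; if one exists, $\lambda_0$ is an eigenvalue. The order $\varkappa$ of the zero of $A(\lambda)\varphi(\lambda)$ at $\lambda_0$ is the multiplicity of the root function, $\varphi^{(0)}$ is an eigenvector, and $\varphi^{(0)},\dots,\varphi^{(\varkappa-1)}$ is a Jordan chain. The rank of an eigenvector is the maximal multiplicity of root functions with $\varphi(\lambda_0)=\varphi^{(0)}$. Let $J=\dim\ker A(\lambda_0)$ and let $\varphi^{(0,1)},\dots,\varphi^{(0,J)}$ be eigenvectors such that $\varphi^{(0,1)}$ has the greatest rank of all eigenvectors at $\lambda_0$, and $\varphi^{(0,j)}$ ($j\ge2$) the greatest rank among eigenvectors in some orthogonal complement in $\ker A(\lambda_0)$ of the span of $\varphi^{(0,1)},\dots,\varphi^{(0,j-1)}$. Put $\varkappa_j=\mathrm{rank}\,\varphi^{(0,j)}$ (partial multiplicities). If $\varphi^{(0,j)},\dots,\varphi^{(\varkappa_j-1,j)}$ is a Jordan chain for each $j$, these chains form a canonical system of Jordan chains at $\lambda_0$. For $\lambda_n$ the numbers are $J_n$, $\varkappa_{j,n}$ (the same for $\tilde{\mathcal Q}$ at $\bar\lambda_n-2i(m-1)$). *)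

(* Defs.v *)
From HB Require Import structures.
From mathcomp Require Import all_boot all_order all_algebra.
From mathcomp Require Import complex.
From mathcomp Require Import all_classical all_reals all_analysis.

Set Implicit Arguments.
Unset Strict Implicit.
Unset Printing Implicit Defensive.

Import Order.TTheory GRing.Theory Num.Theory.
Import numFieldNormedType.Exports.

Local Open Scope classical_set_scope.
Local Open Scope ring_scope.
Local Open Scope complex_scope.

Section ComplexValued.
Context {R : realType}.
Implicit Types z : R[i].

Definition reC z : R := complex.Re z.
Definition imC z : R := complex.Im z.
Definition sqnorm z : R := reC z ^+ 2 + imC z ^+ 2.

Definition cexp z : R[i] := (expR (reC z))%:C * (cos (imC z) +i* sin (imC z)).

(* [r ^ e] for [0 < r] *)
Definition cpow (r : R) (e : R[i]) : R[i] := cexp (e * (ln r)%:C).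

Definition cint d (T : measurableType d) (mu : {measure set T -> \bar R})
    (D : set T) (f : T -> R[i]) : R[i] :=
  Rintegral mu D (reC \o f) +i* Rintegral mu D (imC \o f).

Definition cintegrable d (T : measurableType d) (mu : {measure set T -> \bar R})
    (D : set T) (f : T -> R[i]) : Prop :=
  mu.-integrable D (EFin \o (reC \o f)) /\
  mu.-integrable D (EFin \o (imC \o f)).

(* linear in the first argument, antilinear in the second *)
Definition cdot d (T : measurableType d) (mu : {measure set T -> \bar R})
    (D : set T) (f g : T -> R[i]) : R[i] :=
  cint mu D (fun x => f x * (g x)^*).

End ComplexValued.

Section Circle.
Context {R : realType}.
Implicit Types (phi g : R -> R[i]) (s t : nat) (lam : R[i]).

Definition leb : {measure set (measurableTypeR R) -> \bar R} := lebesgue_measure.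

Definition I2pi : set R := `]0, 2 * pi[%classic.

Definition eq2pi phi g : Prop := {ae leb, forall x, I2pi x -> phi x = g x}.

Definition cderive1 (f : R -> R[i]) : R -> R[i] :=
  fun x => derive1 (reC \o f) x +i* derive1 (imC \o f) x.

Definition smooth1 (f : R -> R[i]) : Prop :=
  forall n x, derivable (derive1n n (reC \o f)) x 1 /\
    derivable (derive1n n (imC \o f)) x 1.

Definition periodic_smooth (f : R -> R[i]) : Prop :=
  smooth1 f /\ forall x, f (x + 2 * pi) = f x.

Definition test1 (f : R -> R[i]) : Prop :=
  smooth1 f /\
  exists K, [/\ compact K, K `<=` I2pi & forall x, ~ K x -> f x = 0].

Definition locint1 (f : R -> R[i]) : Prop :=
  forall K : set R, compact K -> K `<=` I2pi -> cintegrable leb K f.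

Definition is_weakD1 (j : nat) phi g : Prop :=
  [/\ locint1 phi, locint1 g &
    forall chi, test1 chi ->
      cint leb I2pi (fun x => phi x * iter j cderive1 chi x) =
      (-1) ^+ j * cint leb I2pi (fun x => g x * chi x)].

Definition weakD1 (j : nat) phi : R -> R[i] :=
  xget (fun=> 0) [set g | is_weakD1 j phi g].

(* [D_omega ^ j], with [D_omega = -i d/domega], in the weak sense on [(0, 2 pi)] *)
Definition Domega (j : nat) phi : R -> R[i] :=
  fun x => (- 'i) ^+ j * weakD1 j phi x.

Definition Wnorm s phi : \bar R :=
  ((\sum_(j < s.+1) \int[leb]_(x in I2pi) (sqnorm (Domega j phi x))%:E) `^ 2^-1)%E.

Definition sobolev s phi : Prop :=
  (forall j, (j <= s)%N -> exists g, is_weakD1 j phi g) /\ (Wnorm s phi < +oo)%E.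

Definition W2pi s phi : Prop :=
  sobolev s phi /\
  exists phi_ : nat -> R -> R[i],
    (forall n, periodic_smooth (phi_ n)) /\
    (fun n => Wnorm s (fun x => phi_ n x - phi x)) @ \oo --> 0%E.

(* [Phi] is holomorphic at [lam0] with values in [W2pi s], with Taylor
   coefficients [c] *)
Definition expansion s (Phi : R[i] -> R -> R[i]) lam0 (c : nat -> R -> R[i]) : Prop :=
  (forall j, W2pi s (c j)) /\
  exists2 rho : R, 0 < rho & forall lam, `|lam - lam0| < rho%:C ->
    W2pi s (Phi lam) /\
    (fun n => Wnorm s (fun x =>
       Phi lam x - \sum_(j < n) (lam - lam0) ^+ j * c j x)) @ \oo --> 0%E.

End Circle.

(* The pencil [A lam] acts from [W2pi s] to [W2pi t]. *)
Section JordanChains.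
Context {R : realType}.
Variables (s t : nat) (A : R[i] -> (R -> R[i]) -> (R -> R[i])).
Implicit Types (phi : R -> R[i]) (lam : R[i]).

Definition zero2pi phi : Prop := eq2pi phi (fun=> 0).

Definition root_function lam0 (Phi : R[i] -> R -> R[i]) (c : nat -> R -> R[i]) : Prop :=
  [/\ expansion s Phi lam0 c, ~ zero2pi (Phi lam0) & zero2pi (A lam0 (Phi lam0))].

Definition multiplicity lam0 (Phi : R[i] -> R -> R[i]) (kap : nat) : Prop :=
  exists G d, [/\ expansion t G lam0 d, ~ zero2pi (G lam0) &
    exists2 rho : R, 0 < rho & forall lam, `|lam - lam0| < rho%:C ->
      eq2pi (A lam (Phi lam)) (fun x => (lam - lam0) ^+ kap * G lam x)].

Definition pencil_eigenvalue lam0 : Prop := exists Phi c, root_function lam0 Phi c.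

Definition eigenvector lam0 phi : Prop :=
  W2pi s phi /\
  exists Phi c, root_function lam0 Phi c /\ eq2pi (c 0%N) phi.

Definition ev_rank lam0 phi (kap : nat) : Prop :=
  (exists Phi c, [/\ root_function lam0 Phi c, eq2pi (c 0%N) phi &
     multiplicity lam0 Phi kap]) /\
  (forall Phi c kap', root_function lam0 Phi c -> eq2pi (c 0%N) phi ->
     multiplicity lam0 Phi kap' -> (kap' <= kap)%N).

Definition jordan_chain lam0 (kap : nat) (ch : nat -> R -> R[i]) : Prop :=
  (forall k, (k < kap)%N -> W2pi s (ch k)) /\
  exists Phi c, [/\ root_function lam0 Phi c, multiplicity lam0 Phi kap &
    forall k, (k < kap)%N -> eq2pi (ch k) (c k)].

Definition in_ker lam0 phi : Prop := W2pi s phi /\ zero2pi (A lam0 phi).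

Definition ker_dim lam0 (J : nat) : Prop :=
  exists e : 'I_J -> R -> R[i],
    [/\ forall j, in_ker lam0 (e j),
        forall z : 'I_J -> R[i],
          zero2pi (fun x => \sum_j z j * e j x) -> forall j, z j = 0 &
        forall phi, in_ker lam0 phi ->
          exists z : 'I_J -> R[i], eq2pi phi (fun x => \sum_j z j * e j x)].

Definition ker_inner lam0 (ip : (R -> R[i]) -> (R -> R[i]) -> R[i]) : Prop :=
  [/\ forall phi phi' chi, in_ker lam0 phi -> in_ker lam0 phi' ->
        in_ker lam0 chi -> eq2pi phi phi' -> ip phi chi = ip phi' chi,
      forall z phi phi' chi, in_ker lam0 phi -> in_ker lam0 phi' ->
        in_ker lam0 chi ->
        ip (fun x => z * phi x + phi' x) chi = z * ip phi chi + ip phi' chi,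
      forall phi chi, in_ker lam0 phi -> in_ker lam0 chi ->
        ip chi phi = (ip phi chi)^* &
      forall phi, in_ker lam0 phi -> ~ zero2pi phi -> 0 < ip phi phi].

(* The inner product on the kernel that gives the orthogonal complement is
   arbitrary and may depend on [j]: "some orthogonal complement". *)
Definition canonical_system lam0 (J : nat) (kap : 'I_J -> nat)
    (ch : 'I_J -> nat -> R -> R[i]) : Prop :=
  [/\ ker_dim lam0 J,
      forall j : 'I_J, eigenvector lam0 (ch j 0%N) /\ ev_rank lam0 (ch j 0%N) (kap j),
      forall j : 'I_J, exists ip, [/\ ker_inner lam0 ip,
        forall i : 'I_J, (i < j)%N -> ip (ch j 0%N) (ch i 0%N) = 0 &
        forall phi kap', eigenvector lam0 phi ->
          (forall i : 'I_J, (i < j)%N -> ip phi (ch i 0%N) = 0) ->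
          ev_rank lam0 phi kap' -> (kap' <= kap j)%N] &
      forall j, jordan_chain lam0 (kap j) (ch j)].

End JordanChains.

Section Plane.
Context {R : realType}.
Implicit Types (w g : R * R -> R[i]) (al : nat * nat) (y : R * R).

Definition leb2 : {measure set (measurableTypeR R * measurableTypeR R) -> \bar R} :=
  (lebesgue_measure \x lebesgue_measure)%E.

Definition punctured : set (R * R) := [set y | y <> (0, 0)].

Definition polar_radius y : R := Num.sqrt (y.1 ^+ 2 + y.2 ^+ 2).

(* values in [[0, 2 pi)] *)
Definition polar_angle y : R :=
  if 0 <= y.2 then acos (y.1 / polar_radius y) else 2 * pi - acos (y.1 / polar_radius y).

Definition cderive (v : R * R) w : R * R -> R[i] :=
  fun y => 'D_v (reC \o w) y +i* 'D_v (imC \o w) y.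

Definition partial1 := cderive (1, 0).
Definition partial2 := cderive (0, 1).

Definition classicD al w : R * R -> R[i] :=
  iter al.1 partial1 (iter al.2 partial2 w).

Definition smooth2 w : Prop :=
  forall (dirs : seq bool) y,
    let w' := foldr (fun b : bool => if b then partial1 else partial2) w dirs in
    differentiable (reC \o w') y /\ differentiable (imC \o w') y.

(* [C_0^oo (R^2 \ {0})] *)
Definition test2 w : Prop :=
  smooth2 w /\
  exists K, [/\ compact K, K `<=` punctured & forall y, ~ K y -> w y = 0].

Definition locint2 w : Prop :=
  forall K : set (R * R), compact K -> K `<=` punctured -> cintegrable leb2 K w.

Definition is_weakD2 al w g : Prop :=
  [/\ locint2 w, locint2 g &
    forall chi, test2 chi ->
      cint leb2 setT (fun y => w y * classicD al chi y) =
      (-1) ^+ (al.1 + al.2) * cint leb2 setT (fun y => g y * chi y)].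

Definition weakD2 al w : R * R -> R[i] :=
  xget (fun=> 0) [set g | is_weakD2 al w g].

Definition Hnorm (a : R) (l : nat) w : \bar R :=
  ((\sum_(j < l.+1) \sum_(k < l.+1 | (j + k <= l)%N)
     \int[leb2]_(y in setT)
       (polar_radius y `^ (2 * (a - l%:R + (j + k)%:R)) *
        sqnorm ((- 'i) ^+ (j + k) * weakD2 (j : nat, k : nat) w y))%:E) `^ 2^-1)%E.

(* The completion of [C_0^oo (R^2 \ {0})] in [Hnorm a l], realised as a space
   of weakly differentiable functions on the punctured plane. *)
Definition Hspace (a : R) (l : nat) w : Prop :=
  [/\ forall al, (al.1 + al.2 <= l)%N -> exists g, is_weakD2 al w g,
      (Hnorm a l w < +oo)%E &
      exists w_ : nat -> R * R -> R[i],
        (forall n, test2 (w_ n)) /\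
        (fun n => Hnorm a l (fun y => w_ n y - w y)) @ \oo --> 0%E].

(* [p] stands for [\sum_(k <= 2m) p k * D_1 ^ k * D_2 ^ (2m - k)], [D_j = -i d_j];
   [deriv] is the notion of partial derivative in use. *)
Definition diffop (deriv : nat * nat -> (R * R -> R[i]) -> (R * R -> R[i]))
    (m : nat) (p : 'I_(2 * m).+1 -> R[i]) w : R * R -> R[i] :=
  fun y => \sum_k p k * (- 'i) ^+ (2 * m) * deriv (k : nat, (2 * m - k)%N) w y.

Definition adjoint (m : nat) (p : 'I_(2 * m).+1 -> R[i]) :
    'I_(2 * m).+1 -> R[i] := fun k => (p k)^*.

Definition solves (m : nat) (p : 'I_(2 * m).+1 -> R[i]) w g : Prop :=
  (forall k : 'I_(2 * m).+1,
     exists g', is_weakD2 (k : nat, (2 * m - k)%N) w g') /\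
  {ae leb2, forall y, diffop weakD2 p w y = g y}.

Definition symbol (m : nat) (p : 'I_(2 * m).+1 -> R[i]) (xi : R * R) : R[i] :=
  \sum_k p k * xi.1%:C ^+ k * xi.2%:C ^+ (2 * m - k).

(* the polynomial [tau |-> P (xi + tau * eta)] *)
Definition line_symbol (m : nat) (p : 'I_(2 * m).+1 -> R[i]) (xi eta : R * R) :
    {poly R[i]} :=
  \sum_k (p k)%:P * ((xi.1%:C)%:P + eta.1%:C *: 'X) ^+ k
                  * ((xi.2%:C)%:P + eta.2%:C *: 'X) ^+ (2 * m - k).

Definition properly_elliptic (m : nat) (p : 'I_(2 * m).+1 -> R[i]) : Prop :=
  (forall xi, xi <> (0, 0) -> symbol p xi <> 0) /\
  (forall xi eta : R * R, xi.1 * eta.2 - xi.2 * eta.1 != 0 ->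
     exists c (zs : seq R[i]),
       [/\ c != 0, line_symbol p xi eta = c *: \prod_(z <- zs) ('X - z%:P),
           size zs = (2 * m)%N & count (fun z => 0 < imC z) zs = m]).

End Plane.

Section Pencil.
Context {R : realType}.

(* functions of the polar coordinates [(r, omega)] *)
Definition rDr (F : R -> R -> R[i]) : R -> R -> R[i] :=
  fun r omega => r%:C * (- 'i) * cderive1 (fun r' => F r' omega) r.
Definition Dang (F : R -> R -> R[i]) : R -> R -> R[i] :=
  fun r omega => - 'i * cderive1 (F r) omega.

(* [P(D_y) = r^(-2m) \sum_(j + k <= 2m) b j k omega * D_omega ^ j * (r D_r) ^ k];
   this determines the [b j k], [j + k <= 2m]. *)
Definition polar_form (m : nat) (p : 'I_(2 * m).+1 -> R[i])
    (b : nat -> nat -> R -> R[i]) : Prop :=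
  (forall j k, (j + k <= 2 * m)%N -> periodic_smooth (b j k)) /\
  forall w, test2 w -> forall r omega, 0 < r ->
    diffop classicD p w (r * cos omega, r * sin omega) =
    (r%:C ^- (2 * m)) *
    \sum_(j < (2 * m).+1) \sum_(k < (2 * m).+1 | (j + k <= 2 * m)%N)
      b j k omega *
      iter j Dang (iter k rDr
        (fun r' omega' => w (r' * cos omega', r' * sin omega'))) r omega.

(* [P~(omega, D_omega, lam)] *)
Definition pencil (m : nat) (b : nat -> nat -> R -> R[i]) (lam : R[i])
    (phi : R -> R[i]) : R -> R[i] :=
  fun omega => \sum_(j < (2 * m).+1) \sum_(k < (2 * m).+1 | (j + k <= 2 * m)%N)
    b j k omega * lam ^+ k * Domega j phi omega.

(* [d^s P~ / dlam^s (lam) phi] *)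
Definition pencil_derive (m : nat) (b : nat -> nat -> R -> R[i]) (s : nat)
    (lam : R[i]) (phi : R -> R[i]) : R -> R[i] :=
  fun omega => derive1n s (fun z : R[i] => (pencil m b z phi omega : R[i]^o)) lam.

(* [r^e \sum_(q <= k) (i ln r)^q / q! * ch (k - q) (omega)] *)
Definition power_solution (e : R[i]) (ch : nat -> R -> R[i]) (k : nat) :
    R * R -> R[i] :=
  fun y => cpow (polar_radius y) e *
    \sum_(q < k.+1) (q`!%:R)^-1 * ('i * (ln (polar_radius y))%:C) ^+ q *
                    ch (k - q)%N (polar_angle y).

Definition biorthonormal (m : nat) (b : nat -> nat -> R -> R[i]) (lam : R[i])
    (J : nat) (kap : 'I_J -> nat) (phi psi : 'I_J -> nat -> R -> R[i]) : Prop :=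
  forall (zeta xi : 'I_J) (nu k : nat), (nu < kap zeta)%N -> (k < kap xi)%N ->
    \sum_(p < nu.+1) \sum_(q < k.+1)
      ((nu + k + 1 - p - q)`!%:R)^-1 *
      cdot leb I2pi (pencil_derive m b (nu + k + 1 - p - q) lam (phi xi q))
                    (psi zeta p)
    = ((xi == zeta) && (kap xi - k - 1 == nu)%N)%:R.

End Pencil.

(* Main.v *)
(** Put [t = ln r]. Then [r ^ (2 m) P] is the pencil with [lambda] replaced by
    [D_t = - i d/dt], and the integral of [tau (t) g (omega)] over the plane splits into a
    product. Test [P u = f] with [(eta (t + n) - eta (t - n)) v], [eta] a smooth step: as
    [P* v = 0], only the commutators of [P*] with the two steps survive, so that [(f, v)] is
    the limit of [E (u, - n) - E (u, n)], where the boundary pairing [E (u, T)] sees only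
    [T <= t <= T + 1]. The weights force [E (u, n) -> 0] and [E (u1, - n) -> 0], hence
    [(f, v)] is the pairing of [v] with the sum of power solutions. On a power solution the
    pairing is [i] times a Wronskian of the two chains. By the chain relations and the Green
    formula this Wronskian is constant in [t]; being also [exp (i (lambda - lambda_n) t)] times
    a polynomial, it vanishes for different eigenvalues, and for equal ones its value at
    [t = 0] is the left side of the biorthogonality relation. *)

Require Import Defs.
From HB Require Import structures.
From mathcomp Require Import all_boot all_order all_algebra.
From mathcomp Require Import complex.
From mathcomp Require Import all_classical all_reals all_analysis.
From mathcomp Require Import measurable_realfun.
From mathcomp Require Import ring lra zify.

Set Implicit Arguments.
Unset Strict Implicit.
Unset Printing Implicit Defensive.

Import Order.TTheory GRing.Theory Num.Theory.
Import numFieldNormedType.Exports.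

Local Open Scope classical_set_scope.
Local Open Scope ring_scope.
Local Open Scope complex_scope.

(** * Complex-valued integrals *)

Section ComplexModulus.
Context {R : realType}.
Implicit Types z w : R[i].

(** The chain elements are only known to lie in [W2pi], and the chain relations are hidden in the
    definition of a root function, so a power solution cannot be differentiated classically. Every
    identity with an angular factor is therefore proved for smooth periodic factors, where it is
    classical integration by parts in the plane, and then extended by density. For this it is
    written as a vanishing sum of functionals of the derivatives D_omega^j phi, each Lipschitz in
    L2. The chain relations are extracted from the expansion of a root function by pairing it with
    test functions and comparing powers of a real increment of lambda. The Green formula is itself
    derived from the planar one, with exponentials in t cut off by bumps; its shift 2i(m-1) records
    the factor r^(-2m) of the operator times the factor r^2 of the area element in (t, omega). The
    decay rates of the boundary pairings at the two ends are the distances of Im lambda_n from the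
    two lines bounding the strip, and half of each rate is spent on absorbing the powers of t. *)

Definition cabs z : R := complex.Re `|z|.

Lemma normcC z : `|z| = (cabs z)%:C.
Proof. by rewrite /cabs normc_def. Qed.

Lemma cabs_ge0 z : 0 <= cabs z.
Proof. by rewrite /cabs normc_def /= sqrtr_ge0. Qed.

Lemma cabsM z w : cabs (z * w) = cabs z * cabs w.
Proof. by apply: complexI; rewrite rmorphM /= -!normcC normrM. Qed.

Lemma cabsX z n : cabs (z ^+ n) = cabs z ^+ n.
Proof. by apply: complexI; rewrite rmorphXn /= -!normcC normrX. Qed.

Lemma ler_cabsD z w : cabs (z + w) <= cabs z + cabs w.
Proof. by rewrite -lecR rmorphD /= -!normcC ler_normD. Qed.

Lemma cabsN z : cabs (- z) = cabs z.
Proof. by rewrite /cabs normrN. Qed.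

Lemma cabsJ z : cabs z^* = cabs z.
Proof. by rewrite /cabs normcJ. Qed.

Lemma cabs0 : cabs 0 = 0. Proof. by rewrite /cabs normr0. Qed.

Lemma cabs1 : cabs 1 = 1. Proof. by rewrite /cabs normr1. Qed.

Lemma cabs_real (x : R) : cabs x%:C = `|x|.
Proof. by rewrite /cabs normc_def /= expr0n addr0 sqrtr_sqr. Qed.

Lemma cabs_i : cabs ('i : R[i]) = 1.
Proof. by rewrite /cabs normc_def /= expr0n expr1n add0r sqrtr1. Qed.

Lemma cabs_eq0 z : cabs z = 0 -> z = 0.
Proof. by move=> z0; apply/normr0_eq0; rewrite normcC z0. Qed.

Lemma ler_cabs_sum I (r : seq I) (P : pred I) (F : I -> R[i]) :
  cabs (\sum_(i <- r | P i) F i) <= \sum_(i <- r | P i) cabs (F i).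
Proof.
elim/big_ind2 : _ => [|x1 x2 y1 y2 h1 h2|//]; first by rewrite cabs0.
by apply: (le_trans (ler_cabsD _ _)); exact: lerD.
Qed.

Lemma sqnormE z : sqnorm z = cabs z ^+ 2.
Proof.
by apply: complexI; rewrite rmorphXn /= -normcC /sqnorm /reC /imC add_Re2_Im2.
Qed.

Lemma sqnorm_ge0 z : 0 <= sqnorm z.
Proof. by rewrite sqnormE sqr_ge0. Qed.

Lemma cabsE z : cabs z = Num.sqrt (sqnorm z).
Proof. by rewrite sqnormE sqrtr_sqr ger0_norm// cabs_ge0. Qed.

Lemma reC_le z : `|reC z| <= cabs z.
Proof. by rewrite cabsE -sqrtr_sqr ler_wsqrtr// /sqnorm lerDl sqr_ge0. Qed.

Lemma imC_le z : `|imC z| <= cabs z.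
Proof. by rewrite cabsE -sqrtr_sqr ler_wsqrtr// /sqnorm lerDr sqr_ge0. Qed.

Lemma cabs_le z : cabs z <= `|reC z| + `|imC z|.
Proof.
rewrite -(@ler_pXn2r _ 2) ?nnegrE ?cabs_ge0 ?addr_ge0//.
rewrite -sqnormE /sqnorm sqrrD !real_normK ?num_real//.
by rewrite -addrA lerD2l lerDr mulrn_wge0// mulr_ge0.
Qed.

Lemma reCD z w : reC (z + w) = reC z + reC w. Proof. by case: z; case: w. Qed.
Lemma imCD z w : imC (z + w) = imC z + imC w. Proof. by case: z; case: w. Qed.
Lemma reCN z : reC (- z) = - reC z. Proof. by case: z. Qed.
Lemma imCN z : imC (- z) = - imC z. Proof. by case: z. Qed.
Lemma reCM z w : reC (z * w) = reC z * reC w - imC z * imC w.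
Proof. by case: z; case: w. Qed.
Lemma imCM z w : imC (z * w) = reC z * imC w + imC z * reC w.
Proof. by case: z; case: w. Qed.
Lemma reCJ z : reC z^* = reC z. Proof. by case: z. Qed.
Lemma imCJ z : imC z^* = - imC z. Proof. by case: z. Qed.
Lemma ceqP z w : reC z = reC w -> imC z = imC w -> z = w.
Proof. by case: z; case: w => a b c d /= -> ->. Qed.

End ComplexModulus.

Section ComplexIntegral.
Context d (T : measurableType d) (R : realType).
Variable mu : {measure set T -> \bar R}.
Implicit Types (D : set T) (f g h : T -> R[i]).

Definition cmeas D f :=
  measurable_fun D (reC \o f) /\ measurable_fun D (imC \o f).

Lemma cmeas_ext D f g : {in D, f =1 g} -> cmeas D f -> cmeas D g.
Proof.
move=> fg [m1 m2]; split; [apply: eq_measurable_fun m1|apply: eq_measurable_fun m2];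
  by move=> x xD /=; rewrite fg.
Qed.

Lemma cmeas_cst D z : cmeas D (fun=> z).
Proof. by split; exact: measurable_cst. Qed.

Lemma cmeasD D f g : cmeas D f -> cmeas D g -> cmeas D (fun x => f x + g x).
Proof.
move=> [f1 f2] [g1 g2]; split.
  by rewrite (_ : _ \o _ = (reC \o f) \+ (reC \o g));
    [exact: measurable_funD|apply/funext => x /=; rewrite reCD].
by rewrite (_ : _ \o _ = (imC \o f) \+ (imC \o g));
    [exact: measurable_funD|apply/funext => x /=; rewrite imCD].
Qed.

Lemma cmeasM D f g : cmeas D f -> cmeas D g -> cmeas D (fun x => f x * g x).
Proof.
move=> [f1 f2] [g1 g2]; split.
  rewrite (_ : _ \o _ = ((reC \o f) \* (reC \o g)) \- ((imC \o f) \* (imC \o g))).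
    by apply: measurable_funB; exact: measurable_funM.
  by apply/funext => x /=; rewrite reCM.
rewrite (_ : _ \o _ = ((reC \o f) \* (imC \o g)) \+ ((imC \o f) \* (reC \o g))).
  by apply: measurable_funD; exact: measurable_funM.
by apply/funext => x /=; rewrite imCM.
Qed.

Lemma cmeasJ D f : cmeas D f -> cmeas D (fun x => (f x)^*).
Proof.
move=> [f1 f2]; split.
  by rewrite (_ : _ \o _ = reC \o f)//; apply/funext => x /=; rewrite reCJ.
rewrite (_ : _ \o _ = \- (imC \o f)); first exact: measurableT_comp.
by apply/funext => x /=; rewrite imCJ.
Qed.

Lemma cmeas_sum D I (r : seq I) (P : pred I) (F : I -> T -> R[i]) :
  (forall i, P i -> cmeas D (F i)) ->
  cmeas D (fun x => \sum_(i <- r | P i) F i x).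
Proof.
move=> mF; elim: r => [|i r ih].
  by apply: (cmeas_ext _ (cmeas_cst D 0)) => x _; rewrite big_nil.
case Pi: (P i).
  by apply: (cmeas_ext _ (cmeasD (mF i Pi) ih)) => x _; rewrite big_cons Pi.
by apply: (cmeas_ext _ ih) => x _; rewrite big_cons Pi.
Qed.

Lemma cmeas_real D (f : T -> R) :
  measurable_fun D f -> cmeas D (fun x => (f x)%:C).
Proof. by move=> mf; split => //; exact: measurable_cst. Qed.

Lemma measurable_cabs D f : measurable D -> cmeas D f ->
  measurable_fun D (cabs \o f).
Proof.
move=> mD [f1 f2].
rewrite (_ : _ \o _ =
  @Num.sqrt R \o (fun x => (reC (f x)) ^+ 2 + (imC (f x)) ^+ 2)); last first.
  by apply/funext => x /=; rewrite cabsE.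
apply: (measurable_comp measurableT) => //=.
  by apply: continuous_measurable_fun; exact: sqrt_continuous.
by apply: measurable_funD; exact: measurable_funX.
Qed.

Lemma cintegrable_meas D f : cintegrable mu D f -> cmeas D f.
Proof.
by move=> [/integrableP[f1 _] /integrableP[f2 _]]; split; apply/measurable_EFinP.
Qed.

Lemma cintegrable_le D f (g : T -> R) : measurable D -> cmeas D f ->
  mu.-integrable D (EFin \o g) -> (forall x, D x -> cabs (f x) <= g x) ->
  cintegrable mu D f.
Proof.
move=> mD [f1 f2] ig fg; split.
  apply: (le_integrable mD _ _ ig); first exact/measurable_EFinP.
  move=> x Dx /=; rewrite lee_fin (le_trans (reC_le _))// (le_trans (fg _ Dx))//.
  exact: ler_norm.
apply: (le_integrable mD _ _ ig); first exact/measurable_EFinP.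
move=> x Dx /=; rewrite lee_fin (le_trans (imC_le _))// (le_trans (fg _ Dx))//.
exact: ler_norm.
Qed.

Lemma integrable_cabs D f : measurable D -> cintegrable mu D f ->
  mu.-integrable D (EFin \o (cabs \o f)).
Proof.
move=> mD fi; have [f1 f2] := fi.
have i12 : mu.-integrable D (EFin \o (fun x => `|reC (f x)| + `|imC (f x)|)).
  rewrite (_ : _ \o _ = (EFin \o (fun x => `|reC (f x)|)) \+
    (EFin \o (fun x => `|imC (f x)|)))//.
  by apply: integrableD => //; exact: integrable_norm.
apply: (le_integrable mD _ _ i12).
  by apply/measurable_EFinP; apply: measurable_cabs => //; exact: cintegrable_meas.
move=> x Dx /=; rewrite lee_fin ger0_norm ?cabs_ge0// (le_trans (cabs_le _))//.
exact: ler_norm.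
Qed.

Lemma cintegrable_ext D f g : {in D, f =1 g} -> measurable D ->
  cintegrable mu D f -> cintegrable mu D g.
Proof.
move=> fg mD [f1 f2]; split; [move: f1|move: f2]; apply: eq_integrable => // x xD /=;
  by rewrite fg.
Qed.

Lemma cint_ext D f g : {in D, f =1 g} -> cint mu D f = cint mu D g.
Proof.
by move=> fg; rewrite /cint; congr Complex; apply: eq_Rintegral => x xD /=; rewrite fg.
Qed.

Lemma cintegrableD D f g : measurable D -> cintegrable mu D f ->
  cintegrable mu D g -> cintegrable mu D (fun x => f x + g x).
Proof.
move=> mD [f1 f2] [g1 g2]; split.
  rewrite (_ : _ \o _ = (EFin \o (reC \o f)) \+ (EFin \o (reC \o g))).
    exact: integrableD.
  by apply/funext => x /=; rewrite reCD.
rewrite (_ : _ \o _ = (EFin \o (imC \o f)) \+ (EFin \o (imC \o g))).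
  exact: integrableD.
by apply/funext => x /=; rewrite imCD.
Qed.

Lemma cintD D f g : measurable D -> cintegrable mu D f -> cintegrable mu D g ->
  cint mu D (fun x => f x + g x) = cint mu D f + cint mu D g.
Proof.
move=> mD [f1 f2] [g1 g2]; apply: ceqP; rewrite ?reCD ?imCD /=.
  rewrite -RintegralD//; apply: eq_Rintegral => x _ /=; exact: reCD.
rewrite -RintegralD//; apply: eq_Rintegral => x _ /=; exact: imCD.
Qed.

Lemma cintegrableZ D f z : measurable D -> cintegrable mu D f ->
  cintegrable mu D (fun x => z * f x).
Proof.
move=> mD fi.
have := integrableZl mD (cabs z) (integrable_cabs mD fi).
rewrite (_ : (fun _ => _) = EFin \o (fun x => cabs z * cabs (f x)))//.
move/(cintegrable_le mD); apply.
  by apply: cmeasM; [exact: cmeas_cst|exact: cintegrable_meas].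
by move=> x Dx; rewrite cabsM.
Qed.

Lemma cintZ D f z : measurable D -> cintegrable mu D f ->
  cint mu D (fun x => z * f x) = z * cint mu D f.
Proof.
move=> mD [f1 f2].
have i1 a : mu.-integrable D (EFin \o (fun x => a * (reC (f x)))).
  by rewrite (_ : _ \o _ = (fun x => (a%:E * (reC (f x))%:E)%E))//; exact: integrableZl.
have i2 a : mu.-integrable D (EFin \o (fun x => a * (imC (f x)))).
  by rewrite (_ : _ \o _ = (fun x => (a%:E * (imC (f x))%:E)%E))//; exact: integrableZl.
apply: ceqP; rewrite ?reCM ?imCM /=.
  rewrite -!RintegralZl// -RintegralB//.
  by apply: eq_Rintegral => x _ /=; rewrite reCM.
rewrite -!RintegralZl// -RintegralD//.
by apply: eq_Rintegral => x _ /=; rewrite imCM.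
Qed.

Lemma cintegrable0 D : cintegrable mu D (fun=> 0).
Proof. by split; rewrite (_ : _ \o _ = cst 0%E)//; exact: integrable0. Qed.

Lemma cint0 D : cint mu D (fun=> 0) = 0.
Proof.
by apply: ceqP; rewrite /cint /= /Rintegral (eq_integral (cst 0%E))// integral0.
Qed.

Lemma cintegrable_sum D I (r : seq I) (P : pred I) (F : I -> T -> R[i]) :
  measurable D -> (forall i, P i -> cintegrable mu D (F i)) ->
  cintegrable mu D (fun x => \sum_(i <- r | P i) F i x).
Proof.
move=> mD iF; elim: r => [|i r ih].
  by apply: (cintegrable_ext _ mD (cintegrable0 D)) => x _; rewrite big_nil.
case Pi: (P i).
  by apply: (cintegrable_ext _ mD (cintegrableD mD (iF i Pi) ih)) => x _; rewrite big_cons Pi.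
by apply: (cintegrable_ext _ mD ih) => x _; rewrite big_cons Pi.
Qed.

Lemma cint_sum D I (r : seq I) (P : pred I) (F : I -> T -> R[i]) :
  measurable D -> (forall i, P i -> cintegrable mu D (F i)) ->
  cint mu D (fun x => \sum_(i <- r | P i) F i x) =
  \sum_(i <- r | P i) cint mu D (F i).
Proof.
move=> mD iF; elim: r => [|i r ih].
  by rewrite big_nil -[RHS](cint0 D); apply: cint_ext => x _; rewrite big_nil.
rewrite big_cons -ih; case Pi: (P i).
  rewrite -cintD; [|by []|exact: iF|exact: cintegrable_sum].
  by apply: cint_ext => x _; rewrite big_cons Pi.
by apply: cint_ext => x _; rewrite big_cons Pi.
Qed.

Lemma cintegrableN D f : measurable D -> cintegrable mu D f ->
  cintegrable mu D (fun x => - f x).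
Proof.
move=> mD fi; apply: (cintegrable_ext _ mD (cintegrableZ (-1) mD fi)) => x _.
by rewrite mulN1r.
Qed.

Lemma cintN D f : measurable D -> cintegrable mu D f ->
  cint mu D (fun x => - f x) = - cint mu D f.
Proof.
move=> mD fi; rewrite -mulN1r -cintZ//; apply: cint_ext => x _.
by rewrite mulN1r.
Qed.

Lemma cintegrableB D f g : measurable D -> cintegrable mu D f ->
  cintegrable mu D g -> cintegrable mu D (fun x => f x - g x).
Proof. by move=> mD fi gi; apply: cintegrableD => //; exact: cintegrableN. Qed.

Lemma cintB D f g : measurable D -> cintegrable mu D f -> cintegrable mu D g ->
  cint mu D (fun x => f x - g x) = cint mu D f - cint mu D g.
Proof.
by move=> mD fi gi; rewrite cintD// ?cintN//; exact: cintegrableN.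
Qed.

Lemma cintegrableJ D f : measurable D -> cintegrable mu D f ->
  cintegrable mu D (fun x => (f x)^*).
Proof.
move=> mD fi; apply: (cintegrable_le mD _ (integrable_cabs mD fi)).
  by apply: cmeasJ; exact: cintegrable_meas.
by move=> x _; rewrite cabsJ.
Qed.

Lemma cintJ D f : measurable D -> cintegrable mu D f ->
  cint mu D (fun x => (f x)^*) = (cint mu D f)^*.
Proof.
move=> mD [f1 f2]; apply: ceqP; rewrite ?reCJ ?imCJ /=.
  by apply: eq_Rintegral => x _ /=; rewrite reCJ.
rewrite -mulN1r -RintegralZl//; apply: eq_Rintegral => x _ /=.
by rewrite imCJ mulN1r.
Qed.

(** The real and imaginary parts are bounded separately by the integral of the modulus, whence the
    factor 2. *)
Lemma cabs_cint D f : measurable D -> cintegrable mu D f ->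
  cabs (cint mu D f) <= 2 * Rintegral mu D (cabs \o f).
Proof.
move=> mD fi; have [f1 f2] := fi; have fa := integrable_cabs mD fi.
rewrite (le_trans (cabs_le _))// mulr_natl mulr2n; apply: lerD.
  rewrite (le_trans (le_normr_Rintegral mD f1))//; apply: le_Rintegral => //.
    exact: integrable_norm.
  by move=> x _; exact: reC_le.
rewrite (le_trans (le_normr_Rintegral mD f2))//; apply: le_Rintegral => //.
  exact: integrable_norm.
by move=> x _; exact: imC_le.
Qed.

Lemma cint_ae_eq D f g : measurable D -> cmeas D f -> cmeas D g ->
  {ae mu, forall x, D x -> f x = g x} -> cint mu D f = cint mu D g.
Proof.
move=> mD [f1 f2] [g1 g2] fg; apply: ceqP; rewrite /cint /= /Rintegral; congr fine;
  apply: ae_eq_integral => //; try exact/measurable_EFinP;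
  by apply: filterS fg => x /[apply] /= ->.
Qed.

Lemma cintegrable_ae_eq D f g : measurable D -> cmeas D g ->
  {ae mu, forall x, D x -> f x = g x} -> cintegrable mu D f -> cintegrable mu D g.
Proof.
move=> mD [g1 g2] fg fi; have [/integrableP[f1 f1o] /integrableP[f2 f2o]] := fi.
split; apply/integrableP; split; try exact/measurable_EFinP.
- rewrite (ae_eq_integral (fun x => `|(EFin \o (reC \o f)) x|%E))//.
  + by apply: measurableT_comp => //; exact/measurable_EFinP.
  + exact: measurableT_comp.
  + by apply: filterS fg => x /[apply] /= ->.
- rewrite (ae_eq_integral (fun x => `|(EFin \o (imC \o f)) x|%E))//.
  + by apply: measurableT_comp => //; exact/measurable_EFinP.
  + exact: measurableT_comp.
  + by apply: filterS fg => x /[apply] /= ->.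
Qed.

Lemma cintegrableS D E f : measurable D -> measurable E -> D `<=` E ->
  cintegrable mu E f -> cintegrable mu D f.
Proof. by move=> mD mE DE [f1 f2]; split; exact: integrableS f1 || exact: integrableS f2. Qed.

(** Pointwise convergence is assumed as eventual equality, which is what cut-off functions equal to
    1 on growing sets provide. The conclusion is stated through [cabs], so only limits of real
    sequences occur. *)
Lemma cint_dominated D (f_ : nat -> T -> R[i]) f (g : T -> R) :
  measurable D -> (forall n, cmeas D (f_ n)) -> cmeas D f ->
  mu.-integrable D (EFin \o g) ->
  (forall n x, D x -> cabs (f_ n x) <= g x) ->
  (forall x, D x -> \forall n \near \oo, f_ n x = f x) ->
  (fun n => cabs (cint mu D (f_ n) - cint mu D f)) @ \oo --> 0.
Proof.
move=> mD mf_ mf ig fg cf.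
have H (p : R[i] -> R) : (forall z, `|p z| <= cabs z) ->
    (forall n, measurable_fun D (p \o f_ n)) -> measurable_fun D (p \o f) ->
    (fun n => Rintegral mu D (p \o f_ n)) @ \oo --> Rintegral mu D (p \o f).
  move=> pz mpf_ mpf.
  have [||||i _ c] := @dominated_convergence _ _ _ mu D mD
    (fun n => EFin \o (p \o f_ n)) (EFin \o (p \o f)) (EFin \o g) _ _ _ ig _.
  - by move=> n; exact/measurable_EFinP.
  - exact/measurable_EFinP.
  - apply/aeW => x Dx /=; apply: cvg_near_cst.
    by apply: filterS (cf x Dx) => n /= ->.
  - apply/aeW => x n Dx /=; rewrite lee_fin (le_trans (pz _))//; exact: fg.
  rewrite /Rintegral; apply: fine_cvg.
  by rewrite fineK//; exact: integrable_fin_num.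
apply: (@squeeze_cvgr _ _ _ _ (fun=> 0) (fun n =>
  `|Rintegral mu D (reC \o f_ n) - Rintegral mu D (reC \o f)| +
  `|Rintegral mu D (imC \o f_ n) - Rintegral mu D (imC \o f)|)).
- apply: nearW => n; rewrite cabs_ge0/=.
  by rewrite (le_trans (cabs_le _))// reCD imCD reCN imCN.
- exact: cvg_cst.
rewrite -[X in _ --> X]addr0; apply: cvgD.
  rewrite -(normr0 R); apply: cvg_norm.
  rewrite -(subrr (Rintegral mu D (reC \o f))); apply: cvgB; last exact: cvg_cst.
  by apply: H => [z|n|]; [exact: reC_le|have [] := mf_ n|have [] := mf].
rewrite -(normr0 R); apply: cvg_norm.
rewrite -(subrr (Rintegral mu D (imC \o f))); apply: cvgB; last exact: cvg_cst.
by apply: H => [z|n|]; [exact: imC_le|have [] := mf_ n|have [] := mf].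
Qed.

Definition L2 D f := cmeas D f /\ mu.-integrable D (EFin \o (fun x => cabs (f x) ^+ 2)).

Definition sqn D f : R := Rintegral mu D (fun x => cabs (f x) ^+ 2).

Lemma sqn_ge0 D f : 0 <= sqn D f.
Proof. by apply: Rintegral_ge0 => x _; exact: sqr_ge0. Qed.

Lemma integrable_cabsM D f g : measurable D -> L2 D f -> L2 D g ->
  mu.-integrable D (EFin \o (fun x => cabs (f x) * cabs (g x))).
Proof.
move=> mD [mf f2] [mg g2].
have i : mu.-integrable D (EFin \o (fun x => cabs (f x) ^+ 2 + cabs (g x) ^+ 2)).
  rewrite (_ : _ \o _ = (EFin \o (fun x => cabs (f x) ^+ 2)) \+
    (EFin \o (fun x => cabs (g x) ^+ 2)))//.
  exact: integrableD.
apply: (le_integrable mD _ _ i).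
  apply/measurable_EFinP; apply: measurable_funM.
    exact: (measurable_cabs mD mf).
  exact: (measurable_cabs mD mg).
move=> x Dx /=; rewrite lee_fin ger0_norm ?mulr_ge0 ?cabs_ge0//.
rewrite ger0_norm ?addr_ge0 ?sqr_ge0//.
have := cabs_ge0 (f x); have := cabs_ge0 (g x); nra.
Qed.

Lemma L2_cintegrableM D f g : measurable D -> L2 D f -> L2 D g ->
  cintegrable mu D (fun x => f x * g x).
Proof.
move=> mD f2 g2; apply: (cintegrable_le mD _ (integrable_cabsM mD f2 g2)).
  by apply: cmeasM; [case: f2|case: g2].
by move=> x _; rewrite cabsM.
Qed.

(** The integral of (s|f| - |g|)^2 is a nonnegative quadratic in s, so its discriminant is not
    positive. The factor 4 is the square of the constant in [cabs_cint]. *)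
Lemma cauchy_schwarz D f g : measurable D -> L2 D f -> L2 D g ->
  cabs (cint mu D (fun x => f x * g x)) ^+ 2 <= 4 * (sqn D f * sqn D g).
Proof.
move=> mD f2 g2; set X := Rintegral mu D (fun x => cabs (f x) * cabs (g x)).
have X0 : 0 <= X by apply: Rintegral_ge0 => x _; rewrite mulr_ge0 ?cabs_ge0.
have iX := integrable_cabsM mD f2 g2.
have [mf i1] := f2; have [mg i2] := g2.
have key s : 0 <= s ^+ 2 * sqn D f - 2 * s * X + sqn D g.
  have ia a (h : T -> R) : mu.-integrable D (EFin \o h) ->
      mu.-integrable D (EFin \o (fun x => a * h x)).
    move=> hi; rewrite (_ : _ \o _ = (fun x => (a%:E * (h x)%:E)%E))//.
    exact: integrableZl.
  have -> : s ^+ 2 * sqn D f - 2 * s * X + sqn D g =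
      Rintegral mu D (fun x => (s * cabs (f x) - cabs (g x)) ^+ 2).
    rewrite /sqn /X -RintegralZl// -[2 * s * _]RintegralZl//.
    rewrite -RintegralB//; [|exact: ia|exact: ia].
    rewrite -RintegralD//.
      by apply: eq_Rintegral => x _ /=; ring.
    rewrite (_ : _ \o _ = ((EFin \o (fun x => (s ^+ 2 * cabs (f x) ^+ 2)%R)) \-
      (EFin \o (fun x => (2 * s * (cabs (f x) * cabs (g x)))%R)))%E)//.
    by apply: integrableB => //; exact: ia.
  by apply: Rintegral_ge0 => x _; exact: sqr_ge0.
have XX : X ^+ 2 <= sqn D f * sqn D g.
  have f0 := sqn_ge0 D f; have g0 := sqn_ge0 D g.
  (* The quadratic is evaluated at its minimum s = X / sqn f. If the leading coefficient vanishes
     and X does not, s = (sqn g + 1) / (2 X) makes it equal to -1. *)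
  have [A0|A0] := ltP 0 (sqn D f).
    have := key (X / sqn D f).
    rewrite (_ : _ + _ = sqn D g - X ^+ 2 / sqn D f).
      by rewrite subr_ge0 ler_pdivrMr// mulrC.
    by field; rewrite gt_eqF.
  have A : sqn D f = 0 by apply/eqP; rewrite eq_le A0 f0.
  rewrite A mul0r; have [->|X1] := eqVneq X 0; first by rewrite expr0n.
  have Xp : 0 < X by rewrite lt_def X1.
  have := key ((sqn D g + 1) / (2 * X)).
  rewrite A mulr0 add0r (_ : _ + _ = -1); last by field.
  by rewrite ler0N1.
have := cabs_cint mD (L2_cintegrableM mD f2 g2).
rewrite (_ : Rintegral mu D _ = X); last first.
  by apply: eq_Rintegral => x _ /=; rewrite cabsM.
have := cabs_ge0 (cint mu D (fun x => f x * g x)); nra.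
Qed.

Lemma L2D D f g : measurable D -> L2 D f -> L2 D g -> L2 D (fun x => f x + g x).
Proof.
move=> mD [mf f2] [mg g2]; have mfg := cmeasD mf mg; split=> //.
have i : mu.-integrable D (EFin \o (fun x => 2 * (cabs (f x) ^+ 2 + cabs (g x) ^+ 2))).
  rewrite (_ : _ \o _ = (fun x => 2%:E * ((cabs (f x) ^+ 2 + cabs (g x) ^+ 2)%:E))%E)//.
  apply: integrableZl => //.
  rewrite (_ : (fun _ => _) = (EFin \o (fun x => cabs (f x) ^+ 2)) \+
    (EFin \o (fun x => cabs (g x) ^+ 2)))//.
  exact: integrableD.
apply: (le_integrable mD _ _ i).
  by apply/measurable_EFinP; apply: measurable_funX; exact: (measurable_cabs mD mfg).
move=> x Dx /=; rewrite lee_fin ger0_norm ?sqr_ge0// ger0_norm; last first.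
  by rewrite mulr_ge0// addr_ge0// sqr_ge0.
have h0 := cabs_ge0 (f x + g x); have h1 := ler_cabsD (f x) (g x).
have := ler_pM h0 h0 h1 h1.
have := sqr_ge0 (cabs (f x) - cabs (g x)); nra.
Qed.

Lemma L2_ext D f g : {in D, f =1 g} -> measurable D -> L2 D f -> L2 D g.
Proof.
move=> fg mD [mf f2]; split; first exact: cmeas_ext mf.
by apply: eq_integrable f2 => // x xD /=; rewrite fg.
Qed.

Lemma L2_bounded D f g (C : R) : measurable D -> cmeas D g ->
  (forall x, D x -> cabs (g x) <= C) -> L2 D f -> L2 D (fun x => g x * f x).
Proof.
move=> mD mg gC [mf f2]; have mgf := cmeasM mg mf; split=> //.
have i : mu.-integrable D (EFin \o (fun x => C ^+ 2 * (cabs (f x) ^+ 2))).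
  rewrite (_ : _ \o _ = (fun x => (C ^+ 2)%:E * ((cabs (f x) ^+ 2)%:E))%E)//.
  exact: integrableZl.
apply: (le_integrable mD _ _ i).
  by apply/measurable_EFinP; apply: measurable_funX; exact: (measurable_cabs mD mgf).
move=> x Dx /=; rewrite lee_fin ger0_norm ?sqr_ge0// ger0_norm; last first.
  by rewrite mulr_ge0// sqr_ge0.
rewrite cabsM exprMn ler_wpM2r ?sqr_ge0// ler_sqr ?nnegrE ?cabs_ge0 ?gC//.
by rewrite (le_trans (cabs_ge0 _) (gC x Dx)).
Qed.

Lemma L2Z D f z : measurable D -> L2 D f -> L2 D (fun x => z * f x).
Proof.
move=> mD; apply: (L2_bounded mD (cmeas_cst D z)) => x _; exact: lexx.
Qed.

Lemma L2B D f g : measurable D -> L2 D f -> L2 D g -> L2 D (fun x => f x - g x).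
Proof.
move=> mD f2 g2; have := L2D mD f2 (L2Z (-1) mD g2).
by apply: L2_ext => // x _; rewrite mulN1r.
Qed.

Lemma L2J D f : measurable D -> L2 D f -> L2 D (fun x => (f x)^*).
Proof.
move=> mD [mf f2]; split; first exact: cmeasJ.
by apply: eq_integrable f2 => // x _ /=; rewrite cabsJ.
Qed.

Lemma L2_sum D I (r : seq I) (P : pred I) (F : I -> T -> R[i]) :
  measurable D -> (forall i, P i -> L2 D (F i)) ->
  L2 D (fun x => \sum_(i <- r | P i) F i x).
Proof.
move=> mD iF; elim: r => [|i r ih].
  have : L2 D (fun=> 0).
    split; first exact: cmeas_cst.
    by rewrite (_ : _ \o _ = cst 0%E) ?integrable0//; apply/funext => x /=; rewrite cabs0 expr0n.
  by apply: L2_ext => // x _; rewrite big_nil.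
case Pi: (P i).
  by apply: (L2_ext _ mD (L2D mD (iF i Pi) ih)) => x _; rewrite big_cons Pi.
by apply: (L2_ext _ mD ih) => x _; rewrite big_cons Pi.
Qed.

End ComplexIntegral.

(** * Smooth complex-valued functions on the line *)

Section SmoothCalculus.
Context {R : realType}.
Implicit Types (f g : R -> R[i]) (x : R) (z : R[i]).

Definition is_cd x f z :=
  is_derive x (1 : R) (reC \o f) (reC z) /\ is_derive x (1 : R) (imC \o f) (imC z).

Lemma is_cd_eq x f z w : is_cd x f z -> z = w -> is_cd x f w.
Proof. by move=> h <-. Qed.

Lemma is_cdE x f z : is_cd x f z -> cderive1 f x = z.
Proof.
by move=> [h1 h2]; apply: ceqP; rewrite /cderive1 /= derive1E derive_val.
Qed.

Lemma is_cdP x f : derivable (reC \o f) x 1 -> derivable (imC \o f) x 1 ->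
  is_cd x f (cderive1 f x).
Proof. by move=> h1 h2; split; [have := derivableP h1|have := derivableP h2];
  rewrite -derive1E. Qed.

Lemma is_cd_cst x z : is_cd x (fun=> z) 0.
Proof. by split => /=; exact: is_derive_cst. Qed.

Lemma is_cdD x f g z w : is_cd x f z -> is_cd x g w ->
  is_cd x (fun t => f t + g t) (z + w).
Proof.
move=> [f1 f2] [g1 g2]; split.
  rewrite (_ : _ \o _ = (reC \o f) + (reC \o g)).
    by rewrite reCD; exact: is_deriveD.
  by apply/funext => t /=; rewrite reCD.
rewrite (_ : _ \o _ = (imC \o f) + (imC \o g)).
  by rewrite imCD; exact: is_deriveD.
by apply/funext => t /=; rewrite imCD.
Qed.

Lemma is_cdM x f g z w : is_cd x f z -> is_cd x g w ->
  is_cd x (fun t => f t * g t) (z * g x + f x * w).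
Proof.
move=> [f1 f2] [g1 g2]; split.
  rewrite (_ : _ \o _ = (reC \o f) * (reC \o g) - (imC \o f) * (imC \o g)).
    apply: (is_derive_eq (is_deriveB (is_deriveM f1 g1) (is_deriveM f2 g2))).
    by rewrite /GRing.scale /= reCD !reCM; ring.
  by apply/funext => t /=; rewrite reCM.
rewrite (_ : _ \o _ = (reC \o f) * (imC \o g) + (imC \o f) * (reC \o g)).
  apply: (is_derive_eq (is_deriveD (is_deriveM f1 g2) (is_deriveM f2 g1))).
  by rewrite /GRing.scale /= imCD !imCM; ring.
by apply/funext => t /=; rewrite imCM.
Qed.

Lemma is_cdZ x f a z : is_cd x f z -> is_cd x (fun t => a * f t) (a * z).
Proof.
by move=> fz; apply: (is_cd_eq (is_cdM (is_cd_cst x a) fz)); rewrite mul0r add0r.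
Qed.

Lemma is_cdJ x f z : is_cd x f z -> is_cd x (fun t => (f t)^*) z^*.
Proof.
move=> [f1 f2]; split.
  by rewrite reCJ (_ : _ \o _ = reC \o f)//; apply/funext => t /=; rewrite reCJ.
rewrite imCJ (_ : _ \o _ = - (imC \o f)); first exact: is_deriveN.
by apply/funext => t /=; rewrite imCJ.
Qed.

Lemma is_cd_real x (h : R -> R) (a : R) : is_derive x (1 : R) h a ->
  is_cd x (fun t => (h t)%:C) a%:C.
Proof. by move=> ha; split => //=; exact: is_derive_cst. Qed.

Lemma is_cd_comp x f (h : R -> R) z (a : R) : is_cd (h x) f z ->
  is_derive x (1 : R) h a -> is_cd x (f \o h) (a%:C * z).
Proof.
move=> [f1 f2] ha; split.
  rewrite reCM /= mul0r subr0 mulrC.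
  exact: (is_derive1_comp (f := reC \o f)).
rewrite imCM /= mul0r addr0 mulrC.
exact: (is_derive1_comp (f := imC \o f)).
Qed.

Lemma is_cd_sum x I (r : seq I) (P : pred I) (F : I -> R -> R[i]) (dF : I -> R[i]) :
  (forall i, P i -> is_cd x (F i) (dF i)) ->
  is_cd x (fun t => \sum_(i <- r | P i) F i t) (\sum_(i <- r | P i) dF i).
Proof.
move=> h; elim: r => [|i r ih].
  rewrite big_nil (_ : (fun _ => _) = fun=> 0); first exact: is_cd_cst.
  by apply/funext => t; rewrite big_nil.
rewrite big_cons; case: ifPn => Pi.
  rewrite (_ : (fun _ => _) = fun t => F i t + \sum_(j <- r | P j) F j t).
    by apply: is_cdD => //; exact: h.
  by apply/funext => t; rewrite big_cons Pi.
rewrite (_ : (fun _ => _) = fun t => \sum_(j <- r | P j) F j t)//.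
by apply/funext => t; rewrite big_cons (negbTE Pi).
Qed.

(** Asking for the derivatives as functions makes sums, products and conjugates closed under this
    notion by induction on the order, without formulas for iterated derivatives. *)
Fixpoint CD n f := if n is m.+1
  then exists2 f', forall x, is_cd x f (f' x) & CD m f' else True.

Variant smooth f : Prop := Smooth of (forall n, CD n f).

Lemma smooth1P f : smooth1 f <-> smooth f.
Proof.
have it n h : iter n cderive1 h = fun x => derive1n n (reC \o h) x +i* derive1n n (imC \o h) x.
  elim: n => [|n ih] /=; first by apply/funext => x /=; case: (h x).
  by rewrite ih; apply/funext => x.
split=> [sf|[fn] n x].
  split=> n; have : forall k, CD n (iter k cderive1 f).
    elim: n => [//|n ih] k /=; exists (iter k.+1 cderive1 f); last exact: ih.
    move=> x; have [h1 h2] := sf k x.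
    by apply: is_cdP; rewrite it /comp /=; [apply h1|apply h2].
  by move=> /(_ 0%N).
have : CD 1 (iter n cderive1 f).
  have H k g : CD n.+1 g -> (k <= n)%N -> CD (n.+1 - k) (iter k cderive1 g).
    elim: k => [|k ih]; first by rewrite subn0.
    move=> cg kn; have {ih} := ih cg (ltnW kn).
    rewrite subSn ?(ltnW kn)// => -[f' hf'].
    rewrite (_ : f' = iter k.+1 cderive1 g)//.
    by apply/funext => t /=; rewrite (is_cdE (hf' t)).
  by have := H n f (fn n.+1) (leqnn _); rewrite subSnn.
by move=> [f' /(_ x)[h1 h2] _]; move: h1 h2; rewrite it /comp /= => h1 h2; split.
Qed.

Lemma smoothE f x : smooth f -> is_cd x f (cderive1 f x).
Proof. by case=> /(_ 1%N)[f' h _]; rewrite (is_cdE (h x)). Qed.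

Lemma smooth_continuous f x : smooth f ->
  {for x, continuous (reC \o f)} /\ {for x, continuous (imC \o f)}.
Proof.
move=> /(smoothE x)[h1 h2]; split; apply: differentiable_continuous;
  apply/derivable1_diffP.
  by case: h1.
by case: h2.
Qed.

Lemma CDS n f : CD n.+1 f -> CD n f.
Proof. by elim: n f => [//|n ih] f [f' h /ih]; exists f'. Qed.

Lemma CDD n f g : CD n f -> CD n g -> CD n (fun t => f t + g t).
Proof.
elim: n f g => [//|n ih] f g [f' hf cf] [g' hg cg].
exists (fun t => f' t + g' t); last exact: ih.
by move=> x; exact: is_cdD.
Qed.

Lemma CDM n f g : CD n f -> CD n g -> CD n (fun t => f t * g t).
Proof.
elim: n f g => [//|n ih] f g cf cg; have f1 := CDS cf; have g1 := CDS cg.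
case: cf cg => f' hf cf [g' hg cg].
exists (fun t => f' t * g t + f t * g' t); last by apply: CDD; exact: ih.
by move=> x; exact: is_cdM.
Qed.

Lemma CDJ n f : CD n f -> CD n (fun t => (f t)^*).
Proof.
elim: n f => [//|n ih] f [f' hf cf]; exists (fun t => (f' t)^*); last exact: ih.
by move=> x; exact: is_cdJ.
Qed.

Lemma smooth_derive f : smooth f -> smooth (cderive1 f).
Proof.
move=> [sf]; split=> n; have [f' hf] := sf n.+1.
by rewrite (_ : cderive1 f = f')//; apply/funext => x; exact: is_cdE.
Qed.

Lemma smooth_iter n f : smooth f -> smooth (iter n cderive1 f).
Proof. by elim: n => //= n ih /ih; exact: smooth_derive. Qed.

(** Smoothness by coinduction: it is enough to exhibit a family of functions containing the
    derivatives of its members, such as the multiples of one exponential; all orders follow by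
    induction. *)
Lemma smooth_coind (S : set (R -> R[i])) :
  (forall f, S f -> exists2 f', forall x, is_cd x f (f' x) & S f') ->
  forall f, S f -> smooth f.
Proof.
move=> h f Sf; split=> n.
by elim: n f Sf => [//|n ih] f /h[f' hf /ih]; exists f'.
Qed.

Lemma smooth_step f f' : (forall x, is_cd x f (f' x)) -> smooth f' -> smooth f.
Proof. by move=> h [s]; split=> -[//|n]; exists f'. Qed.

Lemma smooth_cst z : smooth (fun=> z).
Proof.
apply: (@smooth_coind [set f | exists z, f = fun=> z]); last by exists z.
by move=> f [w ->]; exists (fun=> 0); [move=> x; exact: is_cd_cst|exists 0].
Qed.

Lemma smoothD f g : smooth f -> smooth g -> smooth (fun t => f t + g t).
Proof. by move=> [sf] [sg]; split=> n; exact: CDD. Qed.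

Lemma smoothM f g : smooth f -> smooth g -> smooth (fun t => f t * g t).
Proof. by move=> [sf] [sg]; split=> n; exact: CDM. Qed.

Lemma smoothJ f : smooth f -> smooth (fun t => (f t)^*).
Proof. by move=> [sf]; split=> n; exact: CDJ. Qed.

Lemma smoothZ f z : smooth f -> smooth (fun t => z * f t).
Proof. by move=> sf; apply: smoothM => //; exact: smooth_cst. Qed.

Lemma smooth_sum I (r : seq I) (P : pred I) (F : I -> R -> R[i]) :
  (forall i, P i -> smooth (F i)) -> smooth (fun t => \sum_(i <- r | P i) F i t).
Proof.
move=> h; elim: r => [|i r ih].
  rewrite (_ : (fun _ => _) = fun=> 0); first exact: smooth_cst.
  by apply/funext => t; rewrite big_nil.
case Pi: (P i).
  rewrite (_ : (fun _ => _) = fun t => F i t + \sum_(j <- r | P j) F j t).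
    by apply: smoothD => //; exact: h.
  by apply/funext => t; rewrite big_cons Pi.
rewrite (_ : (fun _ => _) = fun t => \sum_(j <- r | P j) F j t)//.
by apply/funext => t; rewrite big_cons Pi.
Qed.

Lemma is_derive_mull x (a : R) : is_derive x (1 : R) (fun t => a * t) a.
Proof.
have := is_deriveZ a (is_derive_id x (1 : R)).
by rewrite [X in is_derive _ _ _ X -> _]mulr1.
Qed.

Lemma is_cd_affine x f (a c : R) z : is_cd (a * x + c) f z ->
  is_cd x (fun t => f (a * t + c)) (a%:C * z).
Proof.
move=> fz; have := is_cd_comp (h := fun t => a * t + c) fz; apply.
rewrite -[X in is_derive _ _ _ X]addr0.
exact: (is_deriveD (is_derive_mull x a) (is_derive_cst c x 1)).
Qed.

Lemma smooth_affine f (a c : R) : smooth f -> smooth (fun t => f (a * t + c)).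
Proof.
move=> sf; apply: (@smooth_coind
  [set h | exists z g, smooth g /\ h = fun t => z * g (a * t + c)]); last first.
  by exists 1, f; split=> //; apply/funext => t; rewrite mul1r.
move=> h [z [g [sg ->]]]; exists (fun t => (z * a%:C) * cderive1 g (a * t + c)).
  move=> x; apply: (is_cd_eq (is_cdZ _ (is_cd_affine (smoothE _ sg)))).
  by rewrite mulrA.
by exists (z * a%:C), (cderive1 g); split=> //; exact: smooth_derive.
Qed.

Lemma cderive1_affine f (a c : R) : smooth f ->
  cderive1 (fun t => f (a * t + c)) = fun t => a%:C * cderive1 f (a * t + c).
Proof. by move=> sf; apply/funext => x; exact: (is_cdE (is_cd_affine (smoothE _ sf))). Qed.

Lemma is_cd_cexp x z : is_cd x (fun t => cexp (z * t%:C)) (z * cexp (z * x%:C)).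
Proof.
have E : is_derive x (1 : R) (fun t => expR (reC z * t)) (reC z * expR (reC z * x)).
  rewrite mulrC; apply: (is_derive1_comp (f := expR)); exact: is_derive_mull.
have L := is_derive_mull x (imC z).
have C : is_derive x (1 : R) (fun t => cos (imC z * t)) (- sin (imC z * x) * imC z).
  exact: (is_derive1_comp (f := cos)).
have S : is_derive x (1 : R) (fun t => sin (imC z * t)) (cos (imC z * x) * imC z).
  exact: (is_derive1_comp (f := sin)).
have eq t : cexp (z * t%:C) = (expR (reC z * t) * cos (imC z * t)) +i*
    (expR (reC z * t) * sin (imC z * t)).
  rewrite /cexp reCM imCM /= !mulr0 subr0 add0r.
  by apply: ceqP; rewrite /reC /imC /= ?mul0r ?subr0 ?addr0.
rewrite eq (_ : (fun _ => _) = fun t => (expR (reC z * t) * cos (imC z * t)) +i*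
    (expR (reC z * t) * sin (imC z * t))); last by apply/funext => t; exact: eq.
split.
  rewrite reCM /= (_ : reC \o _ = (fun t => expR (reC z * t)) * (fun t => cos (imC z * t)))//.
  by apply: is_derive_eq; rewrite /GRing.scale /=; ring.
rewrite imCM /= (_ : imC \o _ = (fun t => expR (reC z * t)) * (fun t => sin (imC z * t)))//.
by apply: is_derive_eq; rewrite /GRing.scale /=; ring.
Qed.

Lemma smooth_cexp z : smooth (fun t => cexp (z * t%:C)).
Proof.
apply: (@smooth_coind [set f | exists a, f = fun t => a * cexp (z * t%:C)]); last first.
  by exists 1; apply/funext => t; rewrite mul1r.
move=> f [a ->]; exists (fun t => (a * z) * cexp (z * t%:C)); last by exists (a * z).
by move=> x; apply: (is_cd_eq (is_cdZ _ (is_cd_cexp _ _))); rewrite mulrA.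
Qed.

Lemma is_cd_horner x (A : {poly R[i]}) :
  is_cd x (fun t => A.[t%:C]) (A^`().[x%:C]).
Proof.
elim/poly_ind: A => [|A c ih].
  rewrite deriv0 horner0 (_ : (fun _ => _) = fun=> 0); first exact: is_cd_cst.
  by apply/funext => t; rewrite horner0.
have h : is_cd x (fun t : R => t%:C) 1.
  by apply: (is_cd_real (h := id)); exact: is_derive_id.
rewrite (_ : (fun _ => _) = fun t => A.[t%:C] * t%:C + c); last first.
  by apply/funext => t; rewrite !hornerE.
rewrite derivD derivC addr0 derivM derivX mulr1 !hornerE.
apply: (is_cd_eq (is_cdD (is_cdM ih h) (is_cd_cst x c))).
by rewrite mulr1 addr0.
Qed.

Lemma smooth_horner (A : {poly R[i]}) : smooth (fun t => A.[t%:C]).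
Proof.
apply: (@smooth_coind [set f | exists A : {poly R[i]}, f = fun t => A.[t%:C]]);
  last by exists A.
move=> f [B ->]; exists (fun t => B^`().[t%:C]); last by exists B^`().
by move=> x; exact: is_cd_horner.
Qed.

Lemma cexp0 : cexp (0 : R[i]) = 1.
Proof. by rewrite /cexp /= cos0 sin0 expR0 mul1r. Qed.

Lemma cexpD z w : cexp (z + w) = cexp z * cexp w.
Proof.
rewrite /cexp reCD imCD expRD cosD sinD; apply: ceqP;
  rewrite !(reCM, imCM) /=; ring.
Qed.

Lemma cexp_real x : cexp x%:C = (expR x)%:C.
Proof. by rewrite /cexp /= cos0 sin0 mulr1. Qed.

Lemma cexpJ z : (cexp z)^* = cexp z^*.
Proof.
by rewrite /cexp reCJ imCJ cosN sinN rmorphM /= oppr0.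
Qed.

Lemma cabs_cexp z : cabs (cexp z) = expR (reC z).
Proof.
rewrite /cexp cabsM cabs_real ger0_norm ?expR_ge0// [X in _ * X]cabsE.
by rewrite /sqnorm /= cos2Dsin2 sqrtr1 mulr1.
Qed.

Lemma cexp_neq0 z : cexp z != 0.
Proof.
apply/eqP => /(congr1 cabs); rewrite cabs_cexp cabs0 => /eqP.
by rewrite expR_eq0.
Qed.

Lemma smooth_cos : smooth (fun x : R => (cos x)%:C).
Proof.
apply: (@smooth_coind [set f | exists a b : R[i],
  f = fun t : R => a * (cos t)%:C + b * (sin t)%:C]); last first.
  by exists 1, 0; apply/funext => t; rewrite mul1r mul0r addr0.
move=> f [a [b ->]]; exists (fun t => b * (cos t)%:C + - a * (sin t)%:C).
  move=> x; apply: (is_cd_eq (is_cdD (is_cdZ a (is_cd_real (is_derive_cos x)))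
    (is_cdZ b (is_cd_real (is_derive_sin x))))).
  by rewrite rmorphN /= mulrN mulNr addrC.
by exists b, (- a).
Qed.

Lemma smooth_sin : smooth (fun x : R => (sin x)%:C).
Proof.
apply: (smooth_step (f' := fun x => (cos x)%:C)); last exact: smooth_cos.
by move=> x; apply: is_cd_real; exact: is_derive_sin.
Qed.

Lemma cderive1_cexp z :
  cderive1 (fun t => cexp (z * t%:C)) = fun t => z * cexp (z * t%:C).
Proof. by apply/funext => x; exact: (is_cdE (is_cd_cexp x z)). Qed.

Lemma cderive1_horner (A : {poly R[i]}) :
  cderive1 (fun t => A.[t%:C]) = fun t => A^`().[t%:C].
Proof. by apply/funext => x; exact: (is_cdE (is_cd_horner x A)). Qed.

Lemma cderive1D f g : smooth f -> smooth g ->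
  cderive1 (fun t => f t + g t) = fun t => cderive1 f t + cderive1 g t.
Proof.
by move=> sf sg; apply/funext => x; exact: (is_cdE (is_cdD (smoothE x sf) (smoothE x sg))).
Qed.

Lemma cderive1M f g : smooth f -> smooth g ->
  cderive1 (fun t => f t * g t) = fun t => cderive1 f t * g t + f t * cderive1 g t.
Proof.
by move=> sf sg; apply/funext => x; exact: (is_cdE (is_cdM (smoothE x sf) (smoothE x sg))).
Qed.

Lemma cderive1Z f z : smooth f ->
  cderive1 (fun t => z * f t) = fun t => z * cderive1 f t.
Proof. by move=> sf; apply/funext => x; exact: (is_cdE (is_cdZ z (smoothE x sf))). Qed.

Lemma cderive1J f : smooth f ->
  cderive1 (fun t => (f t)^*) = fun t => (cderive1 f t)^*.
Proof. by move=> sf; apply/funext => x; exact: (is_cdE (is_cdJ (smoothE x sf))). Qed.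

Lemma cderive1_sum I (r : seq I) (P : pred I) (F : I -> R -> R[i]) :
  (forall i, P i -> smooth (F i)) ->
  cderive1 (fun t => \sum_(i <- r | P i) F i t) =
  fun t => \sum_(i <- r | P i) cderive1 (F i) t.
Proof.
by move=> sF; apply/funext => x; apply: is_cdE; apply: is_cd_sum => i Pi; exact/smoothE/sF.
Qed.

Lemma near_cderive1 f g x : (\forall t \near x, f t = g t) ->
  cderive1 f x = cderive1 g x.
Proof.
move=> fg; apply: ceqP; rewrite /cderive1 /= !derive1E; apply: near_eq_derive;
  rewrite ?oner_eq0//; by near=> t => /=; rewrite (near fg).
Unshelve. all: by end_near. Qed.

Lemma near_iter_cderive1 n f g x : (\forall t \near x, f t = g t) ->
  iter n cderive1 f x = iter n cderive1 g x.
Proof.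
elim: n f g x => [|n ih] f g x fg; first exact: (nbhs_singleton fg).
rewrite !iterSr; apply: ih; have := near_join fg; apply: filterS => t.
exact: near_cderive1.
Qed.

Lemma smooth_cmeas f D : measurable D ->
  smooth f -> @cmeas _ (measurableTypeR R) R D f.
Proof.
move=> mD sf; split; apply: (@measurable_funS _ _ _ _ setT) => //;
  apply: continuous_measurable_fun => x.
  exact: (smooth_continuous x sf).1.
exact: (smooth_continuous x sf).2.
Qed.

End SmoothCalculus.

(** * Integration in polar coordinates *)

Section Density.
Local Open Scope ereal_scope.
Context d (T : measurableType d) (R : realType).
Variables (mu : {measure set T -> \bar R}) (w : T -> \bar R).
Hypotheses (w0 : forall x, 0 <= w x) (mw : measurable_fun setT w).

(** The two proofs are arguments so that the measure structure declared below can be attached to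
    this constant. *)
Definition density of (forall x, 0 <= w x) & measurable_fun setT w :=
  fun A : set T => \int[mu]_(x in A) w x.

Let dens := density w0 mw.

Let dens0 : dens set0 = 0. Proof. exact: integral_set0. Qed.

Let dens_ge0 A : 0 <= dens A. Proof. by apply: integral_ge0 => x _; exact: w0. Qed.

Let dens_sigma_additive : semi_sigma_additive dens.
Proof.
move=> F mF tF mUF; rewrite /dens /density ge0_integral_bigcup//; last exact: measurable_funTS.
by apply: is_cvg_ereal_nneg_natsum => n _; apply: integral_ge0 => x _; exact: w0.
Qed.

HB.instance Definition _ := isMeasure.Build _ _ _ dens dens0 dens_ge0 dens_sigma_additive.

Definition density_measure : {measure set T -> \bar R} := dens.

End Density.

Section Transfer.
Local Open Scope ereal_scope.
Context d1 d2 (T1 : measurableType d1) (T2 : measurableType d2) (R : realType).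
Variables (mu1 : {measure set T1 -> \bar R}) (mu2 : {measure set T2 -> \bar R}).
Variables (D2 : set T2) (mD2 : measurable D2) (Phi : T1 -> T2) (w : T1 -> R).
Hypotheses (mPhi : measurable_fun setT Phi) (w0 : forall x, (0 <= w x)%R)
  (mw : measurable_fun setT w).

Import HBNNSimple.

Let mpre A : measurable A -> measurable (Phi @^-1` A).
Proof. by move=> mA; rewrite -[X in measurable X]setTI; exact: mPhi. Qed.

(** An identity between measures becomes one between integrals: it holds for the simple functions
    approximating [F], and both sides pass to the limit by monotone convergence. *)
Lemma ge0_integral_transfer (F : T2 -> \bar R) :
  (forall A, measurable A -> mu2 (A `&` D2) = \int[mu1]_(x in Phi @^-1` A) (w x)%:E) ->
  measurable_fun setT F -> (forall y, 0 <= F y) ->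
  \int[mu2]_(y in D2) F y = \int[mu1]_x (F (Phi x) * (w x)%:E).
Proof.
move=> H mF F0; pose f_ := nnsfun_approx measurableT mF.
have mf_ n : measurable_fun setT (fun x => (f_ n (Phi x))%:E).
  apply/measurable_EFinP; apply: (measurableT_comp (f := f_ n)) => //.
transitivity (limn (fun n => \int[mu2]_(y in D2) (f_ n y)%:E)).
  rewrite -monotone_convergence//=.
  - apply: eq_integral => x _; apply/esym/cvg_lim => //=.
    by apply: cvg_nnsfun_approx.
  - by move=> n; apply/measurable_EFinP; exact: measurable_funTS.
  - by move=> n x _; rewrite lee_fin.
  - by move=> x _ a b ab; rewrite lee_fin//; exact/lefP/nd_nnsfun_approx.
rewrite [RHS](_ : _ = limn (fun n => \int[mu1]_x ((f_ n (Phi x))%:E * (w x)%:E))); last first.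
  rewrite -monotone_convergence//=.
  - apply: eq_integral => x _; apply/esym/cvg_lim => //.
    apply: cvgeZr => //.
    by apply: cvg_nnsfun_approx.
  - by move=> n; apply: emeasurable_funM => //; exact/measurable_EFinP.
  - by move=> n x _; rewrite mule_ge0// lee_fin.
  - move=> x _ a b ab; apply: lee_wpmul2r; rewrite lee_fin//.
    exact/lefP/nd_nnsfun_approx.
congr (limn _); apply/funext => n.
transitivity (\sum_(k \in range (f_ n)) k%:E * mu2 ((f_ n @^-1` [set k]) `&` D2)).
  under eq_integral do rewrite fimfunE -fsumEFin//.
  rewrite ge0_integral_fsum//; last 2 first.
  - by move=> y; apply/measurable_EFinP/measurable_funM => //; exact: measurable_funTS.
  - by move=> y x _; rewrite nnfun_muleindic_ge0.
  by apply: eq_fsbigr => r _; rewrite integralZl_indic_nnsfun// integral_indic.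
transitivity (\sum_(k \in range (f_ n))
    \int[mu1]_x (k%:E * (\1_(Phi @^-1` (f_ n @^-1` [set k])) x)%:E * (w x)%:E)).
  apply: eq_fsbigr => r _; rewrite H//.
  have [r0|r0] := ltP r 0%R.
    rewrite preimage_nnfun0// preimage_set0 integral_set0 mule0.
    by apply/esym/integral0_eq => x _; rewrite indic0 mule0 mul0e.
  under [RHS]eq_integral do rewrite -muleA.
  rewrite ge0_integralZl//; [congr (_ * _)| |].
  - rewrite integral_mkcond; apply: eq_integral => x _.
    rewrite /patch indicE; case: (boolP (x \in _)) => xA; by rewrite ?mul1e ?mul0e.
  - apply: emeasurable_funM; apply/measurable_EFinP => //.
    exact/measurable_indic/mpre.
  - by move=> x _; rewrite mule_ge0// lee_fin.
rewrite -ge0_integral_fsum//.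
- apply: eq_integral => x _; rewrite [in RHS]fimfunE -fsumEFin// ge0_mule_fsuml//.
  by move=> k; rewrite EFinM nnfun_muleindic_ge0.
- move=> r; apply: emeasurable_funM; last exact/measurable_EFinP.
  apply: emeasurable_funM; first exact: measurable_cst.
  by apply/measurable_EFinP; exact/measurable_indic/mpre.
- move=> r x _; rewrite mule_ge0//.
    exact: (nnfun_muleindic_ge0 (f_ n) r (Phi x)).
  by rewrite lee_fin.
Qed.

(** The image under [Phi] of the measure with density [w] and the restriction of [mu2] to [D2] agree
    on a generating pi-system that covers the space by sets of finite measure, hence on all
    measurable sets. *)
Lemma ge0_integral_transfer_pi (G : set (set T2)) (g : (set T2)^nat) (F : T2 -> \bar R) :
  measurable = <<s G >> -> setI_closed G -> (forall k, G (g k)) ->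
  \bigcup_k g k = setT -> (forall k, mu2 (g k `&` D2) < +oo) ->
  (forall A, G A -> mu2 (A `&` D2) = \int[mu1]_(x in Phi @^-1` A) (w x)%:E) ->
  measurable_fun setT F -> (forall y, 0 <= F y) ->
  \int[mu2]_(y in D2) F y = \int[mu1]_x (F (Phi x) * (w x)%:E).
Proof.
move=> mG GI Gg gT gfin GH; apply: ge0_integral_transfer => A mA.
pose m1 : {measure set T2 -> \bar R} := mrestr mu2 mD2.
have w0E x : 0 <= (EFin \o w) x by rewrite lee_fin.
have mwE : measurable_fun setT (EFin \o w) by exact/measurable_EFinP.
pose m2 : {measure set T2 -> \bar R} :=
  pushforward (density_measure mu1 w0E mwE) Phi.
have -> : mu2 (A `&` D2) = m1 A by [].
rewrite (@measure_unique _ _ _ G g mG GI Gg gT m1 (m2 mPhi))//.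
Qed.

End Transfer.

(** * Change of variables on the line for nonnegative measurable functions *)

Section Substitution.
Context {R : realType}.
Notation mu := (@lebesgue_measure R).

Lemma measurable_RGenInftyO :
  @measurable _ (measurableTypeR R) = <<s @RGenInftyO.G R >>.
Proof. exact: RGenInftyO.measurableE. Qed.

(** Since [F] is merely measurable, the two measures are compared on the rays []-oo, x[]. There the
    identity is the fundamental theorem of calculus for [Phi] on the part of [[a, b]] mapped below
    x. *)
Lemma ge0_substitution_compact (a b : R) (Phi w : R -> R) (F : R -> \bar R) :
  (a < b)%R -> (forall t, t \in `[a, b] -> is_derive t (1 : R) Phi (w t)) ->
  (forall t, t \in `[a, b] -> {for t, continuous w}) ->
  (forall t, t \in `[a, b] -> (0 < w t)%R) ->
  measurable_fun (setT : set (measurableTypeR R)) F -> (forall y, (0 <= F y)%E) ->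
  (\int[mu]_(y in `[Phi a, Phi b]) F y =
  \int[mu]_(t in `[a, b]) (F (Phi t) * (w t)%:E))%E.
Proof.
move=> ab dPhi cw w_gt0 mF F0.
have cPhi : {within `[a, b], continuous Phi}.
  apply: derivable_within_continuous => t tab; by case: (dPhi t tab).
have sub c : (c \in `]a, b])%R -> {subset `[a, c] <= `[a, b]}.
  move=> cab x; rewrite !in_itv/= in cab *; case/andP: cab => ac cb.
  by move=> /andP[-> /le_trans ->].
have inc : {in `[a, b] &, {homo Phi : x y / (x < y)%R}}.
  move=> x y xab yab xy.
  apply: (@gtr0_derive1_lt_cc _ Phi a b) => //.
  - by move=> t /subset_itv_oo_cc tab; case: (dPhi t tab).
  - move=> t /subset_itv_oo_cc tab; rewrite derive1E.
    by have := dPhi t tab => d; rewrite derive_val w_gt0.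
have aab : a \in `[a, b] by rewrite in_itv/= lexx ltW.
have bab : b \in `[a, b] by rewrite in_itv/= lexx ltW.
have Pab := inc a b aab bab ab.
have mono : {in `[a, b] &, {mono Phi : x y / (x <= y)%R}} by apply: le_mono_in.
have FTC c : c \in `]a, b] -> (\int[mu]_(t in `[a, c]) (w t)%:E = (Phi c - Phi a)%:E)%E.
  move=> cab; have ac : (a < c)%R by move: cab; rewrite in_itv/= => /andP[].
  rewrite (continuous_FTC2 (F := Phi)) ?EFinB//.
  - apply: continuous_in_subspaceT => t; rewrite inE /= => tac.
    by apply: cw; exact: (sub c cab).
  - split.
    + move=> t /subset_itv_oo_cc tac; by case: (dPhi t (sub c cab t tac)).
    + apply: cvg_at_right_filter; apply: differentiable_continuous.
      by apply/derivable1_diffP; case: (dPhi a aab).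
    + apply: cvg_at_left_filter; apply: differentiable_continuous.
      apply/derivable1_diffP; have cc : c \in `[a, b].
        by apply: (sub c cab); rewrite in_itv/= lexx ltW.
      by case: (dPhi c cc).
  - move=> t /subset_itv_oo_cc tac; rewrite derive1E.
    by have := dPhi t (sub c cab t tac) => d; rewrite derive_val.
(* Extension by 0 makes both functions measurable on the whole line; outside [[a, b]], where [P'] is
   no longer [Phi], the density [w'] vanishes. *)
pose w' : R -> R := w \_ `[a, b].
pose P' : R -> R := Phi \_ `[a, b].
have mw' : measurable_fun (setT : set (measurableTypeR R)) w'.
  apply/(measurable_restrictT _ _).1 => //.
  apply: subspace_continuous_measurable_fun => //.
  by apply: continuous_in_subspaceT => t; rewrite inE; exact: cw.
have mP' : measurable_fun (setT : set (measurableTypeR R)) P'.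
  apply/(measurable_restrictT _ _).1 => //.
  exact: subspace_continuous_measurable_fun.
have w'0 t : (0 <= w' t)%R.
  by rewrite /w' /patch; case: ifPn => // /set_mem /w_gt0 /ltW.
rewrite (@ge0_integral_transfer_pi _ _ (measurableTypeR R) (measurableTypeR R) R mu mu
  `[Phi a, Phi b]%classic _ P' w' mP' w'0 mw'
  (@RGenInftyO.G R) (fun n => `]-oo, n%:R[%classic)) //.
- rewrite [RHS]integral_mkcond; apply: eq_integral => t _.
  rewrite /w' /P' /patch; case: ifPn => //; by rewrite mule0.
- exact: measurable_RGenInftyO.
- move=> _ _ [x ->] [y ->]; exists (Num.min x y).
  apply/seteqP; split=> z /=; rewrite !in_itv/= lt_min.
    by move=> [-> ->].
  by case/andP.
- by move=> k; exists k%:R.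
- apply/seteqP; split=> // x _; exists (Num.bound `|x|) => //=.
  by rewrite in_itv/= (le_lt_trans (ler_norm x))// archi_boundP.
- move=> k; apply: (@le_lt_trans _ _ (mu `[Phi a, Phi b]%classic)).
    by apply: le_measure; rewrite ?inE//=; exact: measurableI.
  by rewrite lebesgue_measure_itv/= lte_fin Pab -EFinB ltry.
- move=> _ [x ->].
  have -> : (\int[mu]_(t in P' @^-1` `]-oo, x[) (w' t)%:E =
      \int[mu]_(t in `[a, b] `&` [set t | (Phi t < x)%R]) (w t)%:E)%E.
    rewrite [LHS]integral_mkcond [RHS]integral_mkcond; apply: eq_integral => t _.
    have w'E : w' t = if t \in `[a, b] then w t else 0 by rewrite /w' /patch mem_setE.
    have P'E : t \in `[a, b] -> P' t = Phi t by rewrite /P' /patch mem_setE => ->.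
    rewrite /patch; case: ifPn => [/set_mem /= h1|/negP h1];
      case: ifPn => [/set_mem /= h2|/negP h2] //.
    - by case: h2 => h2 _; rewrite w'E (_ : t \in _).
    - rewrite w'E; case: ifPn => // tab; case: h2; apply/mem_set; split=> //.
      by move: h1; rewrite /= in_itv/= P'E.
    - by case: h1; apply/mem_set; case: h2 => h2 h3; rewrite /= in_itv/= P'E.
  (* The ray misses the image, covers it, or cuts it at a value [x = Phi c] given by the
     intermediate value theorem. *)
  have [xa|ax] := leP x (Phi a).
    rewrite (_ : _ `&` _ = set0) ?measure0; last first.
      apply/seteqP; split=> // y [] /=; rewrite !in_itv/= => yx /andP[ay _].
      by have := lt_le_trans (lt_le_trans yx xa) ay; rewrite ltxx.
    rewrite (_ : _ `&` _ = set0) ?integral_set0//.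
    apply/seteqP; split=> // t [] /= tab tx.
    have := lt_le_trans tx xa; rewrite ltNge mono//.
    by move: tab; rewrite in_itv/= => /andP[->].
  have [bx|xb] := ltP (Phi b) x.
    rewrite (_ : `]-oo, x[ `&` _ = `[Phi a, Phi b]%classic); last first.
      apply/seteqP; split=> [y []//|y] /= yab; split=> //.
      by move: yab; rewrite !in_itv/= => /andP[_ /le_lt_trans]; apply.
    rewrite (_ : `[a, b] `&` _ = `[a, b]%classic) ?FTC ?in_itv/= ?ab ?lexx//.
      by rewrite lebesgue_measure_itv/= lte_fin Pab.
    apply/seteqP; split=> [y []//|y] /= yab; split=> //.
    by apply: le_lt_trans bx; rewrite mono//; move: yab; rewrite in_itv/= => /andP[_].
  have [|c cab cx] := @IVT _ Phi a b x (ltW ab) cPhi.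
    by rewrite minElt maxElt Pab (ltW ax) xb.
  have ac : (a < c)%R.
    rewrite lt_neqAle; apply/andP; split; last by move: cab; rewrite in_itv/= => /andP[].
    by apply: contraTneq ax => ->; rewrite cx ltxx.
  rewrite -cx (_ : `]-oo, _[ `&` _ = `[Phi a, Phi c[%classic); last first.
    apply/seteqP; split=> y /=; rewrite !in_itv/=.
      by move=> [-> /andP[->]].
    move=> /andP[ay yc]; split=> //; rewrite ay (le_trans (ltW yc))// mono//.
    by move: cab; rewrite in_itv/= => /andP[].
  have h := lebesgue_measure_itv `[Phi a, Phi c[; rewrite /= lte_fin inc// in h.
  apply: (etrans h).
  rewrite (_ : _ `&` _ = `[a, c[%classic); last first.
    apply/seteqP; split=> y /=; rewrite !in_itv/=.
      move=> [/andP[ya yb]]; rewrite ltNge mono ?in_itv/= ?ya ?yb//.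
      by rewrite -ltNge.
    move=> /andP[ay yc]; have yab : y \in `[a, b].
      rewrite in_itv/= ay (le_trans (ltW yc))//.
      by move: cab; rewrite in_itv/= => /andP[].
    by split; [move: yab; rewrite in_itv|apply: inc].
  rewrite integral_itv_bndo_bndc ?FTC ?in_itv/= ?ac//.
  - by move: cab; rewrite in_itv/= => /andP[].
  - apply/measurable_EFinP; apply: (@measurable_funS _ _ _ _ `[a, b]%classic) => //.
      by move=> t /=; rewrite !in_itv/= => /andP[-> /ltW /le_trans]; apply;
        move: cab; rewrite in_itv/= => /andP[].
    apply: subspace_continuous_measurable_fun => //.
    by apply: continuous_in_subspaceT => t; rewrite inE; exact: cw.
Qed.


(** Exhaustion by nested compact intervals: [Phi] is increasing on each of them, so the images are
    nested too and monotone convergence applies on both sides. *)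
Lemma ge0_substitution (D J : set R) (a b : nat -> R) (Phi w : R -> R) (F : R -> \bar R) :
  (forall n, a n < b n) -> nonincreasing_seq a -> nondecreasing_seq b ->
  \bigcup_n `[a n, b n]%classic = D ->
  \bigcup_n `[Phi (a n), Phi (b n)]%classic = J ->
  (forall t, D t -> is_derive t (1 : R) Phi (w t)) ->
  (forall t, D t -> {for t, continuous w}) ->
  (forall t, D t -> 0 < w t) ->
  measurable_fun (setT : set (measurableTypeR R)) F -> (forall y, (0 <= F y)%E) ->
  (\int[mu]_(y in J) F y = \int[mu]_(t in D) (F (Phi t) * (w t)%:E))%E.
Proof.
move=> ab na nb <- <-.
set D' := \bigcup_n _; move=> dPhi cw w_gt0 mF F0.
have inD n t : t \in `[a n, b n] -> D' t by move=> h; exists n.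
have cPhi n : {within `[a n, b n], continuous Phi}.
  apply: derivable_within_continuous => t tab; by case: (dPhi t (inD n t tab)).
have inc n : {in `[a n, b n] &, {homo Phi : x y / x < y}}.
  move=> x y xab yab xy.
  apply: (@gtr0_derive1_lt_cc _ Phi (a n) (b n)) => //.
  - by move=> t /subset_itv_oo_cc tab; case: (dPhi t (inD n t tab)).
  - move=> t /subset_itv_oo_cc tab; rewrite derive1E.
    by have := dPhi t (inD n t tab) => d; rewrite derive_val w_gt0//; exact: (inD n).
have mono n : {in `[a n, b n] &, {mono Phi : x y / x <= y}} by apply/le_mono_in/inc.
have Pa n k : (n <= k)%N -> Phi (a k) <= Phi (a n).
  move=> nk; rewrite (mono k) ?na// in_itv/= ?lexx ?(ltW (ab k))// na//=.
  by rewrite (le_trans (ltW (ab n)))// nb.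
have Pb n k : (n <= k)%N -> Phi (b n) <= Phi (b k).
  move=> nk; rewrite (mono k) ?nb// in_itv/= ?lexx ?(ltW (ab k))// nb// andbT.
  by rewrite (le_trans _ (ltW (ab n)))// na.
have L := @ge0_nondecreasing_set_cvg_integral _ (measurableTypeR R) R
  (fun n => `[Phi (a n), Phi (b n)]%classic) F mu.
have RR := @ge0_nondecreasing_set_cvg_integral _ (measurableTypeR R) R
  (fun n => `[a n, b n]%classic) (fun t => F (Phi t) * (w t)%:E)%E mu.
have mR n : measurable_fun (`[a n, b n]%classic : set (measurableTypeR R))
    (fun t => F (Phi t) * (w t)%:E)%E.
  apply: emeasurable_funM.
    apply: (measurable_comp measurableT) => //.
    exact: subspace_continuous_measurable_fun.
  apply/measurable_EFinP; apply: subspace_continuous_measurable_fun => //.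
  by apply: continuous_in_subspaceT => t; rewrite inE => /inD; exact: cw.
have eqn n := ge0_substitution_compact (ab n) (fun t h => dPhi t (inD n t h))
   (fun t h => cw t (inD n t h)) (fun t h => w_gt0 t (inD n t h)) mF F0.
apply: (cvg_unique _ (L _ _ _ _)) => //=.
- move=> n k nk; apply/subsetPset => y /=; rewrite !in_itv/= => /andP[h1 h2].
  by rewrite (le_trans (Pa _ _ nk) h1) (le_trans h2 (Pb _ _ nk)).
- by move=> n; exact: measurable_funTS.
under eq_fun do rewrite eqn.
apply: RR => //.
- move=> n k nk; apply/subsetPset => y /=; rewrite !in_itv/= => /andP[h1 h2].
  by rewrite (le_trans (na _ _ nk) h1) (le_trans h2 (nb _ _ nk)).
- by move=> n t /inD /w_gt0 wt; rewrite mule_ge0// lee_fin ltW.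
Qed.

Lemma bigcup_segment_nat : \bigcup_n `[- n.+1%:R, n.+1%:R]%classic = [set: R].
Proof.
apply/seteqP; split=> // x _; exists (Num.bound `|x|) => //=.
rewrite in_itv/= -ler_norml (le_trans (ltW (archi_boundP (normr_ge0 x))))//.
by rewrite ler_nat.
Qed.

Lemma ge0_substitution_affine (a c : R) (F : R -> \bar R) : 0 < a ->
  measurable_fun (setT : set (measurableTypeR R)) F -> (forall y, (0 <= F y)%E) ->
  (\int[mu]_y F y = \int[mu]_t (F (a * t + c)%R * a%:E))%E.
Proof.
move=> a0 mF F0.
apply: (@ge0_substitution setT setT (fun n => - n.+1%:R) (fun n => n.+1%:R)
    (fun t => a * t + c) (fun=> a)) => //.
- by move=> n; rewrite (@lt_trans _ _ 0)// ?oppr_lt0 ltr0n.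
- by move=> n k nk; rewrite lerN2 ler_nat.
- by move=> n k nk; rewrite ler_nat.
- exact: bigcup_segment_nat.
- apply/seteqP; split=> // y _.
  have [n _] : (\bigcup_n `[- n.+1%:R, n.+1%:R]%classic) ((y - c) / a).
    by rewrite bigcup_segment_nat.
  rewrite /= in_itv/= => /andP[]; rewrite ler_pdivlMr// ler_pdivrMr// => h1 h2.
  by exists n => //=; rewrite in_itv/=; apply/andP; split; lra.
- move=> t _; rewrite -[X in is_derive _ _ _ X]addr0.
  exact: (is_deriveD (is_derive_mull t a) (is_derive_cst c t 1)).
- by move=> t _; exact: cvg_cst.
Qed.

Lemma ge0_substitution_exp (a : R) (F : R -> \bar R) : 0 < a ->
  measurable_fun (setT : set (measurableTypeR R)) F -> (forall y, (0 <= F y)%E) ->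
  (\int[mu]_(y in `]0%R, +oo[) F y =
   \int[mu]_t (F (a * expR t)%R * (a * expR t)%:E))%E.
Proof.
move=> a0 mF F0.
apply: (@ge0_substitution setT _ (fun n => - n.+1%:R) (fun n => n.+1%:R)
    (fun t => a * expR t) (fun t => a * expR t)) => //.
- by move=> n; rewrite (@lt_trans _ _ 0)// ?oppr_lt0 ltr0n.
- by move=> n k nk; rewrite lerN2 ler_nat.
- by move=> n k nk; rewrite ler_nat.
- exact: bigcup_segment_nat.
- apply/seteqP; split=> y /=.
    move=> [n _] /=; rewrite !in_itv/= andbT => /andP[+ _]; apply: lt_le_trans.
    by rewrite mulr_gt0// expR_gt0.
  rewrite in_itv/= andbT => y0; have ya : 0 < y / a by rewrite divr_gt0.
  have [n _] : (\bigcup_n `[- n.+1%:R, n.+1%:R]%classic) (ln (y / a)).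
    by rewrite bigcup_segment_nat.
  rewrite /= in_itv/= -ler_expR -[_ <= n.+1%:R]ler_expR lnK ?posrE//.
  rewrite ler_pdivlMr// ler_pdivrMr// => /andP[h1 h2].
  by exists n => //=; rewrite in_itv/= mulrC h1 mulrC h2.
- move=> t _; apply: cvgM; first exact: cvg_cst.
  exact: continuous_expR.
- by move=> t _; rewrite mulr_gt0 ?expR_gt0.
Qed.

Lemma ge0_substitution_tan (F : R -> \bar R) :
  measurable_fun (setT : set (measurableTypeR R)) F -> (forall y, (0 <= F y)%E) ->
  (\int[mu]_y F y =
   \int[mu]_(t in `](- (pi / 2))%R, (pi / 2)%R[) (F (tan t)%R * (cos t ^- 2)%:E))%E.
Proof.
move=> mF F0.
have n1 (n : nat) : 0 < (n.+2%:R^-1 : R) < 1.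
  by rewrite invr_gt0 ltr0n invf_lt1 ?ltr0n// ltr1n.
have pi0 : (0 : R) < pi / 2  by rewrite divr_gt0// pi_gt0.
(* The segments [[- b n, b n]] exhaust the open interval; [n + 2] in place of [n + 1] keeps the one
   for [n = 0] from being a point. *)
pose b n : R := pi / 2 * (1 - n.+2%:R^-1).
have b0 n : 0 < b n by have := n1 n => /andP[h1 h2]; rewrite mulr_gt0// subr_gt0.
have b1 n : b n < pi / 2.
  by have := n1 n => /andP[h1 h2]; rewrite gtr_pMr// gtrDl oppr_lt0.
have cos0 t : t \in `](- (pi / 2))%R, (pi / 2)%R[ -> 0 < cos t.
  by move=> ?; exact: cos_gt0_pihalf.
have nb : nondecreasing_seq b.
  move=> n k nk; rewrite ler_pM2l// lerD2l lerN2 lef_pV2 ?posrE ?ltr0n//.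
  by rewrite ler_nat !ltnS.
have cov : \bigcup_n `[- b n, b n]%classic = `](- (pi / 2)), (pi / 2)[%classic.
  apply/seteqP; split=> t /=.
    move=> [n _] /=; rewrite !in_itv/= => /andP[h1 h2].
    by have := b1 n => h; apply/andP; split; lra.
  rewrite in_itv/= -ltr_norml => tpi.
  have h : 0 < 1 - `|t| / (pi / 2) by rewrite subr_gt0 ltr_pdivrMr// mul1r.
  exists (Num.bound (1 - `|t| / (pi / 2))^-1) => //=; rewrite in_itv/= -ler_norml.
  rewrite /b mulrC -ler_pdivrMr//; set z := 1 - _ in h *.
  have -> : `|t| / (pi / 2) = 1 - z by rewrite /z; ring.
  rewrite lerD2l lerN2 -[leRHS]invrK lef_pV2 ?posrE ?ltr0n ?invr_gt0//.
  rewrite (le_trans (ltW (archi_boundP _))) ?invr_ge0 ?(ltW h)//.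
  by rewrite ler_nat -addn2 leq_addr.
apply: (@ge0_substitution _ setT (fun n => - b n) b tan (fun t => cos t ^- 2)) => //.
- by move=> n; rewrite (@lt_trans _ _ 0)// ?oppr_lt0.
- by move=> n k nk; rewrite lerN2 nb.
- apply/seteqP; split=> // y _.
  have [n _] : (\bigcup_n `[- b n, b n]%classic) (atan y).
    by rewrite cov /= in_itv/= atan_gtNpi2 atan_ltpi2.
  rewrite /= in_itv/= => /andP[h1 h2].
  have ay : atan y \in `](- (pi / 2)), (pi / 2)[ by rewrite in_itv/= atan_gtNpi2 atan_ltpi2.
  have bn : b n \in `](- (pi / 2)), (pi / 2)[.
    by rewrite in_itv/= b1 andbT (lt_trans _ (b0 n))// oppr_lt0.
  have bn' : - b n \in `](- (pi / 2)), (pi / 2)[.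
    by rewrite in_itv/= ltrN2 b1 (lt_trans _ pi0)// oppr_lt0.
  have tm : {in `](- (pi / 2)), (pi / 2)[ &, {mono (@tan R) : x y / x <= y}}.
    by apply: le_mono_in => u v hu hv; rewrite ltr_tan.
  by exists n => //=; rewrite in_itv/= -[y]atanK !tm ?h1 ?h2.
- move=> t /cos0 ct; apply: is_derive_tan; rewrite gt_eqF//.
- move=> t /cos0 ct; apply: cvgV; first by rewrite expf_neq0// gt_eqF.
  have c2 := @exprn_continuous R 2 (cos t).
  exact: (continuous_comp (@continuous_cos R t) c2).
- by move=> t /cos0 ct; rewrite invr_gt0 exprn_gt0.
Qed.

End Substitution.

(** * Logarithmic polar coordinates *)

Section Polar.
Context {R : realType}.
Notation mu := (@lebesgue_measure R).
Notation T1 := (measurableTypeR R).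
Notation T2 := (measurableTypeR R * measurableTypeR R)%type.

(** The radial coordinate is t = ln r, in which r D_r becomes D_t and homogeneity becomes
    translation. *)
Definition pol (t w : R) : R * R := (expR t * cos w, expR t * sin w).

Lemma ge0_integral_reflect (F : R -> \bar R) :
  measurable_fun (setT : set T1) F -> (forall y, (0 <= F y)%E) ->
  (\int[mu]_y F y = \int[mu]_y F (- y)%R)%E.
Proof.
move=> mF F0.
have mN : measurable_fun (setT : set T1) (-%R : T1 -> T1).
  by apply: continuous_measurable_fun; exact: opp_continuous.
have := @ge0_integral_pushforward _ _ _ _ R _ mN mu setT F measurableT mF (fun y _ => F0 y).
rewrite preimage_setT => <-; apply: eq_measure_integral => A mA _.
exact/esym/lebesgue_measureN.
Qed.

Lemma ge0_integral_translate (a b c : R) (K : R -> \bar R) :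
  measurable_fun (setT : set T1) K -> (forall y, (0 <= K y)%E) ->
  (\int[mu]_(w in `]a, b[) K (w + c)%R = \int[mu]_(w in `](a + c)%R, (b + c)%R[) K w)%E.
Proof.
move=> mK K0; rewrite [LHS]integral_mkcond [RHS]integral_mkcond.
rewrite [RHS](@ge0_substitution_affine R 1 c)//.
- apply: eq_integral => w _; rewrite mul1r mule1 /patch !mem_setE !in_itv/=.
  by rewrite !ltrD2r.
- exact/(measurable_restrictT _ _).1/measurable_funTS.
- by move=> y; rewrite /patch; case: ifPn.
Qed.

Lemma ge0_integral_itv_split (a b c : R) (K : R -> \bar R) : a < b -> b < c ->
  measurable_fun (setT : set T1) K -> (forall y, (0 <= K y)%E) ->
  (\int[mu]_(w in `]a, c[) K w =
   \int[mu]_(w in `]a, b[) K w + \int[mu]_(w in `]b, c[) K w)%E.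
Proof.
move=> ab bc mK K0.
rewrite (_ : `]a, c[%classic = `]a, b[ `|` `[b, c[); last first.
  apply/esym; rewrite -itv_bndbnd_setU// bnd_simp//; exact: ltW.
rewrite ge0_integral_setU//=.
- congr (_ + _)%E; apply/esym; apply: integral_itv_obnd_cbnd.
  exact: measurable_funTS.
- exact: measurable_funTS.
- rewrite disj_set2E; apply/eqP; rewrite -subset0 => x []/=; rewrite !in_itv/=.
  by move=> /andP[_ xb] /andP[bx _]; move: (lt_le_trans xb bx); rewrite ltxx.
Qed.

Lemma measurable_pol : measurable_fun (setT : set T2) (fun z : T2 => pol z.1 z.2 : T2).
Proof.
apply: measurable_fun_pair => /=; apply: measurable_funM => //.
- by apply: measurableT_comp => //; exact: measurable_expR.
- apply: measurableT_comp => //.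
  by apply: continuous_measurable_fun; exact: continuous_cos.
- by apply: measurableT_comp => //; exact: measurable_expR.
- apply: measurableT_comp => //.
  by apply: continuous_measurable_fun; exact: continuous_sin.
Qed.

Variable F : R * R -> \bar R.
Hypotheses (mF : measurable_fun (setT : set T2) F) (F0 : forall y, (0 <= F y)%E).

(** Integral over the ray of angle [w]; the factor [expR (2 * t)] is r dr written in t. *)
Definition ang_int (F : R * R -> \bar R) w :=
  (\int[mu]_t (F (pol t w) * (expR (2 * t))%:E))%E.

Lemma measurable_ang_int : measurable_fun (setT : set T1) (ang_int F).
Proof.
have := @measurable_fun_fubini_tonelli_G _ _ T1 T1 R mu
  (fun z => F (pol z.1 z.2) * (expR (2 * z.1))%:E)%E; apply.
- apply: emeasurable_funM.
    by apply: (measurable_comp measurableT) => //; exact: measurable_pol.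
  apply/measurable_EFinP; apply: (measurableT_comp (f := expR)).
    exact: measurable_expR.
  by apply: measurable_funM => //; exact: measurable_cst.
- by move=> z; rewrite mule_ge0// lee_fin expR_ge0.
Qed.

Lemma ang_int_ge0 w : (0 <= ang_int F w)%E.
Proof. by apply: integral_ge0 => t _; rewrite mule_ge0// lee_fin expR_ge0. Qed.

End Polar.

Section PolarFormula.
Context {R : realType}.
Notation mu := (@lebesgue_measure R).
Notation T1 := (measurableTypeR R).
Notation T2 := (measurableTypeR R * measurableTypeR R)%type.

Let halfplane : set T2 := [set y | 0 < y.1].

Let mhalf : measurable halfplane.
Proof.
rewrite (_ : halfplane = `]0%R, +oo[ `*` setT); first exact: measurableX.
by apply/seteqP; split=> -[x y] /=; rewrite in_itv/= andbT; [move=> ->|case].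
Qed.

(* y = x s, then x = e^t cos(atan s), then s = tan w *)
Lemma ge0_integral_polar_right (F : R * R -> \bar R) :
  measurable_fun (setT : set T2) F -> (forall y, (0 <= F y)%E) ->
  (\int[leb2]_y (F \_ halfplane) y =
   \int[mu]_(w in `](- (pi / 2))%R, (pi / 2)%R[) ang_int F w)%E.
Proof.
move=> mF F0.
have F1 : measurable_fun (setT : set T2) (F \_ halfplane).
  by apply/(measurable_restrictT _ _).1 => //; exact: measurable_funTS.
rewrite fubini_tonelli1//; last by move=> y; rewrite /patch; case: ifPn.
pose G (z : R * R) : \bar R :=
  ((fun z : R * R => F (z.1, (z.1 * z.2)%R) * (`|z.1|)%:E)%E \_ halfplane) z.
have mG0 : measurable_fun (setT : set T2) (fun z : T2 => F (z.1, (z.1 * z.2)%R) * (`|z.1|)%:E)%E.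
  apply: emeasurable_funM.
    apply: (measurable_comp measurableT (f := F)) => //.
    by apply: measurable_fun_pair => //; exact: measurable_funM.
  by apply/measurable_EFinP; exact: measurableT_comp.
have mG : measurable_fun (setT : set T2) G.
  by apply/(measurable_restrictT _ _).1 => //; exact: measurable_funTS.
have G0 z : (0 <= G z)%E.
  by rewrite /G /patch; case: ifPn => // _; rewrite mule_ge0// lee_fin.
transitivity (\int[mu]_x \int[mu]_s G (x, s))%E.
  apply: eq_integral => x _; rewrite /fubini_F.
  have [x0|x0] := ltP 0 x.
    rewrite (_ : (fun y => _) = fun y => F (x, y)); last first.
      by apply/funext => y; rewrite /patch mem_set.
    rewrite [LHS](@ge0_substitution_affine R x 0)//.
      apply: eq_integral => s _; rewrite /G /patch mem_set//= addr0.
      by rewrite gtr0_norm.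
    exact: measurable_fun_pair2.
  have xh y : ((x, y) \in halfplane) = false.
    by apply/negbTE; rewrite notin_setE /halfplane/= ltNge x0.
  by rewrite !integral0_eq// => y _; rewrite /G /patch xh.
rewrite (@fubini_tonelli _ _ T1 T1 R mu mu)//.
pose c (s : R) := cos (atan s).
have c0 s : 0 < c s by rewrite cos_gt0_pihalf// atan_gtNpi2 atan_ltpi2.
have mc : measurable_fun (setT : set T1) c.
  apply: continuous_measurable_fun => s; apply: continuous_comp.
    exact: continuous_atan.
  exact: continuous_cos.
pose H (z : R * R) : \bar R :=
  (F ((c z.1 * expR z.2)%R, (c z.1 * expR z.2 * z.1)%R) * (`|c z.1 * expR z.2| * (c z.1 * expR z.2))%:E)%E.
have mce : measurable_fun (setT : set T2) (fun z : T2 => c z.1 * expR z.2).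
  apply: measurable_funM; first exact: measurableT_comp.
  by apply: measurableT_comp => //; exact: measurable_expR.
have mH : measurable_fun (setT : set T2) H.
  apply: emeasurable_funM.
    apply: (measurable_comp measurableT (f := F)) => //.
    by apply: measurable_fun_pair => //; exact: measurable_funM.
  by apply/measurable_EFinP; apply: measurable_funM => //; exact: measurableT_comp.
have H0 z : (0 <= H z)%E.
  by rewrite /H mule_ge0// lee_fin mulr_ge0// mulr_ge0 ?expR_ge0 ?(ltW (c0 _)).
transitivity (\int[mu]_s \int[mu]_t H (s, t))%E.
  apply: eq_integral => s _.
  transitivity (\int[mu]_(x in `]0%R, +oo[) (F (x, (x * s)%R) * (`|x|)%:E))%E.
    rewrite [RHS]integral_mkcond; apply: eq_integral => x _.
    rewrite /G /patch; congr (if _ then _ else _).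
    by apply/idP/idP => /set_mem; rewrite /halfplane /= ?in_itv/= ?andbT => h;
      apply/mem_set; rewrite /halfplane /= ?in_itv/= ?andbT.
  rewrite (@ge0_substitution_exp R (c s))//.
  - by apply: eq_integral => t _; rewrite -muleA -EFinM.
  - have := measurable_fun_pair1 s mG0; exact.
  - by move=> y; rewrite mule_ge0// lee_fin.
have mK := @measurable_fun_fubini_tonelli_F _ _ T1 T1 R mu H mH H0.
have K0 s : (0 <= fubini_F mu H s)%E by apply: integral_ge0.
rewrite (ge0_substitution_tan mK K0).
apply: eq_integral => w; rewrite inE /= => wpi.
have cw : 0 < cos w by apply: cos_gt0_pihalf; move: wpi; rewrite in_itv.
have ctan : c (tan w) = cos w by rewrite /c tanK// inE.
rewrite /fubini_F /ang_int -ge0_integralZr//.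
- apply: eq_integral => t _; rewrite /H /= ctan.
  rewrite -muleA -EFinM; congr (F _ * _%:E)%E.
    rewrite /pol mulrC; congr pair; rewrite /tan mulrAC mulrC mulrA.
    by rewrite [RHS]mulrC; field; rewrite gt_eqF.
  rewrite ger0_norm ?mulr_ge0 ?expR_ge0 ?ltW//.
  rewrite mulrDl mul1r expRD; field; by rewrite gt_eqF.
- have := measurable_fun_pair2 (tan w) mH; exact.
- by rewrite lee_fin invr_ge0 exprn_ge0// ltW.
Qed.

Lemma ge0_integral_reflect2 (F : R * R -> \bar R) :
  measurable_fun (setT : set T2) F -> (forall y, (0 <= F y)%E) ->
  (\int[leb2]_y F y = \int[leb2]_y F (- y.1, - y.2)%R)%E.
Proof.
move=> mF F0.
have mN : measurable_fun (setT : set T1) (-%R : T1 -> T1).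
  by apply: continuous_measurable_fun; exact: opp_continuous.
have mF' : measurable_fun (setT : set T2) (fun y : T2 => F (- y.1, - y.2)).
  apply: (measurable_comp measurableT (f := F)) => //.
  by apply: measurable_fun_pair; exact: measurableT_comp.
rewrite fubini_tonelli1// fubini_tonelli1//.
rewrite ge0_integral_reflect.
- apply: eq_integral => x _; rewrite /fubini_F ge0_integral_reflect//.
  exact: measurable_fun_pair2.
- exact: measurable_fun_fubini_tonelli_F.
- by move=> x; apply: integral_ge0.
Qed.

(** The line [y.1 = 0] is null and the left half plane is the reflection of the right one, so the
    formula on the right half plane gives all angles in ]-pi/2, 3pi/2[ up to a null set; periodicity
    rearranges them into ]0, 2pi[. *)
Lemma ge0_integral_polar (F : R * R -> \bar R) :
  measurable_fun (setT : set T2) F -> (forall y, (0 <= F y)%E) ->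
  (\int[leb2]_y F y = \int[leb]_(w in I2pi) ang_int F w)%E.
Proof.
move=> mF F0.
pose N (y : R * R) : R * R := (- y.1, - y.2).
have mN1 : measurable_fun (setT : set T1) (-%R : T1 -> T1).
  by apply: continuous_measurable_fun; exact: opp_continuous.
have mN : measurable_fun (setT : set T2) (N : T2 -> T2).
  by apply: measurable_fun_pair; exact: measurableT_comp.
have mFN : measurable_fun (setT : set T2) (F \o N).
  exact: (measurable_comp measurableT).
have mFh : measurable_fun (setT : set T2) (F \_ halfplane).
  by apply/(measurable_restrictT _ _).1 => //; exact: measurable_funTS.
have mFNh : measurable_fun (setT : set T2) ((F \o N) \_ halfplane).
  by apply/(measurable_restrictT _ _).1 => //; exact: measurable_funTS.
have p0 A (H : R * R -> \bar R) : (forall y, (0 <= H y)%E) -> forall y, (0 <= (H \_ A) y)%E.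
  by move=> H0 y; rewrite /patch; case: ifPn.
have step1 : (\int[leb2]_y F y = \int[leb2]_y (F \_ halfplane) y +
    \int[leb2]_y ((F \o N) \_ halfplane) y)%E.
  rewrite [X in (_ + X)%E]ge0_integral_reflect2//; last by apply: p0 => z; exact: F0.
  rewrite -ge0_integralD//; first last.
  - exact: (measurable_comp measurableT).
  - by move=> y _; apply: p0 => z; exact: F0.
  - by move=> y _; apply: p0 => z; exact: F0.
  apply: ge0_ae_eq_integral => //.
  - apply: emeasurable_funD => //; exact: (measurable_comp measurableT).
  - by move=> y _; rewrite adde_ge0//; apply: p0 => z; exact: F0.
  exists ([set 0%R] `*` setT); split.
  - by apply: measurableX => //; exact: measurable_set1.
  - apply: (etrans (@product_measure1E _ _ T1 T1 R mu mu [set 0] setT _ _)) => //.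
    by rewrite /= lebesgue_measure_set1 mul0e.
  - move=> [x y] /= H; split=> //=; apply: contrapT => /eqP x0; apply: H => _.
    rewrite /patch /N /=; have [xp|xp] := ltP 0 x.
      rewrite mem_set// memNset ?adde0//= /halfplane/= oppr_gt0.
      by apply/negP; rewrite -leNgt ltW.
    rewrite memNset; last by rewrite /halfplane/= ltNge xp.
    by rewrite mem_set/= ?add0e ?opprK// /halfplane/= oppr_gt0 lt_neqAle x0.
have angN w : ang_int (F \o N) w = ang_int F (w + pi).
  apply: eq_integral => t _; rewrite /pol /N /=.
  by rewrite cosDpi sinDpi !mulrN.
have K0 := ang_int_ge0 F0; have mK := measurable_ang_int mF F0.
rewrite step1 !ge0_integral_polar_right//; last by move=> y; exact: F0.
under [X in (_ + X)%E]eq_integral do rewrite angN.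
have pi0 : (0 : R) < pi := pi_gt0 R.
rewrite ge0_integral_translate//.
rewrite (_ : - (pi / 2) + pi = pi / 2 :> R); last by field.
have -> : (\int[mu]_(w in `](- (pi / 2))%R, (pi / 2)%R[) ang_int F w =
   \int[mu]_(w in `](- (pi / 2))%R, 0%R[) ang_int F w + \int[mu]_(w in `]0%R, (pi / 2)%R[) ang_int F w)%E.
  by apply: ge0_integral_itv_split => //; lra.
(* Only the quadrant ]-pi/2, 0[ lies outside ]0, 2pi[; it is moved by a full turn. *)
have per w : ang_int F (w + pi *+ 2) = ang_int F w.
  by apply: eq_integral => t _; rewrite /pol cosD2pi sinD2pi.
under [X in (X + _ + _)%E]eq_integral do rewrite -per.
rewrite ge0_integral_translate//.
rewrite add0r (_ : - (pi / 2) + pi *+ 2 = pi / 2 + pi :> R); last by field.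
rewrite addeAC -addeA addeC addeAC -addeA.
rewrite /I2pi /leb (@ge0_integral_itv_split R 0 (pi / 2) (2 * pi))//; [|lra|lra].
rewrite (@ge0_integral_itv_split R (pi / 2) (pi / 2 + pi) (2 * pi))//; [|lra|lra].
by rewrite addeA addeC mulr_natl.
Qed.

End PolarFormula.

(** * Cut-off functions and the fundamental lemma *)

Section SmoothStep.
Context {R : realType}.

Lemma is_derive0_sq (f : R -> R) (C : R) : (forall x, `|f x| <= C * x ^+ 2) ->
  is_derive (0 : R) (1 : R) f 0.
Proof.
move=> fC; have C0 : 0 <= C by have := fC 1; rewrite expr1n mulr1; exact: le_trans.
have f0 : f 0 = 0 by apply/normr0_eq0/le_anti; rewrite normr_ge0 (le_trans (fC 0))// expr0n mulr0.
have H : h^-1 *: (f (h *: 1 + 0) - f 0) @[h --> (0 : R)^'] --> (0 : R).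
  apply/cvgr0Pnorm_le => e e0; near=> h.
  have h0 : h != 0 by near: h; exact: nbhs_dnbhs_neq.
  rewrite f0 subr0 addr0 /GRing.scale /= mulr1 normrM normfV.
  rewrite ler_pdivrMl ?normr_gt0//; apply: (le_trans (fC h)).
  rewrite -[h ^+ 2]ger0_norm ?sqr_ge0// normrX expr2 mulrA mulrC ler_wpM2l//.
  have : `|h| < e / (C + 1).
    by near: h; apply: dnbhs0_lt; rewrite divr_gt0// ltr_pwDr.
  rewrite ltr_pdivlMr ?ltr_pwDr// => /ltW; apply: le_trans.
  by rewrite mulrC ler_wpM2l// lerDl.
apply: DeriveDef; first by apply/cvg_ex; exists 0.
by apply: cvg_lim.
Unshelve. all: by end_near. Qed.

(** The polynomial is a parameter because the derivative of P(1/x) exp(-1/x) has the same form with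
    X^2 (P - P'): the family is closed under differentiation. *)
Definition flat (P : {poly R}) (x : R) : R :=
  if 0 < x then P.[x^-1] * expR (- x^-1) else 0.

(** With y = 1/x, the inequality exp(y/(k+2)) >= y/(k+2) raised to the power k+2 gives y^k exp(-y)
    <= (k+2)^(k+2) y^(-2). A quadratic bound is what differentiability at 0 requires. *)
Lemma flat_bound (P : {poly R}) : exists C, forall x, `|flat P x| <= C * x ^+ 2.
Proof.
exists (\sum_(k < size P) `|P`_k| * k.+2%:R ^+ k.+2) => x; rewrite /flat.
case: ifPn => x0; last first.
  by rewrite normr0 mulr_ge0 ?sqr_ge0// sumr_ge0// => k _; rewrite mulr_ge0.
have y0 : 0 < x^-1 by rewrite invr_gt0.
rewrite normrM [`|expR _|]ger0_norm ?expR_ge0// horner_coef.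
apply: (le_trans (ler_wpM2r (expR_ge0 _) (ler_norm_sum _ _ _))).
rewrite !mulr_suml; apply: ler_sum => k _.
rewrite normrM normrX (gtr0_norm y0) expRN ler_pdivrMr ?expR_gt0//.
have : (x^-1 / k.+2%:R) ^+ k.+2 <= expR x^-1.
  have -> : expR x^-1 = expR (x^-1 / k.+2%:R) ^+ k.+2.
    by rewrite -expRM_natl -mulr_natl mulrCA divff ?pnatr_eq0// mulr1.
  rewrite ler_pXn2r ?nnegrE ?expR_ge0//; last by rewrite divr_ge0// ltW.
  by rewrite (le_trans _ (expR_ge1Dx _))// lerDr.
have : 0 < (k.+2%:R ^+ k.+2 : R) by rewrite exprn_gt0.
rewrite expr_div_n; move: (k.+2%:R ^+ k.+2) => N N0; rewrite ler_pdivrMr// => h.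
rewrite -(mulrA `|_|) -!(mulrA `|_|) ler_wpM2l//.
have -> : x^-1 ^+ k = x^-1 ^+ k.+2 * x ^+ 2.
  by rewrite -[k.+2]addn2 exprD -mulrA -exprMn mulVf ?gt_eqF// expr1n mulr1.
by rewrite [leRHS]mulrAC ler_pM2r ?exprn_gt0// mulrC.
Qed.

Lemma is_derive_flat (P : {poly R}) (x : R) :
  is_derive x (1 : R) (flat P) (flat ('X^2 * (P - P^`())) x).
Proof.
have [x0|x0|->] := ltgtP x 0.
- rewrite {2}/flat ltNge (ltW x0)/=.
  have : is_derive x (1 : R) (cst 0) (0 : R) by exact: is_derive_cst.
  apply: near_eq_is_derive => //.
  near=> y; rewrite /flat/= ltNge ltW//; near: y; exact: lt_nbhsl.
- have dV : is_derive x (1 : R) (fun y : R => y^-1) (- x ^- 2).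
    have x1 : x != 0 by rewrite gt_eqF.
    have d0 : derivable (id : R -> R) x (1 : R) by exact: derivable_id.
    have := @derivableV _ _ (id : R -> R) x (1 : R) x1 d0 => d.
    apply: DeriveDef => //; rewrite (@deriveV _ _ (id : R -> R) x (1 : R) x1 d0).
    by rewrite derive_id /GRing.scale /= mulr1.
  have d1 : is_derive x (1 : R) (fun y => P.[y^-1]) (P^`().[x^-1] * - x ^- 2).
    exact: (is_derive1_comp (f := horner P)).
  have d2 : is_derive x (1 : R) (fun y => expR (- y^-1)) (expR (- x^-1) * - (- x ^- 2)).
    exact: (is_derive1_comp (f := expR)).
  have : is_derive x (1 : R) (fun y => P.[y^-1] * expR (- y^-1))
      (flat ('X^2 * (P - P^`())) x).
    apply: (is_derive_eq (is_deriveM d1 d2)).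
    rewrite /flat x0 /GRing.scale /= hornerM hornerD hornerN hornerXn exprVn.
    by move: (x ^- 2) P.[x^-1] P^`().[x^-1] (expR _) => u v w z; ring.
  apply: near_eq_is_derive => //.
  near=> y; rewrite /flat/= (_ : 0 < y)//; near: y; exact: lt_nbhsr.
- have -> : flat ('X^2 * (P - P^`())) 0 = 0 by rewrite /flat ltxx.
  by have [C hC] := flat_bound P; exact: is_derive0_sq hC.
Unshelve. all: by end_near. Qed.

Lemma smooth_flat (P : {poly R}) : smooth (fun x => (flat P x)%:C).
Proof.
apply: (@smooth_coind _ [set f | exists P, f = fun x => (flat P x)%:C]); last by exists P.
move=> f [Q ->]; exists (fun x => (flat ('X^2 * (Q - Q^`())) x)%:C).
  by move=> x; apply: is_cd_real; exact: is_derive_flat.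
by exists ('X^2 * (Q - Q^`())).
Qed.

(** Induction on the order: the derivative of 1/h is -h' (1/h)^2, and 1/h is already known to the
    preceding order. *)
Lemma smooth_inv (h : R -> R) : (forall x, h x != 0) ->
  smooth (fun x => (h x)%:C) -> smooth (fun x => (h x)^-1%:C).
Proof.
move=> h0 sh; split=> n; elim: n => [//|n ih].
exists (fun x => - 1 * cderive1 (fun x => (h x)%:C) x * ((h x)^-1%:C * (h x)^-1%:C)).
  move=> x; have [d1 d2] := smoothE x sh.
  have dh : is_derive x (1 : R) h (reC (cderive1 (fun x => (h x)%:C) x)) by [].
  have dV : is_derive x (1 : R) (fun y => (h y)^-1)
      (- (h x) ^- 2 *: reC (cderive1 (fun x => (h x)%:C) x)).
    have d := @derivableV _ _ h x (1 : R) (h0 x) (@ex_derive _ _ _ _ _ _ _ dh).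
    apply: DeriveDef => //; rewrite (@deriveV _ _ h x (1 : R) (h0 x)); last by case: dh.
    by rewrite (@derive_val _ _ _ _ _ _ _ dh).
  apply: (is_cd_eq (is_cd_real dV)).
  have : imC (cderive1 (fun x => (h x)%:C) x) = 0.
    by rewrite -(@derive_val _ _ _ _ _ _ _ d2) /comp /= derive_cst.
  case: (cderive1 _ x) => u v /= ->.
  apply: ceqP; rewrite !(reCM, imCM) /= ?(mul0r, mulr0, addr0, subr0, oppr0)//.
  by rewrite /GRing.scale /= -expr2 exprVn; ring.
apply: CDM; last exact: CDM.
by have [/(_ n)] := smoothZ (-1) (smooth_derive sh).
Qed.

(** The denominator is positive because x and 1 - x are never both nonpositive. *)
Definition step (x : R) : R := flat 1 x / (flat 1 x + flat 1 (1 - x)).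

Lemma flat1 x : flat 1 x = if 0 < x then expR (- x^-1) else 0.
Proof. by rewrite /flat hornerC mul1r. Qed.

Lemma flat1_ge0 x : 0 <= flat 1 x.
Proof. by rewrite flat1; case: ifP => // _; exact: expR_ge0. Qed.

Lemma flat1_gt0 x : 0 < x -> 0 < flat 1 x.
Proof. by rewrite flat1 => ->; exact: expR_gt0. Qed.

Lemma step_den_gt0 x : 0 < flat 1 x + flat 1 (1 - x).
Proof.
have [x0|x0] := ltP 0 x; first by rewrite ltr_pwDl ?flat1_gt0 ?flat1_ge0.
by rewrite ltr_wpDl ?flat1_ge0// flat1_gt0//; lra.
Qed.

Lemma step_ge0 x : 0 <= step x.
Proof. by rewrite /step divr_ge0 ?flat1_ge0// ltW// step_den_gt0. Qed.

Lemma step_le1 x : step x <= 1.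
Proof. by rewrite /step ler_pdivrMr ?step_den_gt0// mul1r lerDl flat1_ge0. Qed.

Lemma step0 x : x <= 0 -> step x = 0.
Proof. by move=> x0; rewrite /step flat1 ltNge x0 mul0r. Qed.

Lemma step1 x : 1 <= x -> step x = 1.
Proof.
move=> x1; rewrite /step [flat 1 (1 - x)]flat1 (_ : 0 < 1 - x = false); last first.
  by apply/negbTE; rewrite -leNgt subr_le0.
by rewrite addr0 divff// gt_eqF// flat1_gt0// (lt_le_trans ltr01).
Qed.

Lemma smooth_step_fun : smooth (fun x : R => (step x)%:C).
Proof.
have s1 := smooth_flat 1.
have s2 : smooth (fun x => (flat 1 (1 - x))%:C).
  have := smooth_affine (-1) 1 s1; congr smooth.
  by apply/funext => x; rewrite mulN1r addrC.
have s3 : smooth (fun x => (flat 1 x + flat 1 (1 - x))%:C).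
  by have := smoothD s1 s2; congr smooth; apply/funext => x; rewrite rmorphD.
have h0 x : flat 1 x + flat 1 (1 - x) != 0 by rewrite gt_eqF// step_den_gt0.
have := smoothM s1 (smooth_inv h0 s3); congr smooth.
by apply/funext => x; rewrite /step rmorphM.
Qed.

(* supported in [a + 1/n, b - 1/n] and eventually equal to 1 inside (a, b) *)
Definition bump (n : nat) (a b t : R) : R[i] :=
  (step (n%:R * (t - a) - 1))%:C * (step (n%:R * (b - t) - 1))%:C.

Lemma smooth_bump n a b : smooth (bump n a b).
Proof.
apply: smoothM.
  have := smooth_affine n%:R (- n%:R * a - 1) smooth_step_fun; congr smooth.
  by apply/funext => t; congr (step _)%:C; ring.
have := smooth_affine (- n%:R) (n%:R * b - 1) smooth_step_fun; congr smooth.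
by apply/funext => t; congr (step _)%:C; ring.
Qed.

Lemma bump_le1 n a b t : cabs (bump n a b t) <= 1.
Proof.
rewrite /bump cabsM !cabs_real !ger0_norm ?step_ge0//.
by rewrite mulr_ile1 ?step_ge0 ?step_le1.
Qed.

Lemma bump_supp n a b t : ~ (`[a + n.+1%:R^-1, b - n.+1%:R^-1]%classic t) ->
  bump n.+1 a b t = 0.
Proof.
move/negP; rewrite /= in_itv/= negb_and -!ltNge /bump => /orP[] h.
  rewrite step0 ?mul0r// subr_le0 -ler_pdivlMl// mulr1.
  by rewrite lerBlDl ltW.
rewrite [X in _ * X%:C]step0 ?mulr0// subr_le0 -ler_pdivlMl// mulr1.
by rewrite lerBlDl -lerBlDr ltW.
Qed.

Lemma bump_out n a b t : ~ (`]a, b[%classic t) -> bump n.+1 a b t = 0.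
Proof.
move=> h; apply: bump_supp => /= /[!in_itv]/= /andP[h1 h2]; apply: h.
have : 0 < (n.+1%:R^-1 : R) by rewrite invr_gt0.
by move=> n0; rewrite /= in_itv/= (lt_le_trans _ h1) ?ltrDl// (le_lt_trans h2)// gtrBl.
Qed.

Lemma bump_near a b t : `]a, b[%classic t -> \forall n \near \oo, bump n a b t = 1.
Proof.
rewrite /= in_itv/= => /andP[ta tb].
have k c : 0 < c -> \forall n \near \oo, step (n%:R * c - 1) = 1.
  move=> c0; exists (Num.bound (2 / c)) => // n /= hn; apply: step1.
  rewrite lerBrDr -ler_pdivrMr//.
  apply: (le_trans _ (_ : (Num.bound (2 / c))%:R <= _)); last by rewrite ler_nat.
  by apply/ltW; have := archi_boundP (_ : 0 <= 2 / c); apply; rewrite divr_ge0// ltW.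
have h1 := k (t - a); have h2 := k (b - t); rewrite !subr_gt0 in h1 h2.
by apply: filterS2 (h1 ta) (h2 tb) => n; rewrite /bump => -> ->; rewrite mulr1.
Qed.

End SmoothStep.

(** * Borel sets of the plane and the product sigma-algebra *)

Section PlaneMeasurability.
Context {R : realType}.
Notation T1 := (measurableTypeR R).
Notation T2 := (measurableTypeR R * measurableTypeR R)%type.

(** An open set is the union of the boxes with rational corners that it contains, and these are
    countably many. This links the product topology to the product sigma-algebra. *)
Lemma open2_measurable (U : set (R * R)) : open U -> measurable (U : set T2).
Proof.
move=> oU.
pose B (q : rat * rat * (rat * rat)) : set (R * R) :=
  `]ratr q.1.1, ratr q.1.2[ `*` `]ratr q.2.1, ratr q.2.2[.
have -> : U = \bigcup_(q in [set q | B q `<=` U]) B q.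
  apply/seteqP; split=> [[x y] Uxy|z [q /= qU Bq]]; last exact: qU.
  have [e /= e0 he] : \forall e \near 0^'+, ball (x, y) e `<=` U.
    have := oU _ Uxy; rewrite -nbhs_ballE => -[e /= e0 he].
    exists e => //= d /=; rewrite sub0r normrN => de d0.
    apply: subset_trans he; apply: le_ball; rewrite ltW//.
    by rewrite -(gtr0_norm d0).
  pose d := e / 2; have d0 : 0 < d by rewrite divr_gt0.
  have bd : ball (x, y) d `<=` U.
    apply: he => //=; rewrite sub0r normrN gtr0_norm// /d; lra.
  have rat_btw (u v : R) : u < v -> exists q : rat, u < ratr q < v.
    by move=> uv; have [q] := rat_in_itvoo uv; rewrite in_itv/=; exists q.
  have [a1 /andP[a1x xa1]] : exists q : rat, x - d < ratr q < x by apply: rat_btw; lra.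
  have [a2 /andP[a2x xa2]] : exists q : rat, x < ratr q < x + d by apply: rat_btw; lra.
  have [b1 /andP[b1x xb1]] : exists q : rat, y - d < ratr q < y by apply: rat_btw; lra.
  have [b2 /andP[b2x xb2]] : exists q : rat, y < ratr q < y + d by apply: rat_btw; lra.
  exists ((a1, a2), (b1, b2)); last by split; rewrite /= in_itv/=; apply/andP.
  move=> [x' y'] [] /=; rewrite !in_itv/= => /andP[h1 h2] /andP[h3 h4].
  apply: bd; split; rewrite /ball /= ltr_norml; apply/andP; split; lra.
rewrite bigcup_mkcond; apply: countable_bigcupT_measurable => [|q].
  exact: countableP.
by case: ifPn => // _; exact: measurableX.
Qed.

Lemma closed2_measurable (U : set (R * R)) : closed U -> measurable (U : set T2).
Proof.
by move=> /closed_openC/open2_measurable/measurableC; rewrite setCK.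
Qed.

Lemma compact2_measurable (K : set (R * R)) : compact K -> measurable (K : set T2).
Proof.
move=> cK; apply: closed2_measurable; exact: compact_closed.
Qed.

Lemma continuous2_measurable (f : R * R -> R) : continuous f ->
  measurable_fun (setT : set T2) (f : T2 -> T1).
Proof.
move=> cf; apply: (measurability _ (RGenOpens.measurableE R)) => _ [_ [x [y ->]] <-].
rewrite setTI; apply: open2_measurable; apply: open_comp => // z _; exact: cf.
Qed.

End PlaneMeasurability.

(** * Vanishing almost everywhere *)

Section FundamentalLemma.
Context d (T : measurableType d) (R : realType).
Variable mu : {measure set T -> \bar R}.

(** The positive and negative parts of [f] are densities of finite measures that agree on the
    pi-system, hence everywhere; so [f] has integral 0 over every measurable subset of [D]. *)
Lemma ae_eq0_pi (D : set T) (G : set (set T)) (g : (set T)^nat) (f : T -> R) :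
  measurable D -> mu.-integrable D (EFin \o f) ->
  measurable = <<s G >> -> setI_closed G -> (forall k, G (g k)) ->
  \bigcup_k g k = setT ->
  (forall A, G A -> (\int[mu]_(x in A `&` D) (f x)%:E)%E = 0%E) ->
  {ae mu, forall x, D x -> f x = 0}.
Proof.
move=> mD fi mG GI Gg gT H.
pose p := (EFin \o f^\+) \_ D; pose n := (EFin \o f^\-) \_ D.
have mf : measurable_fun D f by apply/measurable_EFinP; exact: measurable_int fi.
have mp : measurable_fun setT p.
  by apply/(measurable_restrictT _ _).1 => //; apply/measurable_EFinP; exact: measurable_funrpos.
have mn : measurable_fun setT n.
  by apply/(measurable_restrictT _ _).1 => //; apply/measurable_EFinP; exact: measurable_funrneg.
have p0 x : (0 <= p x)%E by rewrite /p /patch; case: ifPn => // _; rewrite lee_fin funrpos_ge0.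
have n0 x : (0 <= n x)%E by rewrite /n /patch; case: ifPn => // _; rewrite lee_fin funrneg_ge0.
have ip : mu.-integrable D (EFin \o f^\+) by exact: integrable_funrpos.
have iN : mu.-integrable D (EFin \o f^\-) by exact: integrable_funrneg.
pose mp' := density_measure mu p0 mp; pose mn' := density_measure mu n0 mn.
have E (h : T -> R) A : (\int[mu]_(x in A) ((EFin \o h) \_ D) x =
    \int[mu]_(x in A `&` D) (h x)%:E)%E.
  by rewrite [RHS]integral_mkcondr.
have sub A : measurable A -> (\int[mu]_(x in A `&` D) (f x)%:E = mp' A - mn' A)%E.
  move=> mA; rewrite /mp' /mn' /= /density /p /n !E.
  have mAD := measurableI _ _ mA mD.
  rewrite -integralB_EFin//; [|exact: integrableS ip|exact: integrableS iN].
  by apply: eq_integral => x _; rewrite -EFinB -[in LHS](funrposBneg f).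
have fin (h : T -> R) A : mu.-integrable D (EFin \o h) -> measurable A ->
    (\int[mu]_(x in A) ((EFin \o h) \_ D) x)%E \is a fin_num.
  move=> hi mA; rewrite E; apply: integrable_fin_num; first exact: measurableI.
  by apply: integrableS hi => //; exact: measurableI.
have mGA A : G A -> measurable A by move=> GA; rewrite mG; exact: sub_sigma_algebra.
have eqpn A : measurable A -> mp' A = mn' A.
  move=> mA; apply: (@measure_unique _ _ _ G g mG GI Gg gT mp' mn') => //.
    move=> B GB; have := H B GB; rewrite sub; last exact: mGA.
    have fp : mp' B \is a fin_num by apply: fin => //; exact: mGA.
    have fn : mn' B \is a fin_num by apply: fin => //; exact: mGA.
    by rewrite -(fineK fp) -(fineK fn) -EFinB => -[] /eqP; rewrite subr_eq0 => /eqP ->.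
  by move=> k; have := fin _ (g k) ip (mGA _ (Gg k)); rewrite fin_numElt => /andP[].
have := @integral_ae_eq _ _ _ mu D mD (cst 0%E) (EFin \o f) fi (measurable_cst _).
move=> /(_ _) h; have {}h : ae_eq mu D (EFin \o f) (cst 0%E).
  apply: h => A AD mA; rewrite integral0 -[A](setIidl AD) sub// eqpn// subee//.
  exact: fin.
by apply: filterS h => x /[apply] /= -[].
Qed.

Lemma cae_eq0_pi (D : set T) (G : set (set T)) (g : (set T)^nat) (f : T -> R[i]) :
  measurable D -> cintegrable mu D f ->
  measurable = <<s G >> -> setI_closed G -> (forall k, G (g k)) ->
  \bigcup_k g k = setT ->
  (forall A, G A -> cint mu (A `&` D) f = 0) ->
  {ae mu, forall x, D x -> f x = 0}.
Proof.
move=> mD [f1 f2] mG GI Gg gT H.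
have mGA A : G A -> measurable A by move=> GA; rewrite mG; exact: sub_sigma_algebra.
have K (h : T -> R) A : mu.-integrable D (EFin \o h) -> G A ->
    Rintegral mu (A `&` D) h = 0 -> (\int[mu]_(x in A `&` D) (h x)%:E)%E = 0%E.
  move=> hi /mGA mA h0; rewrite -[LHS]fineK; last first.
    apply: integrable_fin_num; first exact: measurableI.
    by apply: integrableS hi => //; exact: measurableI.
  by rewrite [fine _]h0.
have h1 : {ae mu, forall x, D x -> reC (f x) = 0}.
  apply: (ae_eq0_pi mD f1 mG GI Gg gT) => A GA; apply: K => //.
  by have := congr1 reC (H A GA).
have h2 : {ae mu, forall x, D x -> imC (f x) = 0}.
  apply: (ae_eq0_pi mD f2 mG GI Gg gT) => A GA; apply: K => //.
  by have := congr1 imC (H A GA).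
by apply: filterS2 h1 h2 => x r0 i0 Dx; apply: ceqP; [exact: r0|exact: i0].
Qed.

Lemma ae_bigcup (D : (set T)^nat) (P : T -> Prop) :
  (forall n, {ae mu, forall x, D n x -> P x}) ->
  {ae mu, forall x, (\bigcup_n D n) x -> P x}.
Proof.
move=> H; have /negligibleS := negligible_bigcup (fun n => H n); apply.
move=> x /= /not_implyP[[n _ Dn] nP]; exists n => //=; exact/not_implyP.
Qed.

Lemma cintegrable_bounded (D : set T) (f g : T -> R[i]) (C : R) : measurable D ->
  cmeas D g -> (forall x, D x -> cabs (g x) <= C) -> cintegrable mu D f ->
  cintegrable mu D (fun x => f x * g x).
Proof.
move=> mD mg gC fi.
have := integrableZl mD C (integrable_cabs mD fi).
rewrite (_ : (fun _ => _) = EFin \o (fun x => C * cabs (f x)))// => H.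
apply: (cintegrable_le mD _ H).
  by apply: cmeasM => //; exact: cintegrable_meas fi.
by move=> x Dx; rewrite cabsM mulrC ler_wpM2r ?cabs_ge0 ?gC.
Qed.

Lemma cintegrable_supp (D K : set T) (f : T -> R[i]) : measurable D -> measurable K ->
  K `<=` D -> (forall x, ~ K x -> f x = 0) -> cintegrable mu K f -> cintegrable mu D f.
Proof.
move=> mD mK KD f0 [f1 f2].
have E (h : T -> R) : (forall x, ~ K x -> h x = 0) ->
    mu.-integrable K (EFin \o h) -> mu.-integrable D (EFin \o h).
  move=> h0 hi; have := (integrable_restrict mu mK mD (EFin \o h)).1.
  rewrite setIidr// => /(_ hi); rewrite (_ : _ \_ _ = EFin \o h)//.
  apply/funext => x; rewrite /patch; case: ifPn => // /negP xK /=.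
  by rewrite h0// => Kx; apply: xK; exact/mem_set.
by split; [apply: E f1|apply: E f2] => x /f0 /= ->.
Qed.

Lemma cint_supp (D K : set T) (f : T -> R[i]) : K `<=` D ->
  (forall x, ~ K x -> f x = 0) -> cint mu D f = cint mu K f.
Proof.
move=> KD f0.
have E (h : T -> R) : (forall x, ~ K x -> h x = 0) -> Rintegral mu D h = Rintegral mu K h.
  move=> h0; rewrite [LHS]Rintegral_mkcond [RHS]Rintegral_mkcond.
  apply: eq_Rintegral => x _; rewrite /patch; case: ifPn; case: ifPn => //.
    by move=> /negP xK _; rewrite h0// => Kx; apply: xK; exact/mem_set.
  by move=> /set_mem/KD Dx /negP; case; exact/mem_set.
by rewrite /cint; congr Complex; apply: E => x /f0 /= ->.
Qed.

(** The cut-offs are bounded by 1 and tend to the indicator of [A], so a vanishing integral against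
    each of them passes to [A] by dominated convergence. *)
Lemma cint_cutoff0 (D A : set T) (g : T -> R[i]) (chi : nat -> T -> R[i]) :
  measurable D -> measurable A -> A `<=` D -> cintegrable mu D g ->
  (forall k, cmeas D (chi k)) -> (forall k x, cabs (chi k x) <= 1) ->
  (forall x, A x -> \forall k \near \oo, chi k x = 1) ->
  (forall k x, ~ A x -> chi k x = 0) ->
  (forall k, cint mu D (fun x => g x * chi k x) = 0) ->
  cint mu A g = 0.
Proof.
move=> mD mA AD ig mchi chi1 chiA chi0 H.
pose f0 t := g t * (\1_A t)%:C; have gm := cintegrable_meas ig.
have m1 : cmeas D (fun t => (\1_A t : R)%:C).
  by apply: cmeas_real; exact: measurable_indic.
have lim0 : cint mu D f0 = 0.
  apply: cabs_eq0.
  have := @cint_dominated _ _ _ mu D (fun k t => g t * chi k t) f0 (cabs \o g) mD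
    (fun k => cmeasM gm (mchi k)) (cmeasM gm m1) (integrable_cabs mD ig).
  move=> h; have {}h := h _ _.
  have : (fun k => cabs (cint mu D (fun t => g t * chi k t) - cint mu D f0))
      @ \oo --> (0 : R).
    apply: h.
      by move=> k t _; rewrite cabsM -[leRHS]mulr1 ler_wpM2l ?cabs_ge0.
    move=> t _; rewrite /f0 indicE; case: (boolP (t \in _)) => [/set_mem|/negP] tD.
      by apply: filterS (chiA t tD) => k ->.
    by apply: nearW => k; rewrite chi0// => tI; apply: tD; exact/mem_set.
  under eq_fun do rewrite H sub0r cabsN.
  by move/(cvg_unique _ (cvg_cst _)) => ->.
rewrite -lim0; transitivity (cint mu A f0).
  by apply: cint_ext => t tD; rewrite /f0 indicE tD mulr1.
by apply/esym/cint_supp => // t tD; rewrite /f0 indicE memNset// mulr0.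
Qed.

End FundamentalLemma.

(** * Generating boxes, and the fundamental lemma on the interval *)

Section WeakUniqueness.
Context {R : realType}.
Notation T1 := (measurableTypeR R).
Notation T2 := (measurableTypeR R * measurableTypeR R)%type.

Lemma mG1 : @measurable _ T1 = <<s @RGenOpens.G R >>.
Proof. exact: RGenOpens.measurableE. Qed.

Lemma G1I : setI_closed (@RGenOpens.G R).
Proof.
move=> _ _ [a [b ->]] [c [d ->]]; exists (Num.max a c), (Num.min b d).
apply/seteqP; split=> z /=; rewrite !in_itv/= lt_min gt_max.
  by move=> [/andP[-> ->] /andP[-> ->]].
by move=> /andP[/andP[-> ->] /andP[-> ->]].
Qed.

Lemma cover1 : \bigcup_k `](- k%:R), k%:R[%classic = [set: R].
Proof.
apply/seteqP; split=> // x _; exists (Num.bound `|x|) => //=.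
by rewrite in_itv/= -ltr_norml archi_boundP.
Qed.

Definition boxes : set (set (R * R)) :=
  [set A `*` B | A in @RGenOpens.G R & B in @RGenOpens.G R].

(** The preimage of an interval under a projection is a strip, and a strip is a countable union of
    boxes. *)
Lemma mG2 : @measurable _ T2 = <<s boxes >>.
Proof.
rewrite eqEsubset; split; last first.
  apply: smallest_sub; first exact: smallest_sigma_algebra.
  move=> _ [_ [a [b ->]] [_ [c [d ->]] <-]]; exact: measurableX.
apply: smallest_sub; first exact: smallest_sigma_algebra.
have G1 k : RGenOpens.G `](- (k%:R : R)), (k%:R : R)[%classic by exists (- k%:R), k%:R.
have sub (f : R * R -> R) : preimage_set_system setT f (@RGenOpens.G R) `<=` <<s boxes >> ->
    preimage_set_system setT f (@measurable _ T1) `<=` <<s boxes >>.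
  move=> H; rewrite mG1.
  have -> : preimage_set_system setT f <<s @RGenOpens.G R >> =
      <<s preimage_set_system setT f (@RGenOpens.G R) >>.
    by rewrite (@g_sigma_preimageE _ R setT f).
  by apply: smallest_sub => //; exact: smallest_sigma_algebra.
rewrite subUset; split; apply: sub => _ [A GA <-]; rewrite setTI.
  rewrite (_ : _ @^-1` _ = \bigcup_k (A `*` `](- k%:R), k%:R[)).
    apply: (@bigcupT_measurable _ (g_sigma_algebraType boxes)) => k.
    by apply: sub_sigma_algebra; exists A => //; exists (`](- k%:R), k%:R[%classic).
  by rewrite -setX_bigcupr cover1; apply/seteqP; split=> [z //|z []].
rewrite (_ : _ @^-1` _ = \bigcup_k (`](- k%:R), k%:R[ `*` A)).
  apply: (@bigcupT_measurable _ (g_sigma_algebraType boxes)) => k.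
  by apply: sub_sigma_algebra; exists (`](- k%:R), k%:R[%classic) => //; exists A.
by rewrite -setX_bigcupl cover1; apply/seteqP; split=> [z //|z []].
Qed.

Lemma G2I : setI_closed boxes.
Proof.
move=> _ _ [A GA [B GB <-]] [C GC [D GD <-]].
exists (A `&` C); first exact: G1I.
exists (B `&` D); first exact: G1I.
by apply/seteqP; split=> z /= [[h1 h2] [h3 h4]].
Qed.

Lemma cover2 : \bigcup_k (`](- k%:R), k%:R[ `*` `](- k%:R), k%:R[) = [set: R * R].
Proof.
apply/seteqP; split=> // -[x y] _; exists (Num.bound (Num.max `|x| `|y|)) => //=.
rewrite !in_itv/= -!ltr_norml; split; apply: (le_lt_trans _ (archi_boundP _));
  by rewrite ?le_max ?lexx ?orbT ?normr_ge0.
Qed.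

(** Only local integrability is available, so the interval is exhausted by the []c n, d n[]. On each
    of them the bumps inside a subinterval show that [g] has integral 0 over that subinterval. *)
Lemma weak_unique1 (g : R -> R[i]) : locint1 g ->
  (forall chi, test1 chi -> cint leb I2pi (fun x => g x * chi x) = 0) ->
  zero2pi g.
Proof.
move=> lg H; pose c n : R := n.+1%:R^-1; pose d n : R := 2 * pi - n.+1%:R^-1.
have c0 n : 0 < c n by rewrite /c invr_gt0.
have dpi n : d n < 2 * pi by rewrite /d ltrBlDr ltrDl c0.
have -> : zero2pi g = {ae leb, forall x, (\bigcup_n `]c n, d n[%classic) x -> g x = 0}.
  congr {ae leb, _}; apply/funext => x; apply/propext; split=> h Ix; apply: h.
    case: Ix => n _ /=; rewrite /I2pi /= !in_itv/= => /andP[h1 h2].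
    by rewrite (lt_trans (c0 n) h1) (lt_trans h2 (dpi n)).
  move: Ix; rewrite /I2pi /= in_itv/= => /andP[x0 xpi].
  have m0 : 0 < Num.min x (2 * pi - x) by rewrite lt_min x0 subr_gt0.
  exists (Num.bound (Num.min x (2 * pi - x))^-1) => //=.
  set k := Num.bound _; have : c k < Num.min x (2 * pi - x).
    rewrite /c invf_plt ?posrE//; apply: lt_trans (_ : k%:R < _); last by rewrite ltr_nat.
    by apply: archi_boundP; rewrite invr_ge0 ltW.
  by rewrite lt_min in_itv/= /d /c => /andP[-> h]; rewrite ltrBrDr addrC -ltrBrDr.
apply: ae_bigcup => n.
have iD : cintegrable leb `]c n, d n[ g.
  have sc : `[c n, d n] `<=` (I2pi : set R); last first.
    apply: (@cintegrableS _ T1 R leb `]c n, d n[%classic `[c n, d n]%classic g) => //.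
      exact: subset_itv_oo_cc.
    by apply: lg => //; exact: segment_compact.
  move=> x /=; rewrite /I2pi /= !in_itv/= => /andP[h1 h2].
  by rewrite (lt_le_trans (c0 n) h1) (le_lt_trans h2 (dpi n)).
apply: (@cae_eq0_pi _ T1 R leb `]c n, d n[%classic (@RGenOpens.G R)
  (fun k => `](- k%:R), k%:R[%classic) g) => //.
- exact: mG1.
- exact: G1I.
- by move=> k; exists (- k%:R), k%:R.
- exact: cover1.
move=> _ [x [y ->]].
pose x' := Num.max x (c n); pose y' := Num.min y (d n).
have -> : `]x, y[ `&` `]c n, d n[ = `]x', y'[%classic.
  apply/seteqP; split=> z /=; rewrite !in_itv/= /x' /y' lt_min gt_max.
    by move=> [/andP[-> ->] /andP[-> ->]].
  by move=> /andP[/andP[-> ->] /andP[-> ->]].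
have sub : `]x', y'[ `<=` `]c n, d n[.
  move=> z /=; rewrite !in_itv/= /x' /y' lt_min gt_max.
  by move=> /andP[/andP[_ ->] /andP[_ ->]].
have subI : `]c n, d n[ `<=` (I2pi : set R).
  move=> z /=; rewrite /I2pi /= !in_itv/= => /andP[h1 h2].
  by rewrite (lt_trans (c0 n) h1) (lt_trans h2 (dpi n)).
have z0 k : cint leb `]c n, d n[ (fun t => g t * bump k.+1 x' y' t) = 0.
  rewrite -(H (bump k.+1 x' y')).
    apply/esym/cint_supp => // t tD; rewrite bump_out ?mulr0//.
    by move=> /sub.
  split; first exact/smooth1P/smooth_bump.
  exists `[x' + k.+1%:R^-1, y' - k.+1%:R^-1]%classic; split.
  - exact: segment_compact.
  - move=> t /=; rewrite /I2pi /= !in_itv/= => /andP[h1 h2]; apply/andP; split.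
      apply: (lt_le_trans _ h1); rewrite ltr_pwDr ?invr_gt0//.
      by rewrite /x' le_max (ltW (c0 n)) orbT.
    apply: (le_lt_trans h2); rewrite ltrBlDr.
    have : y' < 2 * pi by rewrite /y' gt_min dpi orbT.
    by move/lt_le_trans; apply; rewrite lerDl invr_ge0.
  - by move=> t; exact: bump_supp.
apply: (@cint_cutoff0 _ _ _ leb `]c n, d n[%classic _ g (fun k => bump k.+1 x' y')) => //.
- by move=> k; apply: smooth_cmeas => //; exact: smooth_bump.
- by move=> k t; exact: bump_le1.
- move=> t /bump_near[N _ hN]; exists N => // k /= Nk.
  by apply: hN => /=; rewrite (leq_trans Nk).
- by move=> k t; exact: bump_out.
Qed.


End WeakUniqueness.

(** * Weak derivatives in the punctured plane *)

Section PlaneCalculus.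
Context {R : realType}.
Implicit Types (w : R * R -> R[i]) (y v : R * R).

Lemma differentiable_fst y : differentiable (fst : R * R -> R) y.
Proof. by apply: linear_differentiable => z; exact: cvg_fst. Qed.
Lemma differentiable_snd y : differentiable (snd : R * R -> R) y.
Proof. by apply: linear_differentiable => z; exact: cvg_snd. Qed.

Lemma derive_fst y v : 'D_v (fst : R * R -> R) y = v.1.
Proof. rewrite deriveE; last exact: differentiable_fst. by rewrite diff_lin// => z; exact: cvg_fst. Qed.

Lemma derive_snd y v : 'D_v (snd : R * R -> R) y = v.2.
Proof. rewrite deriveE; last exact: differentiable_snd. by rewrite diff_lin// => z; exact: cvg_snd. Qed.

Lemma differentiable_comp1 (h : R -> R) (phi : R * R -> R) y (a : R) :
  differentiable phi y -> is_derive (phi y) (1 : R) h a ->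
  differentiable (h \o phi) y.
Proof.
move=> dphi [dh _]; apply: differentiable_comp => //.
exact/derivable1_diffP.
Qed.

Lemma derive_comp1 (h : R -> R) (phi : R * R -> R) y v (a : R) :
  differentiable phi y -> is_derive (phi y) (1 : R) h a ->
  'D_v (h \o phi) y = a * 'D_v phi y.
Proof.
move=> dphi dh; have [dh1 dh2] := dh.
have dh' : differentiable h (phi y) by exact/derivable1_diffP.
rewrite deriveE; last exact: (differentiable_comp1 dphi dh).
have -> : 'd (h \o phi) y v = 'd h (phi y) ('d phi y v) by rewrite diff_comp.
by rewrite -(deriveE v dphi) (deriv1E dh1) /GRing.scale /= derive1E dh2 mulrC.
Qed.

Definition cdiff w y := differentiable (reC \o w) y /\ differentiable (imC \o w) y.

Lemma cdiffD w g y : cdiff w y -> cdiff g y -> cdiff (fun y => w y + g y) y.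
Proof.
move=> [w1 w2] [g1 g2]; split.
  rewrite (_ : _ \o _ = (reC \o w) + (reC \o g)); first exact: differentiableD.
  by apply/funext => t /=; rewrite reCD.
rewrite (_ : _ \o _ = (imC \o w) + (imC \o g)); first exact: differentiableD.
by apply/funext => t /=; rewrite imCD.
Qed.

Lemma cdiffM w g y : cdiff w y -> cdiff g y -> cdiff (fun y => w y * g y) y.
Proof.
move=> [w1 w2] [g1 g2]; split.
  rewrite (_ : _ \o _ = (reC \o w) * (reC \o g) - (imC \o w) * (imC \o g)).
    by apply: differentiableB; exact: differentiableM.
  by apply/funext => t /=; rewrite reCM.
rewrite (_ : _ \o _ = (reC \o w) * (imC \o g) + (imC \o w) * (reC \o g)).
  by apply: differentiableD; exact: differentiableM.
by apply/funext => t /=; rewrite imCM.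
Qed.

Lemma cdiff_cst (z : R[i]) y : cdiff (fun=> z) y.
Proof. by split; exact: differentiable_cst. Qed.

Definition is_pd y v w (z : R[i]) :=
  is_derive y v (reC \o w) (reC z) /\ is_derive y v (imC \o w) (imC z).

Lemma is_pdE y v w z : is_pd y v w z -> cderive v w y = z.
Proof. by move=> [[_ h1] [_ h2]]; apply: ceqP. Qed.

Lemma cdiff_pd w y v : cdiff w y -> is_pd y v w (cderive v w y).
Proof.
move=> [h1 h2]; split; apply: DeriveDef => //; exact: diff_derivable.
Qed.

Lemma is_pdD y v w g z z' : is_pd y v w z -> is_pd y v g z' ->
  is_pd y v (fun t => w t + g t) (z + z').
Proof.
move=> [f1 f2] [g1 g2]; split.
  rewrite (_ : _ \o _ = (reC \o w) + (reC \o g)).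
    by rewrite reCD; exact: is_deriveD.
  by apply/funext => t /=; rewrite reCD.
rewrite (_ : _ \o _ = (imC \o w) + (imC \o g)).
  by rewrite imCD; exact: is_deriveD.
by apply/funext => t /=; rewrite imCD.
Qed.

Lemma is_pdM y v w g z z' : is_pd y v w z -> is_pd y v g z' ->
  is_pd y v (fun t => w t * g t) (z * g y + w y * z').
Proof.
move=> [f1 f2] [g1 g2]; split.
  rewrite (_ : _ \o _ = (reC \o w) * (reC \o g) - (imC \o w) * (imC \o g)).
    apply: (is_derive_eq (is_deriveB (is_deriveM f1 g1) (is_deriveM f2 g2))).
    by rewrite /GRing.scale /= reCD !reCM; ring.
  by apply/funext => t /=; rewrite reCM.
rewrite (_ : _ \o _ = (reC \o w) * (imC \o g) + (imC \o w) * (reC \o g)).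
  apply: (is_derive_eq (is_deriveD (is_deriveM f1 g2) (is_deriveM f2 g1))).
  by rewrite /GRing.scale /= imCD !imCM; ring.
by apply/funext => t /=; rewrite imCM.
Qed.

Lemma cderiveD w g y v : cdiff w y -> cdiff g y ->
  cderive v (fun y => w y + g y) y = cderive v w y + cderive v g y.
Proof. by move=> /(cdiff_pd v) hw /(cdiff_pd v) hg; exact/is_pdE/is_pdD. Qed.

Lemma cderiveM w g y v : cdiff w y -> cdiff g y ->
  cderive v (fun y => w y * g y) y = cderive v w y * g y + w y * cderive v g y.
Proof. by move=> /(cdiff_pd v) hw /(cdiff_pd v) hg; exact: (is_pdE (is_pdM hw hg)). Qed.

Lemma cderive_cst (z : R[i]) y v : cderive v (fun=> z) y = 0.
Proof. by apply: ceqP; rewrite /cderive /= derive_cst. Qed.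

Lemma near_eq_differentiable (f g : R * R -> R) y :
  (\forall z \near y, f z = g z) -> differentiable f y -> differentiable g y.
Proof.
move=> fg /diff_locallyP[cf ef].
have eg : g \o shift y = cst (g y) + 'd f y +o_ (0 : R * R) id.
  apply/eqaddoP => e e0; have := (eqaddoP _ _ _ _).1 ef e e0.
  have fg' : \forall z \near (0 : R * R), f (z + y) = g (z + y).
    have c : z + y @[z --> (0 : R * R)] --> y.
      by rewrite -[X in _ --> X]add0r; apply: cvgD; [exact: cvg_id|exact: cvg_cst].
    exact: (c _ fg).
  apply: filterS2 fg' => z; rewrite /= !fctE /= => ->.
  by rewrite (nbhs_singleton fg).
have e := diff_unique cf eg.
by apply/diff_locallyP; rewrite e.
Qed.

Lemma cdiff_near w g y : (\forall z \near y, w z = g z) -> cdiff w y -> cdiff g y.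
Proof.
move=> wg [w1 w2]; split; [move: w1|move: w2]; apply: near_eq_differentiable;
  by apply: filterS wg => z /= ->.
Qed.

Lemma cderive_near w g y v : v != 0 -> (\forall z \near y, w z = g z) ->
  cderive v w y = cderive v g y.
Proof.
move=> v0 wg; apply: ceqP; rewrite /cderive /=; apply: near_eq_derive => //;
  by near=> t => /=; rewrite (near wg).
Unshelve. all: by end_near. Qed.

Lemma cdiff_comp1 (f : R -> R[i]) (phi : R * R -> R) y : smooth f ->
  differentiable phi y -> cdiff (f \o phi) y.
Proof.
move=> /(smoothE (phi y))[f1 f2] dphi; split.
  exact: (differentiable_comp1 (h := reC \o f) dphi f1).
exact: (differentiable_comp1 (h := imC \o f) dphi f2).
Qed.

Lemma cderive_comp1 (f : R -> R[i]) (phi : R * R -> R) y v : smooth f ->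
  differentiable phi y ->
  cderive v (f \o phi) y = ('D_v phi y)%:C * cderive1 f (phi y).
Proof.
move=> /(smoothE (phi y))[f1 f2] dphi; apply: ceqP; rewrite ?reCM ?imCM /cderive /=.
  rewrite mul0r subr0 mulrC; exact: (derive_comp1 (h := reC \o f) v dphi f1).
rewrite mul0r addr0 mulrC; exact: (derive_comp1 (h := imC \o f) v dphi f2).
Qed.

End PlaneCalculus.

(** * Test functions and integration by parts in the plane *)

Section TestFunctions.
Context {R : realType}.
Implicit Types (w g chi : R * R -> R[i]) (y v : R * R) (f : R * R -> R).
Notation T1 := (measurableTypeR R).
Notation T2 := (measurableTypeR R * measurableTypeR R)%type.

Definition partial (b : bool) : (R * R -> R[i]) -> R * R -> R[i] :=
  if b then partial1 else partial2.
Definition dir (b : bool) : R * R := if b then (1, 0) else (0, 1).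

Lemma partialE b w : partial b w = cderive (dir b) w.
Proof. by case: b. Qed.

Lemma dir_neq0 b : dir b != 0.
Proof.
by case: b; apply/eqP => /(congr1 (fun z => z.1 + z.2)) /=; rewrite ?add0r ?addr0 => /eqP;
  rewrite oner_eq0.
Qed.

Lemma smooth2_cdiff w y : smooth2 w -> cdiff w y.
Proof. by move=> /(_ [::] y). Qed.

Lemma smooth2_partial b w : smooth2 w -> smooth2 (partial b w).
Proof.
move=> sw dirs y; have := sw (rcons dirs b) y; rewrite foldr_rcons.
by case: b.
Qed.

Lemma smooth2_coind (S : set (R * R -> R[i])) :
  (forall w, S w -> (forall y, cdiff w y) /\ (forall b, S (partial b w))) ->
  forall w, S w -> smooth2 w.
Proof.
move=> H w Sw dirs.
suff : S (foldr (fun b : bool => if b then partial1 else partial2) w dirs).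
  by move=> /H[h _] y; exact: h.
by elim: dirs => //= b dirs /H[_ /(_ b)]; case: b.
Qed.

Lemma smooth2D w g : smooth2 w -> smooth2 g -> smooth2 (fun y => w y + g y).
Proof.
move=> sw sg; apply: (@smooth2_coind
  [set h | exists w g, [/\ smooth2 w, smooth2 g & h = fun y => w y + g y]]);
  last by exists w, g.
move=> _ [{sw}w [{sg}g [sw sg ->]]]; split=> [y|b].
  by apply: cdiffD; exact: smooth2_cdiff.
exists (partial b w), (partial b g); split; try exact: smooth2_partial.
by apply/funext => y; rewrite !partialE cderiveD//; exact: smooth2_cdiff.
Qed.

Lemma cdiffJ w y : cdiff w y -> cdiff (fun y => (w y)^*) y.
Proof.
move=> [h1 h2]; split.
  by rewrite (_ : _ \o _ = reC \o w)//; apply/funext => z /=; rewrite reCJ.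
rewrite (_ : _ \o _ = - (imC \o w)); first exact: differentiableN.
by apply/funext => z /=; rewrite imCJ.
Qed.

Lemma partialJ b w : smooth2 w ->
  partial b (fun y => (w y)^*) = fun y => (partial b w y)^*.
Proof.
move=> sw; apply/funext => y; rewrite !partialE.
have [h1 h2] := cdiff_pd (dir b) (smooth2_cdiff y sw).
apply: is_pdE; split.
  by rewrite reCJ (_ : _ \o _ = reC \o w)//; apply/funext => z /=; rewrite reCJ.
rewrite imCJ (_ : _ \o _ = - (imC \o w)); first exact: is_deriveN.
by apply/funext => z /=; rewrite imCJ.
Qed.

Lemma smooth2J w : smooth2 w -> smooth2 (fun y => (w y)^*).
Proof.
move=> sw; apply: (@smooth2_coind [set h | exists w, smooth2 w /\ h = fun y => (w y)^*]);
  last by exists w.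
move=> _ [{sw}w [sw ->]]; split=> [y|b]; first by apply: cdiffJ; exact: smooth2_cdiff.
by exists (partial b w); split; [exact: smooth2_partial|exact: partialJ].
Qed.

Lemma smooth2_continuous w : smooth2 w ->
  continuous (reC \o w) /\ continuous (imC \o w).
Proof.
by move=> sw; split=> y; apply: differentiable_continuous; have [] := smooth2_cdiff y sw.
Qed.

Lemma smooth2_cmeas w D : measurable (D : set T2) -> smooth2 w -> @cmeas _ T2 R D w.
Proof.
move=> mD /smooth2_continuous[h1 h2].
split; apply: (@measurable_funS _ _ _ _ setT) => //; exact: continuous2_measurable.
Qed.

Lemma compact2_bounded (K : set (R * R)) : compact K ->
  exists2 M, 0 < M & forall y, K y -> `|y.1| < M /\ `|y.2| < M.
Proof.
move=> /compact_bounded[M [_ hM]]; exists (`|M| + 2); first by rewrite ltr_wpDl.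
move=> y Ky; have := hM (`|M| + 1) _ y Ky.
rewrite (le_lt_trans (ler_norm M)) ?ltrDl// => /(_ isT).
have -> : [set x : R * R | `|x| <= `|M| + 1] y = (Num.max `|y.1| `|y.2| <= `|M| + 1) by [].
rewrite ge_max => /andP[h1 h2].
by split; [apply: (le_lt_trans h1)|apply: (le_lt_trans h2)]; rewrite ltrD2l ltr1n.
Qed.

Lemma continuous2_supp_bounded f (K : set (R * R)) : compact K -> continuous f ->
  (forall y, ~ K y -> f y = 0) -> exists C : R, forall y, `|f y| <= C.
Proof.
move=> cK cf f0.
have : compact (f @` K) by apply: continuous_compact => //; exact: continuous_subspaceT.
move=> /compact_bounded[M [_ hM]]; exists (`|M| + 1) => y.
have [Ky|/f0 ->] := pselect (K y); last by rewrite normr0 addr_ge0.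
apply: hM; last by exists y.
by rewrite (le_lt_trans (ler_norm M)) ?ltrDl.
Qed.

Lemma test2_bounded chi : test2 chi -> exists C : R, forall y, cabs (chi y) <= C.
Proof.
move=> [/smooth2_continuous[h1 h2] [K [cK _ K0]]].
have [|C1 hC1] := continuous2_supp_bounded cK h1; first by move=> y /K0 /= ->.
have [|C2 hC2] := continuous2_supp_bounded cK h2; first by move=> y /K0 /= ->.
exists (C1 + C2) => y; apply: (le_trans (cabs_le _)).
by apply: lerD; [exact: hC1|exact: hC2].
Qed.

Lemma test2_integrable h chi : locint2 h -> test2 chi ->
  cintegrable leb2 setT (fun y => h y * chi y).
Proof.
move=> lh tchi; have [C hC] := test2_bounded tchi.
have [schi [K [cK Kp K0]]] := tchi; have mK := compact2_measurable cK.
apply: (@cintegrable_supp _ T2 R leb2 setT K) => //.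
  by move=> y /K0 ->; rewrite mulr0.
by apply: (cintegrable_bounded mK (smooth2_cmeas mK schi) (fun y _ => hC y)); exact: lh.
Qed.

Lemma test2_partial b chi : test2 chi -> test2 (partial b chi).
Proof.
move=> [schi [K [cK Kp K0]]]; split; first exact: smooth2_partial.
exists K; split=> // y Ky; rewrite partialE -(cderive_cst 0 y (dir b)).
apply: cderive_near; first exact: dir_neq0.
have : open (~` K) by apply: closed_openC; exact: compact_closed.
by move=> /(_ y Ky); apply: filterS => z /K0 ->.
Qed.

Lemma test2D w g : test2 w -> test2 g -> test2 (fun y => w y + g y).
Proof.
move=> [sw [K [cK Kp K0]]] [sg [L [cL Lp L0]]]; split; first exact: smooth2D.
exists (K `|` L); split; first exact: compactU.
  by move=> y [/Kp|/Lp].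
by move=> y /not_orP[/K0 -> /L0 ->]; rewrite addr0.
Qed.

Lemma test2J w : test2 w -> test2 (fun y => (w y)^*).
Proof.
move=> [sw [K [cK Kp K0]]]; split; first exact: smooth2J.
by exists K; split=> // y /K0 ->; rewrite conjc0.
Qed.

Lemma test2_classicD al chi : test2 chi -> test2 (classicD al chi).
Proof.
move=> tchi; rewrite /classicD; elim: al.1 => [|n ih] /=; last exact: (test2_partial true).
by elim: al.2 => [//|n ih] /=; exact: (test2_partial false).
Qed.

Lemma is_derive_slice f y (b : bool) (a : R) : is_derive y (dir b) f a ->
  is_derive (if b then y.1 else y.2) (1 : R)
    (fun s => f (if b then (s, y.2) else (y.1, s))) a.
Proof.
move=> [d e].
have eqf : (fun h => h^-1 *: ((fun s => f (if b then (s, y.2) else (y.1, s)))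
      (h *: (1 : R) + (if b then y.1 else y.2)) -
      (fun s => f (if b then (s, y.2) else (y.1, s))) (if b then y.1 else y.2))) =
    (fun h => h^-1 *: ((f \o shift y) (h *: dir b) - f y)).
  apply/funext => h; congr (_ *: (_ - _)); rewrite /= ?/shift.
    congr f; rewrite [RHS]surjective_pairing; case: b {d e} => /=;
      by rewrite scaler0 add0r.
  by congr f; rewrite [RHS]surjective_pairing; case: b {d e}.
apply: DeriveDef.
  by move: d; rewrite /derivable -eqf.
by rewrite -e /derive -eqf.
Qed.

Lemma continuous_slice (b : bool) (c : R) :
  continuous (fun s : R => if b then (s, c) else (c, s)).
Proof.
case: b => s.
  exact: (cvg_pair (@cvg_id R (nbhs s)) (cvg_cst c)).
exact: (cvg_pair (cvg_cst c) (@cvg_id R (nbhs s))).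
Qed.

Lemma leb2_box (M : R) : 0 < M -> (leb2 (`[(- M)%R, M]%classic `*` `[(- M)%R, M]%classic) < +oo)%E.
Proof.
move=> M0.
have -> : (leb2 (`[(- M)%R, M]%classic `*` `[(- M)%R, M]%classic) = (2 * M)%:E * (2 * M)%:E)%E.
  apply: (etrans (@product_measure1E _ _ T1 T1 R lebesgue_measure lebesgue_measure _ _ _ _)) => //.
  by rewrite /= !lebesgue_measure_itv/= lte_fin gtrN// -EFinB opprK mulr_natl mulr2n.
by rewrite -EFinM ltry.
Qed.

(** Fubini with the inner integral in the direction of the derivative: each slice vanishes by the
    fundamental theorem of calculus, [f] being 0 at both ends of the square. *)
Lemma int_partial0 b (f g : R * R -> R) (M : R) : 0 < M ->
  (forall y, is_derive y (dir b) f (g y)) -> continuous g ->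
  (forall y, ~ (`|y.1| < M /\ `|y.2| < M) -> f y = 0 /\ g y = 0) ->
  Rintegral leb2 setT g = 0.
Proof.
move=> M0 df cg supp.
have mg : measurable_fun (setT : set T2) g by exact: continuous2_measurable.
have [C hC] : exists C, forall y, `|g y| <= C.
  apply: (@continuous2_supp_bounded _ (`[- M, M] `*` `[- M, M])%classic) => //.
    by apply: compact_setX; exact: segment_compact.
  move=> [y1 y2] h; apply: (supp _ _).2 => -[/= h1 h2]; apply: h.
  by split; rewrite /= in_itv/= -ler_norml ltW.
have ig : leb2.-integrable setT (EFin \o g).
  have mB : measurable (`[- M, M] `*` `[- M, M] : set T2) by exact: measurableX.
  have := (integrable_restrict leb2 mB measurableT (EFin \o g)).1.
  rewrite setTI (_ : _ \_ _ = EFin \o g); last first.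
    apply/funext => -[y1 y2]; rewrite /patch; case: ifPn => // /negP h /=.
    rewrite (supp _ _).2// => -[/= h1 h2]; apply: h; apply/mem_set.
    by split; rewrite /= in_itv/= -ler_norml ltW.
  apply; apply: measurable_bounded_integrable => //.
  - exact: leb2_box.
  - exact: measurable_funTS.
  - exists C; split; first by rewrite num_real.
    by move=> x Cx y _ /=; rewrite (le_trans (hC y))// ltW.
have slice c : (\int[lebesgue_measure]_s (g (if b then (s, c) else (c, s)))%:E = 0)%E.
  pose F s := f (if b then (s, c) else (c, s)).
  pose G s := g (if b then (s, c) else (c, s)).
  have dF s : is_derive s (1 : R) F (G s).
    by have := is_derive_slice (df (if b then (s, c) else (c, s))); rewrite /F /G; case: (b).
  have cG : continuous G.
    by move=> s; apply: continuous_comp; [exact: continuous_slice|exact: cg].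
  have out s : M <= `|s| -> F s = 0 /\ G s = 0.
    by move=> Ms; apply: supp; case: (b) => /= -[h1 h2]; move: Ms; rewrite leNgt ?h1 ?h2.
  transitivity (\int[lebesgue_measure]_(s in `[(- M)%R, M]) (G s)%:E)%E.
    rewrite [RHS]integral_mkcond; apply: eq_integral => s _; rewrite /patch.
    rewrite -/(G s); case: ifPn => // /negP h.
    have [|_ ->//] := out s; rewrite leNgt; apply/negP => h'; apply: h.
    by apply/mem_set; rewrite /= in_itv/= -ler_norml ltW.
  rewrite (continuous_FTC2 (F := F)).
  - by rewrite (out M _).1 ?gtr0_norm// (out (- M) _).1 ?normrN ?gtr0_norm// subee.
  - by rewrite gtrN.
  - exact: continuous_subspaceT.
  - split.
    + by move=> s _; case: (dF s).
    + apply: cvg_at_right_filter; apply: differentiable_continuous.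
      by apply/derivable1_diffP; case: (dF (- M)).
    + apply: cvg_at_left_filter; apply: differentiable_continuous.
      by apply/derivable1_diffP; case: (dF M).
  - by move=> s _; rewrite derive1E; have [_ ->] := dF s.
rewrite /Rintegral; case: b {df} slice => slice.
  have <- := @integral21_prod_meas1 _ _ T1 T1 R lebesgue_measure lebesgue_measure _ ig.
  by rewrite (eq_integral (cst 0%E)) ?integral0// => c _; exact: slice.
have <- := @integral12_prod_meas1 _ _ T1 T1 R lebesgue_measure lebesgue_measure _ ig.
by rewrite (eq_integral (cst 0%E)) ?integral0// => c _; exact: slice.
Qed.

Lemma locint2_test w : test2 w -> locint2 w.
Proof.
move=> tw K cK Kp; have [C hC] := test2_bounded tw; have mK := compact2_measurable cK.
have mw := smooth2_cmeas mK tw.1.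
apply: (cintegrable_le (g := fun=> C) mK mw) => //.
have [M M0 hM] := compact2_bounded cK.
have mB : measurable (`[- M, M] `*` `[- M, M] : set T2) by exact: measurableX.
apply: measurable_bounded_integrable => //.
- apply: le_lt_trans (leb2_box M0); apply: le_measure; rewrite ?inE//.
  by move=> [y1 y2] /hM[/= h1 h2]; split; rewrite /= in_itv/= -ler_norml ltW.
- by exists `|C|; split; [rewrite num_real|move=> x Cx y _ /=; exact: ltW].
Qed.

(** The sum of the two integrands is the partial derivative of [w chi], which vanishes outside a
    square. *)
Lemma planar_ibp b w chi : test2 w -> test2 chi ->
  cint leb2 setT (fun y => w y * partial b chi y) =
  - cint leb2 setT (fun y => partial b w y * chi y).
Proof.
move=> tw tchi; apply/eqP; rewrite -addr_eq0 -cintD//; last 2 first.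
- by apply: test2_integrable; [exact: locint2_test|exact: test2_partial].
- by apply: test2_integrable => //; apply: locint2_test; exact: test2_partial.
have [K [cK Kp K0]] := tw.2; have [M M0 hM] := compact2_bounded cK.
have [K' [cK' Kp' K0']] := (test2_partial b tw).2; have [M' M0' hM'] := compact2_bounded cK'.
pose N := Num.max M M'.
have out y : ~ (`|y.1| < N /\ `|y.2| < N) -> w y = 0 /\ partial b w y = 0.
  move=> h; split; [apply: K0 => /hM[h1 h2]|apply: K0' => /hM'[h1 h2]]; apply: h;
    by split; rewrite /N lt_max ?h1 ?h2 ?orbT.
have cw := smooth2_continuous tw.1; have cchi := smooth2_continuous tchi.1.
have cdw := smooth2_continuous (smooth2_partial b tw.1).
have cdchi := smooth2_continuous (smooth2_partial b tchi.1).
have D y := is_pdM (cdiff_pd (dir b) (smooth2_cdiff y tw.1))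
  (cdiff_pd (dir b) (smooth2_cdiff y tchi.1)).
apply/eqP/ceqP; rewrite /cint /=.
  apply: (@int_partial0 b (reC \o (fun y => w y * chi y)) _ N); first by rewrite lt_max M0.
  - by move=> y; have [+ _] := D y; rewrite -!partialE addrC.
  - move=> y; rewrite /comp; under eq_fun do rewrite reCD !reCM.
    apply: cvgD; apply: cvgB; apply: cvgM; [exact: cw.1|exact: cdchi.1|exact: cw.2|
      exact: cdchi.2|exact: cdw.1|exact: cchi.1|exact: cdw.2|exact: cchi.2].
  - by move=> y /out[h1 h2]; rewrite /= h1 h2 !mul0r addr0.
apply: (@int_partial0 b (imC \o (fun y => w y * chi y)) _ N); first by rewrite lt_max M0.
- by move=> y; have [_ +] := D y; rewrite -!partialE addrC.
- move=> y; rewrite /comp; under eq_fun do rewrite imCD !imCM.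
  apply: cvgD; apply: cvgD; apply: cvgM; [exact: cw.1|exact: cdchi.2|exact: cw.2|
    exact: cdchi.1|exact: cdw.1|exact: cchi.2|exact: cdw.2|exact: cchi.1].
- by move=> y /out[h1 h2]; rewrite /= h1 h2 !mul0r addr0.
Qed.

End TestFunctions.

Section AlmostEverywhere.
Context d (T : measurableType d) (R : realType).
Variable mu : {measure set T -> \bar R}.

Lemma ae_imp (P Q : T -> Prop) : (forall x, P x -> Q x) ->
  {ae mu, forall x, P x} -> {ae mu, forall x, Q x}.
Proof. by move=> H; apply: filterS. Qed.

Lemma ae_imp2 (P Q S : T -> Prop) : (forall x, P x -> Q x -> S x) ->
  {ae mu, forall x, P x} -> {ae mu, forall x, Q x} -> {ae mu, forall x, S x}.
Proof. by move=> H; apply: filterS2. Qed.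

Lemma ae_true (P : T -> Prop) : (forall x, P x) -> {ae mu, forall x, P x}.
Proof. by move=> H; apply: nearW. Qed.

End AlmostEverywhere.

(** * The fundamental lemma on the punctured plane *)

Section PlaneUniqueness.
Context {R : realType}.
Notation T1 := (measurableTypeR R).
Notation T2 := (measurableTypeR R * measurableTypeR R)%type.
Implicit Types (f g : R -> R[i]) (w h chi : R * R -> R[i]) (y : R * R).

Definition tens f g : R * R -> R[i] := fun y => f y.1 * g y.2.

Lemma cdiff_tens f g y : smooth f -> smooth g -> cdiff (tens f g) y.
Proof.
move=> sf sg; apply: (@cdiffM R (f \o fst) (g \o snd)).
  by apply: cdiff_comp1 => //; exact: differentiable_fst.
by apply: cdiff_comp1 => //; exact: differentiable_snd.
Qed.

Lemma partial_tens b f g : smooth f -> smooth g ->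
  partial b (tens f g) = if b then tens (cderive1 f) g else tens f (cderive1 g).
Proof.
move=> sf sg; apply/funext => y; rewrite partialE.
rewrite (@cderiveM R (f \o fst) (g \o snd)); last 2 first.
  by apply: cdiff_comp1 => //; exact: differentiable_fst.
  by apply: cdiff_comp1 => //; exact: differentiable_snd.
rewrite !cderive_comp1 ?derive_fst ?derive_snd//; last 2 first.
- exact: differentiable_snd.
- exact: differentiable_fst.
by case: b; rewrite /tens /= ?mul1r mul0r ?mulr0 ?mul0r ?addr0 ?add0r ?mul1r.
Qed.

Lemma smooth2_tens f g : smooth f -> smooth g -> smooth2 (tens f g).
Proof.
move=> sf sg; apply: (@smooth2_coind R [set w | exists f g, [/\ smooth f, smooth g & w = tens f g]]);
  last by exists f, g.
move=> _ [{sf}f [{sg}g [sf sg ->]]]; split=> [y|b]; first exact: cdiff_tens.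
rewrite partial_tens//; case: b.
  by exists (cderive1 f), g; split=> //; exact: smooth_derive.
by exists f, (cderive1 g); split=> //; exact: smooth_derive.
Qed.

Definition box a b c d : set (R * R) := `[a, b]%classic `*` `[c, d]%classic.

Lemma compact_box (a b c d : R) : compact (box a b c d).
Proof. by apply: compact_setX; exact: segment_compact. Qed.

Lemma test2_bumps (a b c d : R) n : box a b c d `<=` punctured ->
  test2 (tens (bump n.+1 a b) (bump n.+1 c d)).
Proof.
move=> hp; split; first by apply: smooth2_tens; exact: smooth_bump.
exists (box a b c d); split=> //; first exact: compact_box.
move=> y hy; rewrite /tens.
have [ya|ya] := pselect (`]a, b[%classic y.1); last by rewrite bump_out// mul0r.
have [yc|yc] := pselect (`]c, d[%classic y.2); last by rewrite [X in _ * X]bump_out// mulr0.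
case: hy; split; exact: subset_itv_oo_cc.
Qed.

Lemma box_ae0 h (a b c d : R) : locint2 h -> box a b c d `<=` punctured ->
  (forall f g, smooth f -> smooth g -> test2 (tens f g) ->
    cint leb2 setT (fun y => h y * tens f g y) = 0) ->
  {ae leb2, forall y, (`]a, b[%classic `*` `]c, d[%classic) y -> h y = 0}.
Proof.
move=> lh hp H.
have mo (x y z t : R) : measurable (`]x, y[%classic `*` `]z, t[%classic : set T2).
  exact: measurableX.
have iB (x x' z t : R) : box x x' z t `<=` punctured ->
    cintegrable leb2 (`]x, x'[%classic `*` `]z, t[%classic : set T2) h.
  move=> sp; apply: (@cintegrableS _ T2 R leb2 _ (box x x' z t)) => //.
  - exact: measurableX.
  - by move=> z' [h1 h2]; split; exact: subset_itv_oo_cc.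
  - by apply: lh => //; exact: compact_box.
apply: (@cae_eq0_pi _ T2 R leb2 _ (@boxes R)
  (fun k => `](- k%:R), k%:R[%classic `*` `](- k%:R), k%:R[%classic) h) => //.
- exact: iB.
- exact: mG2.
- exact: G2I.
- move=> k; exists `](- k%:R), k%:R[%classic; first by exists (- k%:R), k%:R.
  by exists `](- k%:R), k%:R[%classic => //; exists (- k%:R), k%:R.
- exact: cover2.
move=> _ [_ [x [x' ->]] [_ [y [y' ->]] <-]].
pose X := Num.max x a; pose X' := Num.min x' b; pose Y := Num.max y c; pose Y' := Num.min y' d.
have -> : (`]x, x'[%classic `*` `]y, y'[%classic) `&` (`]a, b[%classic `*` `]c, d[%classic) =
    (`]X, X'[%classic `*` `]Y, Y'[%classic) :> set (R * R).
  apply/seteqP; split=> z /=; rewrite !in_itv/= !lt_min !gt_max.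
    by move=> [[/andP[-> ->] /andP[-> ->]] [/andP[-> ->] /andP[-> ->]]].
  by move=> [/andP[/andP[-> ->] /andP[-> ->]] /andP[/andP[-> ->] /andP[-> ->]]].
have sub : box X X' Y Y' `<=` box a b c d.
  move=> z; rewrite /box /= !in_itv/= !le_min !ge_max.
  by move=> [/andP[/andP[_ ->] /andP[_ ->]] /andP[/andP[_ ->] /andP[_ ->]]].
have hp' := subset_trans sub hp.
apply: (@cint_cutoff0 _ T2 R leb2 (`]a, b[%classic `*` `]c, d[%classic) _ h
    (fun k => tens (bump k.+1 X X') (bump k.+1 Y Y'))) => //.
- move=> z; rewrite /= !in_itv/= !lt_min !gt_max.
  by move=> [/andP[/andP[_ ->] /andP[_ ->]] /andP[/andP[_ ->] /andP[_ ->]]].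
- exact: iB.
- by move=> k; apply: smooth2_cmeas => //; apply: smooth2_tens; exact: smooth_bump.
- by move=> k z; rewrite /tens cabsM mulr_ile1 ?cabs_ge0 ?bump_le1.
- move=> z [/bump_near h1 /bump_near h2].
  have : \forall k \near \oo, bump k X X' z.1 = 1 /\ bump k Y Y' z.2 = 1.
    by apply: filterS2 h1 h2 => k -> ->.
  move=> [M _ HM]; exists M => // k /= Mk; rewrite /tens.
  by have [-> ->] := HM k.+1 (leqW Mk); rewrite mulr1.
- move=> k z hz; rewrite /tens.
  have [ya|ya] := pselect (`]X, X'[%classic z.1); last by rewrite bump_out// mul0r.
  by rewrite [X in _ * X]bump_out ?mulr0// => yc; apply: hz.
move=> k; rewrite -[RHS](H (bump k.+1 X X') (bump k.+1 Y Y')); last 3 first.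
- exact: smooth_bump.
- exact: smooth_bump.
- exact: test2_bumps.
apply/esym/cint_supp => // z hz; rewrite /tens.
have [ya|ya] := pselect (`]X, X'[%classic z.1); last by rewrite bump_out// mul0r mulr0.
rewrite [X in _ * (_ * X)]bump_out ?mulr0// => yc; apply: hz.
move: ya yc; rewrite /= !in_itv/= !lt_min !gt_max.
by move=> /andP[/andP[_ ->] /andP[_ ->]] /andP[/andP[_ ->] /andP[_ ->]].
Qed.

(** Products of one-variable functions suffice because they approximate indicators of boxes, and
    four families of boxes that avoid the axes cover the plane up to the origin. The restriction to
    products matters: their mixed partials commute by inspection, and the symmetry of second
    derivatives in general is deduced from this lemma. *)
Lemma weak_unique2_tens h : locint2 h ->
  (forall f g, smooth f -> smooth g -> test2 (tens f g) ->
    cint leb2 setT (fun y => h y * tens f g y) = 0) ->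
  {ae leb2, forall y, h y = 0}.
Proof.
move=> lh H; pose e n : R := n.+1%:R^-1.
have e0 n : 0 < e n by rewrite /e invr_gt0.
have small x : 0 < x -> \forall n \near \oo, e n < x.
  move=> x0; exists (Num.bound x^-1) => // k /= hk; rewrite /e invf_plt ?posrE//.
  apply: lt_le_trans (_ : (Num.bound x^-1)%:R <= _); last by rewrite ler_nat (leq_trans hk).
  by apply: archi_boundP; rewrite invr_ge0 ltW.
have big (x : R) : \forall n \near \oo, `|x| < n%:R.
  exists (Num.bound `|x|) => // k /= hk.
  by apply: lt_le_trans (_ : (Num.bound `|x|)%:R <= _); [exact: archi_boundP|rewrite ler_nat].
have ex3 (x p q : R) : 0 < x -> exists n, [/\ e n < x, `|p| < n%:R & `|q| < n%:R].
  move=> x0; apply: (@filter_ex _ (nbhs \oo)).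
  by apply: filterS3 (small x x0) (big p) (big q).
have Hbox a b c d hb := @box_ae0 h a b c d lh hb H.
have A1 : {ae leb2, forall y, (\bigcup_n (`]e n, n%:R[%classic `*` `](- n%:R), n%:R[%classic)) y -> h y = 0}.
  apply: ae_bigcup => n; apply: Hbox => -[y1 y2] [/= + _].
  by rewrite in_itv/= => /andP[h1 _] -[y10]; move: h1; rewrite y10 leNgt e0.
have A2 : {ae leb2, forall y, (\bigcup_n (`](- n%:R), (- e n)[%classic `*` `](- n%:R), n%:R[%classic)) y -> h y = 0}.
  apply: ae_bigcup => n; apply: Hbox => -[y1 y2] [/= + _].
  by rewrite in_itv/= => /andP[_ h1] -[y10]; move: h1; rewrite y10 oppr_ge0 leNgt e0.
have A3 : {ae leb2, forall y, (\bigcup_n (`](- n%:R), n%:R[%classic `*` `]e n, n%:R[%classic)) y -> h y = 0}.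
  apply: ae_bigcup => n; apply: Hbox => -[y1 y2] [_ /=].
  by rewrite in_itv/= => /andP[h1 _] -[_ y10]; move: h1; rewrite y10 leNgt e0.
have A4 : {ae leb2, forall y, (\bigcup_n (`](- n%:R), n%:R[%classic `*` `](- n%:R), (- e n)[%classic)) y -> h y = 0}.
  apply: ae_bigcup => n; apply: Hbox => -[y1 y2] [_ /=].
  by rewrite in_itv/= => /andP[_ h1] -[_ y10]; move: h1; rewrite y10 oppr_ge0 leNgt e0.
have A0 : {ae leb2, forall y : T2, y <> (0, 0)}.
  exists ([set 0] `*` [set 0]); split; first exact: measurableX.
    apply: (etrans (@product_measure1E _ _ T1 T1 R lebesgue_measure lebesgue_measure _ _ _ _)) => //.
    rewrite [X in (X * _)%E](_ : _ = 0%E) ?mul0e//; exact: lebesgue_measure_set1.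
  by move=> [y1 y2] /= /contrapT[-> ->].
have and_ae P Q := @ae_imp2 _ T2 R leb2 P Q _ (fun x p q => conj p q).
apply: ae_imp2 A0 (and_ae _ _ (and_ae _ _ A1 A2) (and_ae _ _ A3 A4)) => -[y1 y2] y0 [[h1 h2] [h3 h4]].
have [y1p|y1n|y10] := ltgtP 0 y1.
- have [n [a1 a2 a3]] := ex3 y1 y1 y2 y1p.
  apply: h1; exists n => //; split; rewrite /= in_itv/= -?ltr_norml//.
  by rewrite a1 (le_lt_trans (ler_norm _)).
- have [|n [a1 a2 a3]] := ex3 (- y1) y1 y2; first by rewrite oppr_gt0.
  apply: h2; exists n => //; split; rewrite /= in_itv/= -?ltr_norml//.
  by rewrite ltrNr a1 andbT; move: a2; rewrite ltr_norml => /andP[].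
have [y2p|y2n|y20] := ltgtP 0 y2.
- have [n [a1 a2 a3]] := ex3 y2 y1 y2 y2p.
  apply: h3; exists n => //; split; rewrite /= in_itv/= -?ltr_norml//.
  by rewrite a1 (le_lt_trans (ler_norm _)).
- have [|n [a1 a2 a3]] := ex3 (- y2) y1 y2; first by rewrite oppr_gt0.
  apply: h4; exists n => //; split; rewrite /= in_itv/= -?ltr_norml//.
  by rewrite ltrNr a1 andbT; move: a3; rewrite ltr_norml => /andP[].
by case: y0; rewrite -y10 -y20.
Qed.

Lemma weak_unique2 h : locint2 h ->
  (forall chi, test2 chi -> cint leb2 setT (fun y => h y * chi y) = 0) ->
  {ae leb2, forall y, h y = 0}.
Proof. by move=> lh H; apply: weak_unique2_tens => // f g _ _; exact: H. Qed.

End PlaneUniqueness.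

(** * Symmetry of mixed derivatives, transposition of the operator, weak solutions *)

Section WeakCalculus.
Context {R : realType}.
Notation T1 := (measurableTypeR R).
Notation T2 := (measurableTypeR R * measurableTypeR R)%type.
Implicit Types (w h g chi : R * R -> R[i]) (y : R * R).

Arguments partial : simpl never.

(** If [h] were nonzero at a point, it would be nonzero on a whole square around it, which has
    positive measure. *)
Lemma continuous_ae0 (h : R * R -> R) : continuous h ->
  {ae leb2, forall y : T2, h y = 0} -> forall y, h y = 0.
Proof.
move=> ch [N [mN N0 hN]] y; apply/eqP/negP => /negP hy.
have : \forall z \near y, h z != 0.
  have : open (h @^-1` [set~ 0]).
    by apply: open_comp => [z _|]; [exact: ch|exact/closed_openC/closed_eq].
  by move=> /(_ y (elimN eqP hy)); apply: filterS => z /= /eqP.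
move=> /nbhs_ballP[e /= e0 he]; move: y he {hy} => [y1 y2] he.
pose B : set T2 := `]y1 - e, y1 + e[%classic `*` `]y2 - e, y2 + e[%classic.
have sub : B `<=` N.
  move=> [z1 z2] [/= h1 h2]; apply: hN => /=; apply/eqP; apply: (he (z1, z2)).
  move: h1 h2; rewrite !in_itv/= -!ltr_distlC => h1 h2.
  by split; rewrite /ball /=.
have mo : measurable B.
  exact: measurableX.
have : (leb2 B <= leb2 N)%E.
  by apply: le_measure; rewrite ?inE.
rewrite N0 leNgt => /negP; apply.
have -> : (leb2 B = (e + e)%:E * (e + e)%:E)%E.
  apply: (etrans (@product_measure1E _ _ T1 T1 R lebesgue_measure lebesgue_measure _ _ _ _)) => //.
  rewrite /= !lebesgue_measure_itv/= !lte_fin !ltrD2l gtrN// -!EFinB.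
  by congr (_%:E * _%:E)%E; ring.
by rewrite -EFinM lte_fin mulr_gt0// addr_gt0.
Qed.

(** The difference of the two mixed derivatives is integrated by parts onto a product test function,
    whose own mixed derivatives commute. So it vanishes almost everywhere, and everywhere by
    continuity. *)
Lemma partial_comm w : test2 w -> partial true (partial false w) = partial false (partial true w).
Proof.
move=> tw; pose t12 := test2_partial true (test2_partial false tw).
pose t21 := test2_partial false (test2_partial true tw).
pose h y := partial true (partial false w) y + (-1) * partial false (partial true w) y.
have cst1 : smooth2 (fun=> -1 : R[i]).
  apply: (@smooth2_coind R [set v | exists z, v = fun=> z]); last by exists (-1).
  move=> _ [z ->]; split=> [y|b]; first exact: cdiff_cst.
  by exists 0; apply/funext => y; rewrite partialE cderive_cst.
have sh : smooth2 h.
  apply: smooth2D t12.1 _.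
  apply: (@smooth2_coind R [set v | exists u, smooth2 u /\ v = fun y => (-1) * u y]);
    last by exists (partial false (partial true w)); split=> //; exact: t21.1.
  move=> _ [u [su ->]]; split=> [y|b].
    by apply: cdiffM; [exact: cdiff_cst|exact: smooth2_cdiff].
  exists (partial b u); split; first exact: smooth2_partial.
  apply/funext => y; rewrite partialE cderiveM; [|exact: cdiff_cst|exact: smooth2_cdiff].
  by rewrite cderive_cst mul0r add0r -partialE.
have th : test2 h.
  split=> //; have [K [cK Kp K0]] := t12.2; have [K' [cK' Kp' K0']] := t21.2.
  exists (K `|` K'); split; first exact: compactU.
    by move=> y [/Kp|/Kp'].
  by move=> y /not_orP[/K0 h1 /K0' h2]; rewrite /h h1 h2 mulr0 addr0.
have h0 : {ae leb2, forall y, h y = 0}.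
  apply: weak_unique2_tens; first exact: locint2_test.
  move=> f g sf sg tfg; pose t := tens f g.
  have i1 b b' : cintegrable leb2 setT (fun y => partial b (partial b' w) y * t y).
    by apply: test2_integrable => //; apply/locint2_test/test2_partial/test2_partial.
  transitivity (cint leb2 setT (fun y => partial true (partial false w) y * t y) -
      cint leb2 setT (fun y => partial false (partial true w) y * t y)).
    rewrite -cintB//; apply: cint_ext => y _; by rewrite /h mulN1r mulrBl.
  have ibp b b' : cint leb2 setT (fun y => partial b (partial b' w) y * t y) =
      cint leb2 setT (fun y => w y * partial b' (partial b t) y).
    by rewrite (planar_ibp b' tw (test2_partial b tfg)) (planar_ibp b (test2_partial b' tw) tfg) opprK.
  have e : partial false (partial true t) = partial true (partial false t).
    by rewrite /t (partial_tens true sf sg) (partial_tens false sf sg)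
      (partial_tens false (smooth_derive sf) sg) (partial_tens true sf (smooth_derive sg)).
  apply/eqP; rewrite subr_eq0; apply/eqP; apply: (etrans (ibp true false)).
  by apply: (etrans _ (esym (ibp false true))); rewrite e.
have [c1 c2] := smooth2_continuous sh.
apply/funext => y; apply/eqP; rewrite -subr_eq0; apply/eqP.
have -> : partial true (partial false w) y - partial false (partial true w) y = h y.
  by rewrite /h mulN1r.
apply: ceqP; [apply: (continuous_ae0 c1)|apply: (continuous_ae0 c2)];
  by apply: ae_imp h0 => z hz; rewrite /comp hz.
Qed.

Lemma test2_iter b n w : test2 w -> test2 (iter n (partial b) w).
Proof. by move=> tw; elim: n => //= n; exact: test2_partial. Qed.

Lemma iter_partial_comm w i j : test2 w ->
  iter i (partial true) (iter j (partial false) w) =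
  iter j (partial false) (iter i (partial true) w).
Proof.
have one j' w' : test2 w' -> partial true (iter j' (partial false) w') =
    iter j' (partial false) (partial true w').
  move=> tw; elim: j' => //= j' <-; rewrite partial_comm//; exact: test2_iter.
move=> tw; elim: i => //= i ->; rewrite one//; exact: test2_iter.
Qed.

Lemma ibp_iter b n w chi : test2 w -> test2 chi ->
  cint leb2 setT (fun y => w y * iter n (partial b) chi y) =
  (-1) ^+ n * cint leb2 setT (fun y => iter n (partial b) w y * chi y).
Proof.
move=> tw tc; elim: n w tw => [|n ih] w tw; first by rewrite mul1r.
rewrite /= planar_ibp//; last exact: test2_iter.
by rewrite ih ?exprS ?mulN1r ?mulNr -?iterSr//; exact: test2_partial.
Qed.

Lemma classicD_ibp al w chi : test2 w -> test2 chi ->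
  cint leb2 setT (fun y => w y * classicD al chi y) =
  (-1) ^+ (al.1 + al.2) * cint leb2 setT (fun y => classicD al w y * chi y).
Proof.
move=> tw tc; rewrite /classicD -[partial1]/(partial true) -[partial2]/(partial false).
rewrite ibp_iter//; last exact: test2_iter.
rewrite ibp_iter//; last exact: test2_iter.
by rewrite mulrA -exprD iter_partial_comm.
Qed.

Lemma partialJ_iter b n w : smooth2 w ->
  iter n (partial b) (fun y => (w y)^*) = fun y => (iter n (partial b) w y)^*.
Proof.
move=> sw; elim: n => //= n ->; rewrite partialJ//.
by elim: n => //= n; exact: smooth2_partial.
Qed.

Lemma classicDJ al w : smooth2 w ->
  classicD al (fun y => (w y)^*) = fun y => (classicD al w y)^*.
Proof.
move=> sw; rewrite /classicD -[partial1]/(partial true) -[partial2]/(partial false).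
rewrite partialJ_iter// partialJ_iter//.
by elim: al.2 => //= n; exact: smooth2_partial.
Qed.

Lemma sign2m m : (- 'i : R[i]) ^+ (2 * m) = (-1) ^+ m.
Proof. by rewrite exprM sqrrN sqr_i. Qed.

(** The scalar (-i)^(2m) = (-1)^m is real, so conjugation acts on the coefficients of [p] alone and
    produces [adjoint p]. *)
Lemma diffopJ m (p : 'I_(2 * m).+1 -> R[i]) w : smooth2 w ->
  diffop classicD p (fun y => (w y)^*) = fun y => (diffop classicD (adjoint p) w y)^*.
Proof.
move=> sw; apply/funext => y; rewrite /diffop rmorph_sum; apply: eq_bigr => k _.
by rewrite classicDJ// !rmorphM /= /adjoint conjcK sign2m rmorphXn rmorphN1.
Qed.

(** The order is even, so the signs of the integrations by parts cancel and the bilinear transpose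
    of P is P itself. *)
Lemma diffop_ibp m (p : 'I_(2 * m).+1 -> R[i]) w chi : test2 w -> test2 chi ->
  cint leb2 setT (fun y => w y * diffop classicD p chi y) =
  cint leb2 setT (fun y => diffop classicD p w y * chi y).
Proof.
move=> tw tc.
have i1 (k : 'I_(2 * m).+1) :
    cintegrable leb2 setT (fun y => w y * classicD (k : nat, (2 * m - k)%N) chi y).
  by apply: test2_integrable; [exact: locint2_test|exact: test2_classicD].
have i2 (k : 'I_(2 * m).+1) :
    cintegrable leb2 setT (fun y => classicD (k : nat, (2 * m - k)%N) w y * chi y).
  by apply: test2_integrable => //; apply/locint2_test/test2_classicD.
transitivity (\sum_k (p k * (- 'i) ^+ (2 * m)) *
    cint leb2 setT (fun y => w y * classicD (k : nat, (2 * m - k)%N) chi y)).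
  under eq_bigr => k _ do rewrite -cintZ//.
  rewrite -cint_sum//; last by move=> k _; exact: cintegrableZ.
  by apply: cint_ext => y _; rewrite /diffop mulr_sumr; apply: eq_bigr => k _; ring.
transitivity (\sum_k (p k * (- 'i) ^+ (2 * m)) *
    cint leb2 setT (fun y => classicD (k : nat, (2 * m - k)%N) w y * chi y)); last first.
  under eq_bigr => k _ do rewrite -cintZ//.
  rewrite -cint_sum//; last by move=> k _; exact: cintegrableZ.
  by apply: cint_ext => y _; rewrite /diffop mulr_suml; apply: eq_bigr => k _; ring.
apply: eq_bigr => k _; congr (_ * _); rewrite classicD_ibp//= subnKC; last first.
  by rewrite -ltnS.
by rewrite exprM sqrrN expr1n expr1n mul1r.
Qed.

Lemma weakD2P al w : (exists g, is_weakD2 al w g) -> is_weakD2 al w (weakD2 al w).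
Proof. by move=> [g hg]; rewrite /weakD2; apply: (xgetI (fun=> 0) hg). Qed.

Lemma locint2_cmeas (K : set (R * R)) w : locint2 w -> compact K -> K `<=` punctured ->
  @cmeas _ T2 R K w.
Proof. by move=> lw cK Kp; apply: cintegrable_meas; exact: (lw K cK Kp). Qed.

Lemma cint_test_ae w g chi : locint2 w -> locint2 g -> test2 chi ->
  {ae leb2, forall y, w y = g y} ->
  cint leb2 setT (fun y => w y * chi y) = cint leb2 setT (fun y => g y * chi y).
Proof.
move=> lw lg tc wg.
apply: (@cint_ae_eq _ T2 R leb2) => //.
- by apply: cintegrable_meas; exact: test2_integrable.
- by apply: cintegrable_meas; exact: test2_integrable.
by apply: ae_imp wg => y -> _.
Qed.

Lemma weakD2_diffop m (p : 'I_(2 * m).+1 -> R[i]) w chi :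
  (forall k : 'I_(2 * m).+1, exists g, is_weakD2 (k : nat, (2 * m - k)%N) w g) ->
  test2 chi ->
  locint2 (diffop weakD2 p w) /\
  cint leb2 setT (fun y => diffop weakD2 p w y * chi y) =
  cint leb2 setT (fun y => w y * diffop classicD p chi y).
Proof.
move=> H tc; have D k := weakD2P (H k).
have lw : locint2 w by have [] := D ord0.
have lD (k : 'I_(2 * m).+1) : locint2 (weakD2 (k : nat, (2 * m - k)%N) w) by have [] := D k.
split.
  move=> K cK Kp; have mK := compact2_measurable cK.
  by apply: cintegrable_sum => // k _; apply: cintegrableZ => //; exact: lD.
transitivity (\sum_k (p k * (- 'i) ^+ (2 * m)) *
    cint leb2 setT (fun y => weakD2 (k : nat, (2 * m - k)%N) w y * chi y)).
  have i2 (k : 'I_(2 * m).+1) :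
      cintegrable leb2 setT (fun y => weakD2 (k : nat, (2 * m - k)%N) w y * chi y).
    exact: test2_integrable.
  under eq_bigr => k _ do rewrite -cintZ//.
  rewrite -cint_sum//; last by move=> k _; exact: cintegrableZ.
  by apply: cint_ext => y _; rewrite /diffop mulr_suml; apply: eq_bigr => k _; ring.
have i1 (k : 'I_(2 * m).+1) :
    cintegrable leb2 setT (fun y => w y * classicD (k : nat, (2 * m - k)%N) chi y).
  by apply: test2_integrable => //; exact: test2_classicD.
transitivity (\sum_k (p k * (- 'i) ^+ (2 * m)) *
    cint leb2 setT (fun y => w y * classicD (k : nat, (2 * m - k)%N) chi y)); last first.
  under eq_bigr => k _ do rewrite -cintZ//.
  rewrite -cint_sum//; last by move=> k _; exact: cintegrableZ.
  by apply: cint_ext => y _; rewrite /diffop mulr_sumr; apply: eq_bigr => k _; ring.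
apply: eq_bigr => k _; congr (_ * _); have [_ _ ->//] := D k.
rewrite /= subnKC; last by rewrite -ltnS.
by rewrite exprM sqrrN expr1n expr1n mul1r.
Qed.

Lemma solves_weak m (p : 'I_(2 * m).+1 -> R[i]) w g chi : solves p w g -> locint2 g ->
  test2 chi ->
  cint leb2 setT (fun y => g y * chi y) =
  cint leb2 setT (fun y => w y * diffop classicD p chi y).
Proof.
move=> [H wg] lg tc; have [ld <-] := weakD2_diffop p H tc.
by apply: cint_test_ae => //; apply: ae_imp wg => y ->.
Qed.

End WeakCalculus.

(** * Products of a function of ln r and a function of the angle *)

Section PolarCoordinates.
Context {R : realType}.
Implicit Types (y v : R * R) (t w x : R) (phi : R -> R[i]).

Definition periodic2pi phi := forall x, phi (x + 2 * pi) = phi x.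

Lemma pi2_gt0 : 0 < 2 * pi :> R. Proof. by rewrite mulr_gt0// pi_gt0. Qed.

Lemma cosD2pi' x : cos (x + 2 * pi) = cos x.
Proof. by rewrite mulr_natl cosD2pi. Qed.

Lemma sinD2pi' x : sin (x + 2 * pi) = sin x.
Proof. by rewrite mulr_natl sinD2pi. Qed.

Lemma periodic2pi_int phi x (k : int) : periodic2pi phi -> phi (x + k%:~R * (2 * pi)) = phi x.
Proof.
move=> pp; have nat n z : phi (z + n%:R * (2 * pi)) = phi z.
  elim: n z => [|n ih] z; first by rewrite mul0r addr0.
  by rewrite -natr1 mulrDl mul1r addrA pp ih.
case: k => n; first exact: nat.
by rewrite NegzE mulrNz mulNr -[in RHS](subrK (n.+1%:R * (2 * pi)) x) nat.
Qed.

Lemma reduce_angle x : exists k : int, 0 <= x + k%:~R * (2 * pi) < 2 * pi.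
Proof.
pose q := x / (2 * pi); exists (- Num.floor q).
have := floor_itv q; rewrite mulrNz mulNr => /andP[h1 h2].
move: h1 h2; rewrite /q ler_pdivlMr ?pi2_gt0// ltr_pdivrMr ?pi2_gt0// => h1 h2.
by rewrite subr_ge0 h1 /= ltrBlDl -[X in _ + X]mul1r -mulrDl (lt_le_trans h2)// intrD.
Qed.

Lemma angle_inj x x' : 0 <= x < 2 * pi -> 0 <= x' < 2 * pi ->
  cos x = cos x' -> sin x = sin x' -> x = x'.
Proof.
have refl (z : R) : pi < z -> cos z = cos (2 * pi - z) /\ sin z = - sin (2 * pi - z).
  move=> _; have := cosD2pi' (- z); have := sinD2pi' (- z).
  by rewrite (addrC (- z)) cosN sinN => -> ->; rewrite opprK.
have neg (z : R) : pi < z < 2 * pi -> sin z < 0.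
  move=> /andP[h1 h2]; rewrite (refl z h1).2 oppr_lt0.
  by apply: sin_gt0_pi; apply/andP; split; lra.
have I (z : R) : 0 <= z <= pi -> z \in `[0, pi] by rewrite in_itv.
move=> /andP[x0 x2] /andP[x0' x2'] ec es.
have [xp|xp] := leP x pi; have [xp'|xp'] := leP x' pi.
- by apply: cos_inj ec; apply: I; rewrite ?x0 ?x0'.
- have := sin_ge0_pi (_ : 0 <= x <= pi); rewrite x0 xp => /(_ isT).
  by rewrite es leNgt neg// xp' x2'.
- have := sin_ge0_pi (_ : 0 <= x' <= pi); rewrite x0' xp' => /(_ isT).
  by rewrite -es leNgt neg// xp x2.
have : 2 * pi - x = 2 * pi - x'.
  apply: cos_inj; rewrite -?(refl _ _).1//; apply: I; apply/andP; split; lra.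
by move/addrI/oppr_inj.
Qed.

(** A periodic function sees an angle only through its cosine and sine, so [polar_angle] with its
    jump may be replaced by any local branch of the angle. *)
Lemma periodic2pi_eq phi x x' : periodic2pi phi -> cos x = cos x' -> sin x = sin x' ->
  phi x = phi x'.
Proof.
move=> pp ec es; have [k hk] := reduce_angle x; have [k' hk'] := reduce_angle x'.
rewrite -(periodic2pi_int x k pp) -(periodic2pi_int x' k' pp); congr phi.
have C (z : R) j : cos (z + j%:~R * (2 * pi)) = cos z.
  have := @periodic2pi_int (fun x => (cos x)%:C) z j.
  by move=> /(_ (fun x => congr1 _ (cosD2pi' x)))[].
have S (z : R) j : sin (z + j%:~R * (2 * pi)) = sin z.
  have := @periodic2pi_int (fun x => (sin x)%:C) z j.
  by move=> /(_ (fun x => congr1 _ (sinD2pi' x)))[].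
by apply: angle_inj => //; rewrite ?C ?S.
Qed.

Lemma polar_radius_gt0 y : y <> (0, 0) -> 0 < polar_radius y.
Proof.
move=> y0; rewrite /polar_radius sqrtr_gt0 lt_neqAle addr_ge0 ?sqr_ge0// andbT eq_sym.
apply/negP; rewrite paddr_eq0 ?sqr_ge0// !sqrf_eq0 => /andP[/eqP h1 /eqP h2].
by apply: y0; rewrite [y]surjective_pairing h1 h2.
Qed.

Lemma polar_radius_sq y : polar_radius y ^+ 2 = y.1 ^+ 2 + y.2 ^+ 2.
Proof. by rewrite sqr_sqrtr// addr_ge0 ?sqr_ge0. Qed.

Lemma polar_angleP y : y <> (0, 0) ->
  [/\ 0 <= polar_angle y < 2 * pi, y.1 = polar_radius y * cos (polar_angle y) &
      y.2 = polar_radius y * sin (polar_angle y)].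
Proof.
move=> y0; have r0 := polar_radius_gt0 y0; have r2 := polar_radius_sq y.
set r := polar_radius y in r0 r2 *; pose q := y.1 / r.
have y1q : y.1 = r * q by rewrite /q mulrC divfK// gt_eqF.
have q1 : q ^+ 2 <= 1.
  rewrite /q expr_div_n ler_pdivrMr ?exprn_gt0// mul1r r2 lerDl sqr_ge0//.
have qb : -1 <= q <= 1 by rewrite -ler_norml -(ler_pXn2r (ltn0Sn 1)) ?nnegrE// real_normK ?num_real// expr1n.
have qi : q \in `[(-1), 1] by rewrite in_itv.
have [/andP[a0 api] ca] := acos_def qb.
have sa : r * sin (acos q) = `|y.2|.
  rewrite sin_acos// -sqrtr_sqr -[r in LHS]ger0_norm ?ltW// -(sqrtr_sqr r) -sqrtrM ?sqr_ge0//.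
  by congr Num.sqrt; rewrite mulrBr mulr1 -exprMn -y1q r2; ring.
have pi0 := @pi_gt0 R.
rewrite /polar_angle -/r -/q; case: ifPn => [y2|]; last rewrite -ltNge => y2.
  split; last by rewrite sa ger0_norm.
    by rewrite a0 /=; lra.
  by rewrite ca.
have a1 : acos q != 0.
  apply/eqP => a00; move: sa; rewrite a00 sin0 mulr0 => /esym/eqP; rewrite normr_eq0.
  by move/eqP => y20; rewrite y20 ltxx in y2.
have eC := cosD2pi' (- acos q); have eS := sinD2pi' (- acos q).
rewrite (addrC (- _)) cosN sinN in eC eS; split.
- by rewrite subr_ge0 ltrBlDr ltrDl lt_neqAle eq_sym a1 a0; apply/andP; split=> //; lra.
- by rewrite eC ca.
- by rewrite eS mulrN sa ltr0_norm// opprK.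
Qed.

Lemma pol_surj y : y <> (0, 0) -> y = pol (ln (polar_radius y)) (polar_angle y).
Proof.
move=> y0; have [_ h1 h2] := polar_angleP y0.
by rewrite [LHS]surjective_pairing /pol lnK ?posrE ?polar_radius_gt0// -h1 -h2.
Qed.

Lemma polar_radius_pol t w : polar_radius (pol t w) = expR t.
Proof.
rewrite /polar_radius /= !exprMn -mulrDr cos2Dsin2 mulr1 sqrtr_sqr gtr0_norm//.
exact: expR_gt0.
Qed.

Lemma pol_neq0 t w : pol t w <> (0, 0).
Proof.
move=> h; have := polar_radius_pol t w; rewrite h /polar_radius /= expr0n /= addr0 sqrtr0.
by move/eqP; rewrite lt_eqF// expR_gt0.
Qed.

Lemma polar_angle_pol_cs t w : cos (polar_angle (pol t w)) = cos w /\
  sin (polar_angle (pol t w)) = sin w.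
Proof.
have [_] := polar_angleP (@pol_neq0 t w); rewrite polar_radius_pol /=.
have e0 : expR t != 0 by rewrite gt_eqF// expR_gt0.
by move=> /(mulfI e0) -> /(mulfI e0) ->.
Qed.

Lemma polar_angle_pol t w : I2pi w -> polar_angle (pol t w) = w.
Proof.
rewrite /I2pi /= in_itv/= => /andP[w0 w2]; have [c s] := polar_angle_pol_cs t w.
have [h _ _] := polar_angleP (@pol_neq0 t w).
by apply: angle_inj => //; rewrite ltW.
Qed.

End PolarCoordinates.

(** * Differentiation of separated functions *)

Section Separated.
Context {R : realType}.
Implicit Types (y v : R * R) (t w x : R) (phi tau : R -> R[i]) (b : bool).

(* at the origin, where [ln] and [polar_angle] take junk values, [sep] is [0] *)
Definition sep tau phi y : R[i] :=
  if y == (0, 0) then 0 else tau (ln (polar_radius y)) * phi (polar_angle y).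

Lemma sep_pol tau phi t w : periodic2pi phi -> sep tau phi (pol t w) = tau t * phi w.
Proof.
move=> pp; rewrite /sep ifN; last by apply/eqP; exact: pol_neq0.
rewrite polar_radius_pol expRK; congr (_ * _).
by apply: periodic2pi_eq => //; have [] := polar_angle_pol_cs t w.
Qed.

Lemma sep_polI tau phi t w : I2pi w -> sep tau phi (pol t w) = tau t * phi w.
Proof.
move=> Iw; rewrite /sep ifN; last by apply/eqP; exact: pol_neq0.
by rewrite polar_radius_pol expRK polar_angle_pol.
Qed.

Lemma is_derive_snd y v : is_derive y v (snd : R * R -> R) v.2.
Proof. by apply: DeriveDef; [exact/diff_derivable/differentiable_snd|exact: derive_snd]. Qed.

Lemma is_derive_fst y v : is_derive y v (fst : R * R -> R) v.1.
Proof. by apply: DeriveDef; [exact/diff_derivable/differentiable_fst|exact: derive_fst]. Qed.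

Lemma derive_lin (c d : R) y v : differentiable (fun y : R * R => c * y.1 + d * y.2) y /\
  'D_v (fun y : R * R => c * y.1 + d * y.2) y = c * v.1 + d * v.2.
Proof.
have d1 := @differentiable_fst R y; have d2 := @differentiable_snd R y.
split.
  apply: differentiableD; apply: differentiableM => //; exact: differentiable_cst.
have := is_deriveD (is_deriveZ c (is_derive_fst y v)) (is_deriveZ d (is_derive_snd y v)).
by case.
Qed.

Lemma derive_lnr y v : y <> (0, 0) ->
  differentiable (fun y : R * R => ln (polar_radius y)) y /\
  'D_v (fun y : R * R => ln (polar_radius y)) y =
    (y.1 * v.1 + y.2 * v.2) / polar_radius y ^+ 2.
Proof.
move=> y0; pose q (y : R * R) := y.1 ^+ 2 + y.2 ^+ 2.
have r0 := polar_radius_gt0 y0.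
have q0 : 0 < q y by rewrite /q -polar_radius_sq exprn_gt0.
have dq : differentiable q y.
  have -> : q = (fst : R * R -> R) * fst + (snd : R * R -> R) * snd.
    by apply/funext => z; rewrite /q !expr2.
  by apply: differentiableD; apply: differentiableM; exact: differentiable_fst || exact: differentiable_snd.
have Dq : 'D_v q y = 2 * (y.1 * v.1 + y.2 * v.2).
  have := is_deriveD (is_deriveM (is_derive_fst y v) (is_derive_fst y v))
    (is_deriveM (is_derive_snd y v) (is_derive_snd y v)).
  case=> _; rewrite (_ : _ + _ = q); last by apply/funext => z; rewrite /q !expr2.
  by move=> ->; rewrite /GRing.scale /=; ring.
have ds := is_derive1_sqrt q0.
have dr : differentiable (@polar_radius R) y := differentiable_comp1 dq ds.
have Dr := derive_comp1 v dq ds.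
have dl := is_derive1_ln r0.
split; first exact: (differentiable_comp1 dr dl).
rewrite (derive_comp1 v dr dl).
rewrite [X in _ * X](_ : _ = (2 * polar_radius y)^-1 * (2 * (y.1 * v.1 + y.2 * v.2))).
  by field; rewrite gt_eqF.
by rewrite -Dq -Dr.
Qed.

(** [A] and [B] are the coordinates of y after rotation by [- w0], and [theta w0] is the branch of
    the angle that is smooth on the half plane [A > 0]. *)
Let A (w0 : R) y := cos w0 * y.1 + sin w0 * y.2.
Let B (w0 : R) y := - sin w0 * y.1 + cos w0 * y.2.
Let theta (w0 : R) y := w0 + atan (B w0 y / A w0 y).

Lemma derive_theta w0 y v : 0 < A w0 y ->
  differentiable (theta w0) y /\
  'D_v (theta w0) y = (y.1 * v.2 - y.2 * v.1) / polar_radius y ^+ 2.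
Proof.
move=> A0; have [dA DA] := derive_lin (cos w0) (sin w0) y v.
have [dB DB] := derive_lin (- sin w0) (cos w0) y v.
have An0 : A w0 y != 0 by rewrite gt_eqF.
have dV : is_derive (A w0 y) (1 : R) (fun x : R => x^-1) (- (A w0 y) ^- 2).
  by have := @is_deriveV R id (A w0 y) 1 1 An0 (is_derive_id _ _); rewrite /GRing.scale /= mulr1.
have dAV := differentiable_comp1 dA dV; have DAV := derive_comp1 v dA dV.
pose q := (B w0 : R * R -> R) * ((fun x : R => x^-1) \o A w0).
have dq : differentiable q y by exact: differentiableM.
have Dq : 'D_v q y = B w0 y * 'D_v ((fun x : R => x^-1) \o A w0) y + (A w0 y)^-1 * 'D_v (B w0) y.
  by rewrite deriveM//; exact: diff_derivable.
have da : is_derive (q y) (1 : R) (fun x => w0 + atan x) (1 + q y ^+ 2)^-1.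
  have := is_deriveD (is_derive_cst w0 (q y) (1 : R)) (is_derive1_atan (q y)).
  by rewrite add0r.
have rAB : polar_radius y ^+ 2 = A w0 y ^+ 2 + B w0 y ^+ 2.
  rewrite polar_radius_sq /A /B; have := cos2Dsin2 w0; set c := cos w0; set s := sin w0 => cs.
  transitivity ((c ^+ 2 + s ^+ 2) * (y.1 ^+ 2 + y.2 ^+ 2)); first by rewrite cs mul1r.
  ring.
have AB : y.1 * v.2 - y.2 * v.1 = A w0 y * (- sin w0 * v.1 + cos w0 * v.2) -
    B w0 y * (cos w0 * v.1 + sin w0 * v.2).
  rewrite /A /B; have := cos2Dsin2 w0; set c := cos w0; set s := sin w0 => cs.
  transitivity ((c ^+ 2 + s ^+ 2) * (y.1 * v.2 - y.2 * v.1)); first by rewrite cs mul1r.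
  ring.
split; first exact: (differentiable_comp1 dq da).
have -> : theta w0 = (fun x => w0 + atan x) \o q by [].
rewrite (derive_comp1 v dq da) Dq DAV DB DA rAB AB /q /=.
have AB0 : A w0 y ^+ 2 + B w0 y ^+ 2 != 0 by rewrite gt_eqF// ltr_pwDl ?exprn_gt0 ?sqr_ge0.
rewrite -[(_ * _) y]/(B w0 y * (A w0 y)^-1).
by field; rewrite An0 AB0.
Qed.

Lemma theta_cs w0 y : 0 < A w0 y ->
  y.1 = polar_radius y * cos (theta w0 y) /\ y.2 = polar_radius y * sin (theta w0 y).
Proof.
move=> A0; set a := A w0 y; set b := B w0 y.
have rAB : polar_radius y ^+ 2 = a ^+ 2 + b ^+ 2.
  rewrite polar_radius_sq /a /b /A /B; have := cos2Dsin2 w0; set c := cos w0; set s := sin w0 => cs.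
  transitivity ((c ^+ 2 + s ^+ 2) * (y.1 ^+ 2 + y.2 ^+ 2)); first by rewrite cs mul1r.
  ring.
have r0 : 0 <= polar_radius y by exact: sqrtr_ge0.
have ca : polar_radius y * cos (atan (b / a)) = a.
  rewrite cos_atan; have -> : 1 + (b / a) ^+ 2 = polar_radius y ^+ 2 / a ^+ 2.
    by rewrite rAB; field; rewrite gt_eqF.
  rewrite sqrtrM ?sqr_ge0// sqrtr_sqr sqrtrV ?sqr_ge0// sqrtr_sqr !ger0_norm ?(ltW A0)//.
  rewrite invf_div mulrC divfK// gt_eqF// lt_neqAle r0 andbT eq_sym -sqrf_eq0 rAB.
  by rewrite gt_eqF// ltr_pwDl ?exprn_gt0 ?sqr_ge0.
have sa : polar_radius y * sin (atan (b / a)) = b.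
  have := atanK (b / a); rewrite /tan => h.
  set q := atan (b / a) in h ca *.
  have c0 : cos q != 0.
    by apply/eqP => c0; move: ca; rewrite c0 mulr0 => a0; rewrite /a in a0; rewrite -a0 ltxx in A0.
  have -> : sin q = cos q * (b / a) by rewrite -h mulrC divfK.
  by rewrite mulrA ca mulrC divfK// gt_eqF.
rewrite /theta -/a -/b; set q := atan (b / a) in ca sa *; set r := polar_radius y in ca sa *.
rewrite cosD sinD.
have -> : r * (cos w0 * cos q - sin w0 * sin q) = cos w0 * (r * cos q) - sin w0 * (r * sin q) by ring.
have -> : r * (sin w0 * cos q + cos w0 * sin q) = sin w0 * (r * cos q) + cos w0 * (r * sin q) by ring.
rewrite ca sa /a /b /A /B; have := cos2Dsin2 w0; set c := cos w0; set s := sin w0 => cs; split.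
  transitivity ((c ^+ 2 + s ^+ 2) * y.1); first by rewrite cs mul1r.
  ring.
transitivity ((c ^+ 2 + s ^+ 2) * y.2); first by rewrite cs mul1r.
ring.
Qed.

Lemma sep_theta tau phi w0 y : periodic2pi phi -> 0 < A w0 y ->
  sep tau phi y = tau (ln (polar_radius y)) * phi (theta w0 y).
Proof.
move=> pp A0; have [h1 h2] := theta_cs A0.
have y0 : y <> (0, 0).
  by move=> y0; move: A0; rewrite y0 /A /= !mulr0 addr0 ltxx.
have r0 := polar_radius_gt0 y0.
rewrite -(sep_pol tau _ _ pp) /pol lnK ?posrE// -h1 -h2; congr sep; exact: surjective_pairing.
Qed.

Lemma near_A w0 y : 0 < A w0 y -> \forall z \near y, 0 < A w0 z.
Proof.
move=> A0; have [dA _] := derive_lin (cos w0) (sin w0) y y.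
have : A w0 z @[z --> y] --> A w0 y by exact: differentiable_continuous.
by move=> /cvgr_gt; apply.
Qed.

(** The branch [theta] is taken with [w0] the angle of y itself: there [A] equals the radius and [B]
    vanishes, so y is well inside the domain of the branch. The chain rule for ln r and [theta] then
    gives the formula. *)
Lemma sep_local tau phi y b : smooth tau -> smooth phi -> periodic2pi phi -> y <> (0, 0) ->
  let t := ln (polar_radius y) in let w := polar_angle y in
  cdiff (sep tau phi) y /\
  partial b (sep tau phi) y =
    ((if b then cos w else sin w) * expR (- t))%:C * (cderive1 tau t * phi w) +
    ((if b then - sin w else cos w) * expR (- t))%:C * (tau t * cderive1 phi w).
Proof.
move=> st sp pp y0 t w; have [_ h1 h2] := polar_angleP y0; have r0 := polar_radius_gt0 y0.
have A0 : 0 < A w y.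
  rewrite /A h1 h2 -/w !(mulrCA _ (polar_radius y)) -mulrDr mulr_gt0//.
  by rewrite -!expr2 cos2Dsin2.
have th : theta w y = w.
  rewrite /theta (_ : B w y = 0) ?mul0r ?atan0 ?addr0//.
  by rewrite /B h1 h2 -/w; ring.
pose lnr (y : R * R) := ln (polar_radius y).
have [dl Dl] := derive_lnr (dir b) y0; have [dt Dt] := derive_theta (dir b) A0.
have nE : \forall z \near y, (tau \o lnr) z * (phi \o theta w) z = sep tau phi z.
  by apply: filterS (near_A A0) => z Az; rewrite (sep_theta _ pp Az).
have c1 := cdiff_comp1 st dl; have c2 := cdiff_comp1 sp dt.
split; first by apply: cdiff_near nE _; exact: cdiffM.
rewrite partialE -(cderive_near (dir_neq0 b) nE) cderiveM//.
rewrite (cderive_comp1 (dir b) st dl) (cderive_comp1 (dir b) sp dt) Dl Dt /comp th -/t.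
have er : expR (- t) = (polar_radius y)^-1 by rewrite expRN lnK ?posrE.
have -> : (y.1 * (dir b).1 + y.2 * (dir b).2) / polar_radius y ^+ 2 =
    (if b then cos w else sin w) * expR (- t).
  rewrite er h1 h2 -/w; case: b {c1 c2 nE Dl Dt} => /=; field; by rewrite gt_eqF.
have -> : (y.1 * (dir b).2 - y.2 * (dir b).1) / polar_radius y ^+ 2 =
    (if b then - sin w else cos w) * expR (- t).
  rewrite er h1 h2 -/w; case: b {c1 c2 nE Dl Dt} => /=; field; by rewrite gt_eqF.
by rewrite /lnr -/t; congr (_ + _); rewrite -?mulrA//; rewrite mulrCA.
Qed.

End Separated.

(** * Separated functions as test functions; the operator in polar form *)

Section SeparatedTests.
Context {R : realType}.
Implicit Types (y v : R * R) (t w x : R) (f g phi tau : R -> R[i]) (b : bool).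

Definition csm tau := smooth tau /\ exists2 M : R, 0 < M & forall t, M <= `|t| -> tau t = 0.

Definition psm phi := smooth phi /\ periodic2pi phi.

Lemma psmP phi : periodic_smooth phi <-> psm phi.
Proof. by rewrite /periodic_smooth smooth1P. Qed.

Lemma cderive1_supp tau : csm tau -> csm (cderive1 tau).
Proof.
move=> [st [M M0 hM]]; split; first exact: smooth_derive.
exists (M + 1) => [|t Mt]; first by rewrite addr_gt0.
rewrite (near_cderive1 (g := fun=> 0)); first by rewrite (is_cdE (is_cd_cst t 0)).
have : `|z| @[z --> t] --> `|t| by exact: norm_continuous.
move=> /cvgr_gt/(_ M) h; apply: filterS (h _) => [z /ltW/hM->//|].
by rewrite (lt_le_trans _ Mt)// ltrDl.
Qed.

Lemma csmM f tau : smooth f -> csm tau -> csm (fun t => f t * tau t).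
Proof.
move=> sf [st [M M0 hM]]; split; first exact: smoothM.
by exists M => // t /hM ->; rewrite mulr0.
Qed.

Lemma csmM2 f tau : smooth f -> csm tau -> csm (fun t => tau t * f t).
Proof.
move=> sf [st [M M0 hM]]; split; first exact: smoothM.
by exists M => // t /hM ->; rewrite mul0r.
Qed.

Lemma csmJ tau : csm tau -> csm (fun t => (tau t)^*).
Proof.
by move=> [st [M M0 hM]]; split; [exact: smoothJ|exists M => // t /hM ->; rewrite conjc0].
Qed.

Lemma periodic_cderive1 phi : smooth phi -> periodic2pi phi -> periodic2pi (cderive1 phi).
Proof.
move=> sp pp x; have := cderive1_affine 1 (2 * pi) sp => /(congr1 (fun h => h x)).
rewrite mul1r mul1r => <-; congr (cderive1 _ x).
by apply/funext => z; rewrite mul1r pp.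
Qed.

Lemma psm_derive phi : psm phi -> psm (cderive1 phi).
Proof. by move=> [sp pp]; split; [exact: smooth_derive|exact: periodic_cderive1]. Qed.

Lemma psmM f g : psm f -> psm g -> psm (fun w => f w * g w).
Proof. by move=> [sf pf] [sg pg]; split; [exact: smoothM|move=> x; rewrite pf pg]. Qed.

Lemma psmD f g : psm f -> psm g -> psm (fun w => f w + g w).
Proof. by move=> [sf pf] [sg pg]; split; [exact: smoothD|move=> x; rewrite pf pg]. Qed.

Lemma psmJ f : psm f -> psm (fun w => (f w)^*).
Proof. by move=> [sf pf]; split; [exact: smoothJ|move=> x; rewrite pf]. Qed.

Lemma psm_cst z : psm (fun=> z).
Proof. by split; [exact: smooth_cst|]. Qed.

Definition em : R -> R[i] := fun t => (expR (- t))%:C.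

Lemma smooth_em : smooth em.
Proof.
have := smooth_cexp (-1 : R[i]); congr smooth; apply/funext => t.
by rewrite mulN1r -rmorphN /= cexp_real.
Qed.

(** [dcos] and [dsin] are the angular coefficients of the partial derivatives: in t = ln r,
    [partial1] is e^(-t) (cos w d_t - sin w d_w) and [partial2] is e^(-t) (sin w d_t + cos w
    d_w). *)
Definition dcos b : R -> R[i] := fun w => (if b then cos w else sin w)%:C.
Definition dsin b : R -> R[i] := fun w => (if b then - sin w else cos w)%:C.

Lemma psm_dcos b : psm (dcos b).
Proof.
split; first by case: b; [exact: smooth_cos|exact: smooth_sin].
by move=> x; rewrite /dcos cosD2pi' sinD2pi'.
Qed.

Lemma psm_dsin b : psm (dsin b).
Proof.
split; last by move=> x; rewrite /dsin cosD2pi' sinD2pi'.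
case: b; last exact: smooth_cos.
rewrite (_ : dsin true = fun x => -1 * (sin x)%:C); first exact: smoothZ smooth_sin.
by apply/funext => t; rewrite /dsin mulN1r rmorphN.
Qed.

Lemma sep_origin tau phi : csm tau ->
  \forall y \near (0, 0), sep tau phi y = 0.
Proof.
move=> [_ [M M0 hM]].
have c : continuous (fun y : R * R => `|y.1| + `|y.2|).
  move=> y; apply: cvgD; apply: cvg_norm; exact: cvg_fst || exact: cvg_snd.
have : `|y.1| + `|y.2| @[y --> ((0, 0) : R * R)] --> (0 : R).
  by have := c (0, 0); rewrite /continuous_at /= !normr0 addr0.
move=> /cvgr_lt/(_ (expR (- M)) (expR_gt0 _)).
apply: filterS => y hy; rewrite /sep; case: eqP => // y0.
have r0 := polar_radius_gt0 y0.
rewrite hM ?mul0r// ler_normr; apply/orP; right.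
rewrite lerNr -[leRHS]expRK ler_ln ?posrE ?expR_gt0//; apply: le_trans (ltW hy).
rewrite -(ler_pXn2r (ltn0Sn 1)) ?nnegrE ?sqrtr_ge0 ?addr_ge0// polar_radius_sq.
rewrite -(real_normK (num_real y.1)) -(real_normK (num_real y.2)) sqrrD addrAC lerDl.
by rewrite mulrn_wge0// mulr_ge0.
Qed.

Lemma sep_cdiff tau phi y : csm tau -> psm phi -> cdiff (sep tau phi) y.
Proof.
move=> ct [sp pp]; have [->|/eqP y0] := eqVneq y (0, 0); last first.
  by have [] := sep_local true ct.1 sp pp y0.
apply: cdiff_near (cdiff_cst 0 _); have := sep_origin phi ct.
by apply: filterS => z ->.
Qed.

Lemma sep_partial b tau phi : csm tau -> psm phi -> partial b (sep tau phi) = fun y =>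
  sep (fun t => em t * cderive1 tau t) (fun w => dcos b w * phi w) y +
  sep (fun t => em t * tau t) (fun w => dsin b w * cderive1 phi w) y.
Proof.
move=> ct [sp pp]; apply/funext => y; have [->|/eqP y0] := eqVneq y (0, 0); last first.
  have [_ ->] := sep_local b ct.1 sp pp y0.
  have yE : (y == (0, 0)) = false by exact/eqP.
  rewrite /sep !yE.
  rewrite /em /dcos /dsin !rmorphM /=; ring.
have -> : partial b (sep tau phi) (0, 0) = 0.
  rewrite partialE (cderive_near (dir_neq0 b) (sep_origin phi ct)).
  by rewrite cderive_cst.
by rewrite /sep eqxx addr0.
Qed.

(** Sums are included because a partial derivative of one product is a sum of two; the span is then
    closed under partial derivatives and proves smoothness by coinduction. *)
Inductive sepspan : (R * R -> R[i]) -> Prop :=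
| SepOne tau phi : csm tau -> psm phi -> sepspan (sep tau phi)
| SepAdd (u1 u2 : R * R -> R[i]) : sepspan u1 -> sepspan u2 -> sepspan (fun y => u1 y + u2 y).

Lemma sep_smooth2 tau phi : csm tau -> psm phi -> smooth2 (sep tau phi).
Proof.
move=> ct pp; apply: (@smooth2_coind R sepspan); last exact: SepOne.
move=> w {tau phi ct pp}; elim=> [tau phi ct pp|f g _ [c1 h1] _ [c2 h2]].
  split=> [y|b]; first exact: sep_cdiff.
  rewrite sep_partial//; apply: SepAdd; apply: SepOne.
  - by apply: csmM; [exact: smooth_em|exact: cderive1_supp].
  - by apply: psmM => //; exact: psm_dcos.
  - by apply: csmM; [exact: smooth_em|].
  - by apply: psmM; [exact: psm_dsin|exact: psm_derive].
split=> [y|b]; first exact: cdiffD.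
rewrite (_ : partial b _ = fun y => partial b f y + partial b g y); first exact: SepAdd.
by apply/funext => y; rewrite !partialE cderiveD.
Qed.

Lemma continuous_sqr_radius : continuous (fun y : R * R => y.1 ^+ 2 + y.2 ^+ 2).
Proof.
by move=> y; under eq_fun do rewrite !expr2; apply: cvgD; apply: cvgM; exact: cvg_fst || exact: cvg_snd.
Qed.

Lemma compact_annulus (a c : R) : 0 < a -> 
  compact [set y : R * R | a <= y.1 ^+ 2 + y.2 ^+ 2 <= c].
Proof.
move=> a0; apply: (@subclosed_compact _ _ (box (- (c + 1)) (c + 1) (- (c + 1)) (c + 1))).
- have -> : [set y : R * R | a <= y.1 ^+ 2 + y.2 ^+ 2 <= c] =
      (fun y : R * R => y.1 ^+ 2 + y.2 ^+ 2) @^-1` `[a, c]%classic.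
    by apply/seteqP; split=> y /=; rewrite in_itv.
  apply: closed_comp; first by move=> y _; exact: continuous_sqr_radius.
  exact: itv_closed.
- exact: compact_box.
move=> y /= /andP[h1 h2].
have c0 : 0 <= c by apply: le_trans h2; apply: le_trans h1; exact: ltW.
have bnd (z : R) : z ^+ 2 <= c -> `[- (c + 1), (c + 1)]%classic z.
  move=> hz; rewrite /= in_itv/= -ler_norml -(ler_pXn2r (ltn0Sn 1)) ?nnegrE ?addr_ge0//.
  by rewrite real_normK ?num_real//; nra.
by split; apply: bnd; apply: le_trans h2; rewrite ?lerDl ?lerDr sqr_ge0.
Qed.

Lemma sep_test2 tau phi : csm tau -> psm phi -> test2 (sep tau phi).
Proof.
move=> ct pp; split; first exact: sep_smooth2.
have [_ [M M0 hM]] := ct.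
exists [set y : R * R | expR (- M) ^+ 2 <= y.1 ^+ 2 + y.2 ^+ 2 <= expR M ^+ 2]; split.
- by apply: compact_annulus; rewrite exprn_gt0// expR_gt0.
- move=> y /= /andP[+ _] y0; rewrite y0 /= expr0n addr0 leNgt exprn_gt0// expR_gt0.
- by [].
move=> y hy; rewrite /sep; case: eqP => // y0; rewrite hM ?mul0r// leNgt.
apply/negP => h; apply: hy; rewrite /= -polar_radius_sq.
have r0 := polar_radius_gt0 y0; move: h; rewrite ltr_norml => /andP[h1 h2].
rewrite !ler_pXn2r ?nnegrE ?expR_ge0 ?sqrtr_ge0//.
by rewrite -(lnK (x := polar_radius y)) ?posrE// !ler_expR !ltW.
Qed.

(** Serves both variables: applied to a function of t = ln r it is r D_r, applied to a function of
    the angle it is D_omega. *)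
Definition Dt f : R -> R[i] := fun t => - 'i * cderive1 f t.

Lemma smooth_Dt f : smooth f -> smooth (Dt f).
Proof. by move=> sf; apply: smoothZ; exact: smooth_derive. Qed.

Lemma smooth_iter_Dt n f : smooth f -> smooth (iter n Dt f).
Proof. by move=> sf; elim: n => //= n; exact: smooth_Dt. Qed.

Lemma iter_DtE n f : smooth f -> iter n Dt f = fun t => (- 'i) ^+ n * iter n cderive1 f t.
Proof.
move=> sf; elim: n => [|n ih]; first by apply/funext => t; rewrite mul1r.
rewrite [LHS]/= ih /Dt; apply/funext => t.
rewrite cderive1Z; last exact: smooth_iter.
by rewrite mulrA -exprS.
Qed.

Lemma iter_rDr_sep tau phi k r w : smooth tau -> 0 < r ->
  iter k rDr (fun r' w' => tau (ln r') * phi w') r w = iter k Dt tau (ln r) * phi w.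
Proof.
move=> st; elim: k r w => [//|k ih] r w r0; rewrite !iterS.
rewrite {1}/rDr (near_cderive1 (g := fun r' => phi w * iter k Dt tau (ln r'))); last first.
  by near=> r'; rewrite ih 1?mulrC//; near: r'; exact: lt_nbhsr.
have sk := smooth_iter_Dt k st.
have := is_cdE (is_cdZ (phi w) (is_cd_comp (smoothE (ln r) sk) (is_derive1_ln r0))).
move=> ->; rewrite /Dt fmorphV /=; field.
by rewrite (_ : (0 : R[i]) = (0 : R)%:C)// (inj_eq (@complexI R)) gt_eqF.
Unshelve. all: by end_near. Qed.

Lemma iter_Dang_sep j (G : R -> R -> R[i]) phi z r : smooth phi ->
  (forall w, G r w = z * phi w) -> forall w, iter j Dang G r w = z * iter j Dt phi w.
Proof.
move=> sp GE; elim: j => [//|j ih] w; rewrite !iterS {1}/Dang.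
have -> : iter j Dang G r = fun w => z * iter j Dt phi w by apply/funext.
rewrite cderive1Z; last exact: smooth_iter_Dt.
by rewrite /Dt mulrCA.
Qed.

Lemma diffop_sep m (p : 'I_(2 * m).+1 -> R[i]) (b : nat -> nat -> R -> R[i]) tau phi t w : polar_form p b ->
  csm tau -> psm phi ->
  diffop classicD p (sep tau phi) (pol t w) =
  (expR (- t))%:C ^+ (2 * m) *
    \sum_(j < (2 * m).+1) \sum_(k < (2 * m).+1 | (j + k <= 2 * m)%N)
      b j k w * iter j Dt phi w * iter k Dt tau t.
Proof.
move=> [_ pf] ct pp; rewrite /pol pf; [|exact: sep_test2|exact: expR_gt0].
congr (_ * _); first by rewrite expRN fmorphV /= exprVn.
apply: eq_bigr => j _; apply: eq_bigr => k _; rewrite -mulrA; congr (_ * _).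
pose F (r' w' : R) := sep tau phi (r' * cos w', r' * sin w').
have Fk w' : iter k rDr F (expR t) w' = iter k Dt tau t * phi w'.
  have := iter_rDr_sep phi k w' ct.1 (expR_gt0 t); rewrite expRK => <-.
  have : forall r : R, 0 < r -> forall w', iter k rDr F r w' =
      iter k rDr (fun r' w' => tau (ln r') * phi w') r w'.
    elim: (k : nat) => [|n ih] r r0 w''.
      by rewrite /= /F -[r in sep _ _ (r * _, _)]lnK ?posrE// -[r in (_, r * _)]lnK ?posrE// sep_pol//; case: pp.
    rewrite !iterS /rDr; congr (_ * _); apply: near_cderive1.
    by near=> r'; rewrite ih//; near: r'; exact: lt_nbhsr.
  by move=> ->//; exact: expR_gt0.
by rewrite (iter_Dang_sep j pp.1 Fk) mulrC.
Unshelve. all: by end_near. Qed.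

End SeparatedTests.

Section LinearCombinations.
Context d (T : measurableType d) (R : realType).
Variable mu : {measure set T -> \bar R}.

Lemma cintegrable_sumZ D I (r : seq I) (P : pred I) (z : I -> R[i]) (F : I -> T -> R[i]) :
  measurable D -> (forall i, P i -> cintegrable mu D (F i)) ->
  cintegrable mu D (fun x => \sum_(i <- r | P i) z i * F i x).
Proof. by move=> mD iF; apply: cintegrable_sum => // i Pi; apply: cintegrableZ => //; exact: iF. Qed.

Lemma cint_sumZ D I (r : seq I) (P : pred I) (z : I -> R[i]) (F : I -> T -> R[i]) :
  measurable D -> (forall i, P i -> cintegrable mu D (F i)) ->
  cint mu D (fun x => \sum_(i <- r | P i) z i * F i x) =
  \sum_(i <- r | P i) z i * cint mu D (F i).
Proof.
move=> mD iF; rewrite cint_sum//; last by move=> i Pi; apply: cintegrableZ => //; exact: iF.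
by apply: eq_bigr => i Pi; rewrite cintZ//; exact: iF.
Qed.

End LinearCombinations.

(** * Measurability and integrals of separated functions *)

Section SeparatedMeasurability.
Context {R : realType}.
Notation T1 := (measurableTypeR R).
Notation T2 := (measurableTypeR R * measurableTypeR R)%type.
Implicit Types (y : R * R) (t w x : R) (f g phi tau : R -> R[i]).

(** Extended by constants outside [-1, 1], the function is measurable on the whole line and can be
    composed. *)
Definition acos' (x : R) : R := if x <= -1 then pi else if 1 <= x then 0 else acos x.

Lemma acos'E (x : R) : -1 <= x <= 1 -> acos' x = acos x.
Proof.
move=> /andP[x1 x2]; rewrite /acos'; case: ifPn => h1.
  by have -> : x = -1; [apply/le_anti; rewrite h1|rewrite acosN1].
by case: ifPn => // h2; have -> : x = 1; [apply/le_anti; rewrite x2|rewrite acos1].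
Qed.

Lemma measurable_acos' : measurable_fun (setT : set T1) (acos' : T1 -> T1).
Proof.
have m1 : measurable_fun (setT : set T1) (fun x : T1 => x <= -1) by exact: measurable_fun_ler.
have m2 : measurable_fun (setT : set T1) (fun x : T1 => 1 <= x) by exact: measurable_fun_ler.
apply: (measurable_fun_if measurableT m1) => //.
have mD : measurable ([set: T1] `&` (fun x : T1 => x <= -1) @^-1` [set false]).
  exact: (m1 measurableT [set false]).
apply: (measurable_fun_if mD (measurable_funS measurableT (@subsetT _ _) m2)) => //.
have -> : [set: T1] `&` (fun x : T1 => x <= -1) @^-1` [set false] `&`
    (fun x : T1 => 1 <= x) @^-1` [set false] = `]-1, 1[%classic.
  apply/seteqP; split=> x /=; rewrite in_itv/=.
    by move=> [[_ /negbT +] /negbT]; rewrite -!ltNge => -> ->.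
  by move=> /andP[h1 h2]; split; [split=> //|]; apply/negbTE; rewrite -ltNge.
apply: subspace_continuous_measurable_fun => //.
apply: continuous_in_subspaceT => x /set_mem; rewrite /= in_itv/=.
exact: continuous_acos.
Qed.

Definition lnr y := ln (polar_radius y).

Lemma measurable_lnr : measurable_fun (setT : set T2) (lnr : T2 -> T1).
Proof.
apply: (measurableT_comp (@measurable_ln R)).
apply: continuous2_measurable => y; apply: continuous_comp; last exact: sqrt_continuous.
exact: continuous_sqr_radius.
Qed.

(** A measurable function on the whole plane that coincides with [polar_angle] off the origin; the
    quotient by the radius is written with an exponential. *)
Definition angle' y : R :=
  let q := y.1 * expR (- lnr y) in if 0 <= y.2 then acos' q else 2 * pi - acos' q.

Lemma angle'E y : y <> (0, 0) -> angle' y = polar_angle y.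
Proof.
move=> y0; have r0 := polar_radius_gt0 y0.
rewrite /angle' /polar_angle expRN lnK ?posrE// acos'E//.
rewrite -ler_norml normrM (gtr0_norm (_ : 0 < (_)^-1)) ?invr_gt0// ler_pdivrMr// mul1r.
rewrite -(ler_pXn2r (ltn0Sn 1)) ?nnegrE ?sqrtr_ge0// polar_radius_sq.
by rewrite real_normK ?num_real// lerDl sqr_ge0.
Qed.

Lemma measurable_angle' : measurable_fun (setT : set T2) (angle' : T2 -> T1).
Proof.
have mq : measurable_fun (setT : set T2) (fun y : T2 => acos' (y.1 * expR (- lnr y)) : T1).
  apply: (measurableT_comp measurable_acos').
  apply: measurable_funM; first exact: measurable_fst.
  apply: (measurableT_comp (@measurable_expR R)).
  rewrite (_ : (fun _ => _) = fun y : T2 => -1 * lnr y); last by apply/funext => y; rewrite mulN1r.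
  by apply: measurable_funM; [exact: measurable_cst|exact: measurable_lnr].
apply: measurable_fun_ifT => //.
  by apply: measurable_fun_ler => //; exact: measurable_snd.
exact: measurable_funB.
Qed.

Lemma cmeas_if d (T : measurableType d) (b : T -> bool) (u v : T -> R[i]) :
  measurable_fun setT b -> cmeas setT u -> cmeas setT v ->
  cmeas setT (fun z => if b z then u z else v z).
Proof.
move=> mb [u1 u2] [v1 v2]; split.
  rewrite (_ : _ \o _ = fun z => if b z then (reC \o u) z else (reC \o v) z).
    exact: measurable_fun_ifT.
  by apply/funext => x /=; case: ifP.
rewrite (_ : _ \o _ = fun z => if b z then (imC \o u) z else (imC \o v) z).
  exact: measurable_fun_ifT.
by apply/funext => x /=; case: ifP.
Qed.

Lemma cmeas_comp (h : T2 -> T1) (u : R -> R[i]) : measurable_fun setT h ->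
  @cmeas _ T1 R setT u -> @cmeas _ T2 R setT (u \o h).
Proof.
move=> mh [u1 u2]; split.
  exact: (measurableT_comp u1 mh).
exact: (measurableT_comp u2 mh).
Qed.

Lemma measurable_I2pi : measurable (I2pi : set T1).
Proof. exact: measurable_itv. Qed.

Lemma cmeas_restrict (D : set T1) g : measurable D -> @cmeas _ T1 R D g ->
  @cmeas _ T1 R setT (fun w => if w \in D then g w else 0).
Proof.
move=> mD [g1 g2]; split.
  have := (measurable_restrictT (reC \o g) mD).1 g1.
  by congr measurable_fun; apply/funext => w; rewrite /patch /=; case: ifP.
have := (measurable_restrictT (imC \o g) mD).1 g2.
by congr measurable_fun; apply/funext => w; rewrite /patch /=; case: ifP.
Qed.

Lemma measurable_origin : measurable_fun (setT : set T2) (fun y : T2 => y == (0, 0)).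
Proof.
rewrite (_ : (fun _ => _) = fun y : T2 => (y.1 == 0) && (y.2 == 0)).
  apply: measurable_and; apply: measurable_fun_eqr => //; exact: measurable_fst || exact: measurable_snd.
by apply/funext => -[y1 y2].
Qed.

Lemma sep_cmeas tau g : @cmeas _ T1 R setT tau -> @cmeas _ T1 R I2pi g ->
  @cmeas _ T2 R setT (sep tau g).
Proof.
move=> mt mg; have mg' := cmeas_restrict measurable_I2pi mg.
have mtl := cmeas_comp measurable_lnr mt.
(* Nothing is known of [g] outside the open interval [I2pi], while the angle takes the value 0; that
   ray is a branch of its own, where [g 0] is a constant. *)
have := cmeas_if measurable_origin (cmeas_cst setT 0)
  (cmeas_if (measurable_fun_eqr measurable_angle' (measurable_cst (0 : T1)))
    (cmeasM mtl (cmeas_cst setT (g 0)))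
    (cmeasM mtl (cmeas_comp measurable_angle' mg'))).
apply: cmeas_ext => y _; rewrite /sep; case: eqP => // y0.
rewrite angle'E//; case: eqP => [->//|a0] /=.
rewrite angle'E// ifT//; apply/mem_set; rewrite /I2pi /= in_itv/=.
have [/andP[h1 ->] _ _] := polar_angleP y0; rewrite andbT lt_neqAle h1 andbT.
by apply/eqP => h; exact: a0.
Qed.


Lemma ge0_sep_integral (F : R * R -> R) (a h : R -> R) :
  (forall t w, I2pi w -> F (pol t w) = a t * h w) ->
  measurable_fun (setT : set T2) (F : T2 -> T1) -> (forall y, 0 <= F y) ->
  (forall t, 0 <= a t) -> (forall w, 0 <= h w) ->
  leb.-integrable setT (fun t => (a t * expR (2 * t))%:E) ->
  leb.-integrable I2pi (EFin \o h) ->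
  leb2.-integrable (setT : set T2) (EFin \o F) /\
  Rintegral leb2 (setT : set T2) F =
    Rintegral leb setT (fun t => a t * expR (2 * t)) * Rintegral leb I2pi h.
Proof.
move=> FE mF F0 a0 h0 ia ih.
pose A := Rintegral leb setT (fun t => a t * expR (2 * t)); pose H := Rintegral leb I2pi h.
rewrite -/A -/H.
have A0 : 0 <= A by apply: Rintegral_ge0 => t _; rewrite mulr_ge0 ?expR_ge0.
have EA : (\int[leb]_t (a t * expR (2 * t))%:E)%E = A%:E.
  by rewrite /A /Rintegral fineK//; exact: integrable_fin_num ia.
have EH : (\int[leb]_(w in I2pi) (h w)%:E)%E = H%:E.
  by rewrite /H /Rintegral fineK//; apply: integrable_fin_num ih; exact: measurable_I2pi.
have key : (\int[leb2]_y (F y)%:E)%E = (A * H)%:E.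
  rewrite (@ge0_integral_polar R (fun y => (F y)%:E)); last 2 first.
  - exact/measurable_EFinP.
  - by move=> y; rewrite lee_fin.
  transitivity (\int[leb]_(w in I2pi) (A%:E * (h w)%:E))%E; last first.
    rewrite ge0_integralZl//=; first by rewrite EH EFinM.
    + exact: measurable_I2pi.
    + by have /integrableP[] := ih.
    + by move=> w _; rewrite lee_fin.
  apply: eq_integral => w /set_mem Iw; rewrite /ang_int -EA.
  transitivity (\int[leb]_t ((h w)%:E * (a t * expR (2 * t))%:E))%E.
    by apply: eq_integral => t _; rewrite FE// -!EFinM; congr EFin; ring.
  rewrite ge0_integralZl//=; first by rewrite muleC.
  + by have /integrableP[] := ia.
  + by move=> t _; rewrite lee_fin mulr_ge0 ?expR_ge0.
  + by rewrite lee_fin.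
split; last by rewrite /Rintegral key.
apply/integrableP; split; first exact/measurable_EFinP.
have -> : (\int[leb2]_y `|(EFin \o F) y|)%E = (\int[leb2]_y (F y)%:E)%E.
  by apply: eq_integral => y _; rewrite /= ger0_norm.
by rewrite key ltry.
Qed.

(** The square of the added factor is the Jacobian e^(2t), so a planar L2 norm becomes a plain L2
    norm on the line. *)
Definition expw tau : R -> R[i] := fun t => tau t * (expR t)%:C.

Lemma expR_cmeas D (c : R) : measurable D -> @cmeas _ T1 R D (fun t => (expR (c * t))%:C).
Proof.
move=> mD; apply: cmeas_real; apply: (@measurable_funS _ _ _ _ setT) => //.
by apply: (measurableT_comp (@measurable_expR R)); apply: measurable_funM.
Qed.

Lemma expw_cmeas tau : @cmeas _ T1 R setT (expw tau) -> @cmeas _ T1 R setT tau.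
Proof.
move=> h; have := cmeasM h (expR_cmeas (-1) measurableT); apply: cmeas_ext => t _.
rewrite /expw -mulrA -rmorphM /= -expRD mulN1r subrr expR0.
by rewrite -[X in _ * X]/(1 : R[i]) mulr1.
Qed.

Lemma sep_L2 tau g : @L2 _ T1 R leb setT (expw tau) -> @L2 _ T1 R leb I2pi g ->
  @L2 _ T2 R leb2 setT (sep tau g) /\
  sqn leb2 (setT : set T2) (sep tau g) = sqn leb setT (expw tau) * sqn leb I2pi g.
Proof.
move=> [mt it] [mg ig]; have ms := sep_cmeas (expw_cmeas mt) mg.
have eA t : cabs (expw tau t) ^+ 2 = cabs (tau t) ^+ 2 * expR (2 * t).
  rewrite cabsM exprMn cabs_real ger0_norm ?expR_ge0//; congr (_ * _).
  by rewrite mulr_natl mulr2n expRD expr2.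
have [|||||||i e] := @ge0_sep_integral (fun y => cabs (sep tau g y) ^+ 2)
  (fun t => cabs (tau t) ^+ 2) (fun w => cabs (g w) ^+ 2).
- by move=> t w Iw; rewrite sep_polI// cabsM exprMn.
- by apply: measurable_funX; exact: (measurable_cabs _ ms).
- by move=> y; exact: sqr_ge0.
- by move=> y; exact: sqr_ge0.
- by move=> y; exact: sqr_ge0.
- by move: it; congr integrable; apply/funext => t /=; rewrite eA.
- by [].
split; first by split.
by rewrite /sqn e; congr (_ * _); apply: eq_Rintegral => t _; rewrite eA.
Qed.

(** The positive and negative parts of the real and imaginary parts, numbered so that z is the sum
    of the i^k [part k z]. *)
Definition part (k : 'I_4) (z : R[i]) : R :=
  match val k with
  | 0 => Num.max (reC z) 0 | 1 => Num.max (imC z) 0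
  | 2 => Num.max (- reC z) 0 | _ => Num.max (- imC z) 0 end.

Lemma partE z : z = \sum_(k < 4) 'i ^+ k * (part k z)%:C.
Proof.
rewrite !big_ord_recr big_ord0 /= add0r /part /= expr0 expr1 mul1r sqr_i exprS sqr_i.
have mx (x : R) : x = Num.max x 0 - Num.max (- x) 0.
  by have [h|h] := leP x 0; [rewrite max_l|rewrite max_r]; lra.
apply: ceqP; rewrite !(reCD, imCD, reCM, imCM) /=.
  by rewrite {1}(mx (reC z)); ring.
by rewrite {1}(mx (imC z)); ring.
Qed.

Lemma part_ge0 k z : 0 <= part k z.
Proof. by case: k => -[|[|[|[|//]]]] h; rewrite /part /= le_max lexx orbT. Qed.

Lemma part_le k z : part k z <= cabs z.
Proof.
have h1 := reC_le z; have h2 := imC_le z.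
have h3 := ler_norm (reC z); have h4 := ler_norm (imC z).
have h5 := ler_norm (- reC z); have h6 := ler_norm (- imC z); rewrite !normrN in h5 h6.
by case: k => -[|[|[|[|//]]]] h; rewrite /part /= ge_max cabs_ge0 andbT; lra.
Qed.

Lemma part_meas d (T : measurableType d) (D : set T) k (f : T -> R[i]) : measurable D ->
  cmeas D f -> measurable_fun D (fun z => part k (f z)).
Proof.
move=> mD [f1 f2].
have mN (h : T -> R) : measurable_fun D h -> measurable_fun D (fun z => - h z).
  move=> mh; rewrite (_ : (fun _ => _) = fun z => -1 * h z); last by apply/funext => z; rewrite mulN1r.
  by apply: measurable_funM => //; exact: measurable_cst.
by case: k => -[|[|[|[|//]]]] h; rewrite /part /=; apply: measurable_maxr => //; exact: mN || exact: measurable_cst.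
Qed.

(** Expanding both factors into their four nonnegative parts leaves sixteen products, to each of
    which the formula for nonnegative functions applies. *)
Lemma sep_cint tau g : cintegrable leb setT (fun t => tau t * (expR (2 * t))%:C) ->
  cintegrable leb I2pi g ->
  cintegrable leb2 (setT : set T2) (sep tau g) /\
  cint leb2 (setT : set T2) (sep tau g) =
    cint leb setT (fun t => tau t * (expR (2 * t))%:C) * cint leb I2pi g.
Proof.
move=> it ig; have mt2 := cintegrable_meas it; have mg := cintegrable_meas ig.
have mt : @cmeas _ T1 R setT tau.
  have := cmeasM mt2 (expR_cmeas (- 2) measurableT); apply: cmeas_ext => t _.
  rewrite -mulrA -rmorphM /= -expRD mulNr subrr expR0.
  by rewrite -[X in _ * X]/(1 : R[i]) mulr1.
pose a k t := part k (tau t); pose h k w := part k (g w).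
have ia k : leb.-integrable setT (fun t => (a k t * expR (2 * t))%:E).
  have := integrable_cabs measurableT it.
  apply: le_integrable => //; last first.
    move=> t _ /=; rewrite lee_fin ger0_norm ?mulr_ge0 ?part_ge0 ?expR_ge0//.
    rewrite ger0_norm ?cabs_ge0// cabsM cabs_real ger0_norm ?expR_ge0//.
    by rewrite ler_wpM2r ?expR_ge0 ?part_le.
  apply/measurable_EFinP; apply: measurable_funM; first exact: part_meas.
  by apply: (measurableT_comp (@measurable_expR R)); apply: measurable_funM.
have ih k : leb.-integrable I2pi (EFin \o h k).
  have := integrable_cabs measurable_I2pi ig.
  apply: le_integrable; first exact: measurable_I2pi.
    by apply/measurable_EFinP; apply: part_meas => //; exact: measurable_I2pi.
  by move=> w _ /=; rewrite lee_fin !ger0_norm ?part_ge0 ?cabs_ge0 ?part_le.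
pose S k l : R * R -> R[i] := sep (fun t => (a k t)%:C) (fun w => (h l w)%:C).
have cr (D : set T1) (u : T1 -> R) : measurable D -> leb.-integrable D (EFin \o u) ->
    cintegrable leb D (fun x => (u x)%:C).
  by move=> mD iu; split=> //=; have [] := cintegrable0 leb D.
have cc (D : set T1) (u : T1 -> R) : cint leb D (fun x => (u x)%:C) = (Rintegral leb D u)%:C.
  rewrite /cint; congr Complex.
  by rewrite (_ : imC \o _ = fun=> 0)// /Rintegral (eq_integral (cst 0%E))// integral0.
have SE k l : cintegrable leb2 (setT : set T2) (S k l) /\
    cint leb2 (setT : set T2) (S k l) =
    cint leb setT (fun t => (a k t * expR (2 * t))%:C) * cint leb I2pi (fun w => (h l w)%:C).
  have [|||||||i e] := @ge0_sep_integral (reC \o S k l) (a k) (h l).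
  - by move=> t w Iw; rewrite /= /S sep_polI// -rmorphM.
  - have [] : @cmeas _ T2 R setT (S k l); last by [].
    apply: sep_cmeas; apply: cmeas_real; apply: part_meas => //; exact: measurable_I2pi.
  - by move=> y; rewrite /= /S /sep; case: eqP => // _; rewrite -rmorphM /= mulr_ge0 ?part_ge0.
  - by move=> t; exact: part_ge0.
  - by move=> t; exact: part_ge0.
  - exact: ia.
  - exact: ih.
  have Sr : S k l = fun y => (reC (S k l y))%:C.
    by apply/funext => y; rewrite /S /sep; case: eqP => // _; rewrite -rmorphM.
  split.
    by rewrite Sr; split=> //=; have [] := cintegrable0 leb2 (setT : set T2).
  rewrite !cc -rmorphM /= -e Sr /cint; congr Complex.
  by rewrite (_ : imC \o _ = fun=> 0)// /Rintegral (eq_integral (cst 0%E))// integral0.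
have sE y : sep tau g y = \sum_(k < 4) \sum_(l < 4) ('i ^+ k * 'i ^+ l) * S k l y.
  rewrite /S /sep; case: eqP => y0.
    by rewrite big1// => k _; rewrite big1// => l _; rewrite mulr0.
  rewrite [tau _]partE [g _]partE mulr_suml; apply: eq_bigr => k _.
  rewrite mulr_sumr; apply: eq_bigr => l _; rewrite /a /h; ring.
have iS (k l : 'I_4) : cintegrable leb2 (setT : set T2) (fun y => ('i ^+ k * 'i ^+ l) * S k l y).
  by apply: cintegrableZ => //; case: (SE k l).
have iS2 (k : 'I_4) : cintegrable leb2 (setT : set T2) (fun y => \sum_(l < 4) ('i ^+ k * 'i ^+ l) * S k l y).
  by apply: cintegrable_sum.
have -> : sep tau g = fun y => \sum_(k < 4) \sum_(l < 4) ('i ^+ k * 'i ^+ l) * S k l y by exact/funext.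
split; first by apply: cintegrable_sum.
rewrite cint_sum//.
have -> : cint leb setT (fun t => tau t * (expR (2 * t))%:C) =
    \sum_(k < 4) 'i ^+ k * cint leb setT (fun t => (a k t * expR (2 * t))%:C).
  rewrite -cint_sumZ//; last first.
    by move=> k _; exact: (cr setT (fun t => a k t * expR (2 * t)) measurableT (ia k)).
  apply: cint_ext => t _; rewrite {1}[tau t]partE mulr_suml; apply: eq_bigr => k _.
  by rewrite rmorphM mulrA.
have -> : cint leb I2pi g = \sum_(l < 4) 'i ^+ l * cint leb I2pi (fun w => (h l w)%:C).
  have mI := measurable_I2pi; rewrite -cint_sumZ//; last by move=> k _; exact: (cr I2pi (h k) mI (ih k)).
  by apply: cint_ext => w _; rewrite {1}[g w]partE.
rewrite mulr_suml; apply: eq_bigr => k _; rewrite cint_sum// mulr_sumr.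
apply: eq_bigr => l _; rewrite cintZ//; last by case: (SE k l).
by have [_ ->] := SE k l; ring.
Qed.

(** The sector over a null set of angles is null by integration in polar coordinates. The origin and
    the ray of angle 0 are thrown into the exceptional set, so that the angle can be taken in
    [I2pi]. *)
Lemma sep_ae (P : R -> Prop) : {ae leb, forall w, I2pi w -> P w} ->
  {ae leb2, forall y : T2, y <> (0, 0) /\ I2pi (polar_angle y) /\ P (polar_angle y)}.
Proof.
move=> [N [mN N0 hN]].
pose b (y : T2) : bool := [|| y == (0, 0), angle' y == 0 | angle' y \in N].
have mb : measurable_fun (setT : set T2) b.
  apply: measurable_or; first exact: measurable_origin.
  apply: measurable_or; first exact: (measurable_fun_eqr measurable_angle' (measurable_cst (0 : T1))).
  apply: (measurable_fun_bool true); rewrite setTI.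
  have := measurable_angle' measurableT mN; rewrite setTI; congr measurable.
  by apply/seteqP; split=> y /= h; [exact/mem_set|exact/set_mem].
have mB : measurable (b @^-1` [set true]).
  by have := mb measurableT [set true]; rewrite setTI; apply.
exists (b @^-1` [set true]); split=> //; last first.
  move=> y /=; apply: contra_notP => /negP/negbTE; rewrite /b => /norP[/eqP y0 /norP[a0 aN]].
  rewrite angle'E// in a0 aN.
  have [/andP[h1 h2] _ _] := polar_angleP y0.
  have Iy : I2pi (polar_angle y) by rewrite /I2pi /= in_itv/= h2 andbT lt_neqAle h1 eq_sym a0.
  split=> //; split=> //; apply: contrapT => nP; move/negP: aN; apply.
  by apply/mem_set/hN => /= /(_ Iy).
transitivity (\int[leb2]_y (\1_(b @^-1` [set true]) y)%:E)%E.
  by rewrite integral_indic// setIT.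
rewrite (@ge0_integral_polar R (fun y => (\1_(b @^-1` [set true]) y)%:E)); last 2 first.
- by apply/measurable_EFinP; exact: measurable_indic.
- by move=> y; rewrite lee_fin indicE.
rewrite (ae_eq_integral (cst 0%E)) ?integral0//.
- exact: measurable_I2pi.
- apply: measurable_funTS; apply: measurable_ang_int => //.
  by apply/measurable_EFinP; exact: measurable_indic.
- exists N; split=> // w /= /not_implyP[Iw h]; apply: contrapT => nN; apply: h.
  rewrite /ang_int integral0_eq// => t _.
  rewrite indicE memNset ?mul0e// /= /b.
  have p0 := @pol_neq0 R t w; rewrite angle'E// polar_angle_pol//.
  case: eqP => //= _; case: eqP => [w0|_] /=.
    by move: Iw; rewrite w0 /I2pi /= in_itv/= ltxx.
  by move/set_mem.
Qed.

End SeparatedMeasurability.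

(** * Sobolev spaces on the circle *)

Section LineIntegrals.
Context {R : realType}.
Notation T1 := (measurableTypeR R).
Implicit Types (t x M : R) (f g chi tau : R -> R[i]).

(** Only the derivative has to vanish far out, so the lemma also covers smooth steps, whose values
    at the two ends differ. *)
Lemma int_derive (F G : R -> R) M : 0 < M -> (forall t, is_derive t (1 : R) F (G t)) ->
  continuous G -> (forall t, M <= `|t| -> G t = 0) ->
  Rintegral leb setT G = F M - F (- M).
Proof.
move=> M0 dF cG out.
have out0 t : ~ `[- M, M]%classic t -> G t = 0.
  move=> h; apply: out; rewrite leNgt; apply/negP => h'; apply: h.
  by rewrite /= in_itv/= -ler_norml ltW.
rewrite Rintegral_mkcond.
transitivity (Rintegral leb `[- M, M]%classic G).
  rewrite [RHS]Rintegral_mkcond; apply: eq_Rintegral => t _; rewrite /patch in_setT.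
  by case: ifPn => // /negP h; apply: out0 => ht; apply: h; exact/mem_set.
rewrite /Rintegral; have -> : (\int[leb]_(t in `[(- M)%R, M]) (G t)%:E)%E = ((F M)%:E - (F (- M))%:E)%E; last by [].
rewrite (continuous_FTC2 (F := F)) => //.
- by rewrite gtrN.
- exact: continuous_subspaceT.
- split.
  + by move=> s _; case: (dF s).
  + apply: cvg_at_right_filter; apply: differentiable_continuous.
    by apply/derivable1_diffP; case: (dF (- M)).
  + apply: cvg_at_left_filter; apply: differentiable_continuous.
    by apply/derivable1_diffP; case: (dF M).
- by move=> s _; rewrite derive1E; have [_ ->] := dF s.
Qed.

Lemma cint_derive tau M : smooth tau -> 0 < M -> (forall t, M <= `|t| -> cderive1 tau t = 0) ->
  cint leb setT (cderive1 tau) = tau M - tau (- M).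
Proof.
move=> st M0 out; have sd := smooth_derive st.
apply: ceqP; rewrite /cint /=.
- rewrite reCD reCN; apply: (int_derive (F := reC \o tau) M0).
  + by move=> t; have [] := smoothE t st.
  + by move=> t; have [] := smooth_continuous t sd.
  + by move=> t /out h; rewrite /comp h.
- rewrite imCD imCN; apply: (int_derive (F := imC \o tau) M0).
  + by move=> t; have [] := smoothE t st.
  + by move=> t; have [] := smooth_continuous t sd.
  + by move=> t /out h; rewrite /comp h.
Qed.

Lemma cint_derive0 tau : csm tau -> cint leb setT (cderive1 tau) = 0.
Proof.
move=> ct; have [st [M M0 hM]] := ct; have [sd [M' M0' hM']] := cderive1_supp ct.
have N0 : 0 < Num.max M M' by rewrite lt_max M0.
rewrite (cint_derive st N0) => [|t]; last by rewrite ge_max => /andP[_ /hM'].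
by rewrite !hM ?subrr// ?normrN gtr0_norm// le_max lexx.
Qed.

Lemma smooth_bounded f M : smooth f -> exists C : R, forall t, `|t| <= M -> cabs (f t) <= C.
Proof.
move=> sf; have b (h : R -> R) : continuous h -> exists C : R, forall t, `|t| <= M -> `|h t| <= C.
  move=> ch; have : compact (h @` `[- M, M]%classic).
    by apply: continuous_compact; [exact: continuous_subspaceT|exact: segment_compact].
  move=> /compact_bounded[N [_ hN]]; exists (`|N| + 1) => t tM.
  apply: hN; last by exists t; rewrite //= in_itv/= -ler_norml.
  by rewrite (le_lt_trans (ler_norm N)) ?ltrDl.
have [|C1 h1] := b (reC \o f); first by move=> t; have [] := smooth_continuous t sf.
have [|C2 h2] := b (imC \o f); first by move=> t; have [] := smooth_continuous t sf.
exists (C1 + C2) => t tM; apply: (le_trans (cabs_le _)).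
by apply: lerD; [exact: h1|exact: h2].
Qed.

Lemma csm_bounded tau : csm tau -> exists C : R, forall t, cabs (tau t) <= C.
Proof.
move=> [st [M M0 hM]]; have [C hC] := smooth_bounded M st; exists C => t.
have [/hC//|/ltW/hM ->] := leP `|t| M.
by rewrite cabs0 (le_trans (cabs_ge0 (tau 0)))// hC// normr0 ltW.
Qed.

Lemma cintegrable_cst (a b : R) (z : R[i]) : cintegrable leb `[a, b]%classic (fun=> z).
Proof.
have fin : (leb `[a, b]%classic < +oo)%E.
  by rewrite /leb /= lebesgue_measure_itv/=; case: ifP => // _; rewrite -EFinB ltry.
split; apply: measurable_bounded_integrable => //; try exact: measurable_cst.
  by exists `|reC z|; split; [rewrite num_real|move=> C hC t _ /=; exact: ltW].
by exists `|imC z|; split; [rewrite num_real|move=> C hC t _ /=; exact: ltW].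
Qed.

Lemma smooth_cintegrable f (a b : R) : smooth f -> cintegrable leb `[a, b]%classic f.
Proof.
move=> sf; have [C hC] := smooth_bounded (`|a| + `|b|) sf.
have mf : @cmeas _ T1 R `[a, b]%classic f by exact: smooth_cmeas.
have H := @cintegrable_bounded _ T1 R leb `[a, b]%classic (fun=> 1) f C (measurable_itv `[a, b]) mf _
  (cintegrable_cst a b 1).
apply: (@cintegrable_ext _ T1 R leb `[a, b]%classic (fun x => 1 * f x) f _ (measurable_itv `[a, b]) (H _)) => [t _|t].
  by rewrite mul1r.
rewrite /= in_itv/= => /andP[h1 h2]; apply: hC; rewrite ler_norml.
have := ler_norm a; have := ler_norm b; have := ler_norm (- a); have := ler_norm (- b).
have := normr_ge0 a; have := normr_ge0 b.
rewrite !normrN => *; apply/andP; split; lra.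
Qed.

Lemma csm_cintegrable tau : csm tau -> cintegrable leb setT tau.
Proof.
move=> [st [M M0 hM]].
apply: (@cintegrable_supp _ T1 R leb setT `[- M, M]%classic) => //.
  move=> t h; apply: hM; rewrite leNgt; apply/negP => h'; apply: h.
  by rewrite /= in_itv/= -ler_norml ltW.
exact: smooth_cintegrable.
Qed.

Lemma line_ibp f tau : smooth f -> csm tau ->
  cint leb setT (fun t => f t * cderive1 tau t) = - cint leb setT (fun t => cderive1 f t * tau t).
Proof.
move=> sf ct; apply/eqP; rewrite -addr_eq0 -cintD//; last 2 first.
- by apply/csm_cintegrable/csmM => //; exact: cderive1_supp.
- by apply/csm_cintegrable/csmM => //; exact: smooth_derive.
rewrite -(cint_derive0 (csmM sf ct)) cderive1M//; last by case: ct.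
by apply/eqP/cint_ext => t _; rewrite addrC.
Qed.

Lemma line_ibp_iter j f tau : smooth f -> csm tau ->
  cint leb setT (fun t => f t * iter j cderive1 tau t) =
  (-1) ^+ j * cint leb setT (fun t => iter j cderive1 f t * tau t).
Proof.
have csi n : forall g, csm g -> csm (iter n cderive1 g).
  by move=> g cg; elim: n => //= n; exact: cderive1_supp.
move=> sf ct; elim: j f sf => [|j ih] f sf; first by rewrite mul1r.
rewrite [LHS](line_ibp sf (csi j _ ct)) ih; last exact: smooth_derive.
by rewrite exprS mulN1r mulNr -iterSr.
Qed.

Lemma test1_csm chi : test1 chi -> csm chi.
Proof.
move=> [/smooth1P sc [K [cK KI K0]]]; split=> //; exists (2 * pi) => [|t ht]; first exact: pi2_gt0.
apply: K0 => /KI; rewrite /I2pi /= in_itv/= => /andP[h1 h2].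
by move: ht; rewrite gtr0_norm// leNgt h2.
Qed.

Lemma test1M f chi : smooth f -> test1 chi -> test1 (fun x => f x * chi x).
Proof.
move=> sf [/smooth1P sc [K [cK KI K0]]]; split; first by apply/smooth1P; exact: smoothM.
by exists K; split=> // x /K0 ->; rewrite mulr0.
Qed.

Lemma test1_derive chi : test1 chi -> test1 (cderive1 chi).
Proof.
move=> [/smooth1P sc [K [cK KI K0]]]; split; first by apply/smooth1P; exact: smooth_derive.
exists K; split=> // x Kx; rewrite (near_cderive1 (g := fun=> 0)); first by rewrite (is_cdE (is_cd_cst x 0)).
have : open (~` K) by apply: closed_openC; apply: compact_closed => //; exact: Rhausdorff.
by move=> /(_ x Kx); apply: filterS => z /K0 ->.
Qed.

Lemma test1_iter j chi : test1 chi -> test1 (iter j cderive1 chi).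
Proof. by move=> tc; elim: j => //= j; exact: test1_derive. Qed.

Lemma test1_out chi x : test1 chi -> ~ I2pi x -> chi x = 0.
Proof. by move=> [_ [K [_ KI K0]]] nI; apply: K0 => /KI. Qed.

Lemma smooth_locint1 f : smooth f -> locint1 f.
Proof.
move=> sf K cK KI.
apply: (@cintegrableS _ T1 R leb K `[0, 2 * pi]%classic f) => //.
- by apply: closed_measurable; apply: compact_closed => //; exact: Rhausdorff.
- by move=> x /KI; rewrite /I2pi /= !in_itv/= => /andP[/ltW -> /ltW ->].
- exact: smooth_cintegrable.
Qed.

Lemma smooth_weakD1 j f : smooth f -> is_weakD1 j f (iter j cderive1 f).
Proof.
move=> sf; split; [exact: smooth_locint1|by apply: smooth_locint1; exact: smooth_iter|].
move=> chi tc.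
have E (g h : R -> R[i]) : test1 h ->
    cint leb I2pi (fun x => g x * h x) = cint leb setT (fun x => g x * h x).
  move=> th; apply/esym/cint_supp => // x nI; by rewrite (test1_out th nI) mulr0.
by rewrite !E//; [apply: line_ibp_iter => //; exact: test1_csm|exact: test1_iter].
Qed.

End LineIntegrals.

(** * Weak derivatives on the circle and density of smooth periodic functions *)

Section CircleSobolev.
Context {R : realType}.
Notation T1 := (measurableTypeR R).
Implicit Types (t x M : R) (f g h phi chi tau : R -> R[i]).

Lemma test1_bounded chi : test1 chi -> exists C : R, forall x, cabs (chi x) <= C.
Proof. by move=> /test1_csm/csm_bounded. Qed.

Lemma test1_cmeas D chi : measurable D -> test1 chi -> @cmeas _ T1 R D chi.
Proof. by move=> mD /test1_csm[sc _]; exact: smooth_cmeas. Qed.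

Lemma test1_integrable g chi : locint1 g -> test1 chi ->
  cintegrable leb I2pi (fun x => g x * chi x).
Proof.
move=> lg tc; have [C hC] := test1_bounded tc; have [sc [K [cK KI K0]]] := tc.
have mK : measurable (K : set T1) by apply: closed_measurable; apply: compact_closed => //; exact: Rhausdorff.
apply: (@cintegrable_supp _ T1 R leb I2pi K) => //.
- exact: measurable_I2pi.
- by move=> x /K0 ->; rewrite mulr0.
apply: (@cintegrable_bounded _ T1 R leb K g chi C) => //.
  exact: test1_cmeas.
exact: lg.
Qed.

Lemma locint1_cmeas g : locint1 g -> @cmeas _ T1 R I2pi g.
Proof.
move=> lg; pose D n : set T1 := `[n.+1%:R^-1, 2 * pi - n.+1%:R^-1]%classic.
have DI n : D n `<=` I2pi.
  move=> x; rewrite /D /I2pi /= !in_itv/= => /andP[h1 h2].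
  have n0 : 0 < (n.+1%:R^-1 : R) by rewrite invr_gt0.
  by rewrite (lt_le_trans n0 h1) (le_lt_trans h2)// gtrBl.
have cover : I2pi = \bigcup_n D n.
  apply/seteqP; split=> [x|x [n _ /DI]//].
  rewrite /I2pi /= in_itv/= => /andP[x0 xpi].
  have m0 : 0 < Num.min x (2 * pi - x) by rewrite lt_min x0 subr_gt0.
  exists (Num.bound (Num.min x (2 * pi - x))^-1) => //=.
  set k := Num.bound _; have : (k.+1%:R^-1 : R) < Num.min x (2 * pi - x).
    rewrite invf_plt ?posrE//; apply: lt_trans (_ : k%:R < _); last by rewrite ltr_nat.
    by apply: archi_boundP; rewrite invr_ge0 ltW.
  rewrite lt_min /D /= in_itv/= => /andP[h1 h2].
  by rewrite (ltW h1) /= lerBrDr -lerBrDl ltW.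
have mD n : @cmeas _ T1 R (D n) g.
  by apply: cintegrable_meas; apply: lg; [exact: segment_compact|exact: DI].
rewrite cover; split; apply/measurable_fun_bigcup => n; try exact: measurable_itv.
  by have [] := mD n.
by have [] := mD n.
Qed.

Lemma locint1D f g z : locint1 f -> locint1 g -> locint1 (fun x => f x + z * g x).
Proof.
move=> lf lg K cK KI.
have mK : measurable (K : set T1) by apply: closed_measurable; apply: compact_closed => //; exact: Rhausdorff.
by apply: cintegrableD => //; [exact: lf|apply: cintegrableZ => //; exact: lg].
Qed.

Lemma weakD1P j phi : (exists g, is_weakD1 j phi g) -> is_weakD1 j phi (weakD1 j phi).
Proof. by move=> [g hg]; apply: (xgetI (fun=> 0) hg). Qed.

(** By the fundamental lemma a weak derivative is unique almost everywhere, so the one picked by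
    [weakD1] may be exchanged for any other. *)
Lemma weakD1_uniq j phi g h : is_weakD1 j phi g -> is_weakD1 j phi h -> eq2pi g h.
Proof.
move=> [lp lg eg] [_ lh eh].
have : zero2pi (fun x => g x + -1 * h x).
  apply: weak_unique1; first exact: locint1D.
  move=> chi tc; have := eg chi tc; rewrite eh// => /(mulrI _) e.
  rewrite (_ : cint _ _ _ = cint leb I2pi (fun x => g x * chi x) +
      -1 * cint leb I2pi (fun x => h x * chi x)).
    by rewrite e ?mulN1r ?subrr// unitfE expf_neq0// oppr_eq0 oner_eq0.
  have mI := @measurable_I2pi R.
  rewrite -cintZ//; last exact: test1_integrable.
  rewrite -cintD//; [|exact: test1_integrable|by apply: cintegrableZ => //; exact: test1_integrable].
  by apply: cint_ext => x _; rewrite mulrDl mulrA.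
by apply: ae_imp => x hx /hx /eqP; rewrite mulN1r subr_eq0 => /eqP.
Qed.

Lemma is_weakD1D j z phi psi g h : is_weakD1 j phi g -> is_weakD1 j psi h ->
  is_weakD1 j (fun x => phi x + z * psi x) (fun x => g x + z * h x).
Proof.
move=> [lp lg eg] [lq lh eh]; split; [exact: locint1D|exact: locint1D|] => chi tc.
have mI := @measurable_I2pi R; have tj := test1_iter j tc.
have L f f' c : locint1 f -> locint1 f' -> test1 c ->
    cint leb I2pi (fun x => (f x + z * f' x) * c x) =
    cint leb I2pi (fun x => f x * c x) + z * cint leb I2pi (fun x => f' x * c x).
  move=> lf lf' tc'; rewrite -cintZ//; last exact: test1_integrable.
  rewrite -cintD//; [|exact: test1_integrable|by apply: cintegrableZ => //; exact: test1_integrable].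
  by apply: cint_ext => x _; rewrite mulrDl mulrA.
by rewrite !L// eg// eh//; ring.
Qed.

Lemma is_weakD1_0 phi : locint1 phi -> is_weakD1 0 phi phi.
Proof. by move=> lp; split=> // chi tc; rewrite mul1r. Qed.

Lemma Wnorm_comp s phi j : (j <= s)%N ->
  (\int[leb]_(x in I2pi) (sqnorm (Domega j phi x))%:E <=
   \sum_(j < s.+1) \int[leb]_(x in I2pi) (sqnorm (Domega j phi x))%:E)%E.
Proof.
move=> js; have p0 (k : nat) : (0 <= \int[leb]_(x in I2pi) (sqnorm (Domega k phi x))%:E)%E.
  by apply: integral_ge0 => x _; rewrite lee_fin sqnorm_ge0.
rewrite (bigD1 (Ordinal (js : (j < s.+1)%N)))//= leeDl//.
by apply: sume_ge0 => k _.
Qed.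

Lemma poweR_half (x : \bar R) (e : R) : (0 <= x)%E -> 0 <= e -> (x `^ 2^-1 <= e%:E)%E ->
  (x <= (e ^+ 2)%:E)%E.
Proof.
move=> x0 e0 h; rewrite -[x]poweRe1// -[X in (_ `^ X)%E](@mulVf _ (2 : R)) ?pnatr_eq0//.
rewrite poweRrM; apply: (le_trans (gt0_ler_poweR _ _ _ h)) => //.
- by rewrite in_itv/= poweR_ge0 leey.
- by rewrite in_itv/= lee_fin e0 leey.
by rewrite poweR_EFin lee_fin powR_mulrn.
Qed.

Lemma L2_fin (D : set T1) f : measurable D -> @cmeas _ T1 R D f ->
  (\int[leb]_(x in D) (sqnorm (f x))%:E < +oo)%E -> @L2 _ T1 R leb D f.
Proof.
move=> mD mf h; split=> //; apply/integrableP; split.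
  by apply/measurable_EFinP; apply: measurable_funX; exact: (measurable_cabs mD mf).
rewrite (_ : (\int[_]_(x in D) _ = \int[leb]_(x in D) (sqnorm (f x))%:E)%E)//.
by apply: eq_integral => x _; rewrite /= ger0_norm ?sqr_ge0// sqnormE.
Qed.

Lemma sqn_fin (D : set T1) f : measurable D -> @L2 _ T1 R leb D f ->
  (\int[leb]_(x in D) (sqnorm (f x))%:E = (sqn leb D f)%:E)%E.
Proof.
move=> mD [mf i]; rewrite /sqn /Rintegral fineK; last exact: integrable_fin_num i.
by apply: eq_integral => x _; rewrite /= sqnormE.
Qed.

Lemma W2pi_weakD1 s phi j : W2pi s phi -> (j <= s)%N -> is_weakD1 j phi (weakD1 j phi).
Proof. by move=> [[h _] _] js; apply: weakD1P; exact: h. Qed.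

Lemma W2pi_L2 s phi j : W2pi s phi -> (j <= s)%N -> @L2 _ T1 R leb I2pi (Domega j phi).
Proof.
move=> hW js; have [_ lg _] := W2pi_weakD1 hW js; have mI := @measurable_I2pi R.
apply: L2_fin => //.
  by apply: cmeasM; [exact: cmeas_cst|exact: locint1_cmeas].
have [[_ fin] _] := hW; apply: (le_lt_trans (Wnorm_comp phi js)).
by apply: lty_poweRy fin; rewrite invr_eq0 pnatr_eq0.
Qed.

Lemma Domega_eq s phi j g : W2pi s phi -> (j <= s)%N -> is_weakD1 j phi g ->
  eq2pi (Domega j phi) (fun x => (- 'i) ^+ j * g x).
Proof.
move=> hW js hg; have := weakD1_uniq (W2pi_weakD1 hW js) hg.
by apply: ae_imp => x h Ix; rewrite /Domega h.
Qed.

Lemma L2_I2pi_smooth f : smooth f -> @L2 _ T1 R leb I2pi f.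
Proof.
move=> sm; have mI := @measurable_I2pi R; have [C hC] := smooth_bounded (2 * pi) sm.
have L1 : @L2 _ T1 R leb I2pi (fun=> 1).
  apply: L2_fin => //; first exact: cmeas_cst.
  rewrite (eq_integral (cst 1%E)); last by move=> x _; rewrite sqnormE cabs1 expr1n.
  rewrite integral_cst// mul1e /leb /= /I2pi lebesgue_measure_itv/=.
  by case: ifP => // _; rewrite -EFinB ltry.
have := @L2_bounded _ T1 R leb I2pi (fun=> 1) f C mI (smooth_cmeas mI sm) _ L1.
move=> h; apply: (L2_ext _ mI (h _)) => [x _|x]; first by rewrite mulr1.
rewrite /I2pi /= in_itv/= => /andP[h1 h2]; apply: hC.
by rewrite gtr0_norm// ltW.
Qed.

(** The Sobolev norm dominates every derivative up to order [s], so one smooth periodic function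
    approximates all of them at once. *)
Lemma W2pi_approx s phi : W2pi s phi -> exists f : nat -> R -> R[i],
  [/\ forall n, psm (f n),
      forall n j, (j <= s)%N -> @L2 _ T1 R leb I2pi (iter j Dt (f n)) &
      forall e, 0 < e -> exists n, forall j, (j <= s)%N ->
        sqn leb I2pi (fun x => iter j Dt (f n) x - Domega j phi x) <= e].
Proof.
move=> hW; have [_ [f [pf cf]]] := hW; have mI := @measurable_I2pi R.
have ps n : psm (f n) by exact/psmP.
have L n j : (j <= s)%N -> @L2 _ T1 R leb I2pi (iter j Dt (f n)).
  by move=> _; apply: L2_I2pi_smooth; apply: smooth_iter_Dt; case: (ps n).
exists f; split=> // e e0.
pose d := Num.sqrt e; have d0 : 0 < d by rewrite sqrtr_gt0.
have : \forall n \near \oo, (Wnorm s (fun x => (f n x - phi x)%R) < d%:E)%E.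
  have := cf; move/(_ [set y | (y < d%:E)%E]); apply.
  (* A neighbourhood of a finite extended real is by definition a neighbourhood of the real. *)
  change (nbhs (0 : R) (fun r : R => (r%:E < d%:E)%E)).
  by have := lt_nbhsl d0; apply: filterS => r; rewrite lte_fin.
move=> [N _ hN]; exists N => j js; have {}hN := hN N (leqnn N).
have X0 : (0 <= \sum_(j < s.+1) \int[leb]_(x in I2pi)
    (sqnorm (Domega j (fun x => f N x - phi x) x))%:E)%E.
  by apply: sume_ge0 => k _; apply: integral_ge0 => x _; rewrite lee_fin sqnorm_ge0.
have X1 := poweR_half X0 (ltW d0) (ltW hN).
have := le_trans (Wnorm_comp _ js) X1; rewrite sqr_sqrtr ?(ltW e0)//.
have wd : is_weakD1 j (fun x => f N x - phi x) (fun x => iter j cderive1 (f N) x - weakD1 j phi x).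
  have := is_weakD1D (-1) (smooth_weakD1 j (ps N).1) (W2pi_weakD1 hW js).
  by congr is_weakD1; apply/funext => x; rewrite mulN1r.
have ae : eq2pi (Domega j (fun x => f N x - phi x)) (fun x => iter j Dt (f N) x - Domega j phi x).
  have := weakD1_uniq (weakD1P (ex_intro _ _ wd)) wd; apply: ae_imp => x h Ix.
  by rewrite /Domega h// iter_DtE; [rewrite mulrBr|case: (ps N)].
have L2d : @L2 _ T1 R leb I2pi (fun x => iter j Dt (f N) x - Domega j phi x).
  by apply: L2B => //; [exact: L|exact: W2pi_L2 hW js].
rewrite (_ : (\int[_]_(x in _) _)%E = (\int[leb]_(x in I2pi)
    (sqnorm (iter j Dt (f N) x - Domega j phi x))%:E)%E).
  by rewrite (sqn_fin mI L2d) lee_fin.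
have mS g : @cmeas _ T1 R I2pi g -> measurable_fun (I2pi : set T1) (fun x => (sqnorm (g x))%:E).
  move=> mg; apply/measurable_EFinP.
  rewrite (_ : (fun _ => _) = fun x => cabs (g x) ^+ 2); last by apply/funext => x; rewrite sqnormE.
  by apply: measurable_funX; exact: (measurable_cabs mI mg).
apply: ae_eq_integral => //.
- apply: mS; apply: cmeasM; first exact: cmeas_cst.
  by apply: locint1_cmeas; have [] := weakD1P (ex_intro _ _ wd).
- by apply: mS; case: L2d.
by apply: ae_imp ae => x h /h ->.
Qed.

(** The density principle behind all identities with a Sobolev angular factor: a relation between
    the derivatives of smooth periodic functions survives the limit because each [T j] is Lipschitz
    in L2. No linearity of [T j] is asked for. *)
Lemma W2pi_density s n phi (T : nat -> (R -> R[i]) -> R[i]) (C : R) : W2pi s phi -> (n <= s)%N ->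
  (forall j g h, (j <= n)%N -> @L2 _ T1 R leb I2pi g -> @L2 _ T1 R leb I2pi h ->
    cabs (T j g - T j h) ^+ 2 <= C * sqn leb I2pi (fun x => g x - h x)) ->
  (forall f, psm f -> \sum_(j < n.+1) T j (iter j Dt f) = 0) ->
  \sum_(j < n.+1) T j (Domega j phi) = 0.
Proof.
move=> hW ns Tlip T0; have [f [pf Lf cf]] := W2pi_approx hW.
apply: cabs_eq0; apply/eqP; rewrite eq_le cabs_ge0 andbT; apply/ler_addgt0Pr => e e0.
(* Chosen so that each of the n + 1 differences is at most e / (n + 1). *)
pose d := e ^+ 2 / (n.+1%:R ^+ 2 * (`|C| + 1)).
have C0 : 0 < `|C| + 1 by rewrite ltr_wpDl.
have N0 : 0 < n.+1%:R :> R by rewrite ltr0n.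
have d0 : 0 < d by rewrite /d divr_gt0 ?mulr_gt0 ?exprn_gt0.
have [k hk] := cf d d0.
have -> : \sum_(j < n.+1) T j (Domega j phi) =
    \sum_(j < n.+1) (T j (iter j Dt (f k)) - T j (Domega j phi)) * -1.
  by rewrite -mulr_suml sumrB T0// sub0r mulrN1 opprK.
rewrite add0r; apply: (le_trans (ler_cabs_sum _ _ _)).
have -> : e = \sum_(j < n.+1) e / n.+1%:R.
  by rewrite sumr_const card_ord -[RHS]mulr_natr divfK// gt_eqF.
apply: ler_sum => j _; have jn : (j <= n)%N by rewrite -ltnS.
rewrite mulrN1 cabsN.
have js := leq_trans jn ns.
have q0 : 0 <= e / n.+1%:R by rewrite divr_ge0// ltW.
rewrite -(ler_pXn2r (ltn0Sn 1)) ?nnegrE ?cabs_ge0//.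
apply: (le_trans (Tlip j _ _ jn (Lf k j js) (W2pi_L2 hW js))).
have s0 := sqn_ge0 leb I2pi (fun x => iter j Dt (f k) x - Domega j phi x).
apply: (le_trans (_ : _ <= (`|C| + 1) * d)); last first.
  have -> : (`|C| + 1) * d = (e / n.+1%:R) ^+ 2; last by [].
  rewrite /d; move: (`|C| + 1) (n.+1%:R : R) C0 N0 => c N c0 N1.
  by field; rewrite (gt_eqF c0) (gt_eqF N1).
apply: (le_trans (_ : _ <= (`|C| + 1) * sqn leb I2pi (fun x => iter j Dt (f k) x - Domega j phi x))).
  by rewrite ler_wpM2r// (le_trans (ler_norm C))// lerDl.
by rewrite ler_wpM2l ?(ltW C0)// hk.
Qed.

End CircleSobolev.

(** * Relations between the members of a Jordan chain *)

Section PowerSeries.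
Context {R : realType}.
Implicit Types (x : R) (a b : nat -> R[i]) (S : R[i]).

(** Convergence of the power series with coefficients [a] at a real point. Root functions are only
    sampled at lam0 + x with x > 0 real, which is enough to separate Taylor coefficients. *)
Definition psc a x S := forall e : R, 0 < e -> exists N, forall n, (N <= n)%N ->
  cabs (\sum_(j < n) x%:C ^+ j * a j - S) <= e.

Lemma psc0 x : psc (fun=> 0) x 0.
Proof.
move=> e e0; exists 0%N => n _; rewrite big1 ?subr0 ?cabs0 ?ltW// => j _.
by rewrite mulr0.
Qed.

Lemma pscD a b x S S' : psc a x S -> psc b x S' -> psc (fun n => a n + b n) x (S + S').
Proof.
move=> ha hb e e0; have e2 : 0 < e / 2 by rewrite divr_gt0.
have [N hN] := ha _ e2; have [M hM] := hb _ e2; exists (maxn N M) => n.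
rewrite geq_max => /andP[/hN h1 /hM h2].
under eq_bigr do rewrite mulrDr; rewrite big_split /= opprD addrACA.
by apply: (le_trans (ler_cabsD _ _)); rewrite [leRHS](splitr e) lerD.
Qed.

Lemma pscZ a x S z : psc a x S -> psc (fun n => z * a n) x (z * S).
Proof.
move=> ha e e0; have c0 : 0 < cabs z + 1 by rewrite ltr_wpDl ?cabs_ge0.
have [N hN] := ha _ (divr_gt0 e0 c0); exists N => n /hN h.
under eq_bigr do rewrite mulrCA; rewrite -mulr_sumr -mulrBr cabsM.
apply: (le_trans (ler_wpM2l (cabs_ge0 z) h)).
rewrite mulrCA ler_piMr ?(ltW e0)// ler_pdivrMr// mul1r lerDl//.
Qed.

Lemma psc_shift a x S : psc a x S -> psc (fun n => if n is n'.+1 then a n' else 0) x (x%:C * S).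
Proof.
move=> ha e e0; have c0 : 0 < cabs x%:C + 1 by rewrite ltr_wpDl ?cabs_ge0.
have [N hN] := ha _ (divr_gt0 e0 c0); exists N.+1 => -[//|n] /hN h.
rewrite big_ord_recl /= mulr0 add0r.
have -> : \sum_(i < n) x%:C ^+ fintype.bump 0 i * a i = x%:C * \sum_(i < n) x%:C ^+ i * a i.
  by rewrite mulr_sumr; apply: eq_bigr => i _; rewrite /fintype.bump leq0n add1n exprS mulrA.
rewrite -mulrBr cabsM; apply: (le_trans (ler_wpM2l (cabs_ge0 _) h)).
rewrite mulrCA ler_piMr ?(ltW e0)// ler_pdivrMr// mul1r lerDl//.
Qed.

Lemma psc_sum I (r : seq I) (P : pred I) (a : I -> nat -> R[i]) x (S : I -> R[i]) :
  (forall i, P i -> psc (a i) x (S i)) ->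
  psc (fun n => \sum_(i <- r | P i) a i n) x (\sum_(i <- r | P i) S i).
Proof.
move=> h; elim: r => [|i r ih].
  rewrite big_nil (_ : (fun _ => _) = fun=> 0); first exact: psc0.
  by apply/funext => n; rewrite big_nil.
case Pi: (P i).
  rewrite big_cons Pi (_ : (fun _ => _) = fun n => a i n + \sum_(i <- r | P i) a i n).
    by apply: pscD => //; exact: h.
  by apply/funext => n; rewrite big_cons Pi.
rewrite big_cons Pi (_ : (fun _ => _) = fun n => \sum_(i <- r | P i) a i n)//.
by apply/funext => n; rewrite big_cons Pi.
Qed.

(** The coefficients are those of the product of the series with the binomial expansion of (l0 +
    x)^k. The induction on k multiplies by l0 + x and uses the Pascal rule. *)
Lemma psc_mul_power a x S (l0 : R[i]) k : psc a x S ->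
  psc (fun n => \sum_(i < n.+1) 'C(k, i)%:R * l0 ^+ (k - i) * a (n - i)%N) x ((l0 + x%:C) ^+ k * S).
Proof.
move=> ha; elim: k => [|k ih].
  rewrite mul1r (_ : (fun _ => _) = a)//; apply/funext => n.
  rewrite big_ord_recl /= big1 ?addr0 ?subn0 ?expr0 ?mul1r// => i _.
  by rewrite bin_small// !mul0r.
rewrite exprS -mulrA mulrDl.
have := pscD (pscZ l0 ih) (psc_shift ih); congr psc; apply/funext => n.
have bl i : l0 * ('C(k, i)%:R * l0 ^+ (k - i)) = 'C(k, i)%:R * l0 ^+ (k.+1 - i).
  have [ik|ki] := leqP i k; first by rewrite subSn// exprS; ring.
  by rewrite bin_small// !mul0r mulr0.
case: n => [|n].
  rewrite !big_ord_recl !big_ord0 !addr0 !subn0 !bin0 exprS; ring.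
rewrite big_ord_recl [in RHS]big_ord_recl mulrDr -addrA; congr (_ + _).
  by rewrite !bin0 !subn0 exprS; ring.
rewrite mulr_sumr -big_split /=; apply: eq_bigr => i _.
by rewrite /fintype.bump leq0n add1n mulrA bl binS natrD !subSS; ring.
Qed.

(** The extra term 2 q^n on the left is what makes the induction close, as q is at most 1/2. *)
Lemma geometric_tail (q : R) k n : 0 <= q <= 2^-1 -> (k <= n)%N ->
  \sum_(k <= j < n) q ^+ j + 2 * q ^+ n <= 2 * q ^+ k.
Proof.
move=> /andP[q0 q2]; elim: n => [|n ih].
  by rewrite leqn0 => /eqP ->; rewrite big_geq// add0r.
rewrite leq_eqVlt => /orP[/eqP ->|]; first by rewrite big_geq// add0r.
rewrite ltnS => kn; rewrite big_nat_recr//=; apply: le_trans (ih kn).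
rewrite -addrA lerD2l exprS.
have := exprn_ge0 n q0; nra.
Qed.

(** Convergence at the single point rho / 2 bounds all terms there by [M]; for x below half of that
    point the terms are dominated by a geometric series of ratio at most 1/2, whose tail from k on
    is O(x^k). *)
Lemma psc_estimate a (rho : R) (S : R -> R[i]) k : 0 < rho ->
  (forall x, 0 < x < rho -> psc a x (S x)) ->
  exists C d : R, 0 < d /\ forall x, 0 < x < d ->
    x < rho /\ cabs (S x - \sum_(j < k) x%:C ^+ j * a j) <= C * x ^+ k.
Proof.
move=> r0 H; pose x1 := rho / 2.
have x10 : 0 < x1 by rewrite /x1 divr_gt0.
have x1r : x1 < rho by rewrite /x1; lra.
have [M hM] : exists M : R, forall j, cabs (x1%:C ^+ j * a j) <= M.
  have [|N hN] := H x1 _ 1 ltr01; first by rewrite x10 x1r.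
  exists (2 + \sum_(j < N) cabs (x1%:C ^+ j * a j)) => j.
  have s0 : 0 <= \sum_(j < N) cabs (x1%:C ^+ j * a j) by apply: sumr_ge0 => i _; exact: cabs_ge0.
  have [jN|Nj] := ltnP j N.
    rewrite (bigD1 (Ordinal jN))//= addrCA lerDl addr_ge0//.
    by apply: sumr_ge0 => i _; exact: cabs_ge0.
  have h1 := hN j Nj; have h2 := hN j.+1 (leqW Nj).
  rewrite big_ord_recr /= in h2.
  have -> : x1%:C ^+ j * a j = (\sum_(i < j) x1%:C ^+ i * a i + x1%:C ^+ j * a j - S x1) -
      (\sum_(i < j) x1%:C ^+ i * a i - S x1) by ring.
  apply: (le_trans (ler_cabsD _ _)); rewrite cabsN.
  by apply: (le_trans (lerD h2 h1)); rewrite -[leLHS]addr0 lerD.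
have M0 : 0 <= M by apply: le_trans (hM 0%N); exact: cabs_ge0.
(* The summand 1 pays for stopping at a partial sum within x^k of the limit. *)
exists (2 * M / x1 ^+ k + 1), (x1 / 2); split; first by rewrite divr_gt0.
move=> x /andP[x0 x2]; have xr : x < rho by apply: (lt_trans x2); lra.
split=> //; pose q := x / x1.
have q0 : 0 <= q by rewrite /q divr_ge0 ?ltW.
have q2 : q <= 2^-1 by rewrite /q ler_pdivrMr// mulrC ltW.
have term j : cabs (x%:C ^+ j * a j) <= M * q ^+ j.
  have -> : x%:C ^+ j * a j = (q ^+ j)%:C * (x1%:C ^+ j * a j).
    rewrite rmorphXn mulrA -exprMn -rmorphM /= /q divfK// gt_eqF//.
  rewrite cabsM cabs_real ger0_norm ?exprn_ge0// mulrC ler_wpM2r ?exprn_ge0//.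
have [|N hN] := H x _ (x ^+ k) (exprn_gt0 k x0); first by rewrite x0 xr.
have h1 := hN (maxn N k) (leq_maxl _ _).
set n := maxn N k in h1; have kn : (k <= n)%N by exact: leq_maxr.
have split_sum : \sum_(j < n) x%:C ^+ j * a j =
    \sum_(j < k) x%:C ^+ j * a j + \sum_(k <= j < n) x%:C ^+ j * a j.
  by rewrite -!(big_mkord xpredT (fun j => x%:C ^+ j * a j)) -big_cat_nat.
have -> : S x - \sum_(j < k) x%:C ^+ j * a j =
   \sum_(k <= j < n) x%:C ^+ j * a j - (\sum_(j < n) x%:C ^+ j * a j - S x).
  by rewrite split_sum; ring.
apply: (le_trans (ler_cabsD _ _)); rewrite cabsN mulrDl mul1r; apply: lerD => //.
apply: (le_trans (ler_cabs_sum _ _ _)).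
apply: (le_trans (ler_sum _ (fun j _ => term j))); rewrite -mulr_sumr.
have := @geometric_tail q k n; rewrite q0 q2 => /(_ isT kn) g.
have qn := exprn_ge0 n q0.
apply: (le_trans (_ : _ <= M * (2 * q ^+ k))); first by rewrite ler_wpM2l//; lra.
rewrite /q exprMn exprVn mulrCA -!mulrA [X in _ <= _ * (_ * X)]mulrC.
by rewrite (mulrCA M).
Qed.

(** A polynomial of degree below k that is O(x^k) at 0 vanishes. By strong induction the lower
    coefficients are 0, and division by x^n leaves [a n] bounded by a multiple of x. *)
Lemma bigO_coef0 a k (C d : R) : 0 < d ->
  (forall x, 0 < x < d -> cabs (\sum_(j < k) x%:C ^+ j * a j) <= C * x ^+ k) ->
  forall n, (n < k)%N -> a n = 0.
Proof.
move=> d0 H n; have [N] := ubnP n; elim: N n => // N ih n; rewrite ltnS => nN nk.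
apply: cabs_eq0; apply/eqP; rewrite eq_le cabs_ge0 andbT.
pose A := \sum_(j < k) cabs (a j).
have A0 : 0 <= A by apply: sumr_ge0 => i _; exact: cabs_ge0.
apply/ler_addgt0Pr => e e0; rewrite add0r.
have B0 : 0 < `|C| + A + 1 by rewrite ltr_wpDl// addr_ge0.
(* The three bounds put x below [d], below 1, and make the final estimate at most [e]. *)
pose x := Num.min (Num.min (d / 2) 2^-1) (e / (`|C| + A + 1)).
have x0 : 0 < x by rewrite !lt_min !divr_gt0//= invr_gt0 ltr0n.
have xd : x < d by rewrite !gt_min; apply/orP; left; apply/orP; left; lra.
have x1 : x <= 1 by rewrite !ge_min; apply/orP; left; apply/orP; right; lra.
have xe : x * (`|C| + A + 1) <= e by rewrite -ler_pdivlMr// ge_min lexx orbT.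
have xn0 : 0 < x ^+ n by rewrite exprn_gt0.
have := H x; rewrite x0 xd => /(_ isT).
have -> : \sum_(j < k) x%:C ^+ j * a j = x%:C ^+ n * a n +
    \sum_(j < k | (n < j)%N) x%:C ^+ j * a j.
  rewrite (bigD1 (Ordinal nk))//=; congr (_ + _).
  rewrite [LHS](bigID (fun j : 'I_k => (n < j)%N))/= [X in _ + X]big1 ?addr0.
    apply: eq_bigl => j; rewrite -val_eqE /=.
    by case: (ltngtP n j) => //= ->; rewrite eqxx.
  move=> j /andP[jn]; rewrite -leqNgt leq_eqVlt => /orP[jn'|jn'].
    by rewrite -val_eqE /= jn' in jn.
  by rewrite (ih j) ?mulr0// (leq_trans jn').
move=> h; have {}h : x ^+ n * cabs (a n) <= C * x ^+ k + x ^+ n.+1 * A.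
  have e1 : x ^+ n * cabs (a n) = cabs (x%:C ^+ n * a n).
    by rewrite cabsM -rmorphXn cabs_real ger0_norm// ltW.
  rewrite e1 -[X in cabs X](addrK (\sum_(j < k | (n < j)%N) x%:C ^+ j * a j)).
  apply: (le_trans (ler_cabsD _ _)); apply: lerD => //; rewrite cabsN.
  apply: (le_trans (ler_cabs_sum _ _ _)); rewrite /A mulr_sumr.
  rewrite [leRHS](bigID (fun j : 'I_k => (n < j)%N))/=.
  apply: (le_trans (_ : _ <= \sum_(j < k | (n < j)%N) x ^+ n.+1 * cabs (a j))).
    apply: ler_sum => j nj; rewrite cabsM -rmorphXn cabs_real ger0_norm ?exprn_ge0 ?(ltW x0)//.
    by rewrite ler_wpM2r ?cabs_ge0// ler_wiXn2l// ltW.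
  by rewrite lerDl sumr_ge0// => j _; rewrite mulr_ge0 ?cabs_ge0// exprn_ge0// ltW.
have xk : C * x ^+ k <= `|C| * x ^+ n.+1.
  apply: (le_trans (_ : _ <= `|C| * x ^+ k)).
    by rewrite ler_wpM2r ?ler_norm// exprn_ge0// ltW.
  by rewrite ler_wpM2l// ler_wiXn2l// ltW.
rewrite -(ler_pM2l xn0); apply: (le_trans h); apply: (le_trans (lerD xk (lexx _))).
rewrite exprSr -!mulrA mulrCA -mulrDr ler_wpM2l ?(ltW xn0)//.
by apply: le_trans xe; nra.
Qed.

End PowerSeries.

(** * Taylor coefficients of the pencil along a root function *)

Section ChainRelations.
Context {R : realType}.
Notation T1 := (measurableTypeR R).
Implicit Types (t x : R) (f g phi chi : R -> R[i]).

(* coefficient of [lambda ^ k] in the pencil *)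
Definition Bop (m : nat) (b : nat -> nat -> R -> R[i]) (k : nat) phi : R -> R[i] :=
  fun w => \sum_(j < (2 * m).+1 | (j + k <= 2 * m)%N) b j k w * Domega j phi w.

Lemma pencilE m b lam phi w :
  pencil m b lam phi w = \sum_(k < (2 * m).+1) lam ^+ k * Bop m b k phi w.
Proof.
rewrite /pencil (exchange_big_dep xpredT)//=; apply: eq_bigr => k _.
by rewrite mulr_sumr; apply: eq_bigr => j _; ring.
Qed.

Lemma test1D f g : test1 f -> test1 g -> test1 (fun x => f x + g x).
Proof.
move=> [/smooth1P sf [K [cK KI K0]]] [/smooth1P sg [L [cL LI L0]]]; split.
  by apply/smooth1P; exact: smoothD.
exists (K `|` L); split; first exact: compactU.
  by move=> y [/KI|/LI].
by move=> y /not_orP[/K0 -> /L0 ->]; rewrite addr0.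
Qed.

Lemma test1_sum I (r : seq I) (P : pred I) (F : I -> R -> R[i]) :
  (forall i, P i -> test1 (F i)) -> test1 (fun x => \sum_(i <- r | P i) F i x).
Proof.
move=> h; elim: r => [|i r ih].
  rewrite (_ : (fun _ => _) = fun=> 0); last by apply/funext => x; rewrite big_nil.
  split; first by apply/smooth1P; exact: smooth_cst.
  by exists set0; split=> //; exact: compact0.
case Pi: (P i).
  rewrite (_ : (fun _ => _) = fun x => F i x + \sum_(i <- r | P i) F i x).
    by apply: test1D => //; exact: h.
  by apply/funext => x; rewrite big_cons Pi.
rewrite (_ : (fun _ => _) = fun x => \sum_(i <- r | P i) F i x)//.
by apply/funext => x; rewrite big_cons Pi.
Qed.

(** The bilinear transpose of [Bop]: the factor i^j is (-i)^j times the sign (-1)^j from j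
    integrations by parts. *)
Definition adjt (m : nat) (b : nat -> nat -> R -> R[i]) (k : nat) chi : R -> R[i] :=
  fun w => \sum_(j < (2 * m).+1 | (j + k <= 2 * m)%N)
    'i ^+ j * iter j cderive1 (fun w => b j k w * chi w) w.

Variables (m : nat) (b : nat -> nat -> R -> R[i]).
Hypothesis sb : forall j k, (j + k <= 2 * m)%N -> smooth (b j k).

Lemma test1_adjt k chi : test1 chi -> test1 (adjt m b k chi).
Proof.
move=> tc; apply: test1_sum => j jk; apply: test1M; first exact: smooth_cst.
by apply: test1_iter; apply: test1M => //; exact: sb.
Qed.

Lemma Bop_locint1 s k phi : W2pi s phi -> (2 * m <= s)%N -> locint1 (Bop m b k phi).
Proof.
move=> hW ms K cK KI.
have mK : measurable (K : set T1) by apply: closed_measurable; apply: compact_closed => //; exact: Rhausdorff.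
apply: cintegrable_sum => // j jk.
have js : (j <= s)%N by apply: leq_trans ms; apply: leq_trans jk; exact: leq_addr.
have [_ lg _] := W2pi_weakD1 hW js.
have [C hC] := smooth_bounded (2 * pi) (sb jk).
have H := @cintegrable_bounded _ T1 R leb K (Domega j phi) (b j k) C mK (smooth_cmeas mK (sb jk)) _ _.
apply: (@cintegrable_ext _ T1 R leb K (fun x => Domega j phi x * b j k x)) => //.
  by move=> x _; rewrite mulrC.
apply: H; last by apply: cintegrableZ => //; exact: lg.
move=> x /KI; rewrite /I2pi /= in_itv/= => /andP[h1 h2]; apply: hC.
by rewrite gtr0_norm// ltW.
Qed.

Lemma Bop_pair s k phi chi : W2pi s phi -> (2 * m <= s)%N -> test1 chi ->
  cint leb I2pi (fun w => Bop m b k phi w * chi w) =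
  cint leb I2pi (fun w => phi w * adjt m b k chi w).
Proof.
move=> hW ms tc; have mI := @measurable_I2pi R.
have js (j : 'I_(2 * m).+1) : (j <= s)%N by apply: leq_trans ms; rewrite -ltnS.
have tb (j : 'I_(2 * m).+1) : (j + k <= 2 * m)%N -> test1 (fun w => b j k w * chi w).
  by move=> jk; apply: test1M => //; exact: sb.
transitivity (\sum_(j < (2 * m).+1 | (j + k <= 2 * m)%N)
    (- 'i) ^+ j * cint leb I2pi (fun w => weakD1 j phi w * (b j k w * chi w))).
  rewrite -cint_sumZ//; last first.
    by move=> j jk; apply: test1_integrable; [have [] := W2pi_weakD1 hW (js j)|exact: tb].
  apply: cint_ext => w _; rewrite /Bop mulr_suml; apply: eq_bigr => j _.
  rewrite /Domega; ring.
transitivity (\sum_(j < (2 * m).+1 | (j + k <= 2 * m)%N)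
    'i ^+ j * cint leb I2pi (fun w => phi w * iter j cderive1 (fun w => b j k w * chi w) w)).
  apply: eq_bigr => j jk; have [_ _ ->] := W2pi_weakD1 hW (js j); last exact: tb.
  have -> : (- 'i : R[i]) ^+ j = 'i ^+ j * (-1) ^+ j by rewrite (exprNn 'i j) mulrC.
  by rewrite -mulrA.
rewrite -cint_sumZ//; last first.
  move=> j jk; apply: test1_integrable; last by apply: test1_iter; exact: tb.
  by have [] := W2pi_weakD1 hW (leq0n s).
by apply: cint_ext => w _; rewrite /adjt mulr_sumr; apply: eq_bigr => j _; ring.
Qed.

Lemma test1_L2 chi : test1 chi -> @L2 _ T1 R leb I2pi chi.
Proof. by move=> [/smooth1P sc _]; exact: L2_I2pi_smooth. Qed.

Lemma Wnorm_L2 s f (d : R) : locint1 f -> 0 <= d -> (Wnorm s f <= d%:E)%E ->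
  @L2 _ T1 R leb I2pi f /\ sqn leb I2pi f <= d ^+ 2.
Proof.
move=> lf d0 h; have mI := @measurable_I2pi R.
have X0 : (0 <= \sum_(j < s.+1) \int[leb]_(x in I2pi) (sqnorm (Domega j f x))%:E)%E.
  by apply: sume_ge0 => k _; apply: integral_ge0 => x _; rewrite lee_fin sqnorm_ge0.
have X1 := le_trans (Wnorm_comp f (leq0n s)) (poweR_half X0 d0 h).
have w0 := is_weakD1_0 lf; have wP := weakD1P (ex_intro _ _ w0).
have ae : eq2pi (Domega 0 f) f.
  by apply: ae_imp (weakD1_uniq wP w0) => x e Ix; rewrite /Domega mul1r e.
have mf := locint1_cmeas lf.
have mS g : @cmeas _ T1 R I2pi g -> measurable_fun (I2pi : set T1) (fun x => (sqnorm (g x))%:E).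
  move=> mg; apply/measurable_EFinP.
  rewrite (_ : (fun _ => _) = fun x => cabs (g x) ^+ 2); last by apply/funext => x; rewrite sqnormE.
  by apply: measurable_funX; exact: (measurable_cabs mI mg).
have eI : (\int[leb]_(x in I2pi) (sqnorm (Domega 0 f x))%:E =
    \int[leb]_(x in I2pi) (sqnorm (f x))%:E)%E.
  apply: ae_eq_integral => //.
  - by apply: mS; apply: cmeasM; [exact: cmeas_cst|apply: locint1_cmeas; case: wP].
  - exact: mS.
  by apply: ae_imp ae => x e Ix; rewrite e.
rewrite eI in X1.
have L2f : @L2 _ T1 R leb I2pi f by apply: L2_fin => //; apply: (le_lt_trans X1); exact: ltry.
by split=> //; rewrite -lee_fin -(sqn_fin mI L2f).
Qed.

(** Convergence in the Sobolev norm implies convergence in L2, and by Cauchy-Schwarz pairing with a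
    test function turns the expansion into a scalar power series. *)
Lemma expansion_psc s Phi lam0 c : expansion s Phi lam0 c -> exists2 rho : R, 0 < rho &
  forall x, 0 < x < rho -> W2pi s (Phi (lam0 + x%:C)) /\ forall chi, test1 chi ->
    psc (fun n => cint leb I2pi (fun w => c n w * chi w)) x
        (cint leb I2pi (fun w => Phi (lam0 + x%:C) w * chi w)).
Proof.
move=> [hc [rho rho0 H]]; exists rho => // x /andP[x0 xr].
have [|hP cv] := H (lam0 + x%:C).
  by rewrite addrC addKr ger0_norm ?ltcR// lecR ltW.
split=> // chi tc e e0; have mI := @measurable_I2pi R.
have lc n : locint1 (c n) by have [] := W2pi_weakD1 (hc n) (leq0n s).
have lP : locint1 (Phi (lam0 + x%:C)) by have [] := W2pi_weakD1 hP (leq0n s).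
pose X := sqn leb I2pi chi; have X0 : 0 <= X := sqn_ge0 _ _ _.
(* Makes 4 d^2 (X + 1)^2 equal to e^2; X + 1 replaces the norm so as not to divide by 0. *)
pose d := e / (2 * (X + 1)); have X1 : 0 < X + 1 by rewrite ltr_wpDl.
have d0 : 0 < d by rewrite /d divr_gt0// mulr_gt0.
pose D n w := Phi (lam0 + x%:C) w - \sum_(j < n) x%:C ^+ j * c j w.
have : \forall n \near \oo, (Wnorm s (D n) < d%:E)%E.
  have eD : D = fun n w => Phi (lam0 + x%:C) w - \sum_(j < n) (lam0 + x%:C - lam0) ^+ j * c j w.
    by apply/funext => n; apply/funext => w; rewrite /D (addrC lam0) addrK.
  rewrite eD; have := cv; move/(_ [set y | (y < d%:E)%E]); apply.
  change (nbhs (0 : R) (fun r : R => (r%:E < d%:E)%E)).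
  by have := lt_nbhsl d0; apply: filterS => r; rewrite lte_fin.
move=> [N _ hN]; exists N => n Nn.
have lD : locint1 (D n).
  move=> K cK KI.
  have mK : measurable (K : set T1) by apply: closed_measurable; apply: compact_closed => //; exact: Rhausdorff.
  apply: cintegrableB => //; first exact: lP.
  by apply: cintegrable_sumZ => // j _; exact: lc.
have [L2D sD] := Wnorm_L2 lD (ltW d0) (ltW (hN n Nn)).
have ic g : locint1 g -> cintegrable leb I2pi (fun w => g w * chi w) by move=> lg; exact: test1_integrable.
have -> : \sum_(j < n) x%:C ^+ j * cint leb I2pi (fun w => c j w * chi w) -
    cint leb I2pi (fun w => Phi (lam0 + x%:C) w * chi w) =
    - cint leb I2pi (fun w => D n w * chi w).
  rewrite -cint_sumZ//; last by move=> j _; exact: ic.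
  rewrite -cintB//; [|by apply: cintegrable_sumZ => // j _; exact: ic|exact: ic].
  rewrite -cintN//; last exact: ic.
  apply: cint_ext => w _; rewrite /D mulrBl opprB mulr_suml; congr (_ - _).
  by apply: eq_bigr => j _; rewrite mulrA.
rewrite cabsN -(ler_pXn2r (ltn0Sn 1)) ?nnegrE ?cabs_ge0 ?(ltW e0)//.
apply: (le_trans (cauchy_schwarz mI L2D (test1_L2 tc))).
apply: (le_trans (_ : _ <= 4 * (d ^+ 2 * (X + 1) ^+ 2))).
  rewrite ler_wpM2l// ler_pM ?sqn_ge0//.
  by rewrite -/X; nra.
have -> : 4 * (d ^+ 2 * (X + 1) ^+ 2) = e ^+ 2; last by [].
have X1n : X + 1 != 0 by rewrite gt_eqF.
by rewrite /d; field.
Qed.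

(** The k-th Taylor coefficient at lam0 of the pencil applied to the root function vanishes for k <
    kap. Multiplicity is a statement about functions of lambda, so it is tested against [chi], where
    both sides become scalar series in a real increment; the fundamental lemma returns to the
    interval. *)
Lemma chain_relation s s' lam0 kap ch k : (2 * m <= s)%N ->
  jordan_chain s s' (pencil m b) lam0 kap ch -> (k < kap)%N ->
  zero2pi (fun w => \sum_(i < k.+1) \sum_(r < (2 * m).+1)
    ('C(r, i)%:R * lam0 ^+ (r - i)) * Bop m b r (ch (k - i)%N) w).
Proof.
move=> ms [hW [Phi [c [[ePhi _ _] [G [d [eG _ [rho' rho'0 HG]]]] cheq]]]] kk.
have mI := @measurable_I2pi R.
have hWi (i : 'I_k.+1) : W2pi s (ch (k - i)%N) by apply: hW; rewrite (leq_ltn_trans (leq_subr _ _)).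
have lB (i : 'I_k.+1) r := Bop_locint1 r (hWi i) ms.
apply: weak_unique1.
  move=> K cK KI.
  have mK : measurable (K : set T1) by apply: closed_measurable; apply: compact_closed => //; exact: Rhausdorff.
  by apply: cintegrable_sum => // i _; apply: cintegrable_sumZ => // r _; exact: lB.
move=> chi tc.
pose a r n := cint leb I2pi (fun w => c n w * adjt m b r chi w).
(* The n-th Taylor coefficient of the tested pencil; [adjt] has moved the differential operators to
   [chi], so only the pairings of the coefficients [c] remain. *)
pose q n := \sum_(r < (2 * m).+1) \sum_(i < n.+1) 'C(r, i)%:R * lam0 ^+ (r - i) * a r (n - i)%N.
transitivity (q k).
  have iB (i : 'I_k.+1) r : cintegrable leb I2pi (fun w => Bop m b r (ch (k - i)%N) w * chi w).
    by apply: test1_integrable => //; exact: lB.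
  transitivity (\sum_(i < k.+1) cint leb I2pi (fun w => \sum_(r < (2 * m).+1)
      ('C(r, i)%:R * lam0 ^+ (r - i)) * (Bop m b r (ch (k - i)%N) w * chi w))).
    rewrite -cint_sum//; last by move=> i _; exact: cintegrable_sumZ.
    apply: cint_ext => w _; rewrite mulr_suml; apply: eq_bigr => i _.
    by rewrite mulr_suml; apply: eq_bigr => r _; rewrite mulrA.
  rewrite /q exchange_big /=; apply: eq_bigr => i _; rewrite cint_sumZ//.
  apply: eq_bigr => r _; congr (_ * _); rewrite (Bop_pair r (hWi i) ms tc) /a.
  have lc : locint1 (c (k - i)%N) by have [hc _] := ePhi; have [] := W2pi_weakD1 (hc (k - i)%N) (leq0n s).
  have lch : locint1 (ch (k - i)%N) by have [] := W2pi_weakD1 (hWi i) (leq0n s).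
  have ta := test1_adjt r tc.
  apply: (@cint_ae_eq _ T1 R leb) => //.
  - by apply: cintegrable_meas; exact: test1_integrable.
  - by apply: cintegrable_meas; exact: test1_integrable.
  have ik : (k - i < kap)%N by rewrite (leq_ltn_trans (leq_subr _ _)).
  by apply: ae_imp (cheq _ ik) => w e Iw; rewrite e.
have [rho rho0 HP] := expansion_psc ePhi; have [rg rg0 HGp] := expansion_psc eG.
pose S x := cint leb I2pi (fun w => pencil m b (lam0 + x%:C) (Phi (lam0 + x%:C)) w * chi w).
have HS x : 0 < x < rho -> psc q x (S x).
  move=> xr; have [WP hP] := HP x xr.
  have -> : S x = \sum_(r < (2 * m).+1) (lam0 + x%:C) ^+ r *
      cint leb I2pi (fun w => Phi (lam0 + x%:C) w * adjt m b r chi w).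
    under eq_bigr => r _ do rewrite -(Bop_pair r WP ms tc).
    rewrite -cint_sumZ//; last by move=> r _; apply: test1_integrable => //; exact: Bop_locint1 WP ms.
    apply: cint_ext => w _; rewrite pencilE mulr_suml; apply: eq_bigr => r _.
    by rewrite mulrA.
  apply: psc_sum => r _; apply: psc_mul_power; apply: hP; exact: test1_adjt.
pose E x := cint leb I2pi (fun w => G (lam0 + x%:C) w * chi w).
have HE x : 0 < x < rg -> psc (fun n => cint leb I2pi (fun w => d n w * chi w)) x (E x).
  by move=> xr; have [_ hE] := HGp x xr; exact: hE.
have SE x : 0 < x < Num.min (Num.min rho rg) rho' -> S x = x%:C ^+ kap * E x.
  rewrite !lt_min => /andP[x0 /andP[/andP[xr xg] xr']].
  have [|WP _] := HP x; first by rewrite x0.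
  have [|WG _] := HGp x; first by rewrite x0.
  have lG : locint1 (G (lam0 + x%:C)) by have [] := W2pi_weakD1 WG (leq0n s').
  rewrite -cintZ//; last exact: test1_integrable.
  apply: (@cint_ae_eq _ T1 R leb) => //.
  - apply: cmeasM; last exact: test1_cmeas.
    have := @cmeas_sum _ T1 R I2pi _ (index_enum 'I_(2 * m).+1) xpredT
      (fun r w => (lam0 + x%:C) ^+ r * Bop m b r (Phi (lam0 + x%:C)) w).
    move=> h; apply: (cmeas_ext _ (h _)) => [w _|r _]; first by rewrite pencilE.
    by apply: cmeasM; [exact: cmeas_cst|apply: locint1_cmeas; exact: Bop_locint1 WP ms].
  - by apply: cmeasM; [exact: cmeas_cst|apply: cintegrable_meas; exact: test1_integrable].
  have := HG (lam0 + x%:C); rewrite addrC addKr ger0_norm ?ltcR ?lecR ?(ltW x0)// => /(_ xr').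
  by apply: ae_imp => w e Iw; rewrite e// mulrA.
have [C1 [d1 [d10 H1]]] := psc_estimate kap rho0 HS.
(* Order 0 of the estimate says that [E] is bounded near 0, hence [S x = x ^ kap * E x] is
   O(x^kap). *)
have [C2 [d2 [d20 H2]]] := psc_estimate 0 rg0 HE.
apply: (@bigO_coef0 R q kap (C1 + C2) (Num.min (Num.min d1 d2) rho')) => //.
  by rewrite !lt_min d10 d20.
move=> x; rewrite !lt_min => /andP[x0 /andP[/andP[xd1 xd2] xr']].
have [|xr h1] := H1 x; first by rewrite x0.
have [|xg h2] := H2 x; first by rewrite x0.
rewrite big_ord0 subr0 expr0 mulr1 in h2.
rewrite -[X in cabs X](subrK (S x)) -opprB mulrDl.
apply: (le_trans (ler_cabsD _ _)); apply: lerD; first by rewrite cabsN.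
rewrite SE; last by rewrite !lt_min x0 xr xg.
rewrite cabsM -rmorphXn cabs_real ger0_norm ?exprn_ge0 ?(ltW x0)// mulrC.
by rewrite ler_wpM2r// exprn_ge0// ltW.
Qed.

End ChainRelations.

(** * Weak form of the equation for separated test functions *)

Section Pairing.
Context {R : realType}.
Notation T1 := (measurableTypeR R).
Notation T2 := (measurableTypeR R * measurableTypeR R)%type.
Implicit Types (t x w : R) (f g phi psi tau : R -> R[i]) (h chi u : R * R -> R[i]) (y : R * R).

Definition wL2 (beta : R) h := @L2 _ T2 R leb2 setT (fun y => (expR (beta * lnr y))%:C * h y).

Definition expc (c : R) tau : R -> R[i] := fun t => tau t * (expR (c * t))%:C.

Lemma sepJ tau g y : (sep tau g y)^* = sep (fun t => (tau t)^*) (fun w => (g w)^*) y.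
Proof. by rewrite /sep; case: eqP => _; rewrite ?conjc0// rmorphM. Qed.

Lemma sepB tau g g' y : sep tau g y - sep tau g' y = sep tau (fun w => g w - g' w) y.
Proof. by rewrite /sep; case: eqP => _; rewrite ?subrr// mulrBr. Qed.

(** Cauchy-Schwarz after moving the weight r^beta from [h] to the separated function. In the
    exponent [1 - beta] the 1 is half of the Jacobian exponent 2. *)
Lemma sep_pairing beta h tau g : wL2 beta h -> @L2 _ T1 R leb setT (expc (1 - beta) tau) ->
  @L2 _ T1 R leb I2pi g ->
  cintegrable leb2 (setT : set T2) (fun y => h y * sep tau g y) /\
  cabs (cint leb2 (setT : set T2) (fun y => h y * sep tau g y)) ^+ 2 <=
    4 * (sqn leb2 (setT : set T2) (fun y => (expR (beta * lnr y))%:C * h y) *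
      (sqn leb setT (expc (1 - beta) tau) * sqn leb I2pi g)).
Proof.
move=> hh ht hg; pose tau' := expc (- beta) tau.
have ew : expw tau' = expc (1 - beta) tau.
  apply/funext => t; rewrite /expw /tau' /expc -mulrA -rmorphM -expRD; congr (_ * (expR _)%:C).
  ring.
have [Ls es] : @L2 _ T2 R leb2 setT (sep tau' g) /\
    sqn leb2 (setT : set T2) (sep tau' g) = sqn leb setT (expw tau') * sqn leb I2pi g.
  by apply: sep_L2 => //; rewrite ew.
have -> : (fun y => h y * sep tau g y) = fun y => ((expR (beta * lnr y))%:C * h y) * sep tau' g y.
  apply/funext => y; rewrite /sep; case: eqP => y0; first by rewrite !mulr0.
  rewrite /tau' /expc -/(lnr y).
  have -> : (expR (beta * lnr y))%:C * h y * (tau (lnr y) * (expR (- beta * lnr y))%:C * g (polar_angle y)) =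
      ((expR (beta * lnr y))%:C * (expR (- beta * lnr y))%:C) * (h y * (tau (lnr y) * g (polar_angle y))) by ring.
  rewrite -rmorphM -expRD mulNr subrr expR0.
  by rewrite -[X in _ = X * _]/(1 : R[i]) mul1r.
split; first exact: (L2_cintegrableM measurableT hh Ls).
by rewrite -ew -es; exact: (cauchy_schwarz measurableT hh Ls).
Qed.

Lemma csm_expc c tau : csm tau -> csm (expc c tau).
Proof.
move=> ct; apply: csmM2 => //.
have := smooth_affine c 0 (smooth_cexp (1 : R[i])); congr smooth; apply/funext => t.
by rewrite addr0 mul1r cexp_real.
Qed.

Lemma csm_L2 tau : csm tau -> @L2 _ T1 R leb setT tau.
Proof.
move=> ct; have [st _] := ct; split; first exact: smooth_cmeas.
have [i _] := csm_cintegrable (csmM st (csmJ ct)).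
move: i; congr integrable; apply/funext => t /=.
by rewrite reCM reCJ imCJ mulrN opprK -!expr2 -sqnormE.
Qed.

Lemma test2_wL2 chi : test2 chi -> wL2 0 chi.
Proof.
move=> tc; rewrite /wL2 (_ : (fun _ => _) = chi); last first.
  by apply/funext => y; rewrite mul0r expR0 -[X in X * _]/(1 : R[i]) mul1r.
split; first by apply: smooth2_cmeas => //; case: tc.
have [i _] := test2_integrable (locint2_test tc) (test2J tc).
move: i; congr integrable; apply/funext => t /=.
by rewrite reCM reCJ imCJ mulrN opprK -!expr2 -sqnormE.
Qed.

(** The form of continuity consumed by the density principle; it is stable under sums and scalar
    multiples. *)
Definition L2lip (F : (R -> R[i]) -> R[i]) := exists C : R, forall g g',
  @L2 _ T1 R leb I2pi g -> @L2 _ T1 R leb I2pi g' ->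
  cabs (F g - F g') <= C * Num.sqrt (sqn leb I2pi (fun w => g w - g' w)).

Lemma L2lip0 : L2lip (fun=> 0).
Proof. by exists 0 => g g' _ _; rewrite subrr cabs0 mul0r. Qed.

Lemma L2lipD F G : L2lip F -> L2lip G -> L2lip (fun g => F g + G g).
Proof.
move=> [C hC] [D hD]; exists (C + D) => g g' Lg Lg'.
rewrite opprD addrACA mulrDl; apply: (le_trans (ler_cabsD _ _)).
by apply: lerD; [exact: hC|exact: hD].
Qed.

Lemma L2lipZ F z : L2lip F -> L2lip (fun g => z * F g).
Proof.
move=> [C hC]; exists (cabs z * C) => g g' Lg Lg'.
by rewrite -mulrBr cabsM -mulrA ler_wpM2l ?cabs_ge0// hC.
Qed.

Lemma L2lip_sum I (r : seq I) (P : pred I) (F : I -> (R -> R[i]) -> R[i]) :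
  (forall i, P i -> L2lip (F i)) -> L2lip (fun g => \sum_(i <- r | P i) F i g).
Proof.
move=> h; elim: r => [|i r ih].
  rewrite (_ : (fun _ => _) = fun=> 0); first exact: L2lip0.
  by apply/funext => g; rewrite big_nil.
case Pi: (P i).
  rewrite (_ : (fun _ => _) = fun g => F i g + \sum_(i <- r | P i) F i g).
    by apply: L2lipD => //; exact: h.
  by apply/funext => g; rewrite big_cons Pi.
rewrite (_ : (fun _ => _) = fun g => \sum_(i <- r | P i) F i g)//.
by apply/funext => g; rewrite big_cons Pi.
Qed.

Lemma L2_smoothM (c : R -> R[i]) g : smooth c -> @L2 _ T1 R leb I2pi g ->
  @L2 _ T1 R leb I2pi (fun w => c w * g w).
Proof.
move=> sc Lg; have mI := @measurable_I2pi R; have [C hC] := smooth_bounded (2 * pi) sc.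
apply: (@L2_bounded _ T1 R leb I2pi g c C) => //; first exact: smooth_cmeas.
move=> x; rewrite /I2pi /= in_itv/= => /andP[h1 h2]; apply: hC.
by rewrite gtr0_norm// ltW.
Qed.

Lemma sqn_smoothM (c : R -> R[i]) : smooth c -> exists2 C : R, 0 <= C &
  forall g, @L2 _ T1 R leb I2pi g -> sqn leb I2pi (fun w => c w * g w) <= C ^+ 2 * sqn leb I2pi g.
Proof.
move=> sc; have mI := @measurable_I2pi R; have [C hC] := smooth_bounded (2 * pi) sc.
have C0 : 0 <= C by apply: le_trans (hC 0 _); rewrite ?cabs_ge0// normr0 ltW// pi2_gt0.
exists C => // g Lg; have [_ i1] := L2_smoothM sc Lg; have [_ i2] := Lg.
rewrite /sqn -RintegralZl//; apply: le_Rintegral => //.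
  have := integrableZl mI (C ^+ 2) i2; congr integrable.
move=> x; rewrite /I2pi /= in_itv/= => /andP[h1 h2].
rewrite cabsM exprMn ler_wpM2r ?sqr_ge0// ler_pXn2r ?nnegrE ?cabs_ge0// hC//.
by rewrite gtr0_norm// ltW.
Qed.

Lemma sep_lip beta h tau (c : R -> R[i]) : wL2 beta h -> @L2 _ T1 R leb setT (expc (1 - beta) tau) ->
  smooth c ->
  L2lip (fun g => cint leb2 (setT : set T2) (fun y => h y * sep tau (fun w => c w * g w) y)).
Proof.
move=> hh ht sc; have [C C0 hC] := sqn_smoothM sc; have mI := @measurable_I2pi R.
set A := sqn leb2 (setT : set T2) (fun y => (expR (beta * lnr y))%:C * h y).
set B := sqn leb setT (expc (1 - beta) tau).
have A0 : 0 <= A by exact: sqn_ge0.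
have B0 : 0 <= B by exact: sqn_ge0.
exists (Num.sqrt (4 * (A * B)) * C) => g g' Lg Lg'.
have Ld := L2B mI Lg Lg'.
have [i1 _] := sep_pairing hh ht (L2_smoothM sc Lg).
have [i2 _] := sep_pairing hh ht (L2_smoothM sc Lg').
have [i3 b3] := sep_pairing hh ht (L2_smoothM sc Ld).
rewrite -cintB//.
have -> : cint leb2 (setT : set T2) (fun y => h y * sep tau (fun w => c w * g w) y -
    h y * sep tau (fun w => c w * g' w) y) =
    cint leb2 (setT : set T2) (fun y => h y * sep tau (fun w => c w * (g w - g' w)) y).
  apply: cint_ext => y _; rewrite -mulrBr sepB /sep; case: eqP => // _.
  by rewrite -mulrBr.
have D0 := sqn_ge0 leb I2pi (fun w => g w - g' w).
rewrite -(ler_pXn2r (ltn0Sn 1)) ?nnegrE ?cabs_ge0 ?mulr_ge0 ?sqrtr_ge0//.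
apply: (le_trans b3); rewrite -/A -/B !exprMn !sqr_sqrtr ?mulr_ge0//.
have -> : 4 * (A * B) * C ^+ 2 * sqn leb I2pi (fun w => g w - g' w) =
  4 * (A * (B * (C ^+ 2 * sqn leb I2pi (fun w => g w - g' w)))) by ring.
by rewrite ler_wpM2l// ler_wpM2l// ler_wpM2l// hC.
Qed.

Lemma W2pi_density_lip s n phi (F : nat -> (R -> R[i]) -> R[i]) : W2pi s phi -> (n <= s)%N ->
  (forall j, (j <= n)%N -> L2lip (F j)) ->
  (forall f, psm f -> \sum_(j < n.+1) F j (iter j Dt f) = 0) ->
  \sum_(j < n.+1) F j (Domega j phi) = 0.
Proof.
move=> hW ns lip F0.
have [C hC] : exists C : nat -> R, forall j, (j <= n)%N -> forall g g',
    @L2 _ T1 R leb I2pi g -> @L2 _ T1 R leb I2pi g' ->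
    cabs (F j g - F j g') <= C j * Num.sqrt (sqn leb I2pi (fun w => g w - g' w)).
  have : forall j, exists C : R, (j <= n)%N -> forall g g',
    @L2 _ T1 R leb I2pi g -> @L2 _ T1 R leb I2pi g' ->
    cabs (F j g - F j g') <= C * Num.sqrt (sqn leb I2pi (fun w => g w - g' w)).
    by move=> j; have [/lip[C hC]|] := leqP j n; [exists C|exists 0].
  by move=> /choice[C hC]; exists C.
apply: (@W2pi_density R s n phi F (\sum_(j < n.+1) C j ^+ 2)) => // j g g' jn Lg Lg'.
have D0 := sqn_ge0 leb I2pi (fun w => g w - g' w).
apply: (le_trans (_ : _ <= C j ^+ 2 * sqn leb I2pi (fun w => g w - g' w))).
  rewrite -[X in _ * X]sqr_sqrtr// -exprMn.
  have h := hC j jn g g' Lg Lg'; have c0 := cabs_ge0 (F j g - F j g').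
  by rewrite ler_pXn2r ?nnegrE// (le_trans c0 h).
rewrite ler_wpM2r// (bigD1 (Ordinal (jn : (j < n.+1)%N)))//= lerDl.
by apply: sumr_ge0 => i _; exact: sqr_ge0.
Qed.

End Pairing.

(** * The equation tested with a cut-off times a Sobolev angular factor *)

Section WeakForms.
Context {R : realType}.
Notation T1 := (measurableTypeR R).
Notation T2 := (measurableTypeR R * measurableTypeR R)%type.
Implicit Types (t x w : R) (f g phi psi tau rho : R -> R[i]) (h chi u : R * R -> R[i]) (y : R * R).

Lemma test2_origin chi : test2 chi -> chi (0, 0) = 0.
Proof. by move=> [_ [K [_ Kp K0]]]; apply: K0 => /Kp; apply. Qed.

Lemma test2_diffop m (p : 'I_(2 * m).+1 -> R[i]) chi : test2 chi -> test2 (diffop classicD p chi).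
Proof.
move=> tc; rewrite /diffop; elim: (index_enum _) => [|k r ih].
  rewrite (_ : (fun _ => _) = fun=> 0); last by apply/funext => y; rewrite big_nil.
  split; last by exists set0; split=> //; exact: compact0.
  apply: (@smooth2_coind R [set v | v = fun=> 0]) => // _ ->; split=> [y|b].
    exact: cdiff_cst.
  by apply/funext => y; rewrite partialE cderive_cst.
rewrite (_ : (fun _ => _) = fun y => p k * (- 'i) ^+ (2 * m) * classicD (k : nat, (2 * m - k)%N) chi y +
    \sum_(k <- r) p k * (- 'i) ^+ (2 * m) * classicD (k : nat, (2 * m - k)%N) chi y).
  apply: test2D => //; set z := p k * _.
  have [sd [K [cK Kp K0]]] := test2_classicD (k : nat, (2 * m - k)%N) tc; split.
    apply: (@smooth2_coind R [set v | exists u, smooth2 u /\ v = fun y => z * u y]);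
      last by exists (classicD (k : nat, (2 * m - k)%N) chi).
    move=> _ [u [su ->]]; split=> [y|b].
      by apply: cdiffM; [exact: cdiff_cst|exact: smooth2_cdiff].
    exists (partial b u); split; first exact: smooth2_partial.
    apply/funext => y; rewrite partialE cderiveM; [|exact: cdiff_cst|exact: smooth2_cdiff].
    by rewrite cderive_cst mul0r add0r -partialE.
  by exists K; split=> // y /K0 ->; rewrite mulr0.
by apply/funext => y; rewrite big_cons.
Qed.

Lemma diffop_sepE m (p : 'I_(2 * m).+1 -> R[i]) (b : nat -> nat -> R -> R[i]) tau phi y :
  polar_form p b -> csm tau -> psm phi ->
  diffop classicD p (sep tau phi) y =
  \sum_(j < (2 * m).+1) \sum_(k < (2 * m).+1 | (j + k <= 2 * m)%N)
    sep (fun t => em t ^+ (2 * m) * iter k Dt tau t) (fun w => b j k w * iter j Dt phi w) y.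
Proof.
move=> pf ct pp; have [->|/eqP y0] := eqVneq y (0, 0).
  rewrite test2_origin; last by apply: test2_diffop; exact: sep_test2.
  by rewrite big1// => j _; rewrite big1// => k _; rewrite /sep eqxx.
rewrite {1}(pol_surj y0) (diffop_sep _ _ pf)// mulr_sumr; apply: eq_bigr => j _.
rewrite mulr_sumr; apply: eq_bigr => k _; rewrite /sep ifN; last exact/eqP.
rewrite /em; ring.
Qed.

Lemma smooth_emX n : smooth (fun t : R => em t ^+ n).
Proof.
elim: n => [|n ih]; first exact: smooth_cst.
rewrite (_ : (fun _ => _) = fun t => em t * em t ^+ n); last by apply/funext => t; rewrite exprS.
by apply: smoothM => //; exact: smooth_em.
Qed.

Lemma csm_iter_Dt k tau : csm tau -> csm (iter k Dt tau).
Proof.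
by move=> ct; elim: k => //= k ih; apply: csmM; [exact: smooth_cst|exact: cderive1_supp].
Qed.

Lemma csm_em_Dt n k tau : csm tau -> csm (fun t => em t ^+ n * iter k Dt tau t).
Proof. by move=> ct; apply: csmM; [exact: smooth_emX|exact: csm_iter_Dt]. Qed.

Lemma polar_form_smooth m (p : 'I_(2 * m).+1 -> R[i]) b j k : polar_form p b ->
  (j + k <= 2 * m)%N -> psm (b j k).
Proof. by move=> [pb _] jk; apply/psmP; exact: pb. Qed.

(** Conjugating the weak equation moves the conjugation from the test function to [u] and [f]; the
    adjoint operator then falls on a plain separated function, whose polar form is at hand. *)
Lemma polar_form_test m (p : 'I_(2 * m).+1 -> R[i]) u (f : R * R -> R[i]) tau phi :
  solves p u f -> locint2 f -> locint2 u ->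
  csm tau -> psm phi ->
  cint leb2 (setT : set T2) (fun y => (f y)^* * sep tau phi y) =
  cint leb2 (setT : set T2) (fun y => (u y)^* * diffop classicD (adjoint p) (sep tau phi) y).
Proof.
move=> su lf lu ct pp; have tc := sep_test2 ct pp.
have tcJ := test2J tc; have H := solves_weak su lf tcJ.
have mT := @measurableT _ T2.
transitivity ((cint leb2 (setT : set T2) (fun y => f y * (sep tau phi y)^*))^*).
  rewrite -cintJ//; last exact: test2_integrable.
  by apply: cint_ext => y _; rewrite rmorphM /= conjcK.
rewrite H -cintJ//; last by apply: test2_integrable => //; exact: test2_diffop.
by apply: cint_ext => y _; rewrite rmorphM diffopJ /= ?conjcK//; case: tc.
Qed.

Lemma wL2_cmeas beta h : wL2 beta h -> @cmeas _ T2 R setT h.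
Proof.
move=> [mh _].
have me : @cmeas _ T2 R setT (fun y => (expR (- beta * lnr y))%:C).
  apply: cmeas_real; apply: (measurableT_comp (@measurable_expR R)).
  by apply: measurable_funM; [exact: measurable_cst|exact: measurable_lnr].
apply: (cmeas_ext _ (cmeasM me mh)) => y _.
rewrite mulrA -rmorphM -expRD mulNr addNr expR0.
by rewrite -[X in X * _]/(1 : R[i]) mul1r.
Qed.

(** For smooth periodic [phi] this is the weak equation with the operator written in polar form.
    Both sides depend on the derivatives of [phi] through L2-Lipschitz functionals, thanks to the
    weights of [u] and [f], so density extends it. *)
Lemma weak_form_sep m (p : 'I_(2 * m).+1 -> R[i]) bs u (f : R * R -> R[i]) tau phi s beta beta' :
  polar_form (adjoint p) bs -> solves p u f -> locint2 f -> locint2 u ->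
  wL2 beta (fun y => (u y)^*) -> wL2 beta' (fun y => (f y)^*) ->
  csm tau -> W2pi s phi -> (2 * m <= s)%N ->
  cint leb2 (setT : set T2) (fun y => (f y)^* * sep tau phi y) =
  \sum_(j < (2 * m).+1) \sum_(k < (2 * m).+1 | (j + k <= 2 * m)%N)
    cint leb2 (setT : set T2) (fun y => (u y)^* *
      sep (fun t => em t ^+ (2 * m) * iter k Dt tau t) (fun w => bs j k w * Domega j phi w) y).
Proof.
move=> pf su lf lu wu wf ct hW ms.
have L k := csm_L2 (csm_expc (1 - beta) (csm_em_Dt (2 * m) k ct)).
have L' := csm_L2 (csm_expc (1 - beta') ct).
pose Fu j g := \sum_(k < (2 * m).+1 | (j + k <= 2 * m)%N)
    cint leb2 (setT : set T2) (fun y => (u y)^* *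
      sep (fun t => em t ^+ (2 * m) * iter k Dt tau t) (fun w => bs j k w * g w) y).
pose Ff g := cint leb2 (setT : set T2) (fun y => (f y)^* * sep tau (fun w => 1 * g w) y).
(* The side containing [f] involves no derivative of [phi] and is subtracted from the term of index
   0, so that the identity becomes one vanishing sum over the derivatives. *)
pose F j g := Fu j g + (if j == 0%N then -1 * Ff g else 0).
have Ff1 g : Ff g = cint leb2 (setT : set T2) (fun y => (f y)^* * sep tau g y).
  by apply: cint_ext => y _; rewrite /sep; case: eqP => // _; rewrite mul1r.
have lipu j : L2lip (Fu j).
  apply: L2lip_sum => k jk; apply: (sep_lip wu) => //.
  by have [] := polar_form_smooth pf jk.
have lip j : (j <= 2 * m)%N -> L2lip (F j).
  move=> _; apply: L2lipD => //; case: (j == 0)%N; last exact: L2lip0.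
  by apply: L2lipZ; apply: (sep_lip wf) => //; exact: smooth_cst.
have sumF (G : nat -> R -> R[i]) : \sum_(j < (2 * m).+1) F j (G j) =
    \sum_(j < (2 * m).+1) Fu j (G j) - Ff (G 0%N).
  rewrite big_split /=; congr (_ + _); rewrite big_ord_recl /= big1 ?addr0 ?mulN1r//.
have F0 g : psm g -> \sum_(j < (2 * m).+1) F j (iter j Dt g) = 0.
  move=> pg; rewrite sumF Ff1 /= (polar_form_test su lf lu ct pg); apply/eqP; rewrite subr_eq0; apply/eqP.
  rewrite /Fu.
  have iS (j k : 'I_(2 * m).+1) : (j + k <= 2 * m)%N -> cintegrable leb2 (setT : set T2) (fun y => (u y)^* *
      sep (fun t => em t ^+ (2 * m) * iter k Dt tau t) (fun w => bs j k w * iter j Dt g w) y).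
    move=> jk; have [sb _] := polar_form_smooth pf jk.
    have [] := sep_pairing wu (L k) (L2_smoothM sb (L2_I2pi_smooth (smooth_iter_Dt j pg.1))).
    by [].
  transitivity (\sum_(j < (2 * m).+1) cint leb2 (setT : set T2)
      (fun y => \sum_(k < (2 * m).+1 | (j + k <= 2 * m)%N) (u y)^* *
      sep (fun t => em t ^+ (2 * m) * iter k Dt tau t) (fun w => bs j k w * iter j Dt g w) y)).
    by apply: eq_bigr => j _; rewrite cint_sum// => k jk; exact: iS.
  rewrite -cint_sum//; last by move=> j _; apply: cintegrable_sum => // k jk; exact: iS.
  apply: cint_ext => y _; rewrite (diffop_sepE _ pf)// mulr_sumr; apply: eq_bigr => j _.
  by rewrite mulr_sumr.
have := W2pi_density_lip hW ms lip F0; rewrite (sumF (fun j => Domega j phi)) => /eqP; rewrite subr_eq0 => /eqP.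
have hD : is_weakD1 0 phi phi.
  by apply: is_weakD1_0; have [] := W2pi_weakD1 hW (leq0n s).
have ae := Domega_eq hW (leq0n s) hD.
rewrite Ff1 => ->; have [i1 _] := sep_pairing wf L' (W2pi_L2 hW (leq0n s)).
have mI := @measurable_I2pi R.
apply: (@cint_ae_eq _ T2 R leb2) => //.
- apply: cmeasM; first exact: wL2_cmeas wf.
  apply: sep_cmeas; first by apply: smooth_cmeas => //; case: ct.
  by apply: locint1_cmeas; have [] := W2pi_weakD1 hW (leq0n s).
- exact: cintegrable_meas i1.
apply: ae_imp (sep_ae ae) => y [y0 [_ e]] _; rewrite /sep; case: eqP => // _.
by rewrite e mul1r.
Qed.

End WeakForms.

(** * Weak derivatives of separated functions with a Sobolev angular factor *)

Section SeparatedDerivatives.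
Context {R : realType}.
Notation T1 := (measurableTypeR R).
Notation T2 := (measurableTypeR R * measurableTypeR R)%type.
Implicit Types (t x w : R) (g phi psi tau rho c : R -> R[i]) (h chi u v : R * R -> R[i]) (y : R * R).

(** A compact set avoiding the origin has bounded ln r, so a radial cut-off equals 1 on it. This
    allows radial factors of unbounded support, such as exponentials. *)
Lemma cutoff_compact (K : set (R * R)) : compact K -> K `<=` punctured ->
  exists kap : R -> R[i], exists2 M : R, csm kap &
  (forall y, K y -> `|lnr y| < M) /\ forall t, `|t| < M -> kap t = 1.
Proof.
move=> cK Kp.
have [M hM] : exists M : R, forall y, K y -> `|lnr y| < M.
  have : compact (lnr @` K).
    apply: continuous_compact => //; apply: continuous_in_subspaceT => y /set_mem/Kp y0.
    by apply: differentiable_continuous; have [] := derive_lnr (0, 0) y0.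
  move=> /compact_bounded[M [_ h]]; exists (`|M| + 2) => y Ky.
  apply: (@le_lt_trans _ _ (`|M| + 1)); last by rewrite ltrD2l ltr1n.
  apply: (h (`|M| + 1)); last by exists y.
  by rewrite (le_lt_trans (ler_norm M)) ?ltrDl.
exists (bump 1 (- (`|M| + 2)) (`|M| + 2)), M; last first.
  split=> // t; rewrite ltr_norml => /andP[h1 h2]; have := ler_norm M.
  by rewrite /bump => h3; rewrite !step1 ?mulr1//; rewrite mul1r; lra.
split; first exact: smooth_bump.
exists (`|M| + 2) => [|t Nt]; first by rewrite ltr_wpDl.
by apply: bump_out; rewrite /= in_itv/= -ltr_norml; apply/negP; rewrite -leNgt.
Qed.

Lemma partial_supp (K : set (R * R)) b chi y : closed K -> (forall y, ~ K y -> chi y = 0) ->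
  ~ K y -> partial b chi y = 0.
Proof.
move=> cK K0 Ky; rewrite partialE -(cderive_cst 0 y (dir b)).
apply: cderive_near; first exact: dir_neq0.
have : open (~` K) by exact: closed_openC.
by move=> /(_ y Ky); apply: filterS => z /K0 ->.
Qed.

Lemma diffop_supp (K : set (R * R)) m (p : 'I_(2 * m).+1 -> R[i]) chi y : closed K ->
  (forall y, ~ K y -> chi y = 0) -> ~ K y -> diffop classicD p chi y = 0.
Proof.
move=> cK K0 Ky; rewrite /diffop big1// => k _.
have it b n (u : R * R -> R[i]) : (forall y, ~ K y -> u y = 0) ->
    forall y, ~ K y -> iter n (partial b) u y = 0.
  by move=> u0; elim: n => //= n ih z; exact: partial_supp.
by rewrite /classicD (it true) ?mulr0//; exact: (it false).
Qed.

Lemma compact_closed2 (K : set (R * R)) : compact K -> closed K.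
Proof. exact: compact_closed. Qed.

Lemma locint2_sep rho g : smooth rho -> @L2 _ T1 R leb I2pi g -> locint2 (sep rho g).
Proof.
move=> sr Lg K cK Kp; have [kap [M ck [hM hk]]] := cutoff_compact cK Kp.
have mK := compact2_measurable cK.
pose chi := sep kap (fun=> 1).
have tc : test2 chi by apply: sep_test2 => //; exact: psm_cst.
have cr : csm (fun t => kap t * rho t) by exact: csmM2.
have [i _] := sep_pairing (test2_wL2 tc) (csm_L2 (csm_expc (1 - 0) cr)) Lg.
apply: (@cintegrable_ext _ T2 R leb2 K (fun y => chi y * sep (fun t => kap t * rho t) g y)) => //.
  move=> y /set_mem Ky; have y0 := Kp y Ky; rewrite /chi /sep ifN; last exact/eqP.
  by rewrite -/(lnr y) hk ?hM// !mul1r.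
by apply: (@cintegrableS _ T2 R leb2 K setT).
Qed.

Lemma chi_sep_cut (K : set (R * R)) M rho rho' g y h :
  (forall y, K y -> `|lnr y| < M) -> (forall t, `|t| < M -> rho' t = rho t) ->
  (forall y, ~ K y -> h y = 0) -> h y * sep rho' g y = h y * sep rho g y.
Proof.
move=> hM hr h0; have [Ky|/h0 ->] := pselect (K y); last by rewrite !mul0r.
by rewrite /sep; case: eqP => // _; rewrite -/(lnr y) hr// hM.
Qed.

Lemma cut_derive kap M rho : smooth rho -> csm kap -> (forall t, `|t| < M -> kap t = 1) ->
  forall n t, `|t| < M -> iter n cderive1 (fun t => kap t * rho t) t = iter n cderive1 rho t.
Proof.
move=> sr ck hk n t tM; apply: near_iter_cderive1.
have : `|z| @[z --> t] --> `|t| by exact: norm_continuous.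
move=> /cvgr_lt/(_ M tM); apply: filterS => z zM.
by rewrite hk// mul1r.
Qed.

Lemma cut_Dt kap M rho : smooth rho -> csm kap -> (forall t, `|t| < M -> kap t = 1) ->
  forall n t, `|t| < M -> iter n Dt (fun t => kap t * rho t) t = iter n Dt rho t.
Proof.
move=> sr ck hk n t tM; rewrite !iter_DtE//; last by apply: smoothM => //; case: ck.
by rewrite (cut_derive sr ck hk).
Qed.

Variables (s : nat) (psi : R -> R[i]).
Hypothesis hW : W2pi s psi.

(** The product rule in polar coordinates in weak form. The three terms differentiate the radial
    factor, the smooth coefficient and D_omega^j psi; the last acquires the factor i, since d_omega
    = i D_omega. *)
Lemma sep_weak_partial b j rho c chi : (j < s)%N -> smooth rho -> psm c -> test2 chi ->
  cint leb2 (setT : set T2) (fun y => partial b chi y * sep rho (fun w => c w * Domega j psi w) y) =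
  - (cint leb2 (setT : set T2) (fun y => chi y *
        sep (fun t => em t * cderive1 rho t) (fun w => (dcos b w * c w) * Domega j psi w) y) +
     cint leb2 (setT : set T2) (fun y => chi y *
        sep (fun t => em t * rho t) (fun w => (dsin b w * cderive1 c w) * Domega j psi w) y) +
     cint leb2 (setT : set T2) (fun y => chi y *
        sep (fun t => em t * rho t) (fun w => ('i * dsin b w * c w) * Domega j.+1 psi w) y)).
Proof.
move=> js sr pc tc; have [schi [K [cK Kp K0]]] := tc.
have [kap [M ck [hM hk]]] := cutoff_compact cK Kp; have clK := compact_closed2 cK.
have td := test2_partial b tc.
have d0 y : ~ K y -> partial b chi y = 0 by exact: partial_supp.
pose r1 := fun t => kap t * rho t.
pose r2 := fun t => kap t * (em t * cderive1 rho t).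
pose r3 := fun t => kap t * (em t * rho t).
have c1 : csm r1 by exact: csmM2.
have c2 : csm r2 by apply: csmM2 => //; apply: smoothM; [exact: smooth_em|exact: smooth_derive].
have c3 : csm r3 by apply: csmM2 => //; apply: smoothM => //; exact: smooth_em.
have kE (r : R -> R[i]) : forall t, `|t| < M -> kap t * r t = r t by move=> t tM; rewrite hk ?mul1r.
have cutE h (r : R -> R[i]) g : (forall y, ~ K y -> h y = 0) ->
    cint leb2 (setT : set T2) (fun y => h y * sep (fun t => kap t * r t) g y) =
    cint leb2 (setT : set T2) (fun y => h y * sep r g y).
  by move=> h0; apply: cint_ext => y _; exact: (chi_sep_cut _ _ hM (kE r) h0).
have s1 : psm (fun w => dcos b w * c w) by apply: psmM => //; exact: psm_dcos.
have s2 : psm (fun w => dsin b w * cderive1 c w).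
  by apply: psmM; [exact: psm_dsin|exact: psm_derive].
have s3 : psm (fun w => 'i * dsin b w * c w).
  by apply: psmM => //; apply: psmM; [exact: psm_cst|exact: psm_dsin].
have E (r : R -> R[i]) : csm r -> @L2 _ T1 R leb setT (expc (1 - 0) r).
  by move=> cr; apply/csm_L2/csm_expc.
have w1 := test2_wL2 td; have w2 := test2_wL2 tc.
pose A g := cint leb2 (setT : set T2) (fun y => partial b chi y * sep r1 (fun w => c w * g w) y) +
  (cint leb2 (setT : set T2) (fun y => chi y * sep r2 (fun w => (dcos b w * c w) * g w) y) +
   cint leb2 (setT : set T2) (fun y => chi y * sep r3 (fun w => (dsin b w * cderive1 c w) * g w) y)).
pose B g := cint leb2 (setT : set T2) (fun y => chi y * sep r3 (fun w => ('i * dsin b w * c w) * g w) y).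
have lA : L2lip A.
  apply: L2lipD; first by apply: (sep_lip w1); [exact: E|case: pc].
  by apply: L2lipD; apply: (sep_lip w2); [exact: E|case: s1|exact: E|case: s2].
have lB : L2lip B by apply: (sep_lip w2); [exact: E|case: s3].
(* Only the derivatives of orders j and j + 1 occur; the other terms of the density sum are 0. *)
pose F i g := if i == j then A g else if i == j.+1 then B g else 0.
have lF i : (i <= j.+1)%N -> L2lip (F i).
  by move=> _; rewrite /F; case: eqP => // _; case: eqP => // _; exact: L2lip0.
have sumF (G : nat -> R -> R[i]) : \sum_(i < j.+2) F i (G i) = A (G j) + B (G j.+1).
  rewrite !big_ord_recr /= big1 ?add0r.
    by rewrite /F eqxx (gtn_eqF (ltnSn j)) eqxx.
  move=> i _; rewrite /F (ltn_eqF (ltn_ord i)) ltn_eqF//.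
  by rewrite (ltn_trans (ltn_ord i)).
have F0 g : psm g -> \sum_(i < j.+2) F i (iter i Dt g) = 0.
  move=> pg; rewrite (sumF (fun i => iter i Dt g)); set G := iter j Dt g.
  have pG : psm G.
    rewrite /G; elim: (j) => [//|n ih]; rewrite iterS /Dt.
    by apply: psmM; [exact: psm_cst|exact: psm_derive].
  have pcG := psmM pc pG; have tw := sep_test2 c1 pcG.
  have dG w : cderive1 G w = 'i * iter j.+1 Dt g w.
    by rewrite iterS /Dt mulrA mulrN -expr2 sqr_i opprK mul1r.
  have LG : @L2 _ T1 R leb I2pi G by apply: L2_I2pi_smooth; case: pG.
  have LG1 : @L2 _ T1 R leb I2pi (iter j.+1 Dt g).
    by apply: L2_I2pi_smooth; apply: smooth_iter_Dt; case: pg.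
  have [i1 _] := sep_pairing w2 (E _ c2) (L2_smoothM s1.1 LG).
  have [i2 _] := sep_pairing w2 (E _ c3) (L2_smoothM s2.1 LG).
  have [i3 _] := sep_pairing w2 (E _ c3) (L2_smoothM s3.1 LG1).
  have ibp := planar_ibp b tw tc.
  rewrite /A /B -addrA -cintD// -cintD//; last by apply: cintegrableD.
  have -> : cint leb2 (setT : set T2) (fun y => partial b chi y * sep r1 (fun w => c w * G w) y) =
      cint leb2 (setT : set T2) (fun y => sep r1 (fun w => c w * G w) y * partial b chi y).
    by apply: cint_ext => y _; rewrite mulrC.
  rewrite ibp; apply/eqP; rewrite addrC subr_eq0; apply/eqP; apply: cint_ext => y _.
  have [Ky|/K0 ->] := pselect (K y); last by rewrite !mul0r !mulr0 !addr0.
  rewrite (sep_partial b c1 pcG); have y0 := Kp y Ky; have yM := hM y Ky.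
  have yE : (y == (0, 0)) = false by exact/eqP.
  rewrite /sep !yE -/(lnr y) /r1 /r2 /r3.
  have d1 := cut_derive sr ck hk 1 yM; rewrite /= in d1.
  rewrite d1 hk// cderive1M; [|by case: pc|by case: pG].
  by rewrite dG; ring.
have := W2pi_density_lip hW js lF F0; rewrite (sumF (fun i => Domega i psi)) /A /B.
rewrite !cutE// => /eqP; by rewrite -addrA addr_eq0 => /eqP ->.
Qed.

(** Separated functions whose angular factor uses at most [n] derivatives of [psi]. A weak partial
    derivative stays in the span and raises [n] by one, so derivatives exist as long as [n] stays
    within the Sobolev order. *)
Inductive ispan (n : nat) : (R * R -> R[i]) -> Prop :=
| IspanOne (rho c : R -> R[i]) j : smooth rho -> psm c -> (j <= n)%N ->
    ispan n (sep rho (fun w => c w * Domega j psi w))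
| IspanAdd (u1 u2 : R * R -> R[i]) : ispan n u1 -> ispan n u2 -> ispan n (fun y => u1 y + u2 y).

Lemma ispan_locint2 n u : (n <= s)%N -> ispan n u -> locint2 u.
Proof.
move=> ns; elim=> [rho c j sr pc jn|u1 u2 _ h1 _ h2].
  apply: locint2_sep => //; apply: L2_smoothM; first by case: pc.
  exact: (W2pi_L2 hW (leq_trans jn ns)).
move=> K cK Kp; have mK := compact2_measurable cK.
by apply: cintegrableD => //; [exact: h1|exact: h2].
Qed.

Lemma ispan_partial b n u : (n < s)%N -> ispan n u -> exists2 v, ispan n.+1 v &
  forall chi, test2 chi -> cint leb2 (setT : set T2) (fun y => u y * partial b chi y) =
    - cint leb2 (setT : set T2) (fun y => v y * chi y).
Proof.
move=> ns iu; have [v [iv lv hv]] : exists v, [/\ ispan n.+1 v, locint2 v &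
    forall chi, test2 chi -> cint leb2 (setT : set T2) (fun y => u y * partial b chi y) =
    - cint leb2 (setT : set T2) (fun y => v y * chi y)]; last by exists v.
have mT := @measurableT _ T2.
elim: iu => [rho c j sr pc jn|u1 u2 i1 [v1 [iv1 l1 h1]] i2 [v2 [iv2 l2 h2]]]; last first.
  have iv := IspanAdd iv1 iv2; exists (fun y => v1 y + v2 y); split=> //.
    exact: (ispan_locint2 ns iv).
  move=> chi tc; have td := test2_partial b tc.
  have lu1 := ispan_locint2 (ltnW ns) i1; have lu2 := ispan_locint2 (ltnW ns) i2.
  transitivity (cint leb2 (setT : set T2) (fun y => u1 y * partial b chi y) +
     cint leb2 (setT : set T2) (fun y => u2 y * partial b chi y)).
    rewrite -cintD//; [|exact: test2_integrable|exact: test2_integrable].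
    by apply: cint_ext => y _; rewrite mulrDl.
  rewrite h1// h2// -opprD; congr (- _); rewrite -cintD//; [|exact: test2_integrable|exact: test2_integrable].
  by apply: cint_ext => y _; rewrite mulrDl.
have js : (j < s)%N := leq_ltn_trans jn ns.
have I1 : ispan n.+1 (sep (fun t => em t * cderive1 rho t) (fun w => (dcos b w * c w) * Domega j psi w)).
  apply: IspanOne; last exact: leqW.
    by apply: smoothM; [exact: smooth_em|exact: smooth_derive].
  by apply: psmM => //; exact: psm_dcos.
have I2 : ispan n.+1 (sep (fun t => em t * rho t) (fun w => (dsin b w * cderive1 c w) * Domega j psi w)).
  apply: IspanOne; last exact: leqW.
    by apply: smoothM => //; exact: smooth_em.
  by apply: psmM; [exact: psm_dsin|exact: psm_derive].
have I3 : ispan n.+1 (sep (fun t => em t * rho t) (fun w => ('i * dsin b w * c w) * Domega j.+1 psi w)).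
  apply: IspanOne => //.
    by apply: smoothM => //; exact: smooth_em.
  by apply: psmM => //; apply: psmM; [exact: psm_cst|exact: psm_dsin].
have iv := IspanAdd (IspanAdd I1 I2) I3; eexists; split; first exact: iv.
  exact: (ispan_locint2 ns iv).
move=> chi tc; have mulC u' v' : cint leb2 (setT : set T2) (fun y => u' y * v' y) =
    cint leb2 (setT : set T2) (fun y => v' y * u' y).
  by apply: cint_ext => y _; rewrite mulrC.
have t_int v' : ispan n.+1 v' -> cintegrable leb2 (setT : set T2) (fun y => chi y * v' y).
  move=> iw; apply: (@cintegrable_ext _ T2 R leb2 setT (fun y => v' y * chi y)) => //.
    by move=> y _; rewrite mulrC.
  by apply: test2_integrable => //; exact: ispan_locint2 ns iw.
rewrite mulC sep_weak_partial//; congr (- _); rewrite [RHS]mulC.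
rewrite -cintD//; [|exact: t_int|exact: t_int].
rewrite -cintD//; [|by apply: cintegrableD => //; exact: t_int|exact: t_int].
by apply: cint_ext => y _; rewrite -!mulrDr.
Qed.

Lemma ispan_iter b n k u : (n + k <= s)%N -> ispan n u -> exists2 v, ispan (n + k)%N v &
  forall chi, test2 chi -> cint leb2 (setT : set T2) (fun y => u y * iter k (partial b) chi y) =
    (-1) ^+ k * cint leb2 (setT : set T2) (fun y => v y * chi y).
Proof.
elim: k n u => [|k ih] n u; first by rewrite addn0 => ns iu; exists u => // chi _; rewrite mul1r.
rewrite addnS -addSn => ns iu.
have [|v iv hv] := ispan_partial b _ iu; first by apply: leq_trans ns; rewrite addSn ltnS leq_addr.
have [w iw hw] := ih _ _ ns iv; exists w => // chi tc.
rewrite [LHS](hv _ (test2_iter b k tc)) hw// exprS mulN1r mulNr//.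
Qed.

Lemma ispan_weakD2 al n u : (n + (al.1 + al.2) <= s)%N -> ispan n u -> exists v, is_weakD2 al u v.
Proof.
rewrite addnA => ns iu.
have ns1 : (n + al.1 <= s)%N by apply: leq_trans ns; exact: leq_addr.
have [v iv hv] := ispan_iter true ns1 iu; have [w iw hw] := ispan_iter false ns iv.
exists w; split.
- by apply: ispan_locint2 iu; apply: leq_trans ns1; exact: leq_addr.
- exact: ispan_locint2 iw.
move=> chi tc; have tcd := test2_iter false al.2 tc.
by rewrite [LHS](hv _ tcd) hw// mulrA -exprD.
Qed.

(** Transposition of the operator from a test function to a separated function with Sobolev angular
    factor. Cutting off the radial factor outside the support of [chi] changes nothing and gives
    access to the smooth case and to density. *)
Lemma sep_diffop_test m (p : 'I_(2 * m).+1 -> R[i]) b rho chi : (2 * m <= s)%N ->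
  polar_form p b -> smooth rho -> test2 chi ->
  cint leb2 (setT : set T2) (fun y => diffop classicD p chi y * sep rho psi y) =
  \sum_(j < (2 * m).+1) \sum_(k < (2 * m).+1 | (j + k <= 2 * m)%N)
    cint leb2 (setT : set T2) (fun y => chi y *
      sep (fun t => em t ^+ (2 * m) * iter k Dt rho t) (fun w => b j k w * Domega j psi w) y).
Proof.
move=> ms pf sr tc; have [schi [K [cK Kp K0]]] := tc.
have [kap [M ck [hM hk]]] := cutoff_compact cK Kp; have clK := compact_closed2 cK.
have td := test2_diffop p tc.
have d0 y : ~ K y -> diffop classicD p chi y = 0 by exact: diffop_supp.
have kE (r : R -> R[i]) : forall t, `|t| < M -> kap t * r t = r t by move=> t tM; rewrite hk ?mul1r.
have cutE h (r : R -> R[i]) g : (forall y, ~ K y -> h y = 0) ->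
    cint leb2 (setT : set T2) (fun y => h y * sep (fun t => kap t * r t) g y) =
    cint leb2 (setT : set T2) (fun y => h y * sep r g y).
  by move=> h0; apply: cint_ext => y _; exact: (chi_sep_cut _ _ hM (kE r) h0).
have E (r : R -> R[i]) : csm r -> @L2 _ T1 R leb setT (expc (1 - 0) r).
  by move=> cr; apply/csm_L2/csm_expc.
have w1 := test2_wL2 td; have w2 := test2_wL2 tc.
have cr : csm (fun t => kap t * rho t) by exact: csmM2.
have ckk k : csm (fun t => kap t * (em t ^+ (2 * m) * iter k Dt rho t)).
  by apply: csmM2 => //; apply: smoothM; [exact: smooth_emX|exact: smooth_iter_Dt].
pose Fu j g := \sum_(k < (2 * m).+1 | (j + k <= 2 * m)%N)
    cint leb2 (setT : set T2) (fun y => chi y *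
      sep (fun t => kap t * (em t ^+ (2 * m) * iter k Dt rho t)) (fun w => b j k w * g w) y).
pose Ff g := cint leb2 (setT : set T2) (fun y => diffop classicD p chi y *
  sep (fun t => kap t * rho t) (fun w => 1 * g w) y).
pose F j g := Fu j g + (if j == 0%N then -1 * Ff g else 0).
have Ff1 g : Ff g = cint leb2 (setT : set T2) (fun y => diffop classicD p chi y *
    sep (fun t => kap t * rho t) g y).
  by apply: cint_ext => y _; rewrite /sep; case: eqP => // _; rewrite mul1r.
have lipu j : L2lip (Fu j).
  apply: L2lip_sum => k jk; apply: (sep_lip w2); first exact: E.
  by have [] := polar_form_smooth pf jk.
have lip j : (j <= 2 * m)%N -> L2lip (F j).
  move=> _; apply: L2lipD => //; case: (j == 0)%N; last exact: L2lip0.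
  by apply: L2lipZ; apply: (sep_lip w1); [exact: E|exact: smooth_cst].
have sumF (G : nat -> R -> R[i]) : \sum_(j < (2 * m).+1) F j (G j) =
    \sum_(j < (2 * m).+1) Fu j (G j) - Ff (G 0%N).
  rewrite big_split /=; congr (_ + _); rewrite big_ord_recl /= big1 ?addr0 ?mulN1r//.
have F0 g : psm g -> \sum_(j < (2 * m).+1) F j (iter j Dt g) = 0.
  move=> pg; rewrite (sumF (fun j => iter j Dt g)) Ff1 /=; apply/eqP; rewrite subr_eq0; apply/eqP.
  have tw := sep_test2 cr pg.
  have -> : cint leb2 (setT : set T2) (fun y => diffop classicD p chi y * sep (fun t => kap t * rho t) g y) =
      cint leb2 (setT : set T2) (fun y => sep (fun t => kap t * rho t) g y * diffop classicD p chi y).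
    by apply: cint_ext => y _; rewrite mulrC.
  rewrite diffop_ibp// /Fu.
  have iS (j k : 'I_(2 * m).+1) : (j + k <= 2 * m)%N -> cintegrable leb2 (setT : set T2) (fun y => chi y *
      sep (fun t => kap t * (em t ^+ (2 * m) * iter k Dt rho t)) (fun w => b j k w * iter j Dt g w) y).
    move=> jk; have [sb _] := polar_form_smooth pf jk.
    by have [] := sep_pairing w2 (E _ (ckk k)) (L2_smoothM sb (L2_I2pi_smooth (smooth_iter_Dt j pg.1))).
  transitivity (\sum_(j < (2 * m).+1) cint leb2 (setT : set T2)
      (fun y => \sum_(k < (2 * m).+1 | (j + k <= 2 * m)%N) chi y *
      sep (fun t => kap t * (em t ^+ (2 * m) * iter k Dt rho t)) (fun w => b j k w * iter j Dt g w) y)).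
    by apply: eq_bigr => j _; rewrite cint_sum// => k jk; exact: iS.
  rewrite -cint_sum//; last by move=> j _; apply: cintegrable_sum => // k jk; exact: iS.
  apply: cint_ext => y _; rewrite (diffop_sepE _ pf)// mulr_suml; apply: eq_bigr => j _.
  rewrite mulr_suml; apply: eq_bigr => k _; rewrite [RHS]mulrC.
  have [Ky|/K0 ->] := pselect (K y); last by rewrite !mul0r.
  have yE : (y == (0, 0)) = false by apply/eqP; exact: Kp.
  rewrite /sep !yE -/(lnr y) (cut_Dt sr ck hk)//; last exact: hM.
  by rewrite hk ?mul1r//; exact: hM.
have := W2pi_density_lip hW ms lip F0; rewrite (sumF (fun j => Domega j psi)) => /eqP.
rewrite subr_eq0 Ff1 => /eqP e.
transitivity (cint leb2 (setT : set T2) (fun y => diffop classicD p chi y *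
    sep (fun t => kap t * rho t) (Domega 0 psi) y)).
  rewrite cutE//; have hD : is_weakD1 0 psi psi.
    by apply: is_weakD1_0; have [] := W2pi_weakD1 hW (leq0n s).
  have ae := Domega_eq hW (leq0n s) hD.
  have L0 := W2pi_L2 hW (leq0n s).
  have md : @cmeas _ T2 R setT (diffop classicD p chi) by apply: smooth2_cmeas => //; case: td.
  have mr : @cmeas _ T1 R setT rho by exact: smooth_cmeas.
  apply: (@cint_ae_eq _ T2 R leb2) => //.
  - apply: cmeasM => //; apply: sep_cmeas => //.
    by apply: locint1_cmeas; have [] := W2pi_weakD1 hW (leq0n s).
  - by apply: cmeasM => //; apply: sep_cmeas => //; case: L0.
  apply: ae_imp (sep_ae ae) => y [y0 [_ e1]] _; rewrite /sep; case: eqP => // _.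
  by rewrite e1 mul1r.
rewrite -e; apply: eq_bigr => j _; apply: eq_bigr => k _; exact: cutE.
Qed.

End SeparatedDerivatives.

(** * Power solutions *)

Section ExponentialPolynomials.
Context {R : realType}.
Implicit Types (t x w : R) (z : R[i]) (A : {poly R[i]}).

(* [D_t] on exponential polynomials: [Dt (expol z A) = expol z (Lp z A)] *)
Definition Lp z A : {poly R[i]} := z *: A - 'i *: A^`().

Definition Aq (q : nat) : {poly R[i]} := ('i ^+ q / q`!%:R) *: 'X^q.

Definition expol z A : R -> R[i] := fun t => cexp ('i * z * t%:C) * A.[t%:C].

Lemma smooth_expol z A : smooth (expol z A).
Proof. by apply: smoothM; [exact: smooth_cexp|exact: smooth_horner]. Qed.

Lemma Dt_expol z A : Dt (expol z A) = expol z (Lp z A).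
Proof.
apply/funext => t; rewrite /Dt /expol cderive1M; [|exact: smooth_cexp|exact: smooth_horner].
rewrite cderive1_cexp cderive1_horner /Lp hornerD hornerN !hornerZ.
have i2 : 'i * 'i = -1 :> R[i] by rewrite -expr2 sqr_i.
have -> : - 'i * ('i * z * cexp ('i * z * t%:C) * A.[t%:C] + cexp ('i * z * t%:C) * (A^`()).[t%:C]) =
   cexp ('i * z * t%:C) * ((- ('i * 'i)) * z * A.[t%:C] - 'i * (A^`()).[t%:C]) by ring.
by rewrite i2 opprK mul1r.
Qed.

Lemma iter_Dt_expol k z A : iter k Dt (expol z A) = expol z (iter k (Lp z) A).
Proof. by elim: k => //= k ->; rewrite Dt_expol. Qed.

Lemma LpD z A B : Lp z (A + B) = Lp z A + Lp z B.
Proof. by rewrite /Lp derivD !scalerDr opprD addrACA. Qed.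

Lemma LpZ z a A : Lp z (a *: A) = a *: Lp z A.
Proof.
rewrite /Lp derivZ scalerBr !scalerA; congr (_ *: _ - _ *: _); exact: mulrC.
Qed.

Lemma Lp0 z : Lp z 0 = 0.
Proof. by rewrite /Lp deriv0 !scaler0 subr0. Qed.

Lemma Lp_sum z I (r : seq I) (P : pred I) (F : I -> {poly R[i]}) :
  Lp z (\sum_(i <- r | P i) F i) = \sum_(i <- r | P i) Lp z (F i).
Proof. by apply: (big_morph _ (LpD z) (Lp0 z)). Qed.

(** The normalisation of [Aq q] as (i t)^q / q! makes [Lp z] the scalar z plus the lowering of the
    index by one. *)
Lemma Lp_Aq z q : Lp z (Aq q) = z *: Aq q + (if q is q'.+1 then Aq q' else 0).
Proof.
rewrite /Lp; congr (_ + _); case: q => [|q]; rewrite /Aq.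
  by rewrite derivZ derivXn mulr0n !scaler0 oppr0.
rewrite derivZ derivXn /= -(scaler_nat q.+1 'X^q) !scalerA -scaleNr; congr (_ *: _).
have i2 : 'i * 'i = -1 :> R[i] by rewrite -expr2 sqr_i.
have f0 : (q`!%:R : R[i]) != 0 by rewrite pnatr_eq0 -lt0n fact_gt0.
have q0 : (q.+1%:R : R[i]) != 0 by rewrite pnatr_eq0.
rewrite exprS factS natrM.
have -> : - ('i * ('i * 'i ^+ q / (q.+1%:R * q`!%:R) * q.+1%:R)) =
   (- ('i * 'i)) * ('i ^+ q / (q.+1%:R * q`!%:R) * q.+1%:R) :> R[i] by ring.
rewrite i2 opprK mul1r.
move: (q.+1%:R : R[i]) (q`!%:R : R[i]) q0 f0 => x y x0 y0.
by field; rewrite x0 y0.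
Qed.

(** The binomial theorem for the sum of a scalar and the lowering operator, which commute. *)
Lemma iter_Lp_Aq k z q :
  iter k (Lp z) (Aq q) = \sum_(i < q.+1) ('C(k, i)%:R * z ^+ (k - i)) *: Aq (q - i).
Proof.
elim: k => [|k ih] /=.
  rewrite big_ord_recl /= big1 ?addr0 ?subn0 ?expr0 ?mul1r ?scale1r// => i _.
  by rewrite bin_small// mul0r scale0r.
have bl i : 'C(k, i)%:R * z ^+ (k - i) * z = 'C(k, i)%:R * z ^+ (k.+1 - i).
  have [ik|ki] := leqP i k; first by rewrite subSn// exprSr mulrA.
  by rewrite bin_small// !mul0r.
transitivity (\sum_(i < q.+1) (('C(k, i)%:R * z ^+ (k.+1 - i)) *: Aq (q - i) +
    ('C(k, i)%:R * z ^+ (k - i)) *: (if (q - i)%N is q'.+1 then Aq q' else 0))).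
  by rewrite ih Lp_sum; apply: eq_bigr => i _; rewrite LpZ Lp_Aq scalerDr scalerA bl.
rewrite big_split /= [in RHS]big_ord_recl /= [X in X + _ = _]big_ord_recl /=.
rewrite !bin0 !subn0 -addrA; congr (_ + _).
rewrite [X in _ + X]big_ord_recr /= subnn scaler0 addr0 -big_split /=.
apply: eq_bigr => i _; rewrite /fintype.bump leq0n add1n.
have -> : (q - i)%N = (q - i.+1).+1 by rewrite subnSK.
by rewrite -scalerDl binS natrD !subSS mulrDl.
Qed.

Lemma sum_triangle (V : nmodType) (F : nat -> nat -> V) n :
  \sum_(q < n.+1) \sum_(i < q.+1) F (q - i)%N i = \sum_(a < n.+1) \sum_(i < (n - a).+1) F a i.
Proof.
elim: n => [|n ih]; first by rewrite !big_ord_recl !big_ord0.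
rewrite big_ord_recr ih /= [RHS]big_ord_recr /= subnn.
under [in RHS]eq_bigr => a _ do rewrite subSn -1?ltnS// big_ord_recr /=.
rewrite big_split /= -addrA; congr (_ + _).
rewrite [RHS]addrC [X in _ = X + _]big_ord_recl big_ord0 addr0 [LHS]big_ord_recl subn0.
congr (_ + _).
rewrite (reindex_inj rev_ord_inj) /=; apply: eq_bigr => a _.
have an : (a <= n)%N by rewrite -ltnS.
by rewrite /fintype.bump leq0n add1n subSS -subSn// !subSS subKn// subSS.
Qed.

(* [g r i] stands for the value of the [r]-th coefficient of the pencil on the [i]-th
   element of a Jordan chain *)
Lemma chain_vanish (N : nat) (g : nat -> nat -> R[i]) z nu :
  (forall mu, (mu <= nu)%N ->
    \sum_(i < mu.+1) \sum_(r < N) ('C(r, i)%:R * z ^+ (r - i)) * g r (mu - i)%N = 0) ->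
  \sum_(q < nu.+1) \sum_(r < N) g r (nu - q)%N *: iter r (Lp z) (Aq q) = 0.
Proof.
move=> H.
transitivity (\sum_(q < nu.+1) \sum_(i < q.+1)
    (\sum_(r < N) ('C(r, i)%:R * z ^+ (r - i)) * g r (nu - (q - i) - i)%N) *: Aq (q - i)).
  apply: eq_bigr => q _; under eq_bigr do rewrite iter_Lp_Aq scaler_sumr.
  rewrite exchange_big /=; apply: eq_bigr => i _; rewrite scaler_suml.
  apply: eq_bigr => r _; rewrite scalerA; congr (_ *: _); rewrite mulrC; congr (_ * g _ _).
  have iq : (i <= q)%N by rewrite -ltnS.
  by rewrite -subnDA subnK.
rewrite (sum_triangle (fun a i => (\sum_(r < N) ('C(r, i)%:R * z ^+ (r - i)) * g r (nu - a - i)%N) *: Aq a)).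
apply: big1 => a _; rewrite -scaler_suml H ?scale0r//; exact: leq_subr.
Qed.

End ExponentialPolynomials.

(** * Power solutions built from Jordan chains solve the homogeneous equation *)

Section PowerSolutions.
Context {R : realType}.
Notation T1 := (measurableTypeR R).
Notation T2 := (measurableTypeR R * measurableTypeR R)%type.
Implicit Types (t x w : R) (h chi u v : R * R -> R[i]) (y : R * R).

Lemma ae_forall_lt d (T : measurableType d) (mu : {measure set T -> \bar R}) n (P : nat -> T -> Prop) :
  (forall i, (i < n)%N -> {ae mu, forall o, P i o}) ->
  {ae mu, forall o, forall i, (i < n)%N -> P i o}.
Proof.
elim: n => [|n ih] H; first by apply: ae_true.
have h1 := ih (fun i (ni : (i < n)%N) => H i (ltnW ni)).
apply: ae_imp2 h1 (H n (ltnSn n)) => z hz hn i; rewrite ltnS leq_eqVlt => /orP[/eqP ->//|].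
exact: hz.
Qed.

Lemma ae2_neq0 : {ae leb2, forall y : T2, y <> (0, 0) :> R * R}.
Proof.
have := @sep_ae R (fun=> True) (ae_true _ (fun _ _ => I)).
by apply: ae_imp => y [].
Qed.

Lemma locint2_ext u v : (forall y, y <> (0, 0) -> u y = v y) -> locint2 u -> locint2 v.
Proof.
move=> uv lu K cK Kp; apply: (@cintegrable_ext _ T2 R leb2 K u v) => //.
- by move=> y /set_mem/Kp/uv.
- exact: compact2_measurable.
exact: lu.
Qed.

Lemma is_weakD2_ae al u v g : locint2 v -> {ae leb2, forall y : T2, u y = v y} ->
  is_weakD2 al u g -> is_weakD2 al v g.
Proof.
move=> lv uv [lu lg H]; split=> // chi tc; rewrite -H//; apply/esym.
by apply: cint_test_ae => //; exact: test2_classicD.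
Qed.

Lemma locint2_sum I (r : seq I) (P : pred I) (F : I -> R * R -> R[i]) :
  (forall i, P i -> locint2 (F i)) -> locint2 (fun y => \sum_(i <- r | P i) F i y).
Proof.
move=> h K cK Kp; have mK := compact2_measurable cK.
by apply: cintegrable_sum => // i Pi; exact: h.
Qed.

Lemma is_weakD2_sum al I (r : seq I) (F G : I -> R * R -> R[i]) :
  (forall i, is_weakD2 al (F i) (G i)) ->
  is_weakD2 al (fun y => \sum_(i <- r) F i y) (fun y => \sum_(i <- r) G i y).
Proof.
move=> h; split.
- by apply: locint2_sum => i _; case: (h i).
- by apply: locint2_sum => i _; case: (h i).
move=> chi tc; have td := test2_classicD al tc.
transitivity (cint leb2 (setT : set T2) (fun y => \sum_(i <- r) F i y * classicD al chi y)).
  by apply: cint_ext => y _; rewrite mulr_suml.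
transitivity ((-1) ^+ (al.1 + al.2) * cint leb2 (setT : set T2) (fun y => \sum_(i <- r) G i y * chi y)); last first.
  by congr (_ * _); apply: cint_ext => y _; rewrite mulr_suml.
rewrite !cint_sum//; last 2 first.
- by move=> i _; apply: test2_integrable => //; case: (h i).
- by move=> i _; apply: test2_integrable => //; case: (h i).
by rewrite mulr_sumr; apply: eq_bigr => i _; have [_ _ ->] := h i.
Qed.

Lemma power_solutionE z ch k y : y <> (0, 0) -> power_solution ('i * z) ch k y =
  \sum_(q < k.+1) sep (expol z (Aq q)) (ch (k - q)%N) y.
Proof.
move=> y0; rewrite /power_solution mulr_sumr; apply: eq_bigr => q _.
rewrite /sep ifN; last exact/eqP.
rewrite /expol /Aq hornerZ hornerXn /cpow exprMn.
by rewrite mulrA; congr (_ * _ * _); rewrite mulrA [_^-1 * _]mulrC.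
Qed.

Lemma W2pi_L20 s (psi : R -> R[i]) : W2pi s psi -> @L2 _ T1 R leb I2pi psi.
Proof.
move=> hW; have L0 := W2pi_L2 hW (leq0n s).
have hD : is_weakD1 0 psi psi.
  by apply: is_weakD1_0; have [] := W2pi_weakD1 hW (leq0n s).
have ae := Domega_eq hW (leq0n s) hD.
have [mD iD] := L0; have mI := @measurable_I2pi R.
have mp : @cmeas _ T1 R I2pi psi by apply: locint1_cmeas; case: hD.
split=> //; have := @cintegrable_ae_eq _ T1 R leb I2pi
  (fun x => (cabs (Domega 0 psi x) ^+ 2)%:C) (fun x => (cabs (psi x) ^+ 2)%:C) mI.
move=> h; have {h}[] := h _ _ _ => //.
- by apply: cmeas_real; apply: measurable_funX; exact: (measurable_cabs mI mp).
- by apply: ae_imp ae => x e Ix; rewrite e// mul1r.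
by split=> //=; have [] := @cintegrable0 _ T1 R leb I2pi.
Qed.

Lemma weakD2_sep s (psi rho : R -> R[i]) al : W2pi s psi -> smooth rho -> (al.1 + al.2 <= s)%N ->
  exists g, is_weakD2 al (sep rho psi) g.
Proof.
move=> hW sr als; have hD : is_weakD1 0 psi psi.
  by apply: is_weakD1_0; have [] := W2pi_weakD1 hW (leq0n s).
have ae := Domega_eq hW (leq0n s) hD.
have [g hg] := @ispan_weakD2 R s psi hW al 0 _ als (@IspanOne R psi 0 rho (fun=> 1) 0 sr (psm_cst 1) isT).
exists g; apply: is_weakD2_ae hg; first by apply: locint2_sep => //; exact: W2pi_L20 hW.
apply: ae_imp (sep_ae ae) => y [y0 [_ e]]; rewrite /sep; case: eqP => // _.
by rewrite e !mul1r.
Qed.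

Lemma chain_pointwise m b s s' z kap ch nu :
  (forall j k, (j + k <= 2 * m)%N -> smooth (b j k)) -> (2 * m <= s)%N ->
  jordan_chain s s' (pencil m b) z kap ch -> (nu < kap)%N ->
  {ae leb, forall w : R, I2pi w -> 
    \sum_(q < nu.+1) \sum_(r < (2 * m).+1) Bop m b r (ch (nu - q)%N) w *: iter r (Lp z) (Aq q) = 0}.
Proof.
move=> sb ms jc nk.
have H mu : (mu < nu.+1)%N -> zero2pi (fun w => \sum_(i < mu.+1) \sum_(r < (2 * m).+1)
    ('C(r, i)%:R * z ^+ (r - i)) * Bop m b r (ch (mu - i)%N) w).
  by move=> mn; apply: (chain_relation sb ms jc); rewrite (leq_trans mn).
apply: ae_imp (ae_forall_lt H) => w hw Iw.
apply: (@chain_vanish R (2 * m).+1 (fun r i => Bop m b r (ch i) w)) => mu mn.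
exact: hw.
Qed.

(** Weak derivatives up to order 2m exist because each summand is separated with a Sobolev angular
    factor. The operator is moved to the test function and back in polar form; at almost every angle
    the resulting exponential polynomial is 0 by the chain relations. *)
Lemma solves_power m (p : 'I_(2 * m).+1 -> R[i]) b s s' z kap ch nu :
  polar_form p b -> (2 * m <= s)%N ->
  jordan_chain s s' (pencil m b) z kap ch -> (nu < kap)%N ->
  solves p (power_solution ('i * z) ch nu) (fun=> 0).
Proof.
move=> pf ms jc nk; have [hW _] := jc.
have sb j k (jk : (j + k <= 2 * m)%N) : smooth (b j k) by case: (polar_form_smooth pf jk).
have hWq (q : 'I_nu.+1) : W2pi s (ch (nu - q)%N) by apply: hW; rewrite (leq_ltn_trans (leq_subr _ _)).
pose V y := \sum_(q < nu.+1) sep (expol z (Aq q)) (ch (nu - q)%N) y.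
have vV y : y <> (0, 0) -> V y = power_solution ('i * z) ch nu y by move=> /power_solutionE ->.
have lV : locint2 V.
  by apply: locint2_sum => q _; apply: locint2_sep; [exact: smooth_expol|exact: W2pi_L20 (hWq q)].
have lv : locint2 (power_solution ('i * z) ch nu) by exact: locint2_ext vV lV.
have D (k : 'I_(2 * m).+1) : exists g, is_weakD2 (k : nat, (2 * m - k)%N) (power_solution ('i * z) ch nu) g.
  have h (q : 'I_nu.+1) : exists g, is_weakD2 (k : nat, (2 * m - k)%N) (sep (expol z (Aq q)) (ch (nu - q)%N)) g.
    apply: (weakD2_sep (hWq q)); first exact: smooth_expol.
    by rewrite /= subnKC// -ltnS.
  have [G hG] := choice h.
  exists (fun y => \sum_q G q y); apply: is_weakD2_ae (is_weakD2_sum _ hG) => //.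
  by apply: ae_imp ae2_neq0 => y /vV.
split=> //; pose Z y := diffop weakD2 p (power_solution ('i * z) ch nu) y.
have lZ : locint2 Z.
  have t0 : test2 (fun=> 0 : R[i]).
    split; last by exists set0; split=> //; exact: compact0.
    apply: (@smooth2_coind R [set v | v = fun=> 0]) => // _ ->; split=> [y|b']; first exact: cdiff_cst.
    by apply/funext => y; rewrite partialE cderive_cst.
  by have [] := weakD2_diffop p D t0.
apply: weak_unique2 => // chi tc; have [_ ->] := weakD2_diffop p D tc.
have td := test2_diffop p tc; have mT := @measurableT _ T2.
transitivity (cint leb2 (setT : set T2) (fun y => \sum_(q < nu.+1)
    sep (expol z (Aq q)) (ch (nu - q)%N) y * diffop classicD p chi y)).
  apply: cint_ext => y _; have [->|/eqP y0] := eqVneq y (0, 0).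
    by rewrite (test2_origin td) mulr0 big1// => q _; rewrite mulr0.
  by rewrite -vV// /V mulr_suml.
rewrite cint_sum//; last first.
  move=> q _; apply: test2_integrable => //; apply: locint2_sep; first exact: smooth_expol.
  exact: W2pi_L20 (hWq q).
pose S (q : 'I_nu.+1) (j k : 'I_(2 * m).+1) y := sep (fun t => em t ^+ (2 * m) * iter k Dt (expol z (Aq q)) t)
  (fun w => b j k w * Domega j (ch (nu - q)%N) w) y.
have lS q (j k : 'I_(2 * m).+1) : (j + k <= 2 * m)%N -> locint2 (S q j k).
  move=> jk; apply: locint2_sep.
    by apply: smoothM; [exact: smooth_emX|apply: smooth_iter_Dt; exact: smooth_expol].
  apply: L2_smoothM; first exact: sb.
  by apply: (W2pi_L2 (hWq q)); apply: leq_trans ms; rewrite -ltnS.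
have iS q (j k : 'I_(2 * m).+1) : (j + k <= 2 * m)%N ->
    cintegrable leb2 (setT : set T2) (fun y => chi y * S q j k y).
  move=> jk; apply: (@cintegrable_ext _ T2 R leb2 setT (fun y => S q j k y * chi y)) => //.
    by move=> y _; rewrite mulrC.
  by apply: test2_integrable => //; exact: lS.
transitivity (\sum_(q < nu.+1) \sum_(j < (2 * m).+1) \sum_(k < (2 * m).+1 | (j + k <= 2 * m)%N)
    cint leb2 (setT : set T2) (fun y => chi y * S q j k y)).
  apply: eq_bigr => q _; rewrite -(sep_diffop_test (hWq q) ms pf (smooth_expol _ _) tc).
  by apply: cint_ext => y _; rewrite mulrC.
transitivity (cint leb2 (setT : set T2) (fun y => \sum_(q < nu.+1) \sum_(j < (2 * m).+1)
    \sum_(k < (2 * m).+1 | (j + k <= 2 * m)%N) chi y * S q j k y)).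
  rewrite cint_sum//; last first.
    by move=> q _; apply: cintegrable_sum => // j _; apply: cintegrable_sum => // k; exact: iS.
  apply: eq_bigr => q _; rewrite cint_sum//; last by move=> j _; apply: cintegrable_sum => // k; exact: iS.
  by apply: eq_bigr => j _; rewrite cint_sum// => k; exact: iS.
rewrite -[RHS](@cint0 _ T2 R leb2 setT); apply: (@cint_ae_eq _ T2 R leb2) => //.
- apply: cmeas_sum => q _; apply: cmeas_sum => j _; apply: cmeas_sum => k jk.
  by apply: cintegrable_meas; exact: iS.
- exact: cmeas_cst.
have cp := chain_pointwise sb ms jc nk.
apply: ae_imp (sep_ae cp) => y [y0 [_ e]] _.
transitivity (chi y * (em (lnr y) ^+ (2 * m) * cexp ('i * z * (lnr y)%:C) *
    (\sum_(q < nu.+1) \sum_(r < (2 * m).+1) Bop m b r (ch (nu - q)%N) (polar_angle y) *: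
      iter r (Lp z) (Aq q)).[(lnr y)%:C])); last by rewrite e horner0 !mulr0.
rewrite horner_sum !mulr_sumr; apply: eq_bigr => q _.
rewrite horner_sum !mulr_sumr (exchange_big_dep xpredT)//=; apply: eq_bigr => k _.
rewrite hornerZ /Bop !mulr_suml !mulr_sumr; apply: eq_bigr => j _.
rewrite /S /sep; case: eqP => // _; rewrite -/(lnr y) iter_Dt_expol /expol; ring.
Qed.

End PowerSolutions.

(** * Green's formula for the pencils *)

Section PencilDerivatives.
Context {R : realType}.
Implicit Types (phi : R -> R[i]) (z lam : R[i]).

Lemma is_derive_horner (q : {poly R[i]}) z :
  is_derive (z : R[i]^o) 1 (horner q : R[i]^o -> R[i]^o) q^`().[z].
Proof.
elim/poly_ind: q => [|q c ih].
  rewrite deriv0 horner0 (_ : horner 0 = cst 0); first exact: is_derive_cst.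
  by apply/funext => x; rewrite horner0.
rewrite (_ : horner _ = (fun x => q.[x] * x + c : R[i]^o)); last first.
  by apply/funext => x; rewrite !hornerE.
have h : is_derive (z : R[i]^o) 1 (fun x => q.[x] * x + c : R[i]^o)
    (q.[z] *: 1 + z *: q^`().[z] + 0).
  apply: is_deriveD; apply: is_deriveM.
apply: is_derive_eq h _.
by rewrite derivMXaddC hornerD hornerMX /GRing.scale /= mulr1 addr0 (mulrC z).
Qed.

Lemma derive1n_horner s (p : {poly R[i]}) :
  derive1n s (horner p : R[i]^o -> R[i]^o) = horner p^`(s).
Proof.
elim: s => [|s ih]; first by rewrite derivn0.
rewrite derive1nS ih derivnS; apply/funext => z; rewrite derive1E.
by apply: derive_val; exact: is_derive_horner.
Qed.

Lemma pencil_deriveE m b s lam phi w : pencil_derive m b s lam phi w =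
  s`!%:R * \sum_(r < (2 * m).+1) ('C(r, s)%:R * lam ^+ (r - s)) * Bop m b r phi w.
Proof.
rewrite /pencil_derive.
pose p : {poly R[i]} := \sum_(r < (2 * m).+1) Bop m b r phi w *: 'X^r.
rewrite (_ : (fun z : R[i] => _) = horner p); last first.
  apply/funext => z; rewrite pencilE /p horner_sum; apply: eq_bigr => r _.
  by rewrite hornerZ hornerXn mulrC.
rewrite derive1n_horner /p raddf_sum /= horner_sum mulr_sumr; apply: eq_bigr => r _.
rewrite derivnZ hornerZ derivnXn hornerMn hornerXn -mulr_natr.
have := bin_ffact r s; move: (nat_of_ord r) => k <-; rewrite natrM.
ring.
Qed.

End PencilDerivatives.

(** * Green formula, for smooth and for Sobolev functions on the circle *)

Section GreenFormula.
Context {R : realType}.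
Notation T1 := (measurableTypeR R).
Notation T2 := (measurableTypeR R * measurableTypeR R)%type.
Implicit Types (t x w : R) (f g phi psi tau : R -> R[i]) (u v : R * R -> R[i]) (y : R * R).

Lemma sepM tau tau' g g' y : sep tau g y * sep tau' g' y =
  sep (fun t => tau t * tau' t) (fun w => g w * g' w) y.
Proof. by rewrite /sep; case: eqP => _; rewrite ?mulr0// mulrACA. Qed.

Definition ip f g : R[i] := cint leb I2pi (fun w => f w * (g w)^*).

Lemma conjE (z : R[i]) : Num.conj z = conjc z. Proof. by []. Qed.

Lemma conjc_i : conjc ('i : R[i]) = - 'i. Proof. by rewrite -conjE conjCi. Qed.

Lemma conjcM (x y : R[i]) : conjc (x * y) = conjc x * conjc y. Proof. exact: rmorphM. Qed.

Lemma conjcX (x : R[i]) n : conjc (x ^+ n) = conjc x ^+ n. Proof. exact: rmorphXn. Qed.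

Lemma ip_lip (c h : R -> R[i]) : smooth c -> @L2 _ T1 R leb I2pi h ->
  L2lip (fun g => cint leb I2pi (fun w => (c w * g w) * h w)).
Proof.
move=> sc Lh; have mI := @measurable_I2pi R; have [C C0 hC] := sqn_smoothM sc.
have h0 := sqn_ge0 leb I2pi h.
exists (Num.sqrt (4 * sqn leb I2pi h) * C) => g g' Lg Lg'.
have Ld := L2B mI Lg Lg'.
have ic k : @L2 _ T1 R leb I2pi k -> cintegrable leb I2pi (fun w => (c w * k w) * h w).
  by move=> Lk; apply: L2_cintegrableM => //; exact: L2_smoothM.
rewrite -cintB//; [|exact: ic|exact: ic].
have -> : cint leb I2pi (fun w => c w * g w * h w - c w * g' w * h w) =
    cint leb I2pi (fun w => (c w * (g w - g' w)) * h w).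
  by apply: cint_ext => w _; rewrite -mulrBl mulrBr.
have D0 := sqn_ge0 leb I2pi (fun w => g w - g' w).
rewrite -(ler_pXn2r (ltn0Sn 1)) ?nnegrE ?cabs_ge0 ?mulr_ge0 ?sqrtr_ge0//.
apply: (le_trans (cauchy_schwarz mI (L2_smoothM sc Ld) Lh)).
rewrite !exprMn !sqr_sqrtr ?mulr_ge0//.
have -> : 4 * sqn leb I2pi h * C ^+ 2 * sqn leb I2pi (fun w => g w - g' w) =
  4 * ((C ^+ 2 * sqn leb I2pi (fun w => g w - g' w)) * sqn leb I2pi h) by ring.
by rewrite ler_wpM2l// ler_wpM2r// hC.
Qed.

Lemma csm_bump n (c d : R) : csm (bump n.+1 c d).
Proof.
split; first exact: smooth_bump.
exists (`|c| + `|d| + 1) => [|t ht]; first by rewrite ltr_wpDl// addr_ge0.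
apply: bump_out; rewrite /= in_itv/= => /andP[h1 h2].
have := ler_norm c; have := ler_norm (- c); have := ler_norm d; have := ler_norm (- d).
by have := ler_norm t; case: (lerP 0 t) ht => t0 ht; rewrite ?(ger0_norm t0) ?(ltr0_norm t0) ?normrN in ht *; lra.
Qed.

Lemma cint_bump_neq0 : cint leb setT (bump 1 (- 2) (3 : R)) != 0.
Proof.
set B := bump 1 (- 2) (3 : R).
have cB : csm B by exact: csm_bump.
have [i1 i2] := csm_cintegrable cB.
have Bge t : 0 <= reC (B t).
  rewrite /B /bump -rmorphM /= mulr_ge0// step_ge0//.
have B1 t : `[0, 1]%classic t -> reC (B t) = 1.
  by rewrite /= in_itv/= => /andP[h1 h2]; rewrite /B /bump !step1 /= ?mulr1//; lra.
apply/eqP => /(congr1 reC) /=; apply/eqP; rewrite gt_eqF//.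
apply: (lt_le_trans ltr01).
have mI : measurable (`[0, 1]%classic : set T1) by exact: measurable_itv.
have -> : 1 = Rintegral leb `[0, 1]%classic (reC \o B).
  rewrite (@eq_Rintegral _ _ _ leb _ (cst 1)); last by move=> t /set_mem/B1.
  by rewrite Rintegral_cst//= /leb /= lebesgue_measure_itv/= lte_fin ltr01 sube0 mul1r.
rewrite /Rintegral fine_le//.
- by apply: integrable_fin_num => //; apply: integrableS i1.
- exact: integrable_fin_num.
apply: ge0_subset_integral => //.
- by case/integrableP: i1.
- by move=> t _; rewrite /= lee_fin; exact: Bge.
Qed.

Section Smooth.
Variables (m : nat) (p : 'I_(2 * m).+1 -> R[i]) (b bs : nat -> nat -> R -> R[i]).
Hypotheses (hb : polar_form p b) (hbs : polar_form (adjoint p) bs).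

Definition Bsm (b : nat -> nat -> R -> R[i]) (k : nat) phi : R -> R[i] :=
  fun w => \sum_(j < (2 * m).+1 | (j + k <= 2 * m)%N) b j k w * iter j Dt phi w.

Lemma psm_iter_Dt j phi : psm phi -> psm (iter j Dt phi).
Proof.
move=> pp; elim: j => //= j ih; rewrite /Dt.
by apply: psmM; [exact: psm_cst|exact: psm_derive].
Qed.

Lemma psm_Bsm b' k (q : 'I_(2 * m).+1 -> R[i]) phi : polar_form q b' -> psm phi -> psm (Bsm b' k phi).
Proof.
move=> pf pp; rewrite /Bsm; elim: (index_enum _) => [|j r ih].
  by rewrite (_ : (fun _ => _) = fun=> 0); [exact: psm_cst|apply/funext => w; rewrite big_nil].
case jk: (j + k <= 2 * m)%N.
  rewrite (_ : (fun _ => _) = fun w => b' j k w * iter j Dt phi w +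
      \sum_(j <- r | (j + k <= 2 * m)%N) b' j k w * iter j Dt phi w).
    by apply: psmD => //; apply: psmM; [exact: polar_form_smooth pf jk|exact: psm_iter_Dt].
  by apply/funext => w; rewrite big_cons jk.
rewrite (_ : (fun _ => _) = fun w => \sum_(j <- r | (j + k <= 2 * m)%N) b' j k w * iter j Dt phi w)//.
by apply/funext => w; rewrite big_cons jk.
Qed.

Lemma diffop_sepB (q : 'I_(2 * m).+1 -> R[i]) b' tau phi y : polar_form q b' -> csm tau -> psm phi ->
  diffop classicD q (sep tau phi) y =
  \sum_(k < (2 * m).+1) sep (fun t => em t ^+ (2 * m) * iter k Dt tau t) (Bsm b' k phi) y.
Proof.
move=> pf ct pp; rewrite (diffop_sepE _ pf)// (exchange_big_dep xpredT)//=.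
apply: eq_bigr => k _; rewrite /sep /Bsm; case: eqP => y0; first by rewrite big1.
by rewrite mulr_sumr.
Qed.

Lemma cint_sep_csm tau g : csm tau -> psm g ->
  cintegrable leb2 (setT : set T2) (sep tau g) /\
  cint leb2 (setT : set T2) (sep tau g) =
    cint leb setT (fun t => tau t * (expR (2 * t))%:C) * cint leb I2pi g.
Proof.
move=> ct [sg _]; apply: sep_cint.
  exact: (csm_cintegrable (csm_expc 2 ct)).
apply: (cintegrableS _ _ _ (smooth_cintegrable 0 (2 * pi) sg)) => //.
  exact: measurable_I2pi.
by move=> t; rewrite /I2pi /= !in_itv/= => /andP[/ltW -> /ltW ->].
Qed.

Lemma green_tests tau1 tau2 phi psi : csm tau1 -> csm tau2 -> psm phi -> psm psi ->
  \sum_(k < (2 * m).+1) cint leb setT (fun t => em t ^+ (2 * m) * iter k Dt tau1 t * (tau2 t)^* *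
      (expR (2 * t))%:C) * ip (Bsm b k phi) psi =
  \sum_(k < (2 * m).+1) cint leb setT (fun t => tau1 t * (em t ^+ (2 * m) * iter k Dt tau2 t)^* *
      (expR (2 * t))%:C) * ip phi (Bsm bs k psi).
Proof.
move=> c1 c2 p1 p2; have t1 := sep_test2 c1 p1; have t2 := sep_test2 c2 p2.
have mT := @measurableT _ T2.
have := diffop_ibp p t1 (test2J t2).
have -> : cint leb2 (setT : set T2) (fun y => diffop classicD p (sep tau1 phi) y * (sep tau2 psi y)^*) =
   \sum_(k < (2 * m).+1) cint leb setT (fun t => em t ^+ (2 * m) * iter k Dt tau1 t * (tau2 t)^* *
      (expR (2 * t))%:C) * ip (Bsm b k phi) psi.
  have H (k : 'I_(2 * m).+1) := @cint_sep_csm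
    (fun t => (em t ^+ (2 * m) * iter k Dt tau1 t) * (tau2 t)^*) (fun w => Bsm b k phi w * (psi w)^*)
    (csmM2 (csmJ c2).1 (csm_em_Dt (2 * m) k c1)) (psmM (psm_Bsm k hb p1) (psmJ p2)).
  under [RHS]eq_bigr => k _ do rewrite /ip -(H k).2.
  rewrite -cint_sum//; last by move=> k _; case: (H k).
  apply: cint_ext => y _; rewrite (diffop_sepB _ hb)// mulr_suml; apply: eq_bigr => k _.
  by rewrite conjE sepJ sepM.
move=> <-; have -> : cint leb2 (setT : set T2) (fun y => sep tau1 phi y * diffop classicD p (fun y => (sep tau2 psi y)^*) y) =
   cint leb2 (setT : set T2) (fun y => sep tau1 phi y * (diffop classicD (adjoint p) (sep tau2 psi) y)^*).
  by apply: cint_ext => y _; rewrite diffopJ//; case: t2.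
have H (k : 'I_(2 * m).+1) := @cint_sep_csm
  (fun t => tau1 t * (em t ^+ (2 * m) * iter k Dt tau2 t)^*) (fun w => phi w * (Bsm bs k psi w)^*)
  (csmM2 (csmJ (csm_em_Dt (2 * m) k c2)).1 c1) (psmM p1 (psmJ (psm_Bsm k hbs p2))).
under [RHS]eq_bigr => k _ do rewrite /ip -(H k).2.
rewrite -cint_sum//; last by move=> k _; case: (H k).
apply: cint_ext => y _; rewrite (diffop_sepB _ hbs)// rmorph_sum mulr_sumr; apply: eq_bigr => k _.
by rewrite -[RHS]sepM; congr (_ * _); exact: sepJ.
Qed.

(** The planar formula is applied to exponentials in t times [phi] and [psi], with the exponents
    chosen so that every integral over t becomes a power of the spectral parameter times the
    integral of one bump. Dividing by that nonzero number leaves the formula on the circle. *)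
Lemma green_smooth phi psi z : psm phi -> psm psi ->
  \sum_(k < (2 * m).+1) (z - 2 * 'i * (m%:R - 1)) ^+ k * ip (Bsm b k phi) psi =
  \sum_(k < (2 * m).+1) z ^+ k * ip phi (Bsm bs k psi).
Proof.
move=> p1 p2; set B := bump 1 (- 2) (3 : R).
have cB : csm B by exact: csm_bump.
(* The factors e^(-2mt), e^(2t) and the conjugate of [e2] combine to e^(at); transposing D_t onto
   this exponential multiplies it by i a = z - 2i(m-1). *)
pose a : R[i] := 2 - 2 * m%:R - 'i * z.
pose f t := cexp (a * t%:C).
have sf : smooth f by exact: smooth_cexp.
pose tau1 t := cexp (- a * t%:C) * B t.
have c1 : csm tau1 by apply: csmM => //; exact: smooth_cexp.
(* [K] is 1 on a neighbourhood of the support of [tau1], so [tau2] has bounded support yet behaves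
   there as the exponential [e2]. *)
pose K := bump 1 (- 7) (7 : R).
have cK : csm K by exact: csm_bump.
have K1 t : `|t| < 4 -> K t = 1.
  by rewrite ltr_norml => /andP[h1 h2]; rewrite /K /bump !step1 ?mulr1//; rewrite mul1r; lra.
have B0 t : 3 < `|t| -> B t = 0.
  move=> ht; apply: bump_out; rewrite /= in_itv/= => /andP[h1 h2].
  by move: ht; rewrite ltNge ler_norml (ltW h2) andbT => /negP; apply; lra.
pose e2 := expol z^* 1 .
have se2 : smooth e2 by exact: smooth_expol.
pose tau2 t := K t * e2 t.
have c2 : csm tau2 by exact: csmM2.
have i2 : 'i * 'i = -1 :> R[i] by rewrite -expr2 sqr_i.
have Jz t : (e2 t)^* = cexp (- ('i * z * t%:C)).
  rewrite /e2 /expol hornerC mulr1 cexpJ; congr cexp.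
  have ci : conjc ('i : R[i]) = - 'i by exact: conjc_i.
  by rewrite !conjcM conjcK conjc_real ci !mulNr.
have De2 k t : iter k Dt e2 t = (z^*) ^+ k * e2 t.
  rewrite /e2 iter_Dt_expol; have -> : iter k (Lp z^*) (1 : {poly R[i]}) = (z^* ^+ k) *: 1.
    elim: k => [|k ih] /=; first by rewrite scale1r.
    by rewrite ih LpZ /Lp -[X in X^`()]/(1%:P) derivC scaler0 subr0 scalerA -exprSr.
  by rewrite /expol hornerZ mulrCA.
have expf t : em t ^+ (2 * m) * (e2 t)^* * (expR (2 * t))%:C = f t.
  rewrite conjE Jz /em -rmorphXn /= -expRM_natl -!cexp_real -!cexpD /f; congr cexp.
  rewrite /a !rmorphM !rmorphN /= natrM; ring.
have IB : cint leb setT (fun t => f t * tau1 t) = cint leb setT B.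
  apply: cint_ext => t _; rewrite /f /tau1 mulrA -cexpD mulNr subrr cexp0 mul1r//.
have fk k : cint leb setT (fun t => f t * iter k Dt tau1 t) =
    (z - 2 * 'i * (m%:R - 1)) ^+ k * cint leb setT B.
  have sfk j : iter j cderive1 f = fun t => a ^+ j * f t.
    elim: j => [|j ih]; first by apply/funext => t; rewrite mul1r.
    rewrite iterS ih cderive1Z// /f cderive1_cexp; apply/funext => t.
    by rewrite mulrA -exprSr.
  transitivity ((- 'i) ^+ k * cint leb setT (fun t => f t * iter k cderive1 tau1 t)).
    rewrite -cintZ//; last first.
      by apply/csm_cintegrable/csmM => //; elim: k => //= k; exact: cderive1_supp.
    by apply: cint_ext => t _; rewrite iter_DtE; [rewrite mulrCA|case: c1].
  rewrite line_ibp_iter// sfk.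
  have -> : cint leb setT (fun t => a ^+ k * f t * tau1 t) = a ^+ k * cint leb setT B.
    rewrite -IB -cintZ//; last by apply/csm_cintegrable/csmM.
    by apply: cint_ext => t _; rewrite mulrA.
  rewrite !mulrA -!exprMn; congr (_ ^+ k * _).
  have -> : - 'i * -1 * a = - ('i * 'i) * z - 2 * 'i * (m%:R - 1) by rewrite /a; ring.
  by rewrite i2 opprK mul1r.
have := green_tests c1 c2 p1 p2.
have -> : \sum_(k < (2 * m).+1) cint leb setT (fun t => em t ^+ (2 * m) * iter k Dt tau1 t * (tau2 t)^* *
    (expR (2 * t))%:C) * ip (Bsm b k phi) psi =
    cint leb setT B * \sum_(k < (2 * m).+1) (z - 2 * 'i * (m%:R - 1)) ^+ k * ip (Bsm b k phi) psi.
  rewrite mulr_sumr; apply: eq_bigr => k _; rewrite mulrA; congr (_ * _).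
  rewrite [RHS]mulrC -fk; apply: cint_ext => t _; rewrite -expf.
  have [ht|ht] := ltP `|t| 4.
    by rewrite /tau2 K1// mul1r; ring.
  suff -> : iter k Dt tau1 t = 0 by rewrite !mulr0 !mul0r.
  have st : closed [set t : R | `|t| <= 3].
    have -> : [set t : R | `|t| <= 3] = `[(- 3), 3]%classic.
      by apply/seteqP; split=> x /=; rewrite in_itv/= ler_norml.
    exact: itv_closed.
  rewrite iter_DtE; last by case: c1.
  rewrite (near_iter_cderive1 k (g := fun=> 0)).
    have -> : iter k cderive1 (fun=> 0 : R[i]) = fun=> 0.
      elim: (k : nat) => //= n ->; apply/funext => x; exact: is_cdE (is_cd_cst x 0).
    by rewrite mulr0.
  have : open (~` [set t : R | `|t| <= 3]) by exact: closed_openC.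
  move=> /(_ t) h; have {}h := h _; apply: filterS (h _) => [x /= /negP|/=].
    by rewrite -ltNge => hx; rewrite /tau1 B0 ?mulr0.
  by apply/negP; rewrite -ltNge (lt_le_trans _ ht)//; lra.
have -> : \sum_(k < (2 * m).+1) cint leb setT (fun t => tau1 t * (em t ^+ (2 * m) * iter k Dt tau2 t)^* *
    (expR (2 * t))%:C) * ip phi (Bsm bs k psi) =
    cint leb setT B * \sum_(k < (2 * m).+1) z ^+ k * ip phi (Bsm bs k psi).
  rewrite mulr_sumr; apply: eq_bigr => k _; rewrite mulrA; congr (_ * _).
  rewrite -IB mulrC -cintZ//; last by apply/csm_cintegrable/csmM.
  apply: cint_ext => t _; have [ht|ht] := ltP `|t| 4; last first.
    by rewrite /tau1 B0 ?(lt_le_trans _ ht) ?ltr_nat// !mulr0 !mul0r ?mulr0.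
  rewrite -expf (cut_Dt se2 cK K1)// De2.
  by move: (e2 t) => X; rewrite !conjE !conjcM !conjcX conjcK conjc_real -/(em t); ring.
by move/(mulfI (cint_bump_neq0)).
Qed.

End Smooth.

Lemma ip_conj f g : @L2 _ T1 R leb I2pi f -> @L2 _ T1 R leb I2pi g -> ip f g = conjc (ip g f).
Proof.
move=> Lf Lg; have mI := @measurable_I2pi R.
rewrite /ip -[RHS](@cintJ _ T1 R leb _ _ mI (L2_cintegrableM mI Lg (L2J mI Lf))).
by apply: cint_ext => w _; rewrite conjE conjcM conjcK mulrC.
Qed.

Lemma ip_sumZ I (r : seq I) (P : pred I) (z : I -> R[i]) (F : I -> R -> R[i]) g :
  (forall i, P i -> @L2 _ T1 R leb I2pi (F i)) -> @L2 _ T1 R leb I2pi g ->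
  ip (fun w => \sum_(i <- r | P i) z i * F i w) g = \sum_(i <- r | P i) z i * ip (F i) g.
Proof.
move=> LF Lg; have mI := @measurable_I2pi R.
rewrite /ip -cint_sumZ//; last by move=> i Pi; apply: L2_cintegrableM => //; [exact: LF|exact: L2J].
by apply: cint_ext => w _; rewrite mulr_suml; apply: eq_bigr => i _; rewrite mulrA.
Qed.

Lemma ip_ae0 f g : @cmeas _ T1 R I2pi f -> @cmeas _ T1 R I2pi g -> zero2pi f -> ip f g = 0.
Proof.
move=> mf mg f0; have mI := @measurable_I2pi R.
rewrite /ip -[RHS](@cint0 _ T1 R leb I2pi); apply: cint_ae_eq => //.
- by apply: cmeasM => //; exact: cmeasJ.
- exact: cmeas_cst.
by apply: ae_imp f0 => w e Iw; rewrite e// mul0r.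
Qed.

Section W2pi.
Variables (m : nat) (b : nat -> nat -> R -> R[i]).
Hypothesis sb : forall j k, (j + k <= 2 * m)%N -> smooth (b j k).

Lemma ip_Dsum k (F : nat -> R -> R[i]) h : (forall j, (j <= 2 * m)%N -> @L2 _ T1 R leb I2pi (F j)) ->
  @L2 _ T1 R leb I2pi h ->
  ip (fun w => \sum_(j < (2 * m).+1 | (j + k <= 2 * m)%N) b j k w * F j w) h =
  \sum_(j < (2 * m).+1 | (j + k <= 2 * m)%N) cint leb I2pi (fun w => (b j k w * F j w) * (h w)^*).
Proof.
move=> LF Lh; have mI := @measurable_I2pi R.
rewrite /ip -cint_sum//; last first.
  move=> j jk; apply: L2_cintegrableM => //; last exact: L2J.
  by apply: L2_smoothM; [exact: sb|apply: LF; rewrite -ltnS].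
by apply: cint_ext => w _; rewrite mulr_suml.
Qed.

Lemma Bop_L2 s k phi : W2pi s phi -> (2 * m <= s)%N -> @L2 _ T1 R leb I2pi (Bop m b k phi).
Proof.
move=> hW ms; apply: L2_sum => [|j jk]; first exact: measurable_I2pi.
by apply: L2_smoothM; [exact: sb|apply: (W2pi_L2 hW); apply: leq_trans ms; rewrite -ltnS].
Qed.

(** Density in the argument [phi]. The right side involves no derivative of it and is subtracted
    from the term of index 0. *)
Lemma green_extend s phi h (hk : nat -> R -> R[i]) (al be : nat -> R[i]) :
  W2pi s phi -> (2 * m <= s)%N -> @L2 _ T1 R leb I2pi h ->
  (forall k, @L2 _ T1 R leb I2pi (hk k)) ->
  (forall f, psm f -> \sum_(k < (2 * m).+1) al k * ip (Bsm m b k f) h =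
                      \sum_(k < (2 * m).+1) be k * ip f (hk k)) ->
  \sum_(k < (2 * m).+1) al k * ip (Bop m b k phi) h = \sum_(k < (2 * m).+1) be k * ip phi (hk k).
Proof.
move=> hW ms Lh Lhk H; have mI := @measurable_I2pi R.
pose F (j : nat) (g : R -> R[i]) : R[i] :=
  \sum_(k < (2 * m).+1 | (j + k <= 2 * m)%N) al k * cint leb I2pi (fun w => (b j k w * g w) * (h w)^*) +
  (- (j == 0%N)%:R) * \sum_(k < (2 * m).+1) be k * ip g (hk k).
have L1 : smooth (fun=> 1 : R[i]) by exact: smooth_cst.
have FE (G : nat -> R -> R[i]) : (forall j, (j <= 2 * m)%N -> @L2 _ T1 R leb I2pi (G j)) ->
    \sum_(j < (2 * m).+1) F j (G j) =
    \sum_(k < (2 * m).+1) al k *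
      ip (fun w => \sum_(j < (2 * m).+1 | (j + k <= 2 * m)%N) b j k w * G j w) h -
    \sum_(k < (2 * m).+1) be k * ip (G 0%N) (hk k).
  move=> LG; rewrite big_split /=; congr (_ + _).
    rewrite (exchange_big_dep xpredT)//=; apply: eq_bigr => k _.
    by rewrite ip_Dsum// mulr_sumr.
  rewrite (bigD1 ord0)//= mulN1r [X in _ + X]big1 ?addr0// => j j0.
  have -> : ((j : nat) == 0%N) = false by apply/negbTE; apply: contraNneq j0 => /= j0; apply/eqP/val_inj.
  by rewrite oppr0 mul0r.
have := @W2pi_density_lip R s (2 * m) phi F hW ms; rewrite (FE (fun j => Domega j phi)); last first.
  by move=> j j2; exact: (W2pi_L2 hW (leq_trans j2 ms)).
have D0 k : ip (Domega 0 phi) (hk k) = ip phi (hk k).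
  have hD : is_weakD1 0 phi phi by apply: is_weakD1_0; have [] := W2pi_weakD1 hW (leq0n s).
  have ae := Domega_eq hW (leq0n s) hD.
  rewrite /ip; apply: cint_ae_eq => //.
  - by apply: cmeasM; [case: (W2pi_L2 hW (leq0n s))|apply: cmeasJ; case: (Lhk k)].
  - by apply: cmeasM; [case: (W2pi_L20 hW)|apply: cmeasJ; case: (Lhk k)].
  by apply: ae_imp ae => w e Iw; rewrite e// mul1r.
rewrite [X in _ - X = 0](eq_bigr (fun k : 'I__ => be k * ip phi (hk k))); last by move=> k _; rewrite D0.
move=> R0; apply/eqP; rewrite -subr_eq0; apply/eqP; apply: R0 => [j j2|g pg].
  apply: L2lipD.
    apply: L2lip_sum => k jk; apply: L2lipZ; apply: ip_lip; first exact: sb.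
    exact: L2J.
  apply: L2lipZ; apply: L2lip_sum => k _; apply: L2lipZ.
  have [C hC] := ip_lip L1 (L2J mI (Lhk k)); exists C => x x' Lx Lx'; have := hC x x' Lx Lx'.
  congr (cabs (_ - _) <= _); apply: cint_ext => w _; rewrite mul1r//.
rewrite (FE (fun j => iter j Dt g)) => [|j j2]; first by apply/eqP; rewrite subr_eq0; apply/eqP; exact: H.
by apply: L2_I2pi_smooth; case: (psm_iter_Dt j pg).
Qed.

End W2pi.

Lemma binomial_wide (x y : R[i]) r n : (r < n)%N ->
  (x + y) ^+ r = \sum_(i < n) ('C(r, i)%:R * x ^+ (r - i)) * y ^+ i.
Proof.
move=> rn; rewrite exprDn (@big_ord_widen _ _ _ r.+1 n (fun i => x ^+ (r - i) * y ^+ i *+ 'C(r, i)))//.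
rewrite big_mkcond /=; apply: eq_bigr => i _; rewrite ltnS; case: leqP => [_|ri].
  by rewrite -mulr_natl mulrA.
by rewrite bin_small ?mul0r.
Qed.

Section GreenW2pi.
Variables (m : nat) (p : 'I_(2 * m).+1 -> R[i]) (b bs : nat -> nat -> R -> R[i]).
Hypotheses (hb : polar_form p b) (hbs : polar_form (adjoint p) bs).
Variables (s : nat) (phi psi : R -> R[i]).
Hypotheses (hphi : W2pi s phi) (hpsi : W2pi s psi) (ms : (2 * m <= s)%N).

(** The two arguments are extended one at a time: [phi] against smooth [f], and after conjugating
    the formula, which exchanges the roles of the arguments, [psi] against the Sobolev [phi]. *)
Lemma green_W2pi z :
  \sum_(k < (2 * m).+1) (z - 2 * 'i * (m%:R - 1)) ^+ k * ip (Bop m b k phi) psi =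
  \sum_(k < (2 * m).+1) z ^+ k * ip phi (Bop m bs k psi).
Proof.
have sb j k : (j + k <= 2 * m)%N -> smooth (b j k) by move=> jk; case: (polar_form_smooth hb jk).
have sbs j k : (j + k <= 2 * m)%N -> smooth (bs j k) by move=> jk; case: (polar_form_smooth hbs jk).
have Lpsm f : psm f -> @L2 _ T1 R leb I2pi f by case=> sf _; exact: L2_I2pi_smooth.
have Lphi := W2pi_L20 hphi; have Lpsi := W2pi_L20 hpsi.
have S1 f : psm f ->
    \sum_(k < (2 * m).+1) (z - 2 * 'i * (m%:R - 1)) ^+ k * ip (Bop m b k phi) f =
    \sum_(k < (2 * m).+1) z ^+ k * ip phi (Bsm m bs k f).
  move=> pf; apply: (green_extend (hk := fun k => Bsm m bs k f)
    (al := fun k => (z - 2 * 'i * (m%:R - 1)) ^+ k) (be := fun k => z ^+ k) sb hphi ms).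
  - exact: Lpsm.
  - by move=> k; apply: Lpsm; exact: psm_Bsm hbs pf.
  - by move=> g pg; exact: (green_smooth hb hbs).
apply: (can_inj (@conjcK R)).
have conj_sum (z' : R[i]) (F : nat -> R[i]) : conjc (\sum_(k < (2 * m).+1) z' ^+ k * F k) =
    \sum_(k < (2 * m).+1) conjc z' ^+ k * conjc (F k).
  by rewrite [LHS]rmorph_sum; apply: eq_bigr => k _; rewrite /= conjcM conjcX.
rewrite (conj_sum _ (fun k => ip (Bop m b k phi) psi)) (conj_sum _ (fun k => ip phi (Bop m bs k psi))).
symmetry.
rewrite (eq_bigr (fun k : 'I_(2 * m).+1 => (conjc z) ^+ k * ip (Bop m bs k psi) phi)); last first.
  by move=> k _; rewrite -ip_conj//; exact: Bop_L2 ms.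
rewrite (green_extend (hk := fun k => Bop m b k phi) (al := fun k => (conjc z) ^+ k)
    (be := fun k => (conjc (z - 2 * 'i * (m%:R - 1))) ^+ k) sbs hpsi ms)//.
- by apply: eq_bigr => k _; rewrite -ip_conj//; exact: Bop_L2 ms.
- by move=> k; exact: Bop_L2 ms.
move=> f pf; have := congr1 conjc (S1 f pf).
rewrite (conj_sum _ (fun k => ip (Bop m b k phi) f)) (conj_sum _ (fun k => ip phi (Bsm m bs k f))) => S1'.
rewrite (eq_bigr (fun k : 'I_(2 * m).+1 => (conjc z) ^+ k * conjc (ip phi (Bsm m bs k f)))); last first.
  by move=> k _; rewrite -ip_conj//; apply: Lpsm; exact: psm_Bsm hbs pf.
rewrite -S1'; apply: eq_bigr => k _; rewrite -ip_conj//; first exact: Lpsm.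
exact: Bop_L2 ms.
Qed.

(** Both sides of the Green formula are polynomials in the spectral parameter; equality along real
    increments forces equality of all Taylor coefficients. *)
Lemma green_taylor (z : R[i]) i : (i < (2 * m).+1)%N ->
  \sum_(k < (2 * m).+1) ('C(k, i)%:R * z ^+ (k - i)) * ip (Bop m b k phi) psi =
  \sum_(k < (2 * m).+1) ('C(k, i)%:R * (z + 2 * 'i * (m%:R - 1)) ^+ (k - i)) * ip phi (Bop m bs k psi).
Proof.
move=> im; apply/eqP; rewrite -subr_eq0; apply/eqP; set c := 2 * 'i * (m%:R - 1).
pose a i := \sum_(k < (2 * m).+1) ('C(k, i)%:R * z ^+ (k - i)) * ip (Bop m b k phi) psi -
  \sum_(k < (2 * m).+1) ('C(k, i)%:R * (z + c) ^+ (k - i)) * ip phi (Bop m bs k psi).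
have H (x : R) : \sum_(j < (2 * m).+1) x%:C ^+ j * a j = 0.
  have := green_W2pi (z + c + x%:C).
  have -> : z + c + x%:C - 2 * 'i * (m%:R - 1) = z + x%:C by rewrite -/c; ring.
  move=> e; rewrite (eq_bigr (fun j : 'I_(2 * m).+1 =>
    \sum_(k < (2 * m).+1) (('C(k, j)%:R * z ^+ (k - j)) * x%:C ^+ j) * ip (Bop m b k phi) psi -
    \sum_(k < (2 * m).+1) (('C(k, j)%:R * (z + c) ^+ (k - j)) * x%:C ^+ j) * ip phi (Bop m bs k psi))).
    rewrite sumrB exchange_big [X in _ - X]exchange_big /=.
    rewrite (eq_bigr (fun k : 'I_(2 * m).+1 => (z + x%:C) ^+ k * ip (Bop m b k phi) psi)) ?e.
      apply/eqP; rewrite subr_eq0; apply/eqP; apply: eq_bigr => k _.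
      by rewrite -mulr_suml -binomial_wide.
    by move=> k _; rewrite -mulr_suml -binomial_wide.
  by move=> j _; rewrite /a mulrBr !mulr_sumr; congr (_ - _); apply: eq_bigr => k _; ring.
apply: (@bigO_coef0 R a (2 * m).+1 0 1 ltr01 _ i im) => x _.
by rewrite H cabs0 mul0r.
Qed.

End GreenW2pi.
End GreenFormula.

(** * The Wronskian of two Jordan chains *)

Section Wronskian.
Context {R : realType}.
Notation T1 := (measurableTypeR R).
Implicit Types (f g e tau : R -> R[i]).

Lemma csmD f g : csm f -> csm g -> csm (fun t => f t + g t).
Proof.
move=> [sf [M M0 hM]] [sg [N N0 hN]]; split; first exact: smoothD.
by exists (M + N) => [|t ht]; [exact: addr_gt0|rewrite hM ?hN ?addr0//; lra].
Qed.

Lemma csm_cst0 : csm (fun=> 0 : R[i]).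
Proof. by split; [exact: smooth_cst|exists 1]. Qed.

Lemma csm_sum I (r : seq I) (P : pred I) (F : I -> R -> R[i]) : (forall i, P i -> csm (F i)) ->
  csm (fun t => \sum_(i <- r | P i) F i t).
Proof.
move=> H; elim: r => [|i r ih].
  rewrite (_ : (fun _ => _) = fun=> 0); first exact: csm_cst0.
  by apply/funext => t; rewrite big_nil.
case Pi: (P i).
  rewrite (_ : (fun _ => _) = fun t => F i t + \sum_(j <- r | P j) F j t).
    by apply: csmD => //; exact: H.
  by apply/funext => t; rewrite big_cons Pi.
rewrite (_ : (fun _ => _) = fun t => \sum_(j <- r | P j) F j t)//.
by apply/funext => t; rewrite big_cons Pi.
Qed.

Lemma csm_Dt f : csm f -> csm (Dt f).
Proof. by move=> cf; apply: csmM; [exact: smooth_cst|exact: cderive1_supp]. Qed.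

Lemma cderive1_Dt f t : cderive1 f t = 'i * Dt f t.
Proof. by rewrite /Dt mulrA mulrN -expr2 sqr_i opprK mul1r. Qed.

Lemma DtD f g : smooth f -> smooth g -> Dt (fun t => f t + g t) = fun t => Dt f t + Dt g t.
Proof. by move=> sf sg; apply/funext => t; rewrite /Dt cderive1D// mulrDr. Qed.

Lemma DtM f g : smooth f -> smooth g -> Dt (fun t => f t * g t) = fun t => Dt f t * g t + f t * Dt g t.
Proof. by move=> sf sg; apply/funext => t; rewrite /Dt cderive1M//; ring. Qed.

Lemma Dt_sum I (r : seq I) (P : pred I) (F : I -> R -> R[i]) : (forall i, smooth (F i)) ->
  Dt (fun t => \sum_(i <- r | P i) F i t) = fun t => \sum_(i <- r | P i) Dt (F i) t.
Proof. by move=> sF; apply/funext => t; rewrite /Dt cderive1_sum// mulr_sumr. Qed.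

Lemma DtZ f z : smooth f -> Dt (fun t => z * f t) = fun t => z * Dt f t.
Proof. by move=> sf; apply/funext => t; rewrite /Dt cderive1Z//; ring. Qed.

Lemma DtJ f : smooth f -> Dt (fun t => conjc (f t)) = fun t => - conjc (Dt f t).
Proof.
move=> sf; apply/funext => t; rewrite /Dt cderive1J// conjcM.
have -> : conjc (- 'i : R[i]) = 'i by rewrite -conjE rmorphN /= conjCi opprK.
by rewrite mulNr.
Qed.

(** The bilinear concomitant of D_t^k: applying D_t to it telescopes, because D_t of a conjugate is
    minus the conjugate of D_t. *)
Definition wronskian k f g : R -> R[i] :=
  fun t => \sum_(j < k) iter j Dt f t * conjc (iter (k - 1 - j) Dt g t).

Lemma smooth_wronskian k f g : smooth f -> smooth g -> smooth (wronskian k f g).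
Proof.
move=> sf sg; apply: smooth_sum => j _; apply: smoothM; first exact: smooth_iter_Dt.
by apply: smoothJ; exact: smooth_iter_Dt.
Qed.

Lemma Dt_wronskian k f g t : smooth f -> smooth g ->
  Dt (wronskian k f g) t = iter k Dt f t * conjc (g t) - f t * conjc (iter k Dt g t).
Proof.
move=> sf sg.
pose F j := iter j Dt f t * conjc (iter (k - j) Dt g t).
have -> : iter k Dt f t * conjc (g t) - f t * conjc (iter k Dt g t) = F k - F 0%N.
  by rewrite /F subnn subn0.
rewrite -(telescope_sumr F (leq0n k)) big_mkord /wronskian Dt_sum; last first.
  move=> j; apply: smoothM; first exact: smooth_iter_Dt.
  by apply: smoothJ; exact: smooth_iter_Dt.
apply: eq_bigr => j _; rewrite DtM; [|exact: smooth_iter_Dt|by apply: smoothJ; exact: smooth_iter_Dt].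
rewrite DtJ; last exact: smooth_iter_Dt.
have -> : (k - 1 - j = k - j.+1)%N by rewrite -subnDA add1n.
have kj : (k - j = (k - j.+1).+1)%N by rewrite subnSK.
by rewrite /F kj /= mulrN.
Qed.

(** The commutator of D_t^k with multiplication by [tau], applied to [e]. It lives where [tau]
    varies, so it has bounded support even for a step. *)
Definition Dcomm k tau e : R -> R[i] :=
  fun t => iter k Dt (fun t => tau t * e t) t - tau t * iter k Dt e t.

Lemma Dcomm0 tau e : Dcomm 0 tau e = fun=> 0.
Proof. by apply/funext => t; rewrite /Dcomm /= subrr. Qed.

Lemma DcommS k tau e : smooth tau -> smooth e ->
  Dcomm k.+1 tau e = fun t => Dt (Dcomm k tau e) t + Dt tau t * iter k Dt e t.
Proof.
move=> st se; apply/funext => t.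
have s1 := smooth_iter_Dt k (smoothM st se); have s2 := smooth_iter_Dt k se.
have -> : Dcomm k tau e = fun t => iter k Dt (fun t => tau t * e t) t + (- 1) * (tau t * iter k Dt e t).
  by apply/funext => x; rewrite mulN1r.
rewrite DtD//; last by apply: smoothZ; exact: smoothM.
rewrite DtZ; last exact: smoothM.
by rewrite DtM// /Dcomm /=; ring.
Qed.

Lemma csm_Dcomm k tau e : smooth tau -> csm (cderive1 tau) -> smooth e -> csm (Dcomm k tau e).
Proof.
move=> st ct se; elim: k => [|k ih]; first by rewrite Dcomm0; exact: csm_cst0.
rewrite DcommS//; apply: csmD; first exact: csm_Dt.
apply: csmM2; first exact: smooth_iter_Dt.
by apply: csmM => //; exact: smooth_cst.
Qed.

(** The integrand differs from i tau' times the Wronskian by D_t of [V], which is a combination of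
    commutators and thus has bounded support, so its derivative integrates to 0. *)
Lemma cint_Dcomm k tau f e : smooth tau -> csm (cderive1 tau) -> (forall t, conjc (tau t) = tau t) ->
  smooth f -> smooth e ->
  cint leb setT (fun t => f t * conjc (Dcomm k tau e t)) =
  'i * cint leb setT (fun t => cderive1 tau t * wronskian k f e t).
Proof.
move=> st ct rt sf se; pose te t := tau t * e t.
have ste : smooth te by exact: smoothM.
pose V t := \sum_(j < k) iter j Dt f t * conjc (Dcomm (k - 1 - j) tau e t).
have cV : csm V.
  apply: csm_sum => j _; apply: csmM; first exact: smooth_iter_Dt.
  by apply: csmJ; exact: csm_Dcomm.
have VE t : V t = wronskian k f te t + (- 1) * (tau t * wronskian k f e t).
  rewrite mulN1r /wronskian mulr_sumr -sumrB; apply: eq_bigr => j _.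
  by rewrite /Dcomm -/te -conjE rmorphB rmorphM /= !conjE rt; ring.
have W1 := smooth_wronskian k sf se; have W2 := smooth_wronskian k sf ste.
have DV t : Dt V t = Dt (wronskian k f te) t - (Dt tau t * wronskian k f e t + tau t * Dt (wronskian k f e) t).
  have -> : V = fun t => wronskian k f te t + (- 1) * (tau t * wronskian k f e t) by apply/funext.
  rewrite DtD//; last by apply: smoothZ; exact: smoothM.
  by rewrite DtZ; [rewrite DtM// mulN1r|exact: smoothM].
have key t : f t * conjc (Dcomm k tau e t) = (- 1) * Dt V t + 'i * (cderive1 tau t * wronskian k f e t).
  rewrite DV !Dt_wronskian// (cderive1_Dt tau).
  have -> : 'i * ('i * Dt tau t * wronskian k f e t) = - (Dt tau t * wronskian k f e t).
    by rewrite !mulrA -expr2 sqr_i !mulNr mul1r.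
  rewrite /Dcomm -/te -[in LHS]conjE rmorphB rmorphM /= !conjE rt.
  have -> : conjc (te t) = tau t * conjc (e t) by rewrite /te conjcM rt.
  ring.
have i1 := csm_cintegrable (csm_Dt cV).
have i2 : cintegrable leb setT (fun t => cderive1 tau t * wronskian k f e t).
  by apply/csm_cintegrable/csmM2.
transitivity (cint leb setT (fun t => (- 1) * Dt V t + 'i * (cderive1 tau t * wronskian k f e t))).
  by apply: cint_ext => t _; exact: key.
rewrite cintD//; [|exact: cintegrableZ|exact: cintegrableZ].
have DV0 : cint leb setT (Dt V) = 0.
  by rewrite /Dt cintZ// ?cint_derive0 ?mulr0//; exact: csm_cintegrable (cderive1_supp cV).
by rewrite cintZ// DV0 mulr0 add0r cintZ.
Qed.

End Wronskian.

(** * Algebra of exponential polynomials *)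

Section ExpolAlgebra.
Context {R : realType}.
Implicit Types (z : R[i]) (A B : {poly R[i]}).

Lemma poly_real_eq0 A : (forall t : R, A.[t%:C] = 0) -> A = 0.
Proof.
move=> H; apply/eqP; apply: contraT => A0.
pose rs := [seq (n%:R : R)%:C | n <- iota 0 (size A)].
have := max_poly_roots (rs := rs) A0; rewrite /rs size_map size_iota ltnn; apply.
  by apply/allP => x /mapP [n _ ->]; rewrite /root H.
rewrite map_inj_uniq ?iota_uniq// => n n' /(congr1 (@complex.Re R))/= /eqP.
by rewrite eqr_nat => /eqP.
Qed.

Lemma expol_eq0 z A : (forall t, expol z A t = 0) -> A = 0.
Proof.
move=> H; apply: poly_real_eq0 => t; have /eqP := H t.
by rewrite /expol mulf_eq0 (negbTE (cexp_neq0 _)) => /eqP.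
Qed.

Lemma expolZ z (c : R[i]) A t : expol z (c *: A) t = c * expol z A t.
Proof. by rewrite /expol hornerZ mulrCA. Qed.

Lemma expol_sum z I (r : seq I) (P : pred I) (F : I -> {poly R[i]}) t :
  expol z (\sum_(i <- r | P i) F i) t = \sum_(i <- r | P i) expol z (F i) t.
Proof. by rewrite /expol horner_sum mulr_sumr. Qed.

Lemma expolM z w A B t : expol z A t * expol w B t = expol (z + w) (A * B) t.
Proof. by rewrite /expol hornerM mulrACA -cexpD mulrDr mulrDl. Qed.

Lemma expolJ z A t : conjc (expol z A t) = expol (- conjc z) (map_poly (@Num.conj R[i]) A) t.
Proof.
rewrite /expol conjcM cexpJ !conjcM conjc_i conjc_real; congr (cexp _ * _); first by ring.
by rewrite -(horner_map (@Num.conj R[i]) A t%:C) /= conjE conjc_real.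
Qed.

(** Otherwise z A = i A', but differentiation lowers the degree of a nonzero polynomial. *)
Lemma Lp_eq0 z A : Lp z A = 0 -> z != 0 -> A = 0.
Proof.
move=> /eqP; rewrite subr_eq0 => /eqP e z0; apply/eqP; apply: contraT => A0.
have := lt_size_deriv A0; have := size_scale A z0; rewrite e size_scale ?neq0Ci// => ->.
by rewrite ltnn.
Qed.

Lemma expol_cst A t : Lp 0 A = 0 -> expol 0 A t = expol 0 A 0.
Proof.
rewrite /Lp scale0r sub0r => /eqP; rewrite oppr_eq0 scaler_eq0 (negbTE (neq0Ci _)) /= => /eqP A0.
suff -> : A = (A`_0)%:P by rewrite /expol !hornerC !mulr0 !mul0r.
apply/polyP => -[|n]; rewrite coefC//=.
have := congr1 (fun B : {poly R[i]} => B`_n) A0; rewrite coef_deriv coef0.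
by move/eqP; rewrite mulrn_eq0 => /eqP.
Qed.

(** At t = 0 only the constant polynomial survives in the binomial expansion of the iterated
    derivative. For j < q the binomial coefficient is 0, so the truncated exponent is harmless. *)
Lemma expol_Aq0 z q j : iter j Dt (expol z (Aq q)) 0 = 'C(j, q)%:R * z ^+ (j - q).
Proof.
rewrite iter_Dt_expol iter_Lp_Aq expol_sum big_ord_recr big1 /= ?add0r => [|i _].
  rewrite expolZ /expol subnn /Aq mulr0 cexp0 hornerZ hornerXn expr0 fact0 invr1 !mulr1//.
rewrite expolZ /expol /Aq hornerZ hornerXn expr0n subn_eq0 leqNgt ltn_ord.
by rewrite !mulr0.
Qed.

(** Counts the subsets of size q + p + 1 of an r-element set by the position j of their element of
    rank q + 1. *)
Lemma bin_convolution r q p : (\sum_(j < r) 'C(j, q) * 'C(r - 1 - j, p) = 'C(r, (q + p).+1))%N.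
Proof.
elim: r p => [|r ih] p; first by rewrite big_ord0.
case: p => [|p].
  rewrite big_ord_recr /= bin0 muln1 addn0 binS; congr (_ + _)%N.
  by rewrite -[in RHS](addn0 q) -ih; apply: eq_bigr => j _; rewrite !bin0.
rewrite big_ord_recr /= subn1 /= subnn bin0n muln0 addn0.
rewrite addnS binS -(ih p) -addnS -(ih p.+1) -big_split /=; apply: eq_bigr => j _.
rewrite -mulnDr; congr (_ * _)%N.
have -> : (r - j = (r - 1 - j).+1)%N by rewrite -subnDA add1n subnSK.
by rewrite binS.
Qed.

End ExpolAlgebra.

(** * Constancy and value of the Wronskian of two chains *)

Section ChainPairing.
Context {R : realType}.
Notation T1 := (measurableTypeR R).

Lemma conjc_nat n : conjc (n%:R : R[i]) = n%:R. Proof. exact: conjC_nat. Qed.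

Lemma conjcB (x y : R[i]) : conjc (x - y) = conjc x - conjc y. Proof. exact: rmorphB. Qed.

Definition wronskian_poly r (z w : R[i]) (A B : {poly R[i]}) : {poly R[i]} :=
  \sum_(j < r) iter j (Lp z) A * map_poly (@Num.conj R[i]) (iter (r - 1 - j) (Lp w) B).

Lemma wronskian_expol r z w A B t :
  wronskian r (expol z A) (expol w B) t = expol (z - conjc w) (wronskian_poly r z w A B) t.
Proof.
rewrite /wronskian /wronskian_poly expol_sum; apply: eq_bigr => j _.
by rewrite !iter_Dt_expol expolJ expolM.
Qed.

Variables (m : nat) (p : 'I_(2 * m).+1 -> R[i]) (b bs : nat -> nat -> R -> R[i]).
Hypotheses (hb : polar_form p b) (hbs : polar_form (adjoint p) bs).
Variables (s s' : nat) (lam mu : R[i]) (kap1 kap2 : nat) (ph ps : nat -> R -> R[i]).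
Hypothesis ms : (2 * m <= s)%N.
Let c : R[i] := 2 * 'i * (m%:R - 1).
Hypotheses (hph : jordan_chain s s' (pencil m b) lam kap1 ph)
           (hps : jordan_chain s s' (pencil m bs) (conjc mu - c) kap2 ps).
Variables (k nu : nat).
Hypotheses (hk : (k < kap1)%N) (hnu : (nu < kap2)%N).

Let H r i j := ip (ph i) (Bop m bs r (ps j)).
(** The shift by [c] multiplies the exponential by e^((2-2m)t): the factor r^(-2m) of the operator
    and the Jacobian r^2 are absorbed into the exponent. *)
Let e1 q := expol (lam + c) (Aq q).
Let e2 q := expol (conjc mu - c) (Aq q).

Definition chain_wronskian t := \sum_(r < (2 * m).+1) \sum_(q < k.+1) \sum_(j < nu.+1)
  H r (k - q) (nu - j) * wronskian r (e1 q) (e2 j) t.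

Let conjc_shift : conjc c = - c.
Proof.
by rewrite /c !conjcM conjc_i conjcB (conjc_nat 1) !conjc_nat; ring.
Qed.

Let sb j r : (j + r <= 2 * m)%N -> smooth (b j r).
Proof. by move=> jr; case: (polar_form_smooth hb jr). Qed.
Let sbs j r : (j + r <= 2 * m)%N -> smooth (bs j r).
Proof. by move=> jr; case: (polar_form_smooth hbs jr). Qed.
Let Wph i : (i <= k)%N -> W2pi s (ph i).
Proof. by case: hph => H1 _ ik; apply: H1; exact: leq_ltn_trans ik hk. Qed.
Let Wps i : (i <= nu)%N -> W2pi s (ps i).
Proof. by case: hps => H1 _ ik; apply: H1; exact: leq_ltn_trans ik hnu. Qed.

Lemma green_taylor' i j z n : (i <= k)%N -> (j <= nu)%N ->
  \sum_(r < (2 * m).+1) ('C(r, n)%:R * z ^+ (r - n)) * ip (Bop m b r (ph i)) (ps j) =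
  \sum_(r < (2 * m).+1) ('C(r, n)%:R * (z + c) ^+ (r - n)) * H r i j.
Proof.
move=> ik jn; have [nm|mn] := ltnP n (2 * m).+1.
  exact: (green_taylor hb hbs (Wph ik) (Wps jn) ms z nm).
rewrite !big1// => r _; rewrite bin_small ?mul0r//.
all: exact: leq_trans (ltn_ord r) mn.
Qed.

(** Paired with a fixed [ps j], the chain relations of [ph] become relations between numbers at lam;
    the Green formula rewrites them with the adjoint coefficients [H] at lam + c, the form in which
    the chain polynomial vanishes. *)
Lemma left_chain_vanish j t : (j <= nu)%N ->
  \sum_(q < k.+1) \sum_(r < (2 * m).+1) H r (k - q) j * iter r Dt (e1 q) t = 0.
Proof.
move=> jn; have mI := @measurable_I2pi R.
have Lpsj := W2pi_L20 (Wps jn).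
have CV := @chain_vanish R (2 * m).+1 (fun r i => H r i j) (lam + c) k.
have {}CV := CV _; rewrite -[RHS](_ : expol (lam + c) 0 t = 0); last by rewrite /expol horner0 mulr0.
rewrite -CV; last first.
  move=> i ik; rewrite (eq_bigr (fun i0 : 'I_i.+1 => \sum_(r < (2 * m).+1)
    ('C(r, i0)%:R * lam ^+ (r - i0)) * ip (Bop m b r (ph (i - i0)%N)) (ps j))); last first.
    by move=> i0 _; rewrite green_taylor'//; exact: leq_trans (leq_subr _ _) ik.
  have L i0 r : @L2 _ T1 R leb I2pi (Bop m b r (ph (i - i0)%N)).
    by apply: (Bop_L2 sb _ (Wph _) ms); exact: leq_trans (leq_subr _ _) ik.
  under eq_bigr => i0 _ do rewrite -ip_sumZ//.
  have := @ip_sumZ R _ (index_enum 'I_i.+1) xpredT (fun=> 1) (fun i0 w => \sum_(r < (2 * m).+1)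
    ('C(r, i0)%:R * lam ^+ (r - i0)) * Bop m b r (ph (i - i0)%N) w) (ps j).
  under [in X in _ -> _ -> _ = X]eq_bigr do rewrite mul1r.
  move=> <-//; last first.
    by move=> i0 _; apply: L2_sum => // r _; exact: L2Z.
  apply: ip_ae0; last 2 first.
  - by case: Lpsj.
  - have := chain_relation sb ms hph (leq_ltn_trans ik hk).
    by apply: ae_imp => w e Iw; rewrite -[RHS](e Iw); apply: eq_bigr => i0 _; rewrite mul1r.
  have [] // : @L2 _ T1 R leb I2pi (fun w => \sum_(i0 < i.+1) 1 * \sum_(r < (2 * m).+1)
    ('C(r, i0)%:R * lam ^+ (r - i0)) * Bop m b r (ph (i - i0)%N) w).
  by apply: L2_sum => // i0 _; apply: L2Z => //; apply: L2_sum => // r _; exact: L2Z.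
rewrite expol_sum; apply: eq_bigr => q _; rewrite expol_sum; apply: eq_bigr => r _.
by rewrite expolZ -iter_Dt_expol.
Qed.

(** The numbers [H] are conjugates of pairings with the adjoint pencil applied to [ps], so the chain
    relations of [ps] apply directly, without the Green formula. *)
Lemma right_chain_vanish i t : (i <= k)%N ->
  \sum_(q < nu.+1) \sum_(r < (2 * m).+1) H r i (nu - q) * conjc (iter r Dt (e2 q) t) = 0.
Proof.
move=> ik; have mI := @measurable_I2pi R.
have Lphi := W2pi_L20 (Wph ik).
have HJ r j : (j <= nu)%N -> conjc (H r i j) = ip (Bop m bs r (ps j)) (ph i).
  by move=> jn; rewrite /H [in LHS]ip_conj ?conjcK//; exact: (Bop_L2 sbs _ (Wps jn) ms).
have CV := @chain_vanish R (2 * m).+1 (fun r j => conjc (H r i j)) (conjc mu - c) nu.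
apply: (can_inj (@conjcK R)); rewrite conjc0.
rewrite -[RHS](_ : expol (conjc mu - c) 0 t = 0); last by rewrite /expol horner0 mulr0.
rewrite -CV; last first.
  move=> j jn; have ij i0 : (j - i0 <= nu)%N by exact: leq_trans (leq_subr _ _) jn.
  have L i0 r : @L2 _ T1 R leb I2pi (Bop m bs r (ps (j - i0)%N)).
    exact: (Bop_L2 sbs _ (Wps (ij i0)) ms).
  rewrite (eq_bigr (fun i0 : 'I_j.+1 => ip (fun w => \sum_(r < (2 * m).+1)
    ('C(r, i0)%:R * (conjc mu - c) ^+ (r - i0)) * Bop m bs r (ps (j - i0)%N) w) (ph i))); last first.
    by move=> i0 _; rewrite ip_sumZ//; apply: eq_bigr => r _; rewrite HJ.
  have := @ip_sumZ R _ (index_enum 'I_j.+1) xpredT (fun=> 1) (fun i0 w => \sum_(r < (2 * m).+1)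
    ('C(r, i0)%:R * (conjc mu - c) ^+ (r - i0)) * Bop m bs r (ps (j - i0)%N) w) (ph i).
  under [in X in _ -> _ -> _ = X]eq_bigr do rewrite mul1r.
  move=> <-//; last first.
    by move=> i0 _; apply: L2_sum => // r _; exact: L2Z.
  apply: ip_ae0; last 2 first.
  - by case: Lphi.
  - have := chain_relation sbs ms hps (leq_ltn_trans jn hnu).
    by apply: ae_imp => w e Iw; rewrite -[RHS](e Iw); apply: eq_bigr => i0 _; rewrite mul1r.
  have [] // : @L2 _ T1 R leb I2pi (fun w => \sum_(i0 < j.+1) 1 * \sum_(r < (2 * m).+1)
    ('C(r, i0)%:R * (conjc mu - c) ^+ (r - i0)) * Bop m bs r (ps (j - i0)%N) w).
  by apply: L2_sum => // i0 _; apply: L2Z => //; apply: L2_sum => // r _; exact: L2Z.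
rewrite expol_sum -conjE rmorph_sum; apply: eq_bigr => q _; rewrite expol_sum rmorph_sum.
apply: eq_bigr => r _; rewrite expolZ -iter_Dt_expol /= conjE conjcM conjcK.
by [].
Qed.

(** The second exponential enters conjugated and [c] is purely imaginary, so the two shifts cancel
    and the exponent is lam - mu. *)
Lemma chain_wronskianE : exists P, forall t, chain_wronskian t = expol (lam - mu) P t.
Proof.
exists (\sum_(r < (2 * m).+1) \sum_(q < k.+1) \sum_(j < nu.+1)
  H r (k - q) (nu - j) *: wronskian_poly r (lam + c) (conjc mu - c) (Aq q) (Aq j)) => t.
rewrite expol_sum; apply: eq_bigr => r _; rewrite expol_sum; apply: eq_bigr => q _.
rewrite expol_sum; apply: eq_bigr => j _; rewrite expolZ [wronskian _ _ _ _]wronskian_expol.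
have -> : lam + c - conjc (conjc mu - c) = lam - mu by rewrite conjcB conjcK conjc_shift; ring.
by [].
Qed.

(** Differentiating each Wronskian leaves all derivatives on one factor or all on the other; summed
    over the chains, these two sums vanish separately by the relations of the first and of the
    second chain. *)
Lemma Dt_chain_wronskian t : Dt chain_wronskian t = 0.
Proof.
have se1 q : smooth (e1 q) by exact: smooth_expol.
have se2 q : smooth (e2 q) by exact: smooth_expol.
have sW r q j : smooth (fun t => H r (k - q) (nu - j) * wronskian r (e1 q) (e2 j) t).
  by apply: smoothZ; exact: smooth_wronskian.
rewrite /chain_wronskian Dt_sum; last first.
  by move=> r; apply: smooth_sum => q _; apply: smooth_sum => j _.
have -> : \sum_(r < (2 * m).+1) Dt (fun t => \sum_(q < k.+1) \sum_(j < nu.+1)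
     H r (k - q) (nu - j) * wronskian r (e1 q) (e2 j) t) t =
   \sum_(r < (2 * m).+1) \sum_(q < k.+1) \sum_(j < nu.+1)
     (H r (k - q) (nu - j) * iter r Dt (e1 q) t * conjc (e2 j t) -
      H r (k - q) (nu - j) * conjc (iter r Dt (e2 j) t) * e1 q t).
  apply: eq_bigr => r _; rewrite Dt_sum; last by move=> q; apply: smooth_sum => j _.
  apply: eq_bigr => q _; rewrite Dt_sum//; apply: eq_bigr => j _.
  by rewrite DtZ; [rewrite Dt_wronskian//; ring|exact: smooth_wronskian].
under eq_bigr => r _ do under eq_bigr => q _ do rewrite sumrB.
under eq_bigr => r _ do rewrite sumrB.
rewrite sumrB; apply/eqP; rewrite subr_eq0; apply/eqP; transitivity (0 : R[i]); last symmetry.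
  under eq_bigr => r _ do rewrite exchange_big /=.
  rewrite exchange_big /= big1// => j _; rewrite exchange_big /=.
  under eq_bigr => q _ do rewrite -mulr_suml.
  by rewrite -mulr_suml left_chain_vanish ?mul0r// leq_subr.
rewrite exchange_big /= big1// => q _; rewrite exchange_big /=.
under eq_bigr => j _ do rewrite -mulr_suml.
by rewrite -mulr_suml right_chain_vanish ?mul0r// leq_subr.
Qed.

(** A constant of the form e^(i(lam - mu)t) P(t) with lam different from mu has D_t equal to 0,
    which forces P = 0. *)
Lemma chain_wronskian_off t : lam != mu -> chain_wronskian t = 0.
Proof.
move=> lm; have [P hP] := chain_wronskianE; rewrite hP.
have e : chain_wronskian = expol (lam - mu) P by apply/funext.
suff -> : P = 0 by rewrite /expol horner0 mulr0.
apply: (@Lp_eq0 _ (lam - mu)); last by rewrite subr_eq0.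
by apply: (@expol_eq0 _ (lam - mu)) => x; rewrite -Dt_expol -e Dt_chain_wronskian.
Qed.

Lemma chain_wronskian_diag t : lam = mu -> chain_wronskian t =
  \sum_(i < nu.+1) \sum_(q < k.+1) ((nu + k + 1 - i - q)`!%:R)^-1 *
    ip (pencil_derive m b (nu + k + 1 - i - q) lam (ph q)) (ps i).
Proof.
move=> lm; have [P hP] := chain_wronskianE.
have e : chain_wronskian = expol (lam - mu) P by apply/funext.
have -> : chain_wronskian t = chain_wronskian 0.
  rewrite !hP lm subrr; apply: expol_cst.
  apply: (@expol_eq0 _ 0) => x; rewrite -Dt_expol.
  by have := Dt_chain_wronskian x; rewrite e lm subrr.
(* For lam = mu both exponentials carry the parameter lam + c once the second is conjugated, so the
   values at 0 multiply to powers of lam + c and the binomials add up by [bin_convolution]. *)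
have W0 r q j : wronskian r (e1 q) (e2 j) 0 =
    'C(r, (q + j).+1)%:R * (lam + c) ^+ (r - (q + j).+1).
  rewrite /wronskian -bin_convolution natr_sum mulr_suml; apply: eq_bigr => i _.
  rewrite !expol_Aq0 conjcM conjcX -[X in _ * (X * _)]conjE conjC_nat.
  rewrite conjcB conjcK conjc_shift opprK -lm natrM.
  have [iq|qi] := ltnP i q; first by rewrite bin_small// !mul0r.
  have [ij|ji] := ltnP (r - 1 - i) j; first by rewrite (bin_small ij) !(mul0r, mulr0).
  rewrite mulrACA -exprD; congr (_ * _ ^+ _).
  have := ltn_ord i; lia.
(* Reversing both inner sums turns the chain indices [k - q] and [nu - j] into the indices of the
   biorthogonality relation. *)
rewrite /chain_wronskian exchange_big /= (reindex_inj rev_ord_inj) /= [RHS]exchange_big /=.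
apply: eq_bigr => q _; rewrite exchange_big /= (reindex_inj rev_ord_inj) /=.
apply: eq_bigr => i _; rewrite !subSS.
have iN := ltn_ord i; have qK := ltn_ord q.
have -> : (k - (k - q))%N = q by rewrite subKn// -ltnS.
have -> : (nu - (nu - i))%N = i by rewrite subKn// -ltnS.
have -> : (nu + k + 1 - i - q = ((k - q) + (nu - i)).+1)%N by move: iN qK; clear; lia.
set n := ((k - q) + (nu - i)).+1.
have n0 : (n`!%:R : R[i]) != 0 by rewrite pnatr_eq0 -lt0n fact_gt0.
transitivity (\sum_(r < (2 * m).+1) ('C(r, n)%:R * (lam + c) ^+ (r - n)) * H r q i).
  by apply: eq_bigr => r _; rewrite W0 mulrC.
rewrite -green_taylor' -1?ltnS//.
have -> : pencil_derive m b n lam (ph q) =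
    fun w => \sum_(r < (2 * m).+1) (n`!%:R * ('C(r, n)%:R * lam ^+ (r - n))) * Bop m b r (ph q) w.
  apply/funext => w; rewrite pencil_deriveE mulr_sumr.
  by apply: eq_bigr => r _; rewrite mulrA.
rewrite ip_sumZ; last 2 first.
- by move=> r _; apply: (Bop_L2 sb _ (Wph _) ms); rewrite -ltnS.
- by apply/W2pi_L20/Wps; rewrite -ltnS.
by rewrite mulr_sumr; apply: eq_bigr => r _; rewrite !mulrA mulVf// mul1r.
Qed.

End ChainPairing.

(** * Boundary pairing with a power solution *)

Section PlanarPairing.
Context {R : realType}.
Notation T1 := (measurableTypeR R).
Notation T2 := (measurableTypeR R * measurableTypeR R)%type.
Implicit Types (e tau : R -> R[i]) (u v : R * R -> R[i]) (y : R * R).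

Lemma iter_DtD k (f g : R -> R[i]) : smooth f -> smooth g ->
  iter k Dt (fun t => f t + g t) = fun t => iter k Dt f t + iter k Dt g t.
Proof.
move=> sf sg; elim: k => //= k ->; rewrite DtD//; exact: smooth_iter_Dt.
Qed.

Lemma iter_DtZ k (f : R -> R[i]) z : smooth f -> iter k Dt (fun t => z * f t) = fun t => z * iter k Dt f t.
Proof.
move=> sf; elim: k => //= k ->; rewrite DtZ//; exact: smooth_iter_Dt.
Qed.

Lemma DcommB k tau tau' e t : smooth tau -> smooth tau' -> smooth e ->
  Dcomm k (fun t => tau t - tau' t) e t = Dcomm k tau e t - Dcomm k tau' e t.
Proof.
move=> s1 s2 se; rewrite /Dcomm.
have -> : (fun t => (tau t - tau' t) * e t) = fun t => tau t * e t + (- 1) * (tau' t * e t).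
  by apply/funext => x; rewrite mulrBl mulN1r.
rewrite iter_DtD; [|exact: smoothM|by apply: smoothZ; exact: smoothM].
by rewrite iter_DtZ; [ring|exact: smoothM].
Qed.

Lemma wL2J beta w : wL2 beta w -> wL2 beta (fun y => conjc (w y)).
Proof.
move=> Lw; have := @L2J _ T2 R leb2 setT _ measurableT Lw; congr L2.
by apply/funext => y; rewrite conjcM conjc_real.
Qed.

Lemma sep_csm_cintegrable beta w tau g : wL2 beta w -> csm tau -> @L2 _ T1 R leb I2pi g ->
  cintegrable leb2 (setT : set T2) (fun y => w y * conjc (sep tau g y)).
Proof.
move=> Lw ct Lg; have mI := @measurable_I2pi R.
have [+ _] := sep_pairing (tau := fun t => conjc (tau t)) Lw
  (csm_L2 (csm_expc (1 - beta) (csmJ ct))) (L2J mI Lg).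
by apply: cintegrable_ext => // y _; rewrite sepJ.
Qed.

Lemma sep_sep_cint a0 g0 tau g : smooth a0 -> @L2 _ T1 R leb I2pi g0 -> csm tau -> @L2 _ T1 R leb I2pi g ->
  cintegrable leb2 (setT : set T2) (fun y => sep a0 g0 y * conjc (sep tau g y)) /\
  cint leb2 (setT : set T2) (fun y => sep a0 g0 y * conjc (sep tau g y)) =
    cint leb setT (fun t => a0 t * conjc (tau t) * (expR (2 * t))%:C) * ip g0 g.
Proof.
move=> sa L0 ct Lg; have mI := @measurable_I2pi R.
have cT : csm (fun t => a0 t * conjc (tau t)) by apply: csmM => //; exact: csmJ.
have := @sep_cint R (fun t => a0 t * conjc (tau t)) (fun w => g0 w * (g w)^*)
  (csm_cintegrable (csm_expc 2 cT)) (L2_cintegrableM mI L0 (L2J mI Lg)).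
have -> : sep (fun t => a0 t * conjc (tau t)) (fun w => g0 w * (g w)^*) =
    fun y => sep a0 g0 y * conjc (sep tau g y).
  by apply/funext => y; rewrite sepJ sepM.
by [].
Qed.

Variables (m : nat) (bs : nat -> nat -> R -> R[i]).
Variables (s s' : nat) (sg : R[i]) (kap : nat) (ps : nat -> R -> R[i]) (nu : nat).
Hypothesis sbs : forall j r, (j + r <= 2 * m)%N -> smooth (bs j r).
Hypothesis ms : (2 * m <= s)%N.
Hypothesis hps : jordan_chain s s' (pencil m bs) sg kap ps.
Hypothesis hnu : (nu < kap)%N.

Let Wps q : W2pi s (ps (nu - q)%N).
Proof. by case: hps => H1 _; apply: H1; apply: leq_ltn_trans hnu; exact: leq_subr. Qed.

Let LG r q : @L2 _ T1 R leb I2pi (Bop m bs r (ps (nu - q)%N)).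
Proof. exact: Bop_L2 ms. Qed.

Definition comm_sep tau q r : R * R -> R[i] :=
  sep (fun t => em t ^+ (2 * m) * Dcomm r tau (expol sg (Aq q)) t) (Bop m bs r (ps (nu - q)%N)).

(* Only [Dcomm] enters, so that [tau] may be a step: the terms with all derivatives on the
   exponential polynomials add up to zero by the chain relations. *)
Definition pairing w tau : R[i] := \sum_(q < nu.+1) \sum_(r < (2 * m).+1)
  cint leb2 (setT : set T2) (fun y => w y * conjc (comm_sep tau q r y)).

(** Holds for weighted L2 functions and for separated ones alike. The second kind is needed for
    power solutions, which no single power weight makes square integrable on the whole plane. *)
Definition pairable w := forall tau q r, smooth tau -> csm (cderive1 tau) ->
  cintegrable leb2 (setT : set T2) (fun y => w y * conjc (comm_sep tau q r y)).

Lemma csm_em_Dcomm tau q r : smooth tau -> csm (cderive1 tau) ->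
  csm (fun t => em t ^+ (2 * m) * Dcomm r tau (expol sg (Aq q)) t).
Proof.
move=> st ct; apply: csmM; first exact: smooth_emX.
by apply: csm_Dcomm => //; exact: smooth_expol.
Qed.

Lemma wL2_pairable beta w : wL2 beta w -> pairable w.
Proof. by move=> Lw tau q r st ct; apply: (sep_csm_cintegrable Lw) => //; exact: csm_em_Dcomm. Qed.

Lemma sep_pairable a0 g0 : smooth a0 -> @L2 _ T1 R leb I2pi g0 -> pairable (sep a0 g0).
Proof. by move=> sa L0 tau q r st ct; have [] := sep_sep_cint sa L0 (csm_em_Dcomm q r st ct) (LG r q). Qed.

Lemma pairing_sumZ I (rs : seq I) (P : pred I) (z : I -> R[i]) (F : I -> R * R -> R[i]) tau :
  (forall i, P i -> pairable (F i)) -> smooth tau -> csm (cderive1 tau) ->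
  pairing (fun y => \sum_(i <- rs | P i) z i * F i y) tau = \sum_(i <- rs | P i) z i * pairing (F i) tau.
Proof.
move=> pF st ct; have mT : measurable (setT : set T2) by [].
transitivity (\sum_(q < nu.+1) \sum_(r < (2 * m).+1) \sum_(i <- rs | P i)
    z i * cint leb2 (setT : set T2) (fun y => F i y * conjc (comm_sep tau q r y))).
  apply: eq_bigr => q _; apply: eq_bigr => r _; rewrite -cint_sumZ//; last by move=> i Pi; exact: pF.
  by apply: cint_ext => y _; rewrite mulr_suml; apply: eq_bigr => i _; rewrite mulrA.
under eq_bigr => q _ do rewrite exchange_big /=.
rewrite exchange_big /=; apply: eq_bigr => i _; rewrite mulr_sumr; apply: eq_bigr => q _.
by rewrite mulr_sumr.
Qed.

Lemma pairable_sumZ I (rs : seq I) (P : pred I) (z : I -> R[i]) (F : I -> R * R -> R[i]) :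
  (forall i, P i -> pairable (F i)) -> pairable (fun y => \sum_(i <- rs | P i) z i * F i y).
Proof.
move=> pF tau q r st ct; have mT : measurable (setT : set T2) by [].
have := @cintegrable_sumZ _ T2 R leb2 setT I rs P z (fun i y => F i y * conjc (comm_sep tau q r y)) mT.
move=> h; have {}h := h (fun i Pi => pF i Pi tau q r st ct).
apply: cintegrable_ext h => // y _; rewrite mulr_suml; apply: eq_bigr => i _; exact: mulrA.
Qed.

Lemma pairing_add w w' tau : pairable w -> pairable w' -> smooth tau -> csm (cderive1 tau) ->
  pairing (fun y => w y + w' y) tau = pairing w tau + pairing w' tau.
Proof.
move=> pw pw' st ct; rewrite /pairing -big_split; apply: eq_bigr => q _; rewrite -big_split; apply: eq_bigr => r _.
rewrite /= -cintD//; [|exact: pw|exact: pw'].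
by apply: cint_ext => y _; rewrite mulrDl.
Qed.

Lemma pairing_sub_cut w tau tau' : pairable w -> smooth tau -> csm (cderive1 tau) ->
  smooth tau' -> csm (cderive1 tau') ->
  pairing w (fun t => tau t - tau' t) = pairing w tau - pairing w tau'.
Proof.
move=> pw st ct st' ct'; rewrite /pairing -sumrB; apply: eq_bigr => q _; rewrite -sumrB; apply: eq_bigr => r _.
rewrite -cintB//; [|exact: pw|exact: pw].
apply: cint_ext => y _; rewrite -mulrBr -conjcB; congr (_ * conjc _).
rewrite /comm_sep /sep; case: eqP => _; first by rewrite subrr.
by rewrite -mulrBl -mulrBr DcommB//; exact: smooth_expol.
Qed.

Lemma pairing_ae w w' tau : @cmeas _ T2 R setT w -> @cmeas _ T2 R setT w' ->
  {ae leb2, forall y : T2, w y = w' y} -> smooth tau -> csm (cderive1 tau) -> pairing w tau = pairing w' tau.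
Proof.
move=> mw mw' ae st ct; apply: eq_bigr => q _; apply: eq_bigr => r _.
have mc : @cmeas _ T2 R setT (fun y => conjc (comm_sep tau q r y)).
  apply: cmeasJ; apply: sep_cmeas; last by case: (LG r q).
  by apply: smooth_cmeas => //; case: (csm_em_Dcomm q r st ct).
apply: cint_ae_eq => //; [exact: cmeasM|exact: cmeasM|].
by apply: ae_imp ae => y e _; rewrite e.
Qed.

Definition chain_solution y : R[i] := \sum_(q < nu.+1) sep (expol sg (Aq q)) (ps (nu - q)%N) y.

(** Testing with [tau] times the chain solution yields the full derivatives D_t^r (tau e).
    Subtracting the commutators leaves tau D_t^r e, whose sum is 0 at almost every angle by the
    chain relations. *)
Lemma weak_pairing (p : 'I_(2 * m).+1 -> R[i]) u (f : R * R -> R[i]) tau beta beta' :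
  polar_form (adjoint p) bs -> solves p u f -> locint2 f -> locint2 u ->
  wL2 beta u -> wL2 beta' f -> csm tau ->
  cint leb2 (setT : set T2) (fun y => f y * conjc (tau (lnr y) * chain_solution y)) = pairing u tau.
Proof.
move=> hbs hu lf lu Lu Lf ct; have [st _] := ct; have mT : measurable (setT : set T2) by [].
have ct' := cderive1_supp ct; have se q := smooth_expol sg (Aq q).
have cte q : csm (fun t => tau t * expol sg (Aq q) t) by exact: csmM2.
have W q := weak_form_sep hbs hu lf lu (wL2J Lu) (wL2J Lf) (cte q) (Wps q) ms.
have ck q r : csm (fun t => em t ^+ (2 * m) * iter r Dt (fun t => tau t * expol sg (Aq q) t) t) by exact: csm_em_Dt.
have Lp0 q : @L2 _ T1 R leb I2pi (ps (nu - q)%N) by exact: W2pi_L20 (Wps q).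
have LD q j r : (j + r <= 2 * m)%N -> @L2 _ T1 R leb I2pi (fun w => bs j r w * Domega j (ps (nu - q)%N) w).
  move=> jr; apply: L2_smoothM; first exact: sbs.
  by apply: (W2pi_L2 (Wps q)); apply: leq_trans ms; exact: leq_trans (leq_addr _ _) jr.
have W1 q : cint leb2 (setT : set T2) (fun y => f y * conjc (sep (fun t => tau t * expol sg (Aq q) t) (ps (nu - q)%N) y)) =
    \sum_(r < (2 * m).+1) cint leb2 (setT : set T2) (fun y => u y *
      conjc (sep (fun t => em t ^+ (2 * m) * iter r Dt (fun t => tau t * expol sg (Aq q) t) t)
        (Bop m bs r (ps (nu - q)%N)) y)).
  apply: (can_inj (@conjcK R)); rewrite -cintJ//; last exact: (sep_csm_cintegrable Lf).
  transitivity (cint leb2 (setT : set T2) (fun y => (f y)^* *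
      sep (fun t => tau t * expol sg (Aq q) t) (ps (nu - q)%N) y)).
    by apply: cint_ext => y _; rewrite conjE conjcM conjcK.
  rewrite W -conjE rmorph_sum /= (exchange_big_dep xpredT)//=; apply: eq_bigr => r _.
  rewrite conjE -cintJ//; last exact: (sep_csm_cintegrable Lu).
  rewrite -cint_sum//; last first.
    move=> j jr; have := sep_csm_cintegrable Lu (ck q r) (LD q j r jr).
    move=> /(@cintegrableJ _ T2 R leb2 _ _ mT); apply: cintegrable_ext => // y _.
    by rewrite conjcM conjcK.
  apply: cint_ext => y _; rewrite conjcM conjcK -mulr_sumr; congr (_ * _).
  rewrite /sep /Bop; case: eqP => _; first by rewrite big1.
  by rewrite mulr_sumr.
transitivity (\sum_(q < nu.+1) cint leb2 (setT : set T2) (fun y => f y *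
   conjc (sep (fun t => tau t * expol sg (Aq q) t) (ps (nu - q)%N) y))).
  rewrite -cint_sum//; last by move=> q _; exact: (sep_csm_cintegrable Lf).
  apply: cint_ext => y _; rewrite /chain_solution mulr_sumr -conjE rmorph_sum /=.
  rewrite mulr_sumr; apply: eq_bigr => q _; rewrite conjE; congr (_ * conjc _).
  by rewrite /sep; case: eqP => _; rewrite ?mulr0// mulrA.
rewrite (eq_bigr _ (fun (q : 'I_nu.+1) _ => W1 q)) /pairing.
apply/eqP; rewrite -subr_eq0 -sumrB; apply/eqP.
transitivity (\sum_(q < nu.+1) \sum_(r < (2 * m).+1) cint leb2 (setT : set T2) (fun y => u y *
   conjc (sep (fun t => em t ^+ (2 * m) * tau t * iter r Dt (expol sg (Aq q)) t)
        (Bop m bs r (ps (nu - q)%N)) y))).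
  apply: eq_bigr => q _; rewrite -sumrB; apply: eq_bigr => r _.
  rewrite -cintB//; [|exact: (sep_csm_cintegrable Lu)|exact: (wL2_pairable Lu)].
  apply: cint_ext => y _; rewrite -mulrBr -conjcB; congr (_ * conjc _).
  rewrite /comm_sep /sep; case: eqP => _; first by rewrite subrr.
  by rewrite -mulrBl /Dcomm; congr (_ * _); ring.
have c3 q r : csm (fun t => em t ^+ (2 * m) * tau t * iter r Dt (expol sg (Aq q)) t).
  by apply: csmM2; [exact: smooth_iter_Dt|apply: csmM => //; exact: smooth_emX].
have iS (q : nat) : cintegrable leb2 (setT : set T2) (fun y => \sum_(r < (2 * m).+1) u y *
   conjc (sep (fun t => em t ^+ (2 * m) * tau t * iter r Dt (expol sg (Aq q)) t)
        (Bop m bs r (ps (nu - q)%N)) y)).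
  by apply: cintegrable_sum => // r _; exact: (sep_csm_cintegrable Lu).
transitivity (\sum_(q < nu.+1) cint leb2 (setT : set T2) (fun y => \sum_(r < (2 * m).+1) u y *
   conjc (sep (fun t => em t ^+ (2 * m) * tau t * iter r Dt (expol sg (Aq q)) t)
        (Bop m bs r (ps (nu - q)%N)) y))).
  by apply: eq_bigr => q _; rewrite cint_sum// => r _; exact: (sep_csm_cintegrable Lu).
rewrite -cint_sum//.
rewrite -[RHS](@cint0 _ T2 R leb2 setT); apply: cint_ae_eq => //.
- by apply: cmeas_sum => q _; exact: cintegrable_meas (iS q).
- exact: cmeas_cst.
apply: ae_imp (sep_ae (chain_pointwise sbs ms hps hnu)) => y [y0 [_ e]] _.
have -> : \sum_(q < nu.+1) \sum_(r < (2 * m).+1) u y * conjc (sep (fun t => em t ^+ (2 * m) * tau t *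
    iter r Dt (expol sg (Aq q)) t) (Bop m bs r (ps (nu - q)%N)) y) =
  u y * conjc (em (lnr y) ^+ (2 * m) * tau (lnr y) * expol sg (\sum_(q < nu.+1) \sum_(r < (2 * m).+1)
    Bop m bs r (ps (nu - q)%N) (polar_angle y) *: iter r (Lp sg) (Aq q)) (lnr y)).
  rewrite expol_sum mulr_sumr -conjE rmorph_sum mulr_sumr; apply: eq_bigr => q _.
  rewrite expol_sum mulr_sumr rmorph_sum mulr_sumr; apply: eq_bigr => r _.
  rewrite expolZ -iter_Dt_expol /= conjE /sep; case: eqP => // _; congr (_ * conjc _).
  by ring.
by rewrite e /expol horner0 !mulr0 conjc0 mulr0.
Qed.

End PlanarPairing.

(** * Smooth steps and cut-offs in the variable ln r *)

Section Cutoffs.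
Context {R : realType}.
Notation T1 := (measurableTypeR R).
Implicit Types (t x T M : R) (f e tau : R -> R[i]).

(* step from [0] to [1] on [T <= t <= T + 1] *)
Definition eta (T : R) : R -> R[i] := fun t => (step (t - T))%:C.

Lemma etaE T : eta T = fun t => eta 0 (t - T).
Proof. by apply/funext => t; rewrite /eta subr0. Qed.

Lemma smooth_eta T : smooth (eta T).
Proof.
have := smooth_affine 1 (- T) (@smooth_step_fun R); congr smooth.
by apply/funext => t; rewrite mul1r.
Qed.

Lemma eta_conj T t : conjc (eta T t) = eta T t.
Proof. exact: conjc_real. Qed.

Lemma eta0_near T t : t < T -> \forall x \near t, eta T x = 0.
Proof.
move=> tT; have : \forall x \near t, x < T by exact: lt_nbhsl.
by apply: filterS => x xT; rewrite /eta step0// subr_le0 ltW.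
Qed.

Lemma eta1_near T t : T + 1 < t -> \forall x \near t, eta T x = 1.
Proof.
move=> tT; have : \forall x \near t, T + 1 < x by exact: lt_nbhsr.
by apply: filterS => x xT; rewrite /eta step1// lerBrDl ltW.
Qed.

Lemma cderive1_eta_out T t : t < T \/ T + 1 < t -> cderive1 (eta T) t = 0.
Proof.
case=> [/eta0_near h|/eta1_near h]; rewrite (near_cderive1 h); exact: (is_cdE (is_cd_cst t _)).
Qed.

Lemma csm_cderive1_eta T : csm (cderive1 (eta T)).
Proof.
split; first exact: smooth_derive (smooth_eta T).
exists (`|T| + 2) => [|t ht]; first by rewrite ltr_wpDl.
apply: cderive1_eta_out; have := ler_norm T; have := ler_norm (- T); rewrite normrN => *.
by have [t0|t0] := leP 0 t; [rewrite (ger0_norm t0) in ht; right; lra|rewrite (ltr0_norm t0) in ht; left; lra].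
Qed.

Lemma cint_cderive1_eta T : cint leb setT (cderive1 (eta T)) = 1.
Proof.
have M0 : 0 < `|T| + 2 by rewrite ltr_wpDl.
have h1 := ler_norm T; have h2 := ler_norm (- T); rewrite normrN in h2.
rewrite (cint_derive (smooth_eta T) M0).
  by rewrite /eta step1 ?step0 ?subr0//; lra.
move=> t ht; apply: cderive1_eta_out.
by have [t0|t0] := leP 0 t; [rewrite (ger0_norm t0) in ht; right; lra|rewrite (ltr0_norm t0) in ht; left; lra].
Qed.

Definition cut (n : nat) : R -> R[i] := fun t => eta (- n%:R) t - eta n%:R t.

Lemma csm_cut n : csm (cut n).
Proof.
split.
  have -> : cut n = fun t => eta (- n%:R) t + (- 1) * eta n%:R t.
    by apply/funext => t; rewrite mulN1r.
  by apply: smoothD; [exact: smooth_eta|apply: smoothZ; exact: smooth_eta].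
have n0 : 0 <= (n%:R : R) by rewrite ler0n.
exists (n%:R + 2) => [|t]; first by rewrite ltr_wpDl.
rewrite /cut /eta; have [t0|t0] := leP 0 t; move=> ht.
  by rewrite (ger0_norm t0) in ht; rewrite !step1 ?subrr//; lra.
by rewrite (ltr0_norm t0) in ht; rewrite !step0 ?subrr//; lra.
Qed.

Lemma cut_bound n t : cabs (cut n t) <= 1.
Proof.
rewrite /cut /eta -rmorphB /= cabs_real.
have n0 : 0 <= (n%:R : R) by rewrite ler0n.
have h1 := step_ge0 (t - - n%:R); have h2 := step_le1 (t - - n%:R).
have h3 := step_ge0 (t - n%:R); have h4 := step_le1 (t - n%:R).
by rewrite ler_norml; apply/andP; split; lra.
Qed.

Lemma cut1_near t : \forall n \near \oo, cut n t = 1.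
Proof.
exists (Num.truncn `|t|).+2 => // n /= hn.
have tn : `|t| + 1 <= n%:R.
  apply: (@le_trans _ _ (Num.truncn `|t|).+2%:R); last by rewrite ler_nat.
  by rewrite -[X in _ <= X]natr1 lerD2r ltW// truncnS_gt.
have h1 := ler_norm t; have h2 := ler_norm (- t); rewrite normrN in h2.
by rewrite /cut /eta step1 ?step0 ?subr0//; lra.
Qed.

End Cutoffs.

(** * Boundary pairing of two power solutions *)

Section ChainPairingPlanar.
Context {R : realType}.
Notation T1 := (measurableTypeR R).
Notation T2 := (measurableTypeR R * measurableTypeR R)%type.
Variables (m : nat) (p : 'I_(2 * m).+1 -> R[i]) (b bs : nat -> nat -> R -> R[i]).
Hypotheses (hb : polar_form p b) (hbs : polar_form (adjoint p) bs).
Variables (s s' : nat) (lam mu : R[i]) (kap1 kap2 : nat) (ph ps : nat -> R -> R[i]).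
Hypothesis ms : (2 * m <= s)%N.
Hypotheses (hph : jordan_chain s s' (pencil m b) lam kap1 ph)
           (hps : jordan_chain s s' (pencil m bs) (conjc mu - 2 * 'i * (m%:R - 1)) kap2 ps).
Variables (k nu : nat).
Hypotheses (hk : (k < kap1)%N) (hnu : (nu < kap2)%N).

Let sbs j r : (j + r <= 2 * m)%N -> smooth (bs j r).
Proof. by move=> jr; case: (polar_form_smooth hbs jr). Qed.
Let Wph q : W2pi s (ph (k - q)%N).
Proof. by case: hph => H1 _; apply: H1; apply: leq_ltn_trans hk; exact: leq_subr. Qed.
Let Wps q : W2pi s (ps (nu - q)%N).
Proof. by case: hps => H1 _; apply: H1; apply: leq_ltn_trans hnu; exact: leq_subr. Qed.
Let sg : R[i] := conjc mu - 2 * 'i * (m%:R - 1).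

Lemma chain_solution_pairable : pairable m bs sg ps nu (chain_solution lam ph k).
Proof.
have := @pairable_sumZ R m bs sg ps nu _ (index_enum 'I_k.+1) xpredT (fun=> 1)
  (fun q => sep (expol lam (Aq q)) (ph (k - q)%N)).
rewrite (_ : (fun y => _) = chain_solution lam ph k).
  apply=> q _; apply: (sep_pairable sbs ms hps hnu); [exact: smooth_expol|exact: W2pi_L20 (Wph q)].
by apply/funext => y; apply: eq_bigr => q _; rewrite mul1r.
Qed.

(** The planar integrals split, and [cint_Dcomm] turns the radial ones into integrals of the
    Wronskians against the derivative of the step. Their combination is a constant, so only the
    integral of that derivative remains, which is 1 whatever [T] is. *)
Lemma pairing_chain T : pairing m bs sg ps nu (chain_solution lam ph k) (eta T) =
  'i * (if lam == mu then
    \sum_(i < nu.+1) \sum_(q < k.+1) ((nu + k + 1 - i - q)`!%:R)^-1 *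
      ip (pencil_derive m b (nu + k + 1 - i - q) lam (ph q)) (ps i) else 0).
Proof.
set C := if _ then _ else _; have CE t : chain_wronskian m bs lam mu ph ps k nu t = C.
  rewrite /C; case: eqP => [lm|/eqP lm].
    exact: (chain_wronskian_diag hb hbs ms hph hps hk hnu).
  exact: (chain_wronskian_off hb hbs ms hph hps hk hnu).
have se := smooth_eta T; have ce := csm_cderive1_eta T.
have Lph q := W2pi_L20 (Wph q).
have LB r q : @L2 _ T1 R leb I2pi (Bop m bs r (ps (nu - q)%N)) by exact: Bop_L2 ms.
pose e1 q := expol (lam + 2 * 'i * (m%:R - 1)) (Aq q).
pose e2 q := expol sg (Aq q).
have iW r q j : cintegrable leb setT (fun t => cderive1 (eta T) t * wronskian r (e1 q) (e2 j) t).
  apply/csm_cintegrable/csmM2 => //; apply: smooth_wronskian; exact: smooth_expol.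
have key q j r : cint leb2 (setT : set T2) (fun y => sep (expol lam (Aq q)) (ph (k - q)%N) y *
    conjc (comm_sep m bs sg ps nu (eta T) j r y)) =
    'i * (cint leb setT (fun t => cderive1 (eta T) t * wronskian r (e1 q) (e2 j) t) *
     ip (ph (k - q)%N) (Bop m bs r (ps (nu - j)%N))).
  have [_ ->] := sep_sep_cint (smooth_expol lam (Aq q)) (Lph q) (csm_em_Dcomm m sg j r se ce) (LB r j).
  rewrite mulrA -(cint_Dcomm r se ce (eta_conj T)); [|exact: smooth_expol|exact: smooth_expol].
  congr (_ * _); apply: cint_ext => t _; rewrite conjcM conjcX conjc_real.
  (* The weight e^(-2mt) e^(2t) is e^(ict) with c = 2i(m-1), since i times i is -1; this is where
     the shifted exponent of the first chain arises. *)
  have -> : e1 q t = expol lam (Aq q) t * (em t ^+ (2 * m) * (expR (2 * t))%:C).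
    rewrite /e1 /expol [RHS]mulrAC; congr (_ * _).
    rewrite /em -rmorphXn /= -expRM_natl -!cexp_real -!cexpD; congr cexp.
    have i2 : 'i * 'i = -1 :> R[i] by rewrite -expr2 sqr_i.
    have -> : 'i * (lam + 2 * 'i * (m%:R - 1)) * t%:C = 'i * lam * t%:C + ('i * 'i) * (2 * (m%:R - 1) * t%:C) by ring.
    by rewrite i2 !rmorphM !rmorphN /= natrM; ring.
  by rewrite -/(em t); ring.
have iS (q j : nat) : pairable m bs sg ps nu (sep (expol lam (Aq q)) (ph (k - q)%N)).
  by apply: (sep_pairable sbs ms hps hnu); [exact: smooth_expol|exact: Lph].
transitivity (\sum_(j < nu.+1) \sum_(r < (2 * m).+1) \sum_(q < k.+1)
   'i * (cint leb setT (fun t => cderive1 (eta T) t * wronskian r (e1 q) (e2 j) t) *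
     ip (ph (k - q)%N) (Bop m bs r (ps (nu - j)%N)))).
  apply: eq_bigr => j _; apply: eq_bigr => r _; rewrite -(eq_bigr _ (fun (q : 'I_k.+1) _ => key q j r)).
  rewrite -cint_sum//; last by move=> q _; exact: iS.
  by apply: cint_ext => y _; rewrite mulr_suml.
pose H r q j := ip (ph (k - q)%N) (Bop m bs r (ps (nu - j)%N)).
pose W r q j t := cderive1 (eta T) t * wronskian r (e1 q) (e2 j) t.
transitivity ('i * \sum_(r < (2 * m).+1) \sum_(q < k.+1) \sum_(j < nu.+1) H r q j * cint leb setT (W r q j)).
  rewrite exchange_big /= mulr_sumr; apply: eq_bigr => r _; rewrite exchange_big /= mulr_sumr.
  by apply: eq_bigr => q _; rewrite mulr_sumr; apply: eq_bigr => j _; rewrite [H _ _ _ * _]mulrC.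
congr (_ * _); have mT : measurable (setT : set T1) by [].
transitivity (cint leb setT (fun t => \sum_(r < (2 * m).+1) \sum_(q < k.+1) \sum_(j < nu.+1) H r q j * W r q j t)).
  rewrite cint_sum//; last first.
    by move=> r _; apply: cintegrable_sum => // q _; apply: cintegrable_sumZ => // j _; exact: iW.
  apply: eq_bigr => r _; rewrite cint_sum//; last first.
    by move=> q _; apply: cintegrable_sumZ => // j _; exact: iW.
  by apply: eq_bigr => q _; rewrite cint_sumZ// => j _; exact: iW.
transitivity (cint leb setT (fun t => C * cderive1 (eta T) t)).
  apply: cint_ext => t _; rewrite -(CE t) /chain_wronskian mulr_suml; apply: eq_bigr => r _.
  rewrite mulr_suml; apply: eq_bigr => q _; rewrite mulr_suml; apply: eq_bigr => j _.
  by rewrite /W [LHS]mulrCA; exact: mulrC.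
by rewrite cintZ ?cint_cderive1_eta ?mulr1//; exact: csm_cintegrable.
Qed.

End ChainPairingPlanar.

(** * Decay of the boundary pairing *)

Section Tails.
Context {R : realType}.
Notation T1 := (measurableTypeR R).
Notation T2 := (measurableTypeR R * measurableTypeR R)%type.
Implicit Types (t x T : R) (f e tau : R -> R[i]).

(** Each factor 1 + x costs half of the remaining rate, so the induction on the degree never
    exhausts [eps]. *)
Lemma poly_exp_bound d (eps : R) : 0 < eps ->
  exists2 K : R, 0 <= K & forall x, 0 <= x -> (1 + x) ^+ d <= K * expR (eps * x).
Proof.
elim: d eps => [|d ih] eps e0.
  exists 1 => // x x0; rewrite expr0 mul1r -expR0 ler_expR.
  by rewrite mulr_ge0// ltW.
have e2 : 0 < eps / 2 by rewrite divr_gt0.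
have [K K0 hK] := ih _ e2; have i0 : 0 < (eps / 2)^-1 by rewrite invr_gt0.
exists ((1 + (eps / 2)^-1) * K) => [|x x0].
  by rewrite mulr_ge0// addr_ge0// ltW.
rewrite exprS; have -> : eps * x = eps / 2 * x + eps / 2 * x by lra.
rewrite expRD mulrACA ler_pM//; [by rewrite addr_ge0|by rewrite exprn_ge0// addr_ge0| |exact: hK].
have h := expR_ge1Dx (eps / 2 * x).
apply: (@le_trans _ _ ((1 + (eps / 2)^-1) * (1 + eps / 2 * x))); last first.
  by rewrite ler_wpM2l// addr_ge0// ltW.
have -> : (1 + (eps / 2)^-1) * (1 + eps / 2 * x) = 1 + eps / 2 * x + (eps / 2)^-1 + ((eps / 2)^-1 * (eps / 2)) * x by ring.
rewrite mulVf ?gt_eqF// mul1r; have : 0 <= eps / 2 * x by rewrite mulr_ge0// ltW.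
by move: i0 => /ltW; lra.
Qed.

Lemma integrable_exp_abs (d : R) : 0 < d -> leb.-integrable setT (EFin \o (fun t => expR (- d * `|t|))).
Proof.
move=> d0; have cf : continuous (fun t : R => expR (- d * `|t|)).
  move=> t; apply: continuous_comp; last exact: continuous_expR.
  by apply: cvgM; [exact: cvg_cst|exact: norm_continuous].
have mf : measurable_fun (setT : set T1) (fun t : R => expR (- d * `|t|)) by exact: continuous_measurable_fun.
apply/integrableP; split; first exact/measurable_EFinP.
under eq_integral => t _ do rewrite /= gtr0_norm ?expR_gt0//.
rewrite (@ge0_symfun_integralT R (fun t => expR (- d * `|t|)))//; last by move=> t /=; rewrite normrN.
apply: lte_mul_pinfty => //.
apply: (@le_lt_trans _ _ (d^-1%:E * \int[lebesgue_measure]_x (exponential_pdf d x)%:E)%E); last first.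
  by rewrite integral_exponential_pdf// mule1 ltry.
rewrite -ge0_integralZl_EFin//; last 3 first.
- by move=> x _; rewrite lee_fin; apply: exponential_pdf_ge0; exact: ltW.
- by apply/measurable_EFinP; exact: measurable_exponential_pdf.
- by rewrite invr_ge0 ltW.
rewrite [X in (X <= _)%E]integral_mkcond; apply: ge0_le_integral => //.
- by move=> t _; rewrite erestrict_ge0// => x _; rewrite lee_fin expR_ge0.
- apply/(measurable_restrictT _ _).1 => //=.
    by rewrite -set_itvcy; exact: measurable_itv.
  by apply/measurable_EFinP; exact: measurable_funTS.
- by apply: measurable_funeM; apply/measurable_EFinP; exact: measurable_exponential_pdf.
move=> t _; rewrite patchE; case: ifPn => [/set_mem/= t0|_].
  rewrite -EFinM lee_fin exponential_pdfE//; rewrite mulrA mulVf ?gt_eqF// mul1r.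
  by rewrite ger0_norm.
by rewrite -EFinM lee_fin mulr_ge0 ?invr_ge0 ?exponential_pdf_ge0// ltW.
Qed.

Lemma exp_abs_L2 (h : R -> R[i]) (K d : R) : @cmeas _ T1 R setT h -> 0 < d ->
  (forall t, cabs (h t) <= K * expR (- d * `|t|)) -> @L2 _ T1 R leb setT h.
Proof.
move=> mh d0 hK; have K0 : 0 <= K.
  by have := le_trans (cabs_ge0 _) (hK 0); rewrite normr0 mulr0 expR0 mulr1.
split=> //; have d2 : 0 < 2 * d by rewrite mulr_gt0.
have mT : measurable (setT : set T1) by [].
have := integrableZl mT (K ^+ 2) (integrable_exp_abs d2); apply: le_integrable => //.
  by apply/measurable_EFinP/measurable_funX; exact: (measurable_cabs mT mh).
move=> t _ /=; rewrite lee_fin ger0_norm ?sqr_ge0// ger0_norm ?mulr_ge0 ?sqr_ge0 ?expR_ge0//.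
apply: (le_trans (lerXn2r 2 _ _ (hK t))); rewrite ?nnegrE ?cabs_ge0//.
  exact: le_trans (cabs_ge0 _) (hK t).
by rewrite exprMn -expRM_natl mulrA mulrN.
Qed.

Lemma sqn_le_bound (h : R -> R[i]) (B T : R) : @L2 _ T1 R leb setT h ->
  (forall t, cabs (h t) <= B) -> (forall t, t < T \/ T + 1 < t -> h t = 0) ->
  sqn leb setT h <= B ^+ 2.
Proof.
move=> [mh ih] hB h0; have mI : measurable (`[T, T + 1]%classic : set T1) by exact: measurable_itv.
have -> : sqn leb setT h = Rintegral leb `[T, T + 1]%classic (fun t => cabs (h t) ^+ 2).
  rewrite /sqn Rintegral_mkcond [RHS]Rintegral_mkcond; apply: eq_Rintegral => t _.
  rewrite /patch in_setT; case: ifPn => // /negP ht; rewrite h0 ?cabs0 ?expr0n//.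
  have [tT|Tt] := ltP t T; [by left|right; rewrite ltNge; apply/negP => tT; apply: ht].
  by apply/mem_set; rewrite /= in_itv/= Tt.
apply: (@le_trans _ _ (Rintegral leb `[T, T + 1]%classic (cst (B ^+ 2)))).
  apply: le_Rintegral => //.
  - exact: integrableS ih.
  - have [] := cintegrable_cst T (T + 1) (B ^+ 2)%:C; rewrite /comp /=.
    by [].
  move=> t _; rewrite lerXn2r ?nnegrE ?cabs_ge0//.
  exact: le_trans (cabs_ge0 _) (hB t).
rewrite Rintegral_cst// /leb /= lebesgue_measure_itv/= lte_fin ltrDl ltr01 -EFinB /=.
by rewrite addrC addKr mulr1.
Qed.

Lemma iter_Dt_shift k f a : smooth f -> iter k Dt (fun t => f (t + a)) = fun t => iter k Dt f (t + a).
Proof.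
move=> sf; elim: k => //= k ->; apply/funext => t; rewrite /Dt.
have := cderive1_affine 1 a (smooth_iter_Dt k sf).
rewrite (_ : (fun t => iter k Dt f (1 * t + a)) = fun t => iter k Dt f (t + a)); last first.
  by apply/funext => x; rewrite mul1r.
by move=> ->; rewrite mul1r mul1r.
Qed.

Lemma smooth_shift f a : smooth f -> smooth (fun t => f (t + a)).
Proof.
move=> sf; have := smooth_affine 1 a sf; congr smooth.
by apply/funext => x; rewrite mul1r.
Qed.

Lemma Dcomm_shift k tau e a t : smooth tau -> smooth e ->
  Dcomm k (fun t => tau (t + a)) (fun t => e (t + a)) t = Dcomm k tau e (t + a).
Proof.
move=> st se; rewrite /Dcomm iter_Dt_shift//.
by rewrite (iter_Dt_shift k a (smoothM st se)).
Qed.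

Lemma Dcomm_sumZ k tau n (z : 'I_n -> R[i]) (e_ : 'I_n -> R -> R[i]) t : smooth tau -> (forall i, smooth (e_ i)) ->
  Dcomm k tau (fun t => \sum_(i < n) z i * e_ i t) t = \sum_(i < n) z i * Dcomm k tau (e_ i) t.
Proof.
move=> st se.
have iter_sum (F : 'I_n -> R -> R[i]) : (forall i, smooth (F i)) ->
    iter k Dt (fun t => \sum_(i < n) F i t) t = \sum_(i < n) iter k Dt (F i) t.
  move=> sF; suff -> : iter k Dt (fun t => \sum_(i < n) F i t) = fun t => \sum_(i < n) iter k Dt (F i) t by [].
  elim: k => //= j ->; rewrite Dt_sum// => i; exact: smooth_iter_Dt.
rewrite /Dcomm (iter_sum (fun i t => z i * e_ i t)); last by move=> i; exact: smoothZ.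
have -> : (fun t => tau t * (\sum_(i < n) z i * e_ i t)) = fun t => \sum_(i < n) z i * (tau t * e_ i t).
  by apply/funext => x; rewrite mulr_sumr; apply: eq_bigr => i _; rewrite mulrCA.
rewrite (iter_sum (fun i t => z i * (tau t * e_ i t))); last by move=> i; apply: smoothZ; exact: smoothM.
rewrite mulr_sumr -sumrB; apply: eq_bigr => i _.
rewrite iter_DtZ; last exact: smoothM.
by rewrite iter_DtZ// mulrBr mulrCA.
Qed.

Lemma near_Dcomm k tau tau' e t : (\forall x \near t, tau x = tau' x) -> smooth tau -> smooth tau' -> smooth e ->
  Dcomm k tau e t = Dcomm k tau' e t.
Proof.
move=> h s1 s2 se; rewrite /Dcomm (nbhs_singleton h) (iter_DtE _ (smoothM s1 se)) (iter_DtE _ (smoothM s2 se)).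
congr (_ * _ - _); apply: near_iter_cderive1.
by apply: filterS h => x ->.
Qed.

Lemma Dcomm_eta0_out k e t : smooth e -> t < 0 \/ 0 + 1 < t -> Dcomm k (eta 0) e t = 0.
Proof.
move=> se [/eta0_near h|/eta1_near h].
  rewrite (near_Dcomm k h (@smooth_eta R 0) (smooth_cst 0) se) /Dcomm mul0r subr0.
  by rewrite iter_DtZ// mul0r.
rewrite (near_Dcomm k h (@smooth_eta R 0) (smooth_cst 1) se) /Dcomm mul1r.
rewrite (_ : (fun t => 1 * e t) = e) ?subrr//.
by apply/funext => x; rewrite mul1r.
Qed.

(** The binomial theorem for the translated argument. It expresses the exponential polynomial near T
    through finitely many fixed ones near 0, with coefficients that carry all the dependence on
    T. *)
Lemma expol_shift (sg : R[i]) q a t : expol sg (Aq q) t =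
  \sum_(i < q.+1) (cexp ('i * sg * a%:C) * (('i * a%:C) ^+ i / i`!%:R)) * expol sg (Aq (q - i)) (t + (- a)).
Proof.
rewrite /expol.
under eq_bigr => i _ do rewrite mulrACA -cexpD -mulrDr -rmorphD /= (addrC a) subrK.
rewrite -mulr_sumr; congr (_ * _); rewrite /Aq hornerZ hornerXn -{1}(subrK a t) rmorphD /= exprDn.
rewrite mulr_sumr; apply: eq_bigr => i _; rewrite hornerZ hornerXn exprMn.
have iq : (i <= q)%N by rewrite -ltnS.
have f0 n : (n`!%:R : R[i]) != 0 by rewrite pnatr_eq0 -lt0n fact_gt0.
have -> : 'i ^+ q = 'i ^+ i * 'i ^+ (q - i) :> R[i] by rewrite -exprD subnKC.
rewrite -[X in _ * X = _]mulr_natr; move: (f0 i) (f0 (q - i)%N) (f0 q) => fi fqi.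
rewrite -(bin_fact iq) !natrM !mulf_eq0 !negb_or => /and3P[c0 _ _].
by field; rewrite c0 fi fqi.
Qed.

Lemma expol_Aq_bound (sg : R[i]) q t :
  cabs (expol sg (Aq q) t) <= expR (- imC sg * t) * (1 + `|t|) ^+ q.
Proof.
have r0 : reC ('i * sg * t%:C) = - imC sg * t.
  by case: sg => x y; rewrite /reC /imC /=; ring.
have q1 : (1 : R) <= q`!%:R by rewrite ler1n fact_gt0.
rewrite /expol cabsM cabs_cexp r0 ler_wpM2l ?expR_ge0// /Aq hornerZ hornerXn !cabsM !cabsX cabs_i expr1n mul1r.
rewrite cabs_real; apply: (@le_trans _ _ (1 * `|t| ^+ q)).
  rewrite ler_wpM2r ?exprn_ge0// -[X in cabs X](_ : ((q`!%:R : R)^-1)%:C = _); last first.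
    by rewrite fmorphV /= rmorph_nat.
  by rewrite cabs_real ger0_norm ?invr_ge0 ?ler0n// invf_le1// (lt_le_trans ltr01).
by rewrite mul1r lerXn2r ?nnegrE ?addr_ge0// lerDr.
Qed.

(** [P] selects a half line of t on which the weighted exponential decays; half of the rate absorbs
    the polynomial factor. *)
Lemma half_line_cintegrable (f : R * R -> R[i]) beta (sg : R[i]) q g (P : R -> bool) :
  wL2 beta f -> @L2 _ T1 R leb I2pi g -> measurable_fun (setT : set T1) P -> 1 - beta - imC sg != 0 ->
  (forall t, P t -> (1 - beta - imC sg) * t <= - `|1 - beta - imC sg| * `|t|) ->
  cintegrable leb2 (setT : set T2) (fun y => f y *
    conjc (sep (fun t => if P t then expol sg (Aq q) t else 0) g y)).
Proof.
move=> Lf Lg mP; set c := 1 - beta - imC sg => c0 hP.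
have mI := @measurable_I2pi R; have c2 : 0 < `|c| / 2 by rewrite divr_gt0 ?normr_gt0.
pose tau t := if P t then expol sg (Aq q) t else 0.
have mt : @cmeas _ T1 R setT tau.
  by apply: cmeas_if => //; [exact: smooth_cmeas (smooth_expol _ _)|exact: cmeas_cst].
have [K K0 hK] := poly_exp_bound q c2.
have Lt : @L2 _ T1 R leb setT (expc (1 - beta) (fun t => conjc (tau t))).
  apply: (@exp_abs_L2 _ K (`|c| / 2)) => //.
    by apply: cmeasM; [exact: cmeasJ|exact: expR_cmeas].
  move=> t; rewrite /expc cabsM cabsJ cabs_real ger0_norm ?expR_ge0// /tau.
  case: ifPn => [Pt|_]; last by rewrite cabs0 mul0r mulr_ge0 ?expR_ge0.
  apply: (@le_trans _ _ ((expR (- imC sg * t) * (1 + `|t|) ^+ q) * expR ((1 - beta) * t))).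
    by rewrite ler_wpM2r ?expR_ge0//; exact: expol_Aq_bound.
  rewrite mulrAC -expRD.
  apply: (@le_trans _ _ (expR (- `|c| * `|t|) * (K * expR (`|c| / 2 * `|t|)))).
    apply: ler_pM; rewrite ?expR_ge0 ?exprn_ge0 ?addr_ge0//; last exact: hK.
    rewrite ler_expR; apply: le_trans (hP t Pt).
    by rewrite /c le_eqVlt; apply/orP; left; apply/eqP; ring.
  rewrite mulrCA -expRD ler_wpM2l// ler_expR le_eqVlt; apply/orP; left; apply/eqP; lra.
have [+ _] := sep_pairing Lf Lt (L2J mI Lg).
by apply: cintegrable_ext => // y _; rewrite sepJ.
Qed.

(** One weight gives decay towards infinity and the other towards the origin, so the exponential is
    split at t = 0 and each half is paired with its own weight. *)
Lemma expol_sep_cintegrable (f : R * R -> R[i]) beta beta' (sg : R[i]) q g :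
  wL2 beta f -> wL2 beta' f -> @L2 _ T1 R leb I2pi g ->
  1 - beta < imC sg -> imC sg < 1 - beta' ->
  cintegrable leb2 (setT : set T2) (fun y => f y * conjc (sep (expol sg (Aq q)) g y)).
Proof.
move=> Lf Lf' Lg h1 h2; have mT : measurable (setT : set T2) by [].
have mP : measurable_fun (setT : set T1) (fun t : T1 => (0 <= t)%R).
  by apply: measurable_fun_ler; [exact: measurable_cst|exact: measurable_id].
have mN : measurable_fun (setT : set T1) (fun t : T1 => ~~ (0 <= t)%R) by exact: measurable_neg.
have n1 : 1 - beta - imC sg < 0 by lra.
have n2 : 0 < 1 - beta' - imC sg by lra.
have i1 : cintegrable leb2 (setT : set T2) (fun y => f y *
    conjc (sep (fun t => if (0 <= t)%R then expol sg (Aq q) t else 0) g y)).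
  apply: (half_line_cintegrable q Lf Lg mP); first by rewrite lt_eqF.
  by move=> t t0; rewrite ltr0_norm// opprK ger0_norm.
have i2 : cintegrable leb2 (setT : set T2) (fun y => f y *
    conjc (sep (fun t => if ~~ (0 <= t)%R then expol sg (Aq q) t else 0) g y)).
  apply: (half_line_cintegrable q Lf' Lg mN); first by rewrite gt_eqF.
  by move=> t; rewrite -ltNge => t0; rewrite gtr0_norm// ltr0_norm// mulrNN.
apply: cintegrable_ext (cintegrableD mT i1 i2) => // y _.
rewrite -mulrDr; congr (_ * _); rewrite -!conjE -rmorphD /= !conjE; congr conjc.
rewrite /sep; case: eqP => _; first by rewrite addr0.
by case: ifPn => _ /=; rewrite ?mul0r ?addr0 ?add0r.
Qed.

Section PairingTail.
Variables (m : nat) (bs : nat -> nat -> R -> R[i]).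
Variables (s s' : nat) (sg : R[i]) (kap : nat) (ps : nat -> R -> R[i]) (nu : nat).
Hypothesis sbs : forall j r, (j + r <= 2 * m)%N -> smooth (bs j r).
Hypothesis ms : (2 * m <= s)%N.
Hypothesis hps : jordan_chain s s' (pencil m bs) sg kap ps.
Hypothesis hnu : (nu < kap)%N.
Variables (beta : R) (u : R * R -> R[i]).
Hypothesis Lu : wL2 beta u.
(** The exponential rate in T of the boundary pairing: [1 - beta] from pairing with [u], -2m from
    the factor r^(-2m), and the last term from the modulus of e^(i sg t). *)
Let g0 := 1 - beta - (2 * m)%:R - imC sg.

(** Translation by T reduces the step at T to the fixed step at 0, and [expol_shift] reduces the
    exponential polynomial to fixed ones; the bound is then uniform over T. *)
Lemma Dcomm_eta_bound q r : exists2 M : R, 0 <= M & forall T t,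
  cabs (expc (1 - beta) (fun t => em t ^+ (2 * m) * Dcomm r (eta T) (expol sg (Aq q)) t) t) <=
    M * ((1 + `|T|) ^+ q * expR (g0 * T)) /\
  (t < T \/ T + 1 < t -> Dcomm r (eta T) (expol sg (Aq q)) t = 0).
Proof.
pose c0 := 1 - beta - (2 * m)%:R.
pose D (i : 'I_q.+1) := expc c0 (Dcomm r (eta 0) (expol sg (Aq (q - i)))).
have /choice [M hM] : forall i, exists C : R, forall t, cabs (D i t) <= C.
  move=> i; apply/csm_bounded/csm_expc/csm_Dcomm; [exact: smooth_eta|exact: csm_cderive1_eta|exact: smooth_expol].
have M0 i : 0 <= M i by exact: le_trans (cabs_ge0 (D i 0)) (hM i 0).
pose z T i := cexp ('i * sg * T%:C) * (('i * T%:C) ^+ i / i`!%:R) : R[i].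
have DE T t : Dcomm r (eta T) (expol sg (Aq q)) t =
    \sum_(i < q.+1) z T i * Dcomm r (eta 0) (expol sg (Aq (q - i))) (t + (- T)).
  rewrite (_ : expol sg (Aq q) = fun t => \sum_(i < q.+1) z T i * expol sg (Aq (q - i)) (t + (- T))); last first.
    by apply/funext => x; exact: expol_shift.
  rewrite Dcomm_sumZ; [|exact: smooth_eta|by move=> i; apply: smooth_shift; exact: smooth_expol].
  apply: eq_bigr => i _; rewrite etaE; congr (_ * _).
  by apply: Dcomm_shift; [exact: smooth_eta|exact: smooth_expol].
exists (\sum_(i < q.+1) M i) => [|T t]; first by apply: sumr_ge0.
split; last first.
  move=> ht; rewrite DE big1// => i _; rewrite Dcomm_eta0_out ?mulr0//; first exact: smooth_expol.
  by case: ht => ht; [left|right]; lra.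
have -> : expc (1 - beta) (fun t => em t ^+ (2 * m) * Dcomm r (eta T) (expol sg (Aq q)) t) t =
    \sum_(i < q.+1) (z T i * (expR (c0 * T))%:C) * D i (t + (- T)).
  rewrite /expc DE mulr_sumr mulr_suml; apply: eq_bigr => i _; rewrite /D /expc.
  have -> : em t ^+ (2 * m) * (z T i * Dcomm r (eta 0) (expol sg (Aq (q - i))) (t + (- T))) * (expR ((1 - beta) * t))%:C =
     z T i * Dcomm r (eta 0) (expol sg (Aq (q - i))) (t + (- T)) * (em t ^+ (2 * m) * (expR ((1 - beta) * t))%:C).
    by ring.
  have -> : z T i * (expR (c0 * T))%:C * (Dcomm r (eta 0) (expol sg (Aq (q - i))) (t + (- T)) *
      (expR (c0 * (t + (- T))))%:C) =
     z T i * Dcomm r (eta 0) (expol sg (Aq (q - i))) (t + (- T)) * ((expR (c0 * T))%:C * (expR (c0 * (t + (- T))))%:C).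
    by ring.
  congr (_ * _); rewrite /em -rmorphXn /= -expRM_natl -!rmorphM /= -!expRD; congr (expR _)%:C.
  by rewrite /c0; ring.
apply: (le_trans (ler_cabs_sum _ _ _)); rewrite mulr_suml; apply: ler_sum => i _.
rewrite cabsM mulrC; apply: ler_pM; rewrite ?cabs_ge0//.
rewrite cabsM cabs_real ger0_norm ?expR_ge0// /z cabsM cabs_cexp.
have r0 : reC ('i * sg * T%:C) = - imC sg * T.
  by case: sg => x y; rewrite /reC /imC /=; ring.
have q1 : (1 : R) <= i`!%:R by rewrite ler1n fact_gt0.
have -> : expR (g0 * T) = expR (- imC sg * T) * expR (c0 * T).
  by rewrite -expRD; congr expR; rewrite /g0 /c0; ring.
rewrite r0 mulrA ler_wpM2r ?expR_ge0// mulrC ler_wpM2r ?expR_ge0//.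
rewrite !cabsM !cabsX cabsM cabs_i mul1r cabs_real.
apply: (@le_trans _ _ (`|T| ^+ i * 1)).
  rewrite ler_wpM2l ?exprn_ge0// -[X in cabs X](_ : ((i`!%:R : R)^-1)%:C = _); last first.
    by rewrite fmorphV /= rmorph_nat.
  by rewrite cabs_real ger0_norm ?invr_ge0 ?ler0n// invf_le1// (lt_le_trans ltr01).
rewrite mulr1; apply: (@le_trans _ _ ((1 + `|T|) ^+ i)).
  by rewrite lerXn2r ?nnegrE ?addr_ge0// lerDr.
by rewrite ler_weXn2l ?lerDl//; rewrite -ltnS.
Qed.

(** The condition on T says that it lies on the side where the exponential of rate [g0] decays. Half
    of the rate is given up to absorb the polynomial growth in T. *)
Lemma pairing_tail : g0 != 0 -> exists2 C : R, 0 <= C & forall T, g0 * T = - `|g0| * `|T| ->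
  cabs (pairing m bs sg ps nu u (eta T)) <= C * expR (- (`|g0| / 2) * `|T|).
Proof.
move=> g00; have mI := @measurable_I2pi R; have c2 : 0 < `|g0| / 2 by rewrite divr_gt0 ?normr_gt0.
have Wps q : W2pi s (ps (nu - q)%N).
  by case: hps => H1 _; apply: H1; apply: leq_ltn_trans hnu; exact: leq_subr.
have LG r q : @L2 _ T1 R leb I2pi (Bop m bs r (ps (nu - q)%N)) by exact: Bop_L2 ms.
have /choice [C hC] : forall qr : 'I_nu.+1 * 'I_(2 * m).+1, exists C : R, 0 <= C /\
    forall T, g0 * T = - `|g0| * `|T| ->
    cabs (cint leb2 (setT : set T2) (fun y => u y * conjc (comm_sep m bs sg ps nu (eta T) qr.1 qr.2 y))) <=
      C * expR (- (`|g0| / 2) * `|T|).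
  move=> [q r] /=; have [M M0 hM] := Dcomm_eta_bound q r; have [K K0 hK] := poly_exp_bound q c2.
  set A := sqn leb2 (setT : set T2) (fun y => (expR (beta * lnr y))%:C * u y).
  set B := sqn leb I2pi (fun w => conjc (Bop m bs r (ps (nu - q)%N) w)).
  have A0 : 0 <= A by exact: sqn_ge0.
  have B0 : 0 <= B by exact: sqn_ge0.
  exists (Num.sqrt (4 * (A * B)) * (M * K)); split=> [|T hT].
    by rewrite !mulr_ge0 ?sqrtr_ge0.
  set tau := fun t => em t ^+ (2 * m) * Dcomm r (eta T) (expol sg (Aq q)) t.
  have ct : csm tau by apply: csm_em_Dcomm; [exact: smooth_eta|exact: csm_cderive1_eta].
  have ctJ := csm_L2 (csm_expc (1 - beta) (csmJ ct)).
  have [_ bd] := sep_pairing Lu ctJ (L2J mI (LG r q)).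
  have -> : cint leb2 (setT : set T2) (fun y => u y * conjc (comm_sep m bs sg ps nu (eta T) q r y)) =
      cint leb2 (setT : set T2) (fun y => u y * sep (fun t => conjc (tau t))
        (fun w => conjc (Bop m bs r (ps (nu - q)%N) w)) y).
    by apply: cint_ext => y _; rewrite /comm_sep sepJ.
  have sq : sqn leb setT (expc (1 - beta) (fun t => conjc (tau t))) <=
      (M * K * expR (- (`|g0| / 2) * `|T|)) ^+ 2.
    apply: (@sqn_le_bound _ _ T) => // [t|t ht]; last first.
      by rewrite /expc /tau (hM T t).2// mulr0 conjc0 mul0r.
    have -> : cabs (expc (1 - beta) (fun t => conjc (tau t)) t) = cabs (expc (1 - beta) tau t).
      by rewrite /expc cabsM [in RHS]cabsM; congr (_ * _); exact: cabsJ.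
    apply: (le_trans (hM T t).1); rewrite -!mulrA ler_wpM2l// hT.
    apply: (@le_trans _ _ ((K * expR (`|g0| / 2 * `|T|)) * expR (- `|g0| * `|T|))).
      by rewrite ler_wpM2r ?expR_ge0// hK.
    rewrite -mulrA -expRD ler_wpM2l// ler_expR le_eqVlt; apply/orP; left; apply/eqP; lra.
  have E0 : 0 <= M * K * expR (- (`|g0| / 2) * `|T|) by rewrite !mulr_ge0 ?expR_ge0.
  rewrite -(ler_pXn2r (ltn0Sn 1)) ?nnegrE ?cabs_ge0 ?mulr_ge0 ?sqrtr_ge0 ?expR_ge0//.
  apply: (le_trans bd); rewrite -[in leRHS]mulrA exprMn sqr_sqrtr ?mulr_ge0//.
  rewrite -[leRHS]mulrA ler_wpM2l// -[leRHS]mulrA; apply: ler_wpM2l => //.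
  by rewrite [leRHS]mulrC; apply: ler_wpM2r.
exists (\sum_(q < nu.+1) \sum_(r < (2 * m).+1) C (q, r)) => [|T hT].
  by apply: sumr_ge0 => q _; apply: sumr_ge0 => r _; case: (hC (q, r)).
rewrite mulr_suml; apply: (le_trans (ler_cabs_sum _ _ _)); apply: ler_sum => q _.
rewrite mulr_suml; apply: (le_trans (ler_cabs_sum _ _ _)); apply: ler_sum => r _.
by have [_ /(_ T hT)] := hC (q, r).
Qed.

End PairingTail.

End Tails.

(** * The coefficient formula *)

Section WeightedSpaces.
Context {R : realType}.
Notation T1 := (measurableTypeR R).
Notation T2 := (measurableTypeR R * measurableTypeR R)%type.

(** Local integrability gives measurability on compact annuli, and these together with the origin
    cover the plane. *)
Lemma locint2_cmeasT (h : R * R -> R[i]) : locint2 h -> @cmeas _ T2 R setT h.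
Proof.
move=> lh; pose A n := [set y : R * R | n.+1%:R^-1 <= y.1 ^+ 2 + y.2 ^+ 2 <= n.+1%:R].
pose E n : set T2 := if n is n'.+1 then A n' else [set (0, 0)].
have n0 n : 0 < (n.+1%:R^-1 : R) by rewrite invr_gt0.
have cA n : compact (A n) by exact: compact_annulus.
have Ap n : A n `<=` punctured.
  by move=> y /= /andP[+ _] y0; rewrite y0 /= expr0n addr0 leNgt n0.
have mE n : measurable (E n).
  by case: n => [|n]; apply: compact2_measurable; [exact: compact_set1|exact: cA].
have cover : (setT : set T2) = \bigcup_n E n.
  apply/seteqP; split=> [y _|//]; have [->|/eqP y0] := eqVneq y (0, 0); first by exists 0%N.
  set r := y.1 ^+ 2 + y.2 ^+ 2; have r0 : 0 < r.
    rewrite lt_neqAle addr_ge0 ?sqr_ge0// andbT eq_sym paddr_eq0 ?sqr_ge0//.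
    rewrite !sqrf_eq0; apply/negP => /andP[/eqP h1 /eqP h2]; apply: y0.
    by rewrite [y]surjective_pairing h1 h2.
  have m0 : 0 <= r + r^-1 by rewrite addr_ge0 ?invr_ge0// ltW.
  have rV : 0 <= r^-1 by rewrite invr_ge0 ltW.
  exists (Num.bound (r + r^-1)).+1 => //=; rewrite /A /= -/r.
  have hb : r + r^-1 < (Num.bound (r + r^-1)).+1%:R.
    by apply: lt_trans (archi_boundP m0) _; rewrite ltr_nat.
  apply/andP; split; last by apply: ltW; apply: le_lt_trans hb; rewrite lerDl.
  rewrite invf_ple ?posrE//; apply: ltW; apply: le_lt_trans hb; rewrite lerDr; exact: ltW.
have mh n : @cmeas _ T2 R (E n) h.
  case: n => [|n]; last exact: locint2_cmeas lh (cA n) (Ap n).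
  by split; exact: measurable_fun_set1.
by rewrite cover; split; apply/measurable_fun_bigcup => // n; case: (mh n).
Qed.

Lemma weakD2_0 (h : R * R -> R[i]) : locint2 h -> {ae leb2, forall y : T2, weakD2 (0%N, 0%N) h y = h y}.
Proof.
move=> lh; have h0 : is_weakD2 (0%N, 0%N) h h.
  by split=> // chi tc; rewrite mul1r.
have [_ lg H] := weakD2P (ex_intro _ _ h0).
have : {ae leb2, forall y : T2, weakD2 (0%N, 0%N) h y - h y = 0}.
  apply: weak_unique2 => [K cK Kp|chi tc].
    have mK := compact2_measurable cK.
    by apply: cintegrableB => //; [exact: lg|exact: lh].
  have i1 := test2_integrable lg tc; have i2 := test2_integrable lh tc.
  transitivity (cint leb2 (setT : set T2) (fun y => weakD2 (0%N, 0%N) h y * chi y - h y * chi y)).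
    by apply: cint_ext => y _; rewrite mulrBl.
  rewrite cintB//; have [_ _ H0] := h0.
  have := H chi tc; rewrite (H0 chi tc) expr0 !mul1r => ->; exact: subrr.
by apply: ae_imp => y /eqP; rewrite subr_eq0 => /eqP.
Qed.

Lemma Hspace_locint2 a l (h : R * R -> R[i]) : Hspace a l h -> locint2 h.
Proof. by case=> /(_ (0%N, 0%N) isT) [g []]. Qed.

(** Read off the term of the norm without derivatives, whose weight is r^(2(a - l)); the chosen weak
    derivative of order 0 is replaced by [h] almost everywhere. *)
Lemma Hspace_wL2 a l (h : R * R -> R[i]) : Hspace a l h -> wL2 (a - l%:R) h.
Proof.
move=> hH; have lh := Hspace_locint2 hH; have mh := locint2_cmeasT lh.
have mT : measurable (setT : set T2) by [].
have [hD fin _] := hH; have [_ lg _] := weakD2P (hD (0%N, 0%N) isT); have mg := locint2_cmeasT lg.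
have me : @cmeas _ T2 R setT (fun y => (expR ((a - l%:R) * lnr y))%:C).
  apply: cmeas_real; apply: (measurableT_comp (@measurable_expR R)).
  by apply: measurable_funM; [exact: measurable_cst|exact: measurable_lnr].
have meh := cmeasM me mh; have meg := cmeasM me mg.
have Lg : wL2 (a - l%:R) (weakD2 (0%N, 0%N) h).
  split=> //; apply/integrableP; split.
    by apply/measurable_EFinP/measurable_funX; exact: (measurable_cabs mT meg).
  set X := (\int[leb2]_y (polar_radius y `^ (2 * (a - l%:R + (0 + 0)%:R)) *
        sqnorm ((- 'i) ^+ (0 + 0) * weakD2 (0%N, 0%N) h y))%:E)%E.
  have Xfin : (X < +oo)%E.
    apply: le_lt_trans (lty_poweRy _ fin); last by rewrite invr_eq0 pnatr_eq0.
    have p0 (j k : nat) : (0 <= \int[leb2]_y (polar_radius y `^ (2 * (a - l%:R + (j + k)%:R)) *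
        sqnorm ((- 'i) ^+ (j + k) * weakD2 (j, k) h y))%:E)%E.
      by apply: integral_ge0 => y _; rewrite lee_fin mulr_ge0 ?powR_ge0// sqnorm_ge0.
    rewrite (bigD1 ord0)//= (bigD1 ord0)//= -addeA leeDl//.
    rewrite adde_ge0 ?sume_ge0// => k _; apply: sume_ge0 => j _; exact: p0.
  apply: le_lt_trans Xfin; rewrite le_eqVlt; apply/orP; left; apply/eqP.
  apply: ge0_ae_eq_integral => //.
  - apply: measurableT_comp => //; apply/measurable_EFinP/measurable_funX.
    exact: (measurable_cabs mT meg).
  - apply/measurable_EFinP; apply: measurable_funM.
      apply: (measurableT_comp (@measurable_powR R _)).
      apply: continuous2_measurable => y; apply: continuous_comp; last exact: sqrt_continuous.
      exact: continuous_sqr_radius.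
    rewrite (_ : (fun _ => sqnorm _) = fun y => cabs (weakD2 (0%N, 0%N) h y) ^+ 2).
      by apply: measurable_funX; exact: (measurable_cabs mT mg).
    by apply/funext => y; rewrite expr0 mul1r sqnormE.
  - by move=> y _; rewrite lee_fin mulr_ge0 ?powR_ge0// sqnorm_ge0.
  apply: ae_imp (@ae2_neq0 R) => y y0 _ /=; congr EFin.
  have r0 := polar_radius_gt0 y0.
  rewrite expr0 mul1r addr0 sqnormE cabsM cabs_real ger0_norm ?expR_ge0// ger0_norm ?sqr_ge0//.
  by rewrite exprMn /powR gt_eqF// -/(lnr y) -expRM_natl mulrA.
have := Lg => -[_ ig]; split=> //; have := @cintegrable_ae_eq _ T2 R leb2 setT
  (fun y => (cabs ((expR ((a - l%:R) * lnr y))%:C * weakD2 (0%N, 0%N) h y) ^+ 2)%:C)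
  (fun y => (cabs ((expR ((a - l%:R) * lnr y))%:C * h y) ^+ 2)%:C) mT.
move=> H; have {H}[] := H _ _ _ => //.
- by apply: cmeas_real; apply: measurable_funX; exact: (measurable_cabs mT meh).
- by apply: ae_imp (weakD2_0 lh) => y e _; rewrite e.
by split=> //=; have [] := @cintegrable0 _ T2 R leb2 setT.
Qed.

Lemma exp_seq_cvg0 (C d : R) : 0 < d -> (fun n => C * expR (- d * `|n%:R|)) @ \oo --> 0.
Proof.
move=> d0; rewrite (_ : (fun n => _) = fun n => C * (expR (- d)) ^+ n); last first.
  by apply/funext => n; rewrite normr_nat [- d * _]mulrC expRM_natl.
rewrite -[X in _ --> X](mulr0 C); apply: cvgM; first exact: cvg_cst.
by apply: cvg_expr; rewrite ger0_norm ?expR_ge0// expR_lt1 oppr_lt0.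
Qed.

End WeightedSpaces.

Section PairingSums.
Context {R : realType}.
Variables (m : nat) (bs : nat -> nat -> R -> R[i]) (sg : R[i]) (ps : nat -> R -> R[i]) (nu : nat).

Lemma pairable_sum n (F : 'I_n -> R * R -> R[i]) : (forall i, pairable m bs sg ps nu (F i)) ->
  pairable m bs sg ps nu (fun y => \sum_(i < n) F i y).
Proof.
move=> pF; rewrite (_ : (fun y => _) = fun y => \sum_(i < n) 1 * F i y).
  by apply: pairable_sumZ => i _; exact: pF.
by apply/funext => y; apply: eq_bigr => i _; rewrite mul1r.
Qed.

Lemma pairing_sum n (F : 'I_n -> R * R -> R[i]) tau : (forall i, pairable m bs sg ps nu (F i)) ->
  smooth tau -> csm (cderive1 tau) ->
  pairing m bs sg ps nu (fun y => \sum_(i < n) F i y) tau = \sum_(i < n) pairing m bs sg ps nu (F i) tau.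
Proof.
move=> pF st ct; rewrite (_ : (fun y => _) = fun y => \sum_(i < n) 1 * F i y).
  by rewrite pairing_sumZ//; apply: eq_bigr => i _; rewrite mul1r.
by apply/funext => y; apply: eq_bigr => i _; rewrite mul1r.
Qed.

End PairingSums.

(** * Proof of the coefficient formula *)

Section Main.
Context {R : realType}.
Notation T1 := (measurableTypeR R).
Notation T2 := (measurableTypeR R * measurableTypeR R)%type.

Lemma ler_cabsB' (z w : R[i]) : cabs (z - w) <= cabs z + cabs w.
Proof. by rewrite -[X in _ <= _ + X]cabsN; exact: ler_cabsD. Qed.

Lemma imC_shift m (z : R[i]) : imC (conjc z - 2 * 'i * (m%:R - 1)) = - imC z - 2 * m%:R + 2.
Proof.
have -> : 2 * 'i * (m%:R - 1) = 'i * (2 * (m%:R - 1) : R)%:C :> R[i].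
  by rewrite rmorphM rmorphB rmorph1 /= !rmorph_nat; ring.
case: z => x y; rewrite /imC /=; ring.
Qed.

(** Stated with [chain_solution], a finite sum of separated functions that equals the power solution
    off the origin. The integrals against the truncated [V] tend to the full pairing by dominated
    convergence, and to the coefficient times i by the decay of the boundary pairings, so the two
    limits coincide. *)
Lemma coefficient_formula (m : nat)
    (p : 'I_(2 * m).+1 -> R[i]) (b bstar : nat -> nat -> R -> R[i])
    (hb : polar_form p b) (hbstar : polar_form (adjoint p) bstar)
    (a a1 : R) (l : nat) (f : R * R -> R[i]) (hfa : Hspace a l f) (hfa1 : Hspace a1 l f)
    (N : nat) (lam : 'I_N -> R[i]) (hlam_inj : injective lam)
    (hstrip : forall n, a1 + 1 - l%:R - 2 * m%:R < imC (lam n) < a + 1 - l%:R - 2 * m%:R)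
    (J : 'I_N -> nat) (kap : forall n, 'I_(J n) -> nat)
    (phi psi : forall n, 'I_(J n) -> nat -> R -> R[i])
    (hphi : forall n j, jordan_chain (l + 2 * m) l (pencil m b) (lam n) (kap n j) (phi n j))
    (hpsi : forall n j, jordan_chain (l + 2 * m) l (pencil m bstar)
         (conjc (lam n) - 2 * 'i * (m%:R - 1)) (kap n j) (psi n j))
    (hbi : forall n, biorthonormal m b (lam n) (@kap n) (@phi n) (@psi n))
    (u u1 : R * R -> R[i]) (c : forall n, 'I_(J n) -> nat -> R[i])
    (hu : Hspace a (l + 2 * m) u) (hPu : solves p u f) (hu1 : Hspace a1 (l + 2 * m) u1)
    (hasympt : {ae leb2, forall y, u y =
       \sum_(n < N) \sum_(j < J n) \sum_(k < kap n j)
          c n j k * chain_solution (lam n) (phi n j) k y + u1 y})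
    n (j : 'I_(J n)) k (hk : (k < kap n j)%N) :
  let V := chain_solution (conjc (lam n) - 2 * 'i * (m%:R - 1)) (psi n j) (kap n j - k - 1)%N in
  [/\ @cmeas _ T2 R setT V, cintegrable leb2 (setT : set T2) (fun y => f y * conjc (V y)) &
  cint leb2 (setT : set T2) (fun y => f y * conjc (V y)) = 'i * c n j k].
Proof.
set nu := (kap n j - k - 1)%N; set sg := conjc (lam n) - _ => V.
have hnu : (nu < kap n j)%N by rewrite /nu; lia.
have ms : (2 * m <= l + 2 * m)%N by exact: leq_addl.
have mT : measurable (setT : set T2) by [].
have sbs i r : (i + r <= 2 * m)%N -> smooth (bstar i r) by move=> ir; case: (polar_form_smooth hbstar ir).
have hps := hpsi n j; have /andP[st1 st2] := hstrip n.
have isg : imC sg = - imC (lam n) - 2 * m%:R + 2 by exact: imC_shift.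
have Wps q : W2pi (l + 2 * m) (psi n j (nu - q)%N).
  by case: hps => H1 _; apply: H1; apply: leq_ltn_trans hnu; exact: leq_subr.
have Lps q := W2pi_L20 (Wps q).
have Lf := Hspace_wL2 hfa; have Lf1 := Hspace_wL2 hfa1.
have Lu := Hspace_wL2 hu; have Lu1 := Hspace_wL2 hu1.
(* The two weights of [f] are a - l and a1 - l; in terms of Im sg the required inequalities are
   exactly that lambda_n lies in the open strip. *)
have iq (q : nat) : cintegrable leb2 (setT : set T2) (fun y => f y * conjc (sep (expol sg (Aq q)) (psi n j (nu - q)%N) y)).
  by apply: (expol_sep_cintegrable q Lf Lf1) => //; rewrite isg; lra.
have VE y : f y * conjc (V y) = \sum_(q < nu.+1) f y * conjc (sep (expol sg (Aq q)) (psi n j (nu - q)%N) y).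
  by rewrite /V /chain_solution -[in LHS]conjE rmorph_sum mulr_sumr.
have iF : cintegrable leb2 (setT : set T2) (fun y => f y * conjc (V y)).
  have I : cintegrable leb2 (setT : set T2) (fun y => \sum_(q < nu.+1) f y *
     conjc (sep (expol sg (Aq q)) (psi n j (nu - q)%N) y)) by apply: cintegrable_sum => // q _.
  by apply: cintegrable_ext I => // y _; rewrite VE.
have mV : @cmeas _ T2 R setT V.
  by apply: cmeas_sum => q _; apply: sep_cmeas; [apply: smooth_cmeas => //; exact: smooth_expol|case: (Lps q)].
split=> //.
pose pr := pairing m bstar sg (psi n j) nu.
have seta T := @smooth_eta R T; have ceta T := @csm_cderive1_eta R T.
have pu := wL2_pairable sbs ms hps hnu Lu; have pu1 := wL2_pairable sbs ms hps hnu Lu1.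
have X i : cint leb2 (setT : set T2) (fun y => f y * conjc (cut i (lnr y) * V y)) =
    pr u (eta (- i%:R)) - pr u (eta i%:R).
  rewrite -(pairing_sub_cut pu (seta _) (ceta _) (seta _) (ceta _)).
  by apply: (weak_pairing sbs ms hps hnu hbstar hPu (Hspace_locint2 hfa) (Hspace_locint2 hu) Lu Lf); exact: csm_cut.
pose CS n j k := chain_solution (lam n) (phi n j) k.
have pCS n' j' (k' : 'I_(kap n' j')) : pairable m bstar sg (psi n j) nu (CS n' j' k').
  exact: (chain_solution_pairable hbstar ms (hphi n' j') hps).
have Eoff n' j' (k' : 'I_(kap n' j')) T : n' != n -> pr (CS n' j' k') (eta T) = 0.
  move=> nn; rewrite /pr (pairing_chain hb hbstar ms (hphi n' j') hps)//.
  by rewrite (inj_eq hlam_inj) (negbTE nn) mulr0.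
have Eon j' (k' : 'I_(kap n j')) T : pr (CS n j' k') (eta T) = 'i * ((j' == j) && (k' == k :> nat))%:R.
  rewrite /pr (pairing_chain hb hbstar ms (hphi n j') hps)// eqxx; congr (_ * _).
  apply: (etrans (hbi n j j' nu k' hnu (ltn_ord k'))); congr (_%:R); congr (nat_of_bool _).
  have [jj|//] := eqVneq j' j; rewrite /= /nu.
  move: (ltn_ord k'); move: (nat_of_ord k') => k0; rewrite jj => k0k.
  by apply/eqP/eqP => [|->//]; lia.
(* The asymptotic representation is paired with the step at T; biorthonormality keeps a single
   coefficient, and the result holds for every T. *)
have prS T : pr u (eta T) = 'i * c n j k + pr u1 (eta T).
  pose W y := \sum_(n < N) \sum_(j < J n) \sum_(k < kap n j) c n j k * CS n j k y.
  have pk n' j' : pairable m bstar sg (psi n j) nu (fun y => \sum_(k' < kap n' j') c n' j' k' * CS n' j' k' y).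
    by apply: pairable_sumZ => k' _; exact: pCS.
  have pj n' : pairable m bstar sg (psi n j) nu (fun y => \sum_(j' < J n') \sum_(k' < kap n' j') c n' j' k' * CS n' j' k' y).
    by apply: pairable_sum => j'; exact: pk.
  have pW : pairable m bstar sg (psi n j) nu W by apply: pairable_sum => n'; exact: pj.
  have mu := wL2_cmeas Lu; have mu1 := wL2_cmeas Lu1.
  have mCS n' j' k' : (k' < kap n' j')%N -> @cmeas _ T2 R setT (CS n' j' k').
    move=> kk; apply: cmeas_sum => q _; apply: sep_cmeas.
      by apply: smooth_cmeas => //; exact: smooth_expol.
    have [H1 _] := hphi n' j'; have [] // := W2pi_L20 (H1 (k' - q)%N _).
    by apply: leq_ltn_trans kk; exact: leq_subr.
  have mW : @cmeas _ T2 R setT W.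
    apply: cmeas_sum => n' _; apply: cmeas_sum => j' _; apply: cmeas_sum => k' _.
    by apply: cmeasM; [exact: cmeas_cst|exact: mCS].
  rewrite /pr (pairing_ae sbs ms hps hnu mu (cmeasD mW mu1) hasympt (seta T) (ceta T)).
  rewrite pairing_add//; congr (_ + _); rewrite pairing_sum// (bigD1 n)//= [X in _ + X]big1 ?addr0.
    rewrite (pairing_sum (pk n) (seta T) (ceta T)) (bigD1 j)//= [X in _ + X]big1 ?addr0.
      rewrite pairing_sumZ//.
      rewrite (bigD1 (Ordinal hk))//= [X in _ + X]big1 ?addr0.
        by rewrite [pairing _ _ _ _ _ _ _](Eon j (Ordinal hk)) /= !eqxx mulr1 mulrC.
      move=> k' kk; rewrite [pairing _ _ _ _ _ _ _]Eon eqxx /= (_ : (k' == k :> nat) = false) ?mulr0//.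
      by apply/negbTE; apply: contraNneq kk => kk; apply/eqP/val_inj.
    move=> j' jj; rewrite pairing_sumZ//.
    by rewrite big1// => k' _; rewrite [pairing _ _ _ _ _ _ _]Eon (negbTE jj) /= !mulr0.
  move=> n' nn; rewrite (pairing_sum (pk n') (seta T) (ceta T)) big1// => j' _; rewrite pairing_sumZ//.
  by rewrite big1// => k' _; rewrite [pairing _ _ _ _ _ _ _]Eoff ?mulr0.
(* The two rates simplify to Im lambda_n minus the heights of the upper and of the lower line of the
   strip. Their signs say that the pairing with [u] decays towards infinity and the pairing with
   [u1] towards the origin. *)
have g1 : 1 - (a - (l + 2 * m)%:R) - (2 * m)%:R - imC sg < 0.
  by rewrite isg natrD natrM; lra.
have g2 : 0 < 1 - (a1 - (l + 2 * m)%:R) - (2 * m)%:R - imC sg.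
  by rewrite isg natrD natrM; lra.
have [C1 C10 hC1] := pairing_tail sbs ms hps hnu Lu (ltr0_neq0 g1).
have [C2 C20 hC2] := pairing_tail sbs ms hps hnu Lu1 (lt0r_neq0 g2).
set d1 := `|_| / 2 in hC1; set d2 := `|_| / 2 in hC2.
have d10 : 0 < d1 by rewrite divr_gt0// normr_gt0 ltr0_neq0.
have d20 : 0 < d2 by rewrite divr_gt0// normr_gt0 lt0r_neq0.
pose Y i := cint leb2 (setT : set T2) (fun y => f y * conjc (cut i (lnr y) * V y)).
have c1 : (fun i => cabs (Y i - 'i * c n j k)) @ \oo --> 0.
  apply: (@squeeze_cvgr _ _ _ _ (fun=> 0) (fun i => C2 * expR (- d2 * `|i%:R|) + C1 * expR (- d1 * `|i%:R|))).
  - apply: nearW => i; rewrite cabs_ge0 /=.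
    have -> : Y i - 'i * c n j k = pr u1 (eta (- i%:R)) - pr u (eta i%:R).
      rewrite /Y X (prS (- i%:R)).
      by move: ('i * c n j k) (pr u1 _) (pr u (eta i%:R)) => A B D; ring.
    apply: (le_trans (ler_cabsB' _ _)); rewrite lerD//.
      rewrite -(normrN i%:R); apply: hC2.
      by rewrite normrN normr_nat gtr0_norm// mulrN mulNr.
    by apply: hC1; rewrite normr_nat ltr0_norm// opprK.
  - exact: cvg_cst.
  - by rewrite -(addr0 0); apply: cvgD; exact: exp_seq_cvg0.
have mf := wL2_cmeas Lf.
have c2 : (fun i => cabs (Y i - cint leb2 (setT : set T2) (fun y => f y * conjc (V y)))) @ \oo --> 0.
  apply: (@cint_dominated _ T2 R leb2 setT (fun i y => f y * conjc (cut i (lnr y) * V y))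
    (fun y => f y * conjc (V y)) (fun y => cabs (f y * conjc (V y)))) => //.
  - move=> i; apply: cmeasM => //; apply: cmeasJ; apply: cmeasM => //.
    have [sc _] := @csm_cut R i; have mc : @cmeas _ T1 R setT (cut i) by exact: smooth_cmeas.
    exact: (cmeas_comp (@measurable_lnr R) mc).
  - by apply: cmeasM => //; exact: cmeasJ.
  - exact: integrable_cabs.
  - move=> i y _; rewrite !cabsM !cabsJ cabsM ler_wpM2l ?cabs_ge0//.
    by rewrite ler_piMl ?cabs_ge0// cut_bound.
  - by move=> y _; apply: filterS (cut1_near (lnr y)) => i ->; rewrite mul1r.
set I := cint _ _ _ in c2 *.
have c4 : (fun i : nat => cabs (I - 'i * c n j k)) @ \oo --> 0.
  apply: (@squeeze_cvgr _ _ _ _ (fun=> 0) (fun i => cabs (Y i - 'i * c n j k) + cabs (Y i - I))).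
  - apply: nearW => i; rewrite cabs_ge0 /=.
    have -> : I - 'i * c n j k = (Y i - 'i * c n j k) - (Y i - I) by ring.
    exact: ler_cabsB'.
  - exact: cvg_cst.
  - by rewrite -(addr0 0); apply: cvgD.
apply/eqP; rewrite -subr_eq0; apply/eqP/cabs_eq0.
by rewrite -(cvg_lim (@Rhausdorff R) c4) lim_cst.
Qed.

End Main.

Theorem theorem5p4 (R : realType) (m : nat) (hm : (0 < m)%N)
    (p : 'I_(2 * m).+1 -> R[i]) (hp : properly_elliptic p)
    (b bstar : nat -> nat -> R -> R[i])
    (hb : polar_form p b) (hbstar : polar_form (adjoint p) bstar)
    (a a1 : R) (ha : a1 < a) (l : nat)
    (f : R * R -> R[i]) (hfa : Hspace a l f) (hfa1 : Hspace a1 l f)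
    (hline1 : forall lam : R[i], imC lam = a1 + 1 - l%:R - 2 * m%:R ->
       ~ pencil_eigenvalue (l + 2 * m) (pencil m b) lam)
    (hline : forall lam : R[i], imC lam = a + 1 - l%:R - 2 * m%:R ->
       ~ pencil_eigenvalue (l + 2 * m) (pencil m b) lam)
    (N : nat) (lam : 'I_N -> R[i]) (hlam_inj : injective lam)
    (hlam : forall z : R[i],
       (pencil_eigenvalue (l + 2 * m) (pencil m b) z /\
        a1 + 1 - l%:R - 2 * m%:R < imC z < a + 1 - l%:R - 2 * m%:R) <->
       exists n, z = lam n)
    (J : 'I_N -> nat) (kap : forall n, 'I_(J n) -> nat)
    (phi : forall n, 'I_(J n) -> nat -> R -> R[i])
    (hphi : forall n,
       canonical_system (l + 2 * m) l (pencil m b) (lam n) (kap n) (phi n))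
    (u u1 : R * R -> R[i]) (c : forall n, 'I_(J n) -> nat -> R[i])
    (hu : Hspace a (l + 2 * m) u) (hPu : solves p u f)
    (hu1 : Hspace a1 (l + 2 * m) u1) (hPu1 : solves p u1 f)
    (hasympt : {ae leb2, forall y, u y =
       \sum_(n < N) \sum_(j < J n) \sum_(k < kap n j)
          c n j k * power_solution ('i * lam n) (phi n j) k y
       + u1 y})
    (psi : forall n, 'I_(J n) -> nat -> R -> R[i])
    (hpsi : forall n,
       canonical_system (l + 2 * m) l (pencil m bstar)
         ((lam n)^* - 2 * 'i * (m%:R - 1)) (kap n) (psi n))
    (hbi : forall n, biorthonormal m b (lam n) (kap n) (phi n) (psi n)) :
  let v n (j : 'I_(J n)) nu :=
    power_solution ('i * (lam n)^* + 2 * m%:R - 2) (psi n j) nu in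
  forall n (j : 'I_(J n)),
    (forall nu, (nu < kap n j)%N -> solves (adjoint p) (v n j nu) (fun=> 0)) /\
    (forall k, (k < kap n j)%N ->
       c n j k = cdot leb2 setT f (fun y => 'i * v n j (kap n j - k - 1)%N y)).
Proof.
move=> v n j.
have hphi' n' j' : jordan_chain (l + 2 * m) l (pencil m b) (lam n') (kap n' j') (phi n' j').
  by have [_ _ _] := hphi n'; apply.
have hpsi' n' j' : jordan_chain (l + 2 * m) l (pencil m bstar)
    (conjc (lam n') - 2 * 'i * (m%:R - 1)) (kap n' j') (psi n' j').
  by have [_ _ _] := hpsi n'; apply.
set sg := conjc (lam n) - 2 * 'i * (m%:R - 1) in hpsi' *.
(* As i times i is -1, the exponent r^(2m-2) is absorbed into the eigenvalue of the adjoint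
   pencil. *)
have esg : 'i * (lam n)^* + 2 * m%:R - 2 = 'i * (conjc (lam n) - 2 * 'i * (m%:R - 1)).
  have -> : 'i * (conjc (lam n) - 2 * 'i * (m%:R - 1)) =
    'i * conjc (lam n) - ('i * 'i) * (2 * m%:R - 2) by ring.
  by rewrite -expr2 sqr_i mulN1r opprK addrA.
split=> [nu hnu|k hk].
  by rewrite /v esg; exact: (solves_power hbstar (leq_addl _ _) (hpsi' n j) hnu).
have hstrip n' : a1 + 1 - l%:R - 2 * m%:R < imC (lam n') < a + 1 - l%:R - 2 * m%:R.
  by have [_ /(_ (ex_intro _ n' erefl))[]] := hlam (lam n').
have hasy : {ae leb2, forall y : measurableTypeR R * measurableTypeR R, u y =
    \sum_(n < N) \sum_(j < J n) \sum_(k < kap n j) c n j k * chain_solution (lam n) (phi n j) k y + u1 y}.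
  apply: ae_imp2 hasympt (@ae2_neq0 R) => y -> y0; congr (_ + _).
  apply: eq_bigr => n' _; apply: eq_bigr => j' _; apply: eq_bigr => k' _; congr (_ * _).
  exact: power_solutionE.
have [mV iF FE] := coefficient_formula hb hbstar hfa hfa1 hlam_inj hstrip hphi' hpsi' hbi hu hPu hu1 hasy hk.
set nu := (kap n j - k - 1)%N in mV iF FE *.
set V := chain_solution _ _ _ in mV iF FE.
have mT : measurable (setT : set (measurableTypeR R * measurableTypeR R)) by [].
have mf := wL2_cmeas (Hspace_wL2 hfa).
(* At the origin [sep] is 0 while the power solution takes whatever value its formula gives there;
   this single point is treated apart to obtain measurability, and is null in the integral. *)
have vV (y : R * R) : v n j nu y = if y == (0, 0) then v n j nu (0, 0) else V y.
  by case: eqVneq => [->//|/eqP y0]; rewrite /v esg power_solutionE.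
have mv : cmeas setT (v n j nu).
  apply: cmeas_ext (cmeas_if measurable_origin (cmeas_cst setT (v n j nu (0, 0))) mV) => y _.
  exact: esym (vV y).
have -> : cdot leb2 setT f (fun y => 'i * v n j nu y) =
    cint leb2 setT (fun y => (- 'i) * (f y * conjc (V y))).
  apply: cint_ae_eq => //.
  - apply: cmeasM => //; apply: cmeasJ; apply: cmeasM => //; exact: cmeas_cst.
  - by apply: cmeasM; [exact: cmeas_cst|exact: cintegrable_meas iF].
  apply: ae_imp (@ae2_neq0 R) => y /eqP/negbTE y0 _.
  by rewrite vV y0 conjE conjcM conjc_i; ring.
rewrite cintZ// FE mulrA mulNr -expr2 sqr_i opprK mul1r//.
Qed.
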